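(* Let $\Sigma$ be a complete, connected, $C^2$ oriented immersed surface in $\mathbb{H}^1$ with non-vanishing constant mean curvature. If $\Sigma$ contains an isolated singular point, then $\Sigma$ is congruent with a sphere $\mathbb{S}_H$, where $H>0$ is the mean curvature of $\Sigma$ with respect to the unit normal for which it is positive.
   Context: $\mathbb{H}^1$ is the Heisenberg group: $\mathbb{R}^3\equiv\mathbb{C}\times\mathbb{R}$ with product $[z,t]*[z',t']=[z+z',t+t'+\operatorname{Im}(z\overline{z'})]$, $z=x+iy$. Put $X=\partial_x+y\,\partial_t$, $Y=\partial_y-x\,\partial_t$, $T=\partial_t$. The horizontal distribution is spanned by $X,Y$; $U_H$ is the orthogonal projection of $U$ onto it; a curve is horizontal if it is $C^1$ with tangent vector in the distribution. $g=\langle\cdot,\cdot\rangle$ is the Riemannian metric making $\{X,Y,T\}$ orthonormal, $D$ its Levi-Civita connection, and $J(U)=D_UT$ (so $J(X)=Y$, $J(Y)=-X$, $J(T)=0$). For an oriented immersed surface $\Sigma$ with unit normal $N$, the singular set is $\Sigma_0=\{p\in\Sigma:N_H(p)=0\}$; an isolated singular point is an isolated point of $\Sigma_0$. On $\Sigma-\Sigma_0$ put $\nu_H=N_H/|N_H|$; the mean curvature $H$ is defined there by $-2H=\operatorname{div}_\Sigma\nu_H$, with $\operatorname{div}_\Sigma U=\sum_{i=1}^2\langle D_{e_i}U,e_i\rangle$, $\{e_1,e_2\}$ an orthonormal basis of the tangent plane. Constant mean curvature means $H$ is constant on $\Sigma-\Sigma_0$. Complete means complete as an immersed surface in the Riemannian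 manifold $(\mathbb{H}^1,g)$. A geodesic of curvature $\lambda$ is a $C^2$ horizontal curve $\gamma$ parameterized by arc-length with $D_{\dot\gamma}\dot\gamma+2\lambda J(\dot\gamma)=0$. For $\lambda>0$, $\mathbb{S}_\lambda$ is the union of all geodesics of curvature $\lambda$ starting at the origin with horizontal unit initial velocity, restricted to the interval $[0,\pi/\lambda]$; it is a compact embedded $C^2$ sphere. Two surfaces are congruent if one is the image of the other under an isometry of $(\mathbb{H}^1,g)$ leaving invariant the horizontal distribution (e.g. left translations and rotations about the $t$-axis). *)

(* Defs.v *)
From mathcomp Require Import all_boot all_order all_algebra.
From mathcomp Require Import all_classical all_reals all_analysis.
From mathcomp Require Import ring lra.

Set Implicit Arguments.
Unset Strict Implicit.
Unset Printing Implicit Defensive.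

Import Order.TTheory GRing.Theory Num.Theory.
Import numFieldNormedType.Exports.

Local Open Scope classical_set_scope.
Local Open Scope ring_scope.

(* [Ck k U f]: f is of class C^k at the points of the set U, which is open in
   every use below. The directional derivatives ['D_v f] are taken in the
   ambient space. *)
Fixpoint Ck (R : realType) (V W : normedModType R) (k : nat) (U : set V)
    (f : V -> W) : Prop :=
  (forall x, U x -> {for x, continuous f}) /\
  if k is k'.+1 then
    forall v, (forall x, U x -> derivable f x v) /\ Ck k' U ('D_v f)
  else True.

(* The Heisenberg group as R^3. A tangent vector at p is given by its
   components with respect to the coordinate fields d/dx, d/dy, d/dt. *)
Section heisenberg.
Context {R : realType}.
Local Notation H1 := 'rV[R]_3.
Implicit Types p u v w : H1.

Definition vec3 (a b c : R) : H1 := \row_k [:: a; b; c]`_k.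

Definition xc p : R := p ord0 ord0.
Definition yc p : R := p ord0 1.
Definition tc p : R := p ord0 ord_max.

Definition fieldX p : H1 := vec3 1 0 (yc p).
Definition fieldY p : H1 := vec3 0 1 (- xc p).
Definition fieldT p : H1 := vec3 0 0 1.

(* The T-component of u in the frame X, Y, T; the X- and Y-components are
   [xc u] and [yc u], see [frame_decomp]. *)
Definition tcomp p u : R := tc u - yc p * xc u + xc p * yc u.

Definition metric p u v : R :=
  xc u * xc v + yc u * yc v + tcomp p u * tcomp p v.

Definition gnorm p u : R := Num.sqrt (metric p u u).

Definition horizontal p u : Prop :=
  exists a b : R, u = a *: fieldX p + b *: fieldY p.

Definition hproj p u : H1 :=
  metric p u (fieldX p) *: fieldX p + metric p u (fieldY p) *: fieldY p.

Definition gram p : 'M[R]_3 :=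
  \matrix_(i, j) metric p (delta_mx ord0 i) (delta_mx ord0 j).

Definition christoffel p (i j k : 'I_3) : R :=
  2^-1 * \sum_l invmx (gram p) k l *
    ('D_(delta_mx ord0 i) (fun q => gram q j l) p +
     'D_(delta_mx ord0 j) (fun q => gram q i l) p -
     'D_(delta_mx ord0 l) (fun q => gram q i j) p).

(* The zeroth order part of the Levi-Civita connection: for a vector field W
   along a map f, the covariant derivative of W in a direction e is
   (dW)(e) + [gamma f df(e) W]. *)
Definition gamma p u w : H1 :=
  \row_k \sum_i \sum_j christoffel p i j k * u ord0 i * w ord0 j.

Definition nabla p u (W : H1 -> H1) : H1 := 'D_u W p + gamma p u (W p).

Definition J p u : H1 := nabla p u fieldT.

Definition horizontal_isometry (phi : H1 -> H1) : Prop :=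
  [/\ bijective phi,
      forall k, Ck k setT phi,
      forall p u v, metric (phi p) ('D_u phi p) ('D_v phi p) = metric p u v &
      forall p u, horizontal (phi p) ('D_u phi p) <-> horizontal p u].

(* Geodesics of curvature lam exist for all times, so it is enough to consider
   those defined on the whole line. *)
Definition geodesic (lam : R) (c : R -> H1) : Prop :=
  [/\ Ck (V := R^o) 2 setT c,
      forall s, horizontal (c s) (derive1 c s),
      forall s, gnorm (c s) (derive1 c s) = 1 &
      forall s, derive1 (derive1 c) s +
                gamma (c s) (derive1 c s) (derive1 c s) +
                (2 * lam) *: J (c s) (derive1 c s) = 0].

Definition sphere (lam : R) : set H1 :=
  [set q | exists c s, [/\ geodesic lam c, c 0 = 0,
                           0 <= s <= pi / lam & q = c s]].

Lemma xc_vec3 a b c : xc (vec3 a b c) = a. Proof. by rewrite /xc mxE. Qed.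
Lemma yc_vec3 a b c : yc (vec3 a b c) = b. Proof. by rewrite /yc mxE. Qed.
Lemma tc_vec3 a b c : tc (vec3 a b c) = c. Proof. by rewrite /tc mxE. Qed.

Lemma vec3E p : p = vec3 (xc p) (yc p) (tc p).
Proof.
apply/rowP => -[[|[|[|//]]] i3]; rewrite mxE /=.
- by congr (p _ _); apply/val_inj.
- by congr (p _ _); apply/val_inj.
- by congr (p _ _); apply/val_inj.
Qed.

Lemma frame_decomp p u :
  u = xc u *: fieldX p + yc u *: fieldY p + tcomp p u *: fieldT p.
Proof.
apply/rowP => -[[|[|[|//]]] i3]; rewrite [in LHS](vec3E u) !mxE /= /tcomp; ring.
Qed.

Lemma frame_orthonormal p :
  [/\ metric p (fieldX p) (fieldX p) = 1, metric p (fieldY p) (fieldY p) = 1,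
      metric p (fieldT p) (fieldT p) = 1 &
   [/\ metric p (fieldX p) (fieldY p) = 0, metric p (fieldX p) (fieldT p) = 0 &
       metric p (fieldY p) (fieldT p) = 0]].
Proof.
rewrite /metric /tcomp !(xc_vec3, yc_vec3, tc_vec3).
by split; [| | |split]; ring.
Qed.

End heisenberg.

(* [param] is only meaningful on [codom]; it is a homeomorphism from the open
   set [codom] of R^2 onto the open set [dom], with inverse [coord]. *)
Record chart (R : realType) (S : topologicalType) := Chart {
  dom : set S;
  codom : set 'rV[R]_2;
  coord : S -> 'rV[R]_2;
  param : 'rV[R]_2 -> S;
  dom_open : open dom;
  codom_open : open codom;
  coord_codom : forall p, dom p -> codom (coord p);
  param_dom : forall y, codom y -> dom (param y);
  coordK : forall p, dom p -> param (coord p) = p;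
  paramK : forall y, codom y -> coord (param y) = y;
  coord_continuous : forall p, dom p -> {for p, continuous coord};
  param_continuous : forall y, codom y -> {for y, continuous param} }.

Record surface (R : realType) := Surface {
  carrier :> topologicalType;
  chart_index : Type;
  atlas : chart_index -> chart R carrier;
  surface_hausdorff : hausdorff_space carrier;
  surface_second_countable : @second_countable carrier;
  atlas_cover : forall p, exists i, dom (atlas i) p;
  atlas_compatible : forall i j,
    Ck 2 [set y | codom (atlas i) y /\ dom (atlas j) (param (atlas i) y)]
      (coord (atlas j) \o param (atlas i)) }.

Section immersed_surfaces.
Context {R : realType} {S : surface R}.
Local Notation H1 := 'rV[R]_3.
Implicit Types (F N U : S -> H1) (p q : S) (c : R -> S).

Definition immersion2 F : Prop := forall i : chart_index S,
  Ck 2 (codom (atlas i)) (F \o param (atlas i)) /\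
  forall y, codom (atlas i) y ->
    injective (fun v => 'D_v (F \o param (atlas i)) y).

(* A choice of orientation of the immersed surface F. *)
Definition unit_normal F N : Prop :=
  [/\ continuous N,
      forall p, gnorm (F p) (N p) = 1 &
      forall (i : chart_index S) p v, dom (atlas i) p ->
        metric (F p) (N p)
          ('D_v (F \o param (atlas i)) (coord (atlas i) p)) = 0].

Definition singular_set F N : set S := [set p | hproj (F p) (N p) = 0].

Definition nuH F N p : H1 :=
  (gnorm (F p) (hproj (F p) (N p)))^-1 *: hproj (F p) (N p).

(* The differential of a vector-valued map G on S at p, applied to the tangent
   vector with components v in the chart i. *)
Definition dchart (i : chart_index S) (G : S -> H1) p (v : 'rV[R]_2) : H1 :=
  'D_v (G \o param (atlas i)) (coord (atlas i) p).

Definition nabla_along F (i : chart_index S) U p v : H1 :=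
  dchart i U p v + gamma (F p) (dchart i F p v) (U p).

(* [is_div F U p d]: the sum of <D_e U, e> over an orthonormal basis of the
   tangent plane at p equals d, for every such basis. *)
Definition is_div F U p (d : R) : Prop :=
  forall (i : chart_index S) (v1 v2 : 'rV[R]_2), dom (atlas i) p ->
    let e1 := dchart i F p v1 in
    let e2 := dchart i F p v2 in
    metric (F p) e1 e1 = 1 -> metric (F p) e2 e2 = 1 ->
    metric (F p) e1 e2 = 0 ->
    metric (F p) (nabla_along F i U p v1) e1 +
    metric (F p) (nabla_along F i U p v2) e2 = d.

Definition constant_mean_curvature F N (H : R) : Prop :=
  forall p, ~ singular_set F N p -> is_div F (nuH F N) p (- 2 * H).

Definition C1_curve c : Prop :=
  continuous c /\
  forall i : chart_index S,
    Ck (V := R^o) 1 (c @^-1` dom (atlas i)) (coord (atlas i) \o c).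

Definition curve_length F c : \bar R :=
  (\int[lebesgue_measure]_(s in `[0%R, 1%R])
     (gnorm (F (c s)) (derive1 (F \o c) s))%:E)%E.

(* The Riemannian distance of the metric induced by F. The velocity of a curve
   may vanish, so curves parametrized by the whole line and piecewise C^1
   curves on [0, 1] give the same infimum. *)
Definition idist F p q : \bar R :=
  ereal_inf [set l | exists c,
    [/\ C1_curve c, c 0 = p, c 1 = q & l = curve_length F c]].

Definition complete_surface F : Prop :=
  forall u : nat -> S,
    (forall e : R, 0 < e -> exists n0 : nat, forall m n,
       (n0 <= m)%N -> (n0 <= n)%N -> (idist F (u m) (u n) < e%:E)%E) ->
    exists p, idist F (u n) p @[n --> \oo] --> 0%E.

(* The immersed surface F, moved by an isometry, is the embedded surface A. *)
Definition congruent F (A : set H1) : Prop :=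
  exists phi : H1 -> H1,
    [/\ horizontal_isometry phi, injective F & phi @` range F = A].

End immersed_surfaces.

(* Main.v *)
(** Near an isolated singular point [p] the surface is the graph of a function
    over a disc of the xy-plane, and [(N1, N2) / N3] is a C^1 field with a single
    zero. Constant mean curvature says exactly that the characteristic curves are
    geodesics of curvature [+-H], that is, lifts of circles. Symmetry of second
    derivatives fixes the curl of the field; this and a blow-up at the zero show
    that its differential there is a rotation, so that the characteristic
    geodesics all emanate from [p] and fill a neighbourhood of it. By completeness
    each of them extends inside the surface up to the parameter [pi / |H|]: since
    the Jacobi field of the family is tangent, no singular point is met before.
    At [pi / |H|] they all arrive at the same point, and the union of these arcs
    is compact and open, hence the whole surface, which is thus immersed
    injectively onto a left translate of the sphere. *)

From HB Require Import structures.
Require Import Defs.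
From mathcomp Require Import all_boot all_order all_algebra.
From mathcomp Require Import all_classical all_reals all_analysis.
From mathcomp Require Import ring lra.

Set Implicit Arguments.
Unset Strict Implicit.
Unset Printing Implicit Defensive.

Import Order.TTheory GRing.Theory Num.Theory.
Import numFieldNormedType.Exports.
Local Open Scope classical_set_scope.
Local Open Scope ring_scope.

(** * Derivatives of real functions and linear differential systems *)

(** Geodesics being explicit lifts of circles, the characteristic curves are found by comparison: a
    geodesic that agrees with the surface once, in position and direction, stays in it. The obstacle
    at [p] is that the differential of the slope field at its zero might be singular. The blow-up of
    the curvature equation constrains it only on its own range, and the curl condition excludes the
    zero matrix but not rank one. That case is ruled out at a small scale, by exhibiting two orbits
    that cross. The other obstacle is that distinct points of [S] may have the same image, so that
    equalities in the Heisenberg group say nothing in [S]. Everything is therefore continued through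
    lifts to [S], unique because [F] is locally injective and [S] is Hausdorff; completeness
    provides the limit points of lifts. The sign [eps], the T-component of [N] at [p], orients the
    geodesics away from [p]. Their curvature [lam = eps * H] may be negative, whence the absolute
    value in the final time [pi / |l|]. *)

Section real_functions.
Context {R : realType}.
Implicit Types (f g : R -> R) (s a b c d : R).

Definition drv f s d : Prop := is_derive s 1 f d.

Lemma drv_eq f s a b : drv f s a -> a = b -> drv f s b.
Proof. by move=> fa <-. Qed.

Lemma drv_ext f g s a : (forall x, f x = g x) -> drv f s a -> drv g s a.
Proof. by move=> /funext ->. Qed.

Lemma drv_near f g s a : (\forall x \near s, f x = g x) -> drv f s a -> drv g s a.
Proof. by move=> fg; apply: near_eq_is_derive => //; exact: oner_neq0. Qed.

Lemma drv_cst c s : drv (fun=> c) s 0.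
Proof. exact: is_derive_cst. Qed.

Lemma drv_id s : drv (fun x => x) s 1.
Proof. exact: is_derive_id. Qed.

Lemma drvD f g s a b : drv f s a -> drv g s b -> drv (fun x => f x + g x) s (a + b).
Proof. by move=> fa gb; exact: is_deriveD. Qed.

Lemma drvN f s a : drv f s a -> drv (fun x => - f x) s (- a).
Proof. by move=> fa; exact: is_deriveN. Qed.

Lemma drvB f g s a b : drv f s a -> drv g s b -> drv (fun x => f x - g x) s (a - b).
Proof. by move=> fa gb; exact: is_deriveB. Qed.

Lemma drvM f g s a b : drv f s a -> drv g s b ->
  drv (fun x => f x * g x) s (f s * b + g s * a).
Proof. by move=> fa gb; exact: is_deriveM. Qed.

Lemma drvZ c f s a : drv f s a -> drv (fun x => c * f x) s (c * a).
Proof. by move=> fa; exact: is_deriveZ. Qed.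

Lemma drv_comp f g s a b : drv g s b -> drv f (g s) a ->
  drv (fun x => f (g x)) s (a * b).
Proof. by move=> gb fa; exact: is_derive1_comp. Qed.

Lemma drvV f s a : f s != 0 -> drv f s a ->
  drv (fun x => (f x)^-1) s (- a / f s ^+ 2).
Proof.
move=> f0 [fd fa]; split; first exact: derivableV.
by rewrite deriveV// fa /GRing.scale /= mulrC mulrN mulNr.
Qed.

Lemma drv_sqrt f s a : 0 < f s -> drv f s a ->
  drv (fun x => Num.sqrt (f x)) s (a / (2 * Num.sqrt (f s))).
Proof.
move=> f0 fa; apply: drv_eq; first exact: drv_comp fa (is_derive1_sqrt f0).
by rewrite mulrC.
Qed.

Lemma drv_sin f s a : drv f s a -> drv (fun x => sin (f x)) s (cos (f s) * a).
Proof. by move=> fa; exact: drv_comp fa (is_derive_sin _). Qed.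

Lemma drv_cos f s a : drv f s a -> drv (fun x => cos (f x)) s (- sin (f s) * a).
Proof. by move=> fa; exact: drv_comp fa (is_derive_cos _). Qed.

Lemma drv_cont f s a : drv f s a -> {for s, continuous f}.
Proof. by move=> [fd _]; exact/differentiable_continuous/derivable1_diffP. Qed.

(** First order expansions are the form in which the chain rule and the derivative of an inverse map
    are established below. *)
Lemma drvP f s d : drv f s d <->
  forall e, 0 < e -> \forall h \near (0:R), `|f (s + h) - f s - d * h| <= e * `|h|.
Proof.
split=> [[fd fdE] e e0|H].
- have /cvgrPdist_le/(_ _ e0) : h^-1 *: ((f \o shift s) (h *: (1:R)) - f s) @[h --> 0^'] --> d.
    by rewrite -fdE; exact: fd.
  rewrite /prop_near1 nbhs_nearE near_withinE => Hn.
  near=> h.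
  have [->|h0] := eqVneq h 0; first by rewrite addr0 subrr mulr0 subr0 normr0 mulr0.
  have : `|d - h^-1 *: ((f \o shift s) (h *: (1:R)) - f s)| <= e.
    by apply: (near Hn h _).
  rewrite /= [h *: 1]mulr1 /GRing.scale /= (addrC h) => He.
  have -> : f (s + h) - f s - d * h = - (h * (d - h^-1 * (f (s + h) - f s))).
    by rewrite mulrBr mulrA divff// mul1r; ring.
  by rewrite normrN normrM mulrC ler_wpM2r.
- have D : h^-1 *: ((f \o shift s) (h *: (1:R)) - f s) @[h --> 0^'] --> d.
    apply/cvgrPdist_le => e e0; rewrite /prop_near1 nbhs_nearE near_withinE.
    have {}H := H _ e0; near=> h => h0.
    have : `|f (s + h) - f s - d * h| <= e * `|h| by apply: (near H h _).
    rewrite /= [h *: 1]mulr1 /GRing.scale /= (addrC h) => He.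
    have -> : d - h^-1 * (f (s + h) - f s) = - (h^-1 * (f (s + h) - f s - d * h)).
      by field.
    by rewrite normrN normrM normfV mulrC ler_pdivrMr// normr_gt0.
  split; first by apply/cvg_ex; exists d.
  by apply/cvg_lim.
Unshelve. all: by end_near. Qed.

Lemma drv_unique f s a b : drv f s a -> drv f s b -> a = b.
Proof. by move=> [_ <-] [_ <-]. Qed.

Lemma drv_MVT f df a b : a < b -> (forall s, a <= s <= b -> drv f s (df s)) ->
  exists2 c, a < c < b & f b - f a = df c * (b - a).
Proof.
move=> ab fd; have [||c cab E] := @MVT R f df a b ab.
- by move=> x; rewrite in_itv /= => /andP[ax xb]; apply: fd; rewrite !ltW.
- apply: continuous_in_subspaceT => x; rewrite inE /= in_itv /= => /fd.
  exact: drv_cont.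
- by exists c => //; move: cab; rewrite in_itv.
Qed.

Lemma drv0_cst f a b : (forall s, a <= s <= b -> drv f s 0) ->
  forall s, a <= s <= b -> f s = f a.
Proof.
move=> fd s /andP[+ sb]; rewrite le_eqVlt => /predU1P[->//|as_].
have [|c _] := @drv_MVT f (fun=> 0) a s as_; last by rewrite mul0r => /subr0_eq.
by move=> x /andP[ax xs]; apply: fd; rewrite ax (le_trans xs).
Qed.

(** Completeness of the reals as an induction principle: the supremum of the parameters up to which
    [P] holds cannot lie before [b]. The continuation arguments along geodesics and over angles run
    through it. *)
Lemma real_induction (P : R -> Prop) a b :
  P a ->
  (forall s, a <= s < b -> (forall r, a <= r <= s -> P r) ->
     exists2 e, 0 < e & forall r, s < r < s + e -> P r) ->
  (forall s, a < s <= b -> (forall r, a <= r < s -> P r) -> P s) ->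
  forall s, a <= s <= b -> P s.
Proof.
move=> Pa Pr Pl s0 /andP[as0 s0b].
pose A := [set s | a <= s <= b /\ forall r, a <= r <= s -> P r].
have Aa : A a.
  split; first by rewrite lexx (le_trans as0).
  by move=> r; rewrite -eq_le => /eqP<-.
have hA : has_sup A.
  by split; [exists a|exists b => x [/andP[]]].
set m := sup A.
have am : a <= m by exact: ub_le_sup hA.2 _ Aa.
have mb : m <= b by apply: ge_sup; [exists a|move=> x [/andP[]]].
have Plt r : a <= r < m -> P r.
  move=> /andP[ar rm].
  have [x Ax mx] := sup_adherent (eps := m - r) (ltac:(by rewrite subr_gt0)) hA.
  move: Ax mx => [_ Px]; rewrite -/m subKr => rx; apply: Px.
  by rewrite ar ltW.
have Pm : P m.
  by move: am; rewrite le_eqVlt => /predU1P[<-//|am']; apply: Pl; rewrite ?am'.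
have Ple r : a <= r <= m -> P r.
  move=> /andP[ar]; rewrite le_eqVlt => /predU1P[->//|rm].
  by apply: Plt; rewrite ar.
have mEb : m = b.
  apply/eqP; rewrite eq_le mb leNgt; apply/negP => mb'.
  have [|e e0 He] := Pr m _ Ple; first by rewrite am mb'.
  pose r := Num.min b (m + e / 2).
  have mr : m < r by rewrite lt_min mb' ltrDl divr_gt0.
  have : A r.
    split.
      by rewrite ge_min lexx (le_trans am)// ltW.
    move=> x /andP[ax xr]; have [xm|mx] := leP x m; first by apply: Ple; rewrite ax.
    apply: He; rewrite mx (le_lt_trans xr)// gt_min ltrD2l; apply/orP; right.
    by lra.
  by move/(ub_le_sup hA.2); rewrite -/m leNgt mr.
by apply: Ple; rewrite as0 mEb.
Qed.

(** The function [f s * expR (- C * s)] has nonpositive derivative, so by the mean value theorem it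
    cannot leave 0 upwards. *)
Lemma drv_gronwall_right f df C a b : (forall s, a <= s <= b -> drv f s (df s)) ->
  (forall s, a <= s <= b -> 0 <= f s) ->
  (forall s, a <= s <= b -> df s <= C * f s) ->
  f a = 0 -> forall s, a <= s <= b -> f s = 0.
Proof.
move=> fd f0 fC fa s /andP[+ sb]; rewrite le_eqVlt => /predU1P[<-//|as_].
have E x : drv (fun x => expR (- C * x)) x (expR (- C * x) * - C).
  apply: drv_comp; last exact: is_derive_expR.
  by apply: drv_eq; [exact/drvZ/drv_id|rewrite mulr1].
have [|c /andP[ac cs]] := @drv_MVT (fun x => f x * expR (- C * x))
  (fun x => f x * (expR (- C * x) * - C) + expR (- C * x) * df x) a s as_.
  by move=> x /andP[ax xs]; apply: drvM => //; apply: fd; rewrite ax (le_trans xs).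
rewrite fa mul0r subr0 => Efs; have cab : a <= c <= b by rewrite (ltW ac)/= ltW// (lt_le_trans cs).
have : f s * expR (- C * s) <= 0.
  rewrite Efs mulr_le0_ge0// ?subr_ge0; last exact: ltW.
  have -> : f c * (expR (- C * c) * - C) + expR (- C * c) * df c = expR (- C * c) * (df c - C * f c) by ring.
  by rewrite mulr_ge0_le0 ?expR_ge0// subr_le0 fC.
rewrite pmulr_lle0 ?expR_gt0// => fs; apply/eqP; rewrite eq_le fs f0//.
by rewrite ltW.
Qed.

(** The constant may depend on the point: real induction chains the local estimates, so that
    coefficients need only be continuous. *)
Lemma drv_gronwall_right_local f df a b : (forall s, a <= s <= b -> drv f s (df s)) ->
  (forall s, a <= s <= b -> 0 <= f s) ->
  (forall s, a <= s <= b -> exists C, \forall r \near s, a <= r <= b -> df r <= C * f r) ->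
  f a = 0 -> forall s, a <= s <= b -> f s = 0.
Proof.
move=> fd f0 fC fa; apply: real_induction => //.
- move=> s /andP[as_ sb] fs.
  have [|C /nbhs_ballP[e /= e0 He]] := fC s; first by rewrite as_ ltW.
  exists (Num.min e (b - s)); first by rewrite lt_min e0 subr_gt0.
  move=> r /andP[sr]; rewrite -ltrBlDl lt_min => /andP[re rb].
  have sub x : s <= x <= r -> a <= x <= b.
    by move=> /andP[sx xr]; rewrite (le_trans as_ sx) (le_trans xr)//; lra.
  apply: (@drv_gronwall_right f df C s r) => //.
  + by move=> x /sub; exact: fd.
  + by move=> x /sub; exact: f0.
  + move=> x xsr; apply: He (sub _ xsr).
    by move: xsr => /andP[sx xr]; rewrite /ball /= distrC ger0_norm; lra.
  + by apply: fs; rewrite as_ lexx.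
  + by rewrite lexx ltW.
- move=> s /andP[as_ sb] fs; apply/eqP; rewrite eq_le f0 ?(ltW as_)// andbT.
  rewrite leNgt; apply/negP => fs0.
  have /drv_cont/cvgrPdist_lt/(_ _ fs0) : drv f s (df s) by apply: fd; rewrite (ltW as_).
  move=> /nbhs_ballP[e /= e0 He].
  pose r := Num.max a (s - e / 2).
  have rs : r < s by rewrite gt_max as_ /=; lra.
  have : ball s e r.
    rewrite /ball /= gtr0_norm ?subr_gt0// ltrBlDr -ltrBlDl /r lt_max.
    by apply/orP; right; lra.
  move/He; rewrite (fs r); last by apply/andP; split; [rewrite /r le_max lexx|exact: rs].
  by rewrite subr0 (gtr0_norm fs0) ltxx.
Qed.

Lemma drv_gronwall f df a b s0 : a <= s0 <= b ->
  (forall s, a <= s <= b -> drv f s (df s)) ->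
  (forall s, a <= s <= b -> 0 <= f s) ->
  (forall s, a <= s <= b -> exists C, \forall r \near s, a <= r <= b -> `|df r| <= C * f r) ->
  f s0 = 0 -> forall s, a <= s <= b -> f s = 0.
Proof.
move=> /andP[as0 s0b] fd f0 fC fs0 s /andP[as_ sb].
have [s0s|/ltW ss0] := leP s0 s.
  apply: (@drv_gronwall_right_local f df s0 b) => //; last by rewrite s0s.
  - by move=> x /andP[s0x xb]; apply: fd; rewrite xb (le_trans as0).
  - by move=> x /andP[s0x xb]; apply: f0; rewrite xb (le_trans as0).
  - move=> x /andP[s0x xb]; have [|C HC] := fC x; first by rewrite xb (le_trans as0).
    exists C; apply: filterS HC => r Hr /andP[s0r rb].
    by apply: le_trans (ler_norm _) (Hr _); rewrite rb (le_trans as0).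
(* To the left of [s0] time is reversed, which is why the hypothesis bounds the absolute value of
   [df]. *)
rewrite -(opprK s).
apply: (@drv_gronwall_right_local (fun x => f (- x)) (fun x => df (- x) * - 1) (- s0) (- a)).
- move=> x /andP[s0x xa]; apply: drv_comp; first exact/drvN/drv_id.
  by apply: fd; apply/andP; split; lra.
- by move=> x /andP[s0x xa]; apply: f0; apply/andP; split; lra.
- move=> x /andP[s0x xa]; have [|C HC] := fC (- x); first by apply/andP; split; lra.
  exists C; have cN : - r @[r --> x] --> - x by exact: opp_continuous.
  have : \forall r \near x, a <= - r <= b -> `|df (- r)| <= C * f (- r) by exact: cN HC.
  apply: filterS => r Hr /andP[s0r ra].
  rewrite mulrN1 (le_trans (ler_norm _))// normrN; apply: Hr.
  by apply/andP; split; lra.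
- by rewrite opprK.
- by apply/andP; split; lra.
Qed.

End real_functions.

(** * Coordinates and the sup norm of row vectors *)

Section row_vectors.
Context {R : realType}.

Lemma rV_coord_le n (v : 'rV[R]_n) k : `|v ord0 k| <= `|v|.
Proof.
rewrite [leRHS]/Num.Def.normr/= mx_normrE.
exact: (le_bigmax _ (fun i : 'I_1 * 'I_n => `|v i.1 i.2|) (ord0, k)).
Qed.

Lemma rV_norm_le n (v : 'rV[R]_n) e : 0 <= e ->
  (forall k, `|v ord0 k| <= e) -> `|v| <= e.
Proof.
move=> e0 ve; rewrite /Num.Def.normr/= mx_normrE bigmax_le// => -[i j] _ /=.
by rewrite ord1.
Qed.

Lemma rV_continuous (T : topologicalType) n (f : T -> 'rV[R]_n) x :
  (forall k, {for x, continuous (fun t => f t ord0 k)}) -> {for x, continuous f}.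
Proof.
move=> fk; apply/cvgrPdist_le => e e0; near=> t.
apply: rV_norm_le => [|k]; first exact: ltW.
rewrite !mxE; move: k; near: t; apply: filter_forall => k.
by have /cvgrPdist_le := fk k; exact.
Unshelve. all: by end_near. Qed.

Lemma rV_continuousP (T : topologicalType) n (f : T -> 'rV[R]_n) x :
  {for x, continuous f} <->
  forall e, 0 < e -> \forall t \near x, `|f x - f t| <= e.
Proof. by split=> [/cvgrPdist_le|H] //; apply/cvgrPdist_le. Qed.

Lemma rV_coord_continuous (T : topologicalType) n (f : T -> 'rV[R]_n) x k :
  {for x, continuous f} -> {for x, continuous (fun t => f t ord0 k)}.
Proof.
move=> fx.
exact: (@continuous_comp _ _ _ f (fun v : 'rV[R]_n => v ord0 k) x fx (@coord_continuous _ _ _ _ _ _)).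
Qed.

Definition vec2 (a b : R) : 'rV[R]_2 := \row_k [:: a; b]`_k.
Definition c1 (v : 'rV[R]_2) : R := v ord0 ord0.
Definition c2 (v : 'rV[R]_2) : R := v ord0 1.

Lemma c1_vec2 a b : c1 (vec2 a b) = a. Proof. by rewrite /c1 mxE. Qed.
Lemma c2_vec2 a b : c2 (vec2 a b) = b. Proof. by rewrite /c2 mxE. Qed.

Lemma rV2P (u v : 'rV[R]_2) : c1 u = c1 v -> c2 u = c2 v -> u = v.
Proof.
move=> h1 h2; apply/rowP => -[[|[|//]] i2].
- by have -> : Ordinal i2 = ord0 by exact/val_inj.
- by have -> : Ordinal i2 = 1 by exact/val_inj.
Qed.

Lemma vec2E v : v = vec2 (c1 v) (c2 v).
Proof. by apply: rV2P; rewrite ?c1_vec2 ?c2_vec2. Qed.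

Lemma c1D u v : c1 (u + v) = c1 u + c1 v. Proof. by rewrite /c1 mxE. Qed.
Lemma c2D u v : c2 (u + v) = c2 u + c2 v. Proof. by rewrite /c2 mxE. Qed.
Lemma c1N u : c1 (- u) = - c1 u. Proof. by rewrite /c1 mxE. Qed.
Lemma c2N u : c2 (- u) = - c2 u. Proof. by rewrite /c2 mxE. Qed.
Lemma c1B u v : c1 (u - v) = c1 u - c1 v. Proof. by rewrite c1D c1N. Qed.
Lemma c2B u v : c2 (u - v) = c2 u - c2 v. Proof. by rewrite c2D c2N. Qed.
Lemma c1Z k u : c1 (k *: u) = k * c1 u. Proof. by rewrite /c1 mxE. Qed.
Lemma c2Z k u : c2 (k *: u) = k * c2 u. Proof. by rewrite /c2 mxE. Qed.

Lemma c1_le v : `|c1 v| <= `|v|. Proof. exact: rV_coord_le. Qed.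
Lemma c2_le v : `|c2 v| <= `|v|. Proof. exact: rV_coord_le. Qed.

Lemma norm2_le v e : `|c1 v| <= e -> `|c2 v| <= e -> `|v| <= e.
Proof.
move=> v1 v2; apply: rV_norm_le => [|k]; first exact: le_trans v1.
by rewrite (vec2E v) mxE; case: k => -[|[|//]] i.
Qed.

Lemma vec2_continuous (T : topologicalType) (f g : T -> R) x :
  {for x, continuous f} -> {for x, continuous g} ->
  {for x, continuous (fun t => vec2 (f t) (g t))}.
Proof.
move=> fx gx; apply: rV_continuous => -[[|[|//]] i2].
- suff -> : (fun t => vec2 (f t) (g t) ord0 (Ordinal i2)) = f by [].
  by apply/funext => t; rewrite mxE.
- suff -> : (fun t => vec2 (f t) (g t) ord0 (Ordinal i2)) = g by [].
  by apply/funext => t; rewrite mxE.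
Qed.

Lemma c1_continuous (T : topologicalType) (f : T -> 'rV[R]_2) x :
  {for x, continuous f} -> {for x, continuous (fun t => c1 (f t))}.
Proof. exact: rV_coord_continuous. Qed.

Lemma c2_continuous (T : topologicalType) (f : T -> 'rV[R]_2) x :
  {for x, continuous f} -> {for x, continuous (fun t => c2 (f t))}.
Proof. exact: rV_coord_continuous. Qed.

Lemma near_continuous (T U : topologicalType) (f : T -> U) x (P : set U) :
  {for x, continuous f} -> nbhs (f x) P -> \forall t \near x, P (f t).
Proof. by move=> fx Px; exact: fx. Qed.

Lemma continuous_near_eq (T U : topologicalType) (f g : T -> U) x :
  (\forall t \near x, f t = g t) -> {for x, continuous f} -> {for x, continuous g}.
Proof.
move=> fg fx; rewrite /prop_for /continuous_at -(nbhs_singleton fg).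
by apply: cvg_trans fx; apply: near_eq_cvg; apply: filterS fg.
Qed.

End row_vectors.

(** * C^1 maps of the plane and the inverse function theorem *)

(* [f] is C^1 on [U] with partial derivatives [a] and [b]. Differentiability is
   expressed by the chain rule along curves. *)
Section C1.
Context {R : realType}.
Local Notation V2 := 'rV[R]_2.
Implicit Types (U : set V2) (f g a b : V2 -> R) (y : R -> V2).

Definition drv2 y s (v1 v2 : R) := drv (c1 \o y) s v1 /\ drv (c2 \o y) s v2.

Record C1 U f a b : Prop := MkC1 {
  C1_cont : forall z, U z -> {for z, continuous f};
  C1_cont1 : forall z, U z -> {for z, continuous a};
  C1_cont2 : forall z, U z -> {for z, continuous b};
  C1_chain : forall y s v1 v2, U (y s) -> drv2 y s v1 v2 ->
    drv (f \o y) s (a (y s) * v1 + b (y s) * v2) }.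

Lemma C1_sub U U' f a b : U' `<=` U -> C1 U f a b -> C1 U' f a b.
Proof.
by move=> U'U [fc ac bc fch]; split=> *; [apply: fc|apply: ac|apply: bc|apply: fch]; auto.
Qed.

Lemma C1_eqd U f a b a' b' : open U -> {in U, a =1 a'} -> {in U, b =1 b'} ->
  C1 U f a b -> C1 U f a' b'.
Proof.
move=> oU aa' bb' [fc ac bc fch]; split=> //.
- move=> z Uz; apply: (continuous_near_eq _ (ac _ Uz)).
  by apply: filterS (open_nbhs_nbhs (conj oU Uz)) => t Ut; apply: aa'; exact/mem_set.
- move=> z Uz; apply: (continuous_near_eq _ (bc _ Uz)).
  by apply: filterS (open_nbhs_nbhs (conj oU Uz)) => t Ut; apply: bb'; exact/mem_set.
- by move=> y s v1 v2 Uy yv; rewrite -aa' -?bb' ?inE//; exact: fch.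
Qed.

Lemma C1_eq U f g a b : open U -> {in U, f =1 g} -> C1 U f a b -> C1 U g a b.
Proof.
move=> oU fg [fc ac bc fch]; split=> //.
- move=> z Uz; apply: (continuous_near_eq _ (fc _ Uz)).
  by apply: filterS (open_nbhs_nbhs (conj oU Uz)) => t Ut; apply: fg; exact/mem_set.
- move=> y s v1 v2 Uy yv; apply: drv_near (fch _ _ _ _ Uy yv) => /=.
  have yc : {for s, continuous y}.
    rewrite (_ : y = fun s => vec2 (c1 (y s)) (c2 (y s))); last first.
      by apply/funext => r; rewrite -vec2E.
    by case: yv => /drv_cont y1 /drv_cont y2; apply: vec2_continuous.
  apply: filterS (near_continuous yc (open_nbhs_nbhs (conj oU Uy))) => t Ut.
  by apply: fg; exact/mem_set.
Qed.

Lemma drv2_cont y s v1 v2 : drv2 y s v1 v2 -> {for s, continuous y}.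
Proof.
move=> yv; rewrite (_ : y = fun s => vec2 (c1 (y s)) (c2 (y s))); last first.
  by apply/funext => r; rewrite -vec2E.
by case: yv => /drv_cont y1 /drv_cont y2; apply: vec2_continuous.
Qed.

Lemma C1_cst U c : C1 U (fun=> c) (fun=> 0) (fun=> 0).
Proof.
split=> *; try exact: cst_continuous.
by apply: drv_eq (drv_cst _ _) _; rewrite !mul0r addr0.
Qed.

Lemma C1_c1 U : C1 U c1 (fun=> 1) (fun=> 0).
Proof.
split=> [*|*|*|y s v1 v2 _ [y1 y2]]; try exact: cst_continuous; first exact: coord_continuous.
by apply: drv_eq y1 _; rewrite mul0r addr0 mul1r.
Qed.

Lemma C1_c2 U : C1 U c2 (fun=> 0) (fun=> 1).
Proof.
split=> [*|*|*|y s v1 v2 _ [y1 y2]]; try exact: cst_continuous; first exact: coord_continuous.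
by apply: drv_eq y2 _; rewrite mul0r add0r mul1r.
Qed.

Lemma C1D U f g a b a' b' : C1 U f a b -> C1 U g a' b' ->
  C1 U (fun z => f z + g z) (fun z => a z + a' z) (fun z => b z + b' z).
Proof.
move=> [fc ac bc fch] [gc a'c b'c gch].
split=> [z Uz|z Uz|z Uz|y s v1 v2 Uy yv]; try by apply: continuousD; auto.
by apply: drv_eq (drvD (fch _ _ _ _ Uy yv) (gch _ _ _ _ Uy yv)) _; ring.
Qed.

Lemma C1N U f a b : C1 U f a b ->
  C1 U (fun z => - f z) (fun z => - a z) (fun z => - b z).
Proof.
move=> [fc ac bc fch].
split=> [z Uz|z Uz|z Uz|y s v1 v2 Uy yv]; try by apply: continuousN; auto.
by apply: drv_eq (drvN (fch _ _ _ _ Uy yv)) _; ring.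
Qed.

Lemma C1B U f g a b a' b' : C1 U f a b -> C1 U g a' b' ->
  C1 U (fun z => f z - g z) (fun z => a z - a' z) (fun z => b z - b' z).
Proof. by move=> fC gC; apply: C1D => //; exact: C1N. Qed.

Lemma C1M U f g a b a' b' : C1 U f a b -> C1 U g a' b' ->
  C1 U (fun z => f z * g z) (fun z => f z * a' z + g z * a z)
    (fun z => f z * b' z + g z * b z).
Proof.
move=> [fc ac bc fch] [gc a'c b'c gch].
split=> [z Uz|z Uz|z Uz|y s v1 v2 Uy yv]; first by apply: continuousM; auto.
- by apply: continuousD; apply: continuousM; auto.
- by apply: continuousD; apply: continuousM; auto.
- by apply: drv_eq (drvM (fch _ _ _ _ Uy yv) (gch _ _ _ _ Uy yv)) _ => /=; ring.
Qed.

Lemma C1V U f a b : (forall z, U z -> f z != 0) -> C1 U f a b ->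
  C1 U (fun z => (f z)^-1) (fun z => - a z / f z ^+ 2) (fun z => - b z / f z ^+ 2).
Proof.
move=> f0 [fc ac bc fch].
have f2 z : U z -> {for z, continuous (fun z => (f z ^+ 2)^-1)}.
  move=> Uz; apply: continuousV; first by rewrite expf_neq0// f0.
  by apply: (@continuousM _ _ f f z); exact: fc.
split=> [z Uz|z Uz|z Uz|y s v1 v2 Uy yv]; first by apply: continuousV; auto.
- by apply: continuousM; [apply: continuousN; auto|exact: f2].
- by apply: continuousM; [apply: continuousN; auto|exact: f2].
- by apply: drv_eq (drvV _ (fch _ _ _ _ Uy yv)) _ => /=; [exact: f0|field; rewrite f0].
Qed.

Lemma C1_sqrt U f a b : (forall z, U z -> 0 < f z) -> C1 U f a b ->
  C1 U (fun z => Num.sqrt (f z)) (fun z => a z / (2 * Num.sqrt (f z)))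
    (fun z => b z / (2 * Num.sqrt (f z))).
Proof.
move=> f0 [fc ac bc fch].
have sc z : U z -> {for z, continuous (fun z => Num.sqrt (f z))}.
  by move=> Uz; exact: (continuous_comp (fc _ Uz) (@sqrt_continuous _ _)).
have s0 z : U z -> 2 * Num.sqrt (f z) != 0.
  by move=> Uz; rewrite mulf_neq0 ?sqrtr_eq0 -?ltNge ?f0// pnatr_eq0.
have f2 z : U z -> {for z, continuous (fun z => (2 * Num.sqrt (f z))^-1)}.
  move=> Uz; apply: continuousV; first exact: s0.
  by apply: continuousM; [exact: cst_continuous|exact: sc].
split=> [z Uz|z Uz|z Uz|y s v1 v2 Uy yv]; first exact: sc.
- by apply: continuousM; [auto|exact: f2].
- by apply: continuousM; [auto|exact: f2].
- apply: drv_eq (drv_sqrt _ (fch _ _ _ _ Uy yv)) _ => /=; first exact: f0.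
  by rewrite /=; field; have := s0 _ Uy; rewrite mulf_eq0 negb_or => /andP[].
Qed.

Lemma drv2_line z v s : drv2 (fun r => z + r *: v) s (c1 v) (c2 v).
Proof.
split.
- apply: (@drv_ext _ (fun r => c1 z + r * c1 v)).
    by move=> r /=; rewrite c1D c1Z.
  apply: drv_eq; first by apply: drvD (drv_cst _ _) (drvM (drv_id _) (drv_cst _ _)).
  by rewrite mulr0 !add0r mulr1.
- apply: (@drv_ext _ (fun r => c2 z + r * c2 v)).
    by move=> r /=; rewrite c2D c2Z.
  apply: drv_eq; first by apply: drvD (drv_cst _ _) (drvM (drv_id _) (drv_cst _ _)).
  by rewrite mulr0 !add0r mulr1.
Qed.

Lemma C1_MVT U f a b z v : C1 U f a b ->
  (forall r, 0 <= r <= 1 -> U (z + r *: v)) ->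
  exists2 r, 0 < r < 1 &
    f (z + v) - f z = a (z + r *: v) * c1 v + b (z + r *: v) * c2 v.
Proof.
move=> fC Uz.
have [|r r01] := @drv_MVT _ (fun r => f (z + r *: v))
  (fun r => a (z + r *: v) * c1 v + b (z + r *: v) * c2 v) 0 1 ltr01.
  by move=> s s01; apply: (C1_chain fC) => //; [exact: Uz|exact: drv2_line].
by rewrite scale1r scale0r addr0 subr0 mulr1; exists r.
Qed.

Lemma C1_frechet U f a b z : open U -> U z -> C1 U f a b ->
  forall e, 0 < e -> \forall v \near (0 : V2),
    `|f (z + v) - f z - (a z * c1 v + b z * c2 v)| <= e * `|v|.
Proof.
move=> oU Uz fC e e0; have e20 : 0 < e / 2 by rewrite divr_gt0.
have /cvgrPdist_le/(_ _ e20) := C1_cont1 fC Uz.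
have /cvgrPdist_le/(_ _ e20) := C1_cont2 fC Uz.
have := open_nbhs_nbhs (conj oU Uz).
move=> /nbhs_ballP[d1 /= d10 U1] /nbhs_ballP[d2 /= d20 U2] /nbhs_ballP[d3 /= d30 U3].
near=> v.
have vd : `|v| < Num.min d1 (Num.min d2 d3).
  near: v; apply/nbhs_ballP; exists (Num.min d1 (Num.min d2 d3)).
    by rewrite /= !lt_min d10 d20.
  by move=> w; rewrite -ball_normE /= sub0r normrN.
have Bv r : 0 <= r <= 1 -> ball z d1 (z + r *: v) /\ ball z d2 (z + r *: v) /\ ball z d3 (z + r *: v).
  move=> /andP[r0 r1]; move: vd; rewrite !lt_min => /and3P[vd1 vd2 vd3].
  have N : `|z - (z + r *: v)| <= `|v|.
    by rewrite opprD addrA subrr add0r normrN normrZ ger0_norm// ler_piMl.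
  by rewrite -!ball_normE /=; split; [|split]; apply: le_lt_trans N _.
have [|r /andP[r0 r1] ->] := @C1_MVT U f a b z v fC.
  by move=> r r01; apply: U1; exact: (Bv r r01).1.
have [|_ [/U2 /= b2 /U3 /= a3]] := Bv r; first by rewrite !ltW.
rewrite (_ : _ - _ = (a (z + r *: v) - a z) * c1 v + (b (z + r *: v) - b z) * c2 v); last ring.
rewrite (le_trans (ler_normD _ _))// !normrM (splitr e) mulrDl lerD//.
- by rewrite ler_pM// ?c1_le// distrC.
- by rewrite ler_pM// ?c2_le// distrC.
Unshelve. all: by end_near. Qed.

End C1.

(** Completeness of spaces of row vectors, for the fixed point theorem in [local_inverse]. *)
HB.instance Definition _ (R : realType) (m n : nat) :=
  Uniform_isComplete.Build 'M[R]_(m, n) cauchy_cvg.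

Section local_inverse.
Context {R : realType}.
Local Notation V2 := 'rV[R]_2.

Lemma near0_bound (T : topologicalType) (f : T -> R) x e : 0 < e ->
  {for x, continuous f} -> f x = 0 -> \forall y \near x, `|f y| <= e.
Proof.
move=> e0 fx fx0; have /cvgrPdist_le/(_ _ e0) := fx; apply: filterS => y.
by rewrite fx0 sub0r normrN.
Qed.

Lemma near_neq0 (T : topologicalType) (f : T -> R) x :
  {for x, continuous f} -> f x != 0 -> \forall y \near x, f y != 0.
Proof.
move=> fx fx0; have e0 : 0 < `|f x| by rewrite normr_gt0.
have /cvgrPdist_lt/(_ _ e0) := fx; apply: filterS => y.
by apply: contraTneq => ->; rewrite subr0 ltxx.
Qed.

(** Simplified Newton iteration: with [L] the inverse of the differential at [y0], the equation
    [psi y = z] says that [y] is a fixed point of [y - L (psi y) + L z], a contraction near [y0].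
    The neighbourhood [W] is cut down so that [psi] maps it onto a whole ball. *)
Lemma local_inverse (U : set V2) f1 a11 a12 f2 a21 a22 (y0 : V2) :
  open U -> U y0 -> C1 U f1 a11 a12 -> C1 U f2 a21 a22 ->
  let det y := a11 y * a22 y - a12 y * a21 y in
  let psi y := vec2 (f1 y) (f2 y) in
  det y0 != 0 ->
  exists (W : set V2) (r : R) (eta : V2 -> V2),
  let B := ball (psi y0) r in
  [/\ open W, W y0, W `<=` U & 0 < r] /\
  [/\ forall z, B z -> W (eta z) /\ psi (eta z) = z,
      forall y, W y -> [/\ B (psi y), eta (psi y) = y & det y != 0],
      C1 B (fun z => c1 (eta z)) (fun z => a22 (eta z) / det (eta z))
                                 (fun z => - a12 (eta z) / det (eta z)) &
      C1 B (fun z => c2 (eta z)) (fun z => - a21 (eta z) / det (eta z))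
                                 (fun z => a11 (eta z) / det (eta z))].
Proof.
move=> oU Uy0 f1C f2C det psi d0.
set d := det y0 in d0.
pose l11 := a22 y0 / d; pose l12 := - a12 y0 / d.
pose l21 := - a21 y0 / d; pose l22 := a11 y0 / d.
pose p11 y := 1 - (l11 * a11 y + l12 * a21 y); pose p12 y := 0 - (l11 * a12 y + l12 * a22 y).
pose p21 y := 0 - (l21 * a11 y + l22 * a21 y); pose p22 y := 1 - (l21 * a12 y + l22 * a22 y).
have CZ k f a b : C1 U f a b -> C1 U (fun z => k * f z) (fun z => k * a z) (fun z => k * b z).
  move=> fC; apply: C1_eqd (C1M (C1_cst _ k) fC) => // z _; by rewrite mulr0 addr0.
(* [T] is the identity minus [L \o psi]; its partial derivatives [p11], ..., [p22] vanish at
   [y0]. *)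
pose T1 y := c1 y - (l11 * f1 y + l12 * f2 y).
pose T2 y := c2 y - (l21 * f1 y + l22 * f2 y).
have T1C : C1 U T1 p11 p12 by apply: C1B; [exact: C1_c1|apply: C1D; exact: CZ].
have T2C : C1 U T2 p21 p22 by apply: C1B; [exact: C1_c2|apply: C1D; exact: CZ].
have z8 : 0 < 8^-1 :> R by rewrite invr_gt0.
have dE : a11 y0 * a22 y0 - a12 y0 * a21 y0 = d by [].
have psic z : U z -> {for z, continuous psi}.
  by move=> Uz; apply: vec2_continuous; [exact: (C1_cont f1C)|exact: (C1_cont f2C)].
have detc : {for y0, continuous det}.
  by apply: continuousB; apply: continuousM; [exact: (C1_cont1 f1C)|exact: (C1_cont2 f2C)|exact: (C1_cont2 f1C)|exact: (C1_cont1 f2C)].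
(* Two partial derivatives bounded by 1/8 give each component of [T], hence [T] in the sup norm, the
   Lipschitz constant 1/4. *)
have : \forall y \near y0, [/\ `|p11 y| <= 8^-1, `|p12 y| <= 8^-1, `|p21 y| <= 8^-1 & `|p22 y| <= 8^-1] /\ (U y /\ det y != 0).
  near=> y; split; [split|split].
  - near: y; apply: (@near0_bound _ p11 y0) => //; first exact: (C1_cont1 T1C).
    by rewrite /p11 /l11 /l12; apply/eqP; rewrite subr_eq0; apply/eqP; rewrite -[in LHS](divff d0) -[in LHS]dE; ring.
  - near: y; apply: (@near0_bound _ p12 y0) => //; first exact: (C1_cont2 T1C).
    by rewrite /p12 /l11 /l12; ring.
  - near: y; apply: (@near0_bound _ p21 y0) => //; first exact: (C1_cont1 T2C).
    by rewrite /p21 /l21 /l22; ring.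
  - near: y; apply: (@near0_bound _ p22 y0) => //; first exact: (C1_cont2 T2C).
    by rewrite /p22 /l21 /l22; apply/eqP; rewrite subr_eq0; apply/eqP; rewrite -[in LHS](divff d0) -[in LHS]dE; ring.
  - by near: y; exact: (open_nbhs_nbhs (conj oU Uy0)).
  - by near: y; exact: (near_neq0 detc d0).
move=> /nbhs_ballP[e /= e0 He].
have ballE (x y : V2) t : ball x t y = (`|x - y| < t) :> Prop by rewrite -ball_normE.
pose T y := vec2 (T1 y) (T2 y).
have Tlip y y' : ball y0 e y -> ball y0 e y' -> `|T y' - T y| <= 4^-1 * `|y' - y|.
  move=> By By'.
  have seg r : 0 <= r <= 1 -> ball y0 e (y + r *: (y' - y)).
    move=> /andP[r0 r1]; move: By By'; rewrite !ballE => By By'.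
    have -> : y0 - (y + r *: (y' - y)) = (1 - r) *: (y0 - y) + r *: (y0 - y').
      by apply: rV2P; rewrite !(c1D, c2D, c1N, c2N, c1Z, c2Z); ring.
    rewrite (le_lt_trans (ler_normD _ _))// !normrZ !ger0_norm ?subr_ge0//.
    move: r0; rewrite le_eqVlt => /predU1P[<-|r0]; first by rewrite subr0 mul0r addr0 mul1r.
    have -> : e = (1 - r) * e + r * e by ring.
    by apply: ler_ltD; [rewrite ler_wpM2l ?subr_ge0// ltW|rewrite ltr_pM2l].
  have bnd f p q : C1 U f p q -> (forall z, ball y0 e z -> `|p z| <= 8^-1 /\ `|q z| <= 8^-1) ->
      `|f y' - f y| <= 4^-1 * `|y' - y|.
    move=> fC pq; have [|r /andP[r0 r1]] := @C1_MVT _ U f p q y (y' - y) fC.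
      by move=> r r01; have [_ []] := He _ (seg _ r01).
    rewrite subrKC => ->.
    have [|pb qb] := pq (y + r *: (y' - y)); first by apply: seg; rewrite !ltW.
    have -> : 4^-1 * `|y' - y| = 8^-1 * `|y' - y| + 8^-1 * `|y' - y| by field.
    rewrite (le_trans (ler_normD _ _))// !normrM.
    by apply: lerD; apply: ler_pM => //; [exact: c1_le|exact: c2_le].
  apply: norm2_le; rewrite !(c1B, c2B) ?c1_vec2 ?c2_vec2.
  - by apply: bnd T1C _ => z /He[[]].
  - by apply: bnd T2C _ => z /He[[]].
pose L (w : V2) := vec2 (l11 * c1 w + l12 * c2 w) (l21 * c1 w + l22 * c2 w).
pose K := 1 + (`|l11| + `|l12| + (`|l21| + `|l22|)).
have K1 : 1 <= K by rewrite lerDl !addr_ge0.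
have K0 : 0 < K by exact: lt_le_trans K1.
have LK w : `|L w| <= K * `|w|.
  have b k1 k2 : `|k1| + `|k2| <= K -> `|k1 * c1 w + k2 * c2 w| <= K * `|w|.
    move=> kK; rewrite (le_trans (ler_normD _ _))// !normrM.
    apply: (@le_trans _ _ ((`|k1| + `|k2|) * `|w|)); last by rewrite ler_wpM2r.
    by rewrite mulrDl lerD// ler_wpM2l// ?c1_le ?c2_le.
  apply: norm2_le; rewrite ?c1_vec2 ?c2_vec2; apply: b.
  - by rewrite /K addrCA lerDl addr_ge0// addr_ge0.
  - by rewrite /K addrA lerDr !addr_ge0.
have LB w w' : L (w - w') = L w - L w'.
  by apply: rV2P; rewrite !(c1B, c2B) ?c1_vec2 ?c2_vec2 !(c1B, c2B) ?c1_vec2 ?c2_vec2 ; ring.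
have TL y : T y + L (psi y) = y.
  by apply: rV2P; rewrite !(c1D, c2D) ?c1_vec2 ?c2_vec2 /T1 /T2 /psi ?c1_vec2 ?c2_vec2 subrK.
have inv_lip y y' : ball y0 e y -> ball y0 e y' -> `|y' - y| <= 2 * K * `|psi y' - psi y|.
  move=> By By'; have := Tlip _ _ By By'.
  have := LK (psi y' - psi y).
  have : `|y' - y| <= `|T y' - T y| + `|L (psi y' - psi y)|.
    rewrite -{1}(TL y') -{1}(TL y) LB opprD addrACA; exact: ler_normD.
  have : 0 <= K * `|psi y' - psi y| by rewrite mulr_ge0// ltW.
  by lra.
(* [L] sends the ball of radius [r] into radius [e / 4]. Since [e / 8 + e / 4 < e / 2], the fixed
   point map sends the closed ball of radius [e / 2] into its interior. *)
pose r := e / (4 * K).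
have r0 : 0 < r by rewrite divr_gt0// mulr_gt0.
pose z0 := psi y0.
pose B := ball z0 r.
have Ksurj z : B z -> exists2 y, ball y0 (e / 2) y & psi y = z.
  rewrite /B ballE distrC => Bz.
  pose U0 := [set y : V2 | `|y - y0| <= e / 2].
  have U0e y : U0 y -> ball y0 e y by rewrite /U0 ballE /= distrC => y2; apply: le_lt_trans y2 _; lra.
  have y0U0 : U0 y0 by rewrite /U0 /= subrr normr0 divr_ge0// ltW.
  pose g y := T y + L z.
  have Lz : `|L (z - z0)| <= e / 4.
    apply: le_trans (LK _) _; have -> : e / 4 = K * r by rewrite /r; field; rewrite gt_eqF.
    by rewrite ler_wpM2l// ltW.
  have gstrict y : U0 y -> `|g y - y0| < e / 2.
    move=> U0y; have := Tlip _ _ (U0e _ y0U0) (U0e _ U0y).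
    have -> : g y - y0 = (T y - T y0) + L (z - z0).
      by rewrite LB /g -{1}(TL y0) opprD addrACA.
    have := ler_normD (T y - T y0) (L (z - z0)); move: U0y; rewrite /U0 /=; lra.
  have gU : set_fun U0 U0 g by move=> y U0y; rewrite /U0 /= ltW// gstrict.
  pose gf : {fun U0 >-> U0} := mkfun_fun gU.
  have gctr : is_contraction gf.
    have q0 : 0 <= 4^-1 :> R by rewrite invr_ge0.
    exists (NngNum q0); split => /=; first by rewrite invf_lt1// ltr1n.
    move=> [y y'] [/= U0y U0y']; rewrite /g /= opprD addrACA subrr addr0.
    exact: Tlip (U0e _ U0y') (U0e _ U0y).
  have [||y U0y yE] := @banach_fixed_point R 'rV[R]_2 U0 gf gctr.
  - have nc : continuous (fun y : V2 => `|y - y0|).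
      by move=> y; apply: continuous_comp; [apply: continuousB; [exact: cvg_id|exact: cst_continuous]|exact: norm_continuous].
    exact: (closed_comp (fun y _ => nc y) (@closed_le R (e / 2))).
  - by exists y0.
  exists y; first by rewrite ballE distrC yE gstrict.
  have yE' : y = T y + L z by exact: yE.
  have Lzy : L z = L (psi y) by apply: (addrI (T y)); rewrite TL.
  have [h1 h2] : l11 * c1 z + l12 * c2 z = l11 * f1 y + l12 * f2 y /\
     l21 * c1 z + l22 * c2 z = l21 * f1 y + l22 * f2 y.
    have := congr1 c1 Lzy; have := congr1 c2 Lzy.
    by rewrite ?c1_vec2 ?c2_vec2 /psi ?c1_vec2 ?c2_vec2.
  apply: rV2P; rewrite /psi ?c1_vec2 ?c2_vec2.
  - have E u v : u = a11 y0 * (l11 * u + l12 * v) + a12 y0 * (l21 * u + l22 * v) :> R.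
      by rewrite /l11 /l12 /l21 /l22 -[in LHS](mulr1 u) -(divff d0) -[X in _ * (X / _) = _]dE; ring.
    by rewrite (E (f1 y) (f2 y)) -h1 -h2 -E.
  - have E u v : v = a21 y0 * (l11 * u + l12 * v) + a22 y0 * (l21 * u + l22 * v) :> R.
      by rewrite /l11 /l12 /l21 /l22 -[in LHS](mulr1 v) -(divff d0) -[X in _ * (X / _) = _]dE; ring.
    by rewrite (E (f1 y) (f2 y)) -h1 -h2 -E.
pose W := [set y | ball y0 (e / 2) y /\ B (psi y)].
have We y : W y -> ball y0 e y.
  by move=> [+ _]; rewrite !ballE => y2; apply: lt_le_trans y2 _; lra.
have WU y : W y -> U y by move=> /We/He[_ []].
pose eta z := xget y0 [set y | ball y0 (e / 2) y /\ psi y = z].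
have etaP z : B z -> W (eta z) /\ psi (eta z) = z.
  move=> Bz; have [y By yE] := Ksurj _ Bz.
  rewrite /eta; case: xgetP => [w _ [h1 h2]|/(_ y)]; last by case.
  by split=> //; split=> //; rewrite h2.
have etaK y : W y -> eta (psi y) = y.
  move=> Wy; have [We' E] := etaP _ Wy.2.
  apply/eqP; rewrite -subr_eq0 -normr_eq0 eq_le normr_ge0 andbT.
  by have := inv_lip _ _ (We _ Wy) (We _ We'); rewrite E subrr normr0 mulr0.
have eta_lip z z' : B z -> B z' -> `|eta z' - eta z| <= 2 * K * `|z' - z|.
  move=> /etaP[W1 E1] /etaP[W2 E2].
  by have := inv_lip _ _ (We _ W1) (We _ W2); rewrite E1 E2.
have oB : open (B : set V2) by exact: ball_open.
have nB (z : V2) : B z -> nbhs z B by move=> Bz; exact: open_nbhs_nbhs.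
have etac (z : V2) : B z -> {for z, continuous eta}.
  move=> Bz; apply/rV_continuousP => t t0.
  have t10 : 0 < (2 * K)^-1 * t by rewrite mulr_gt0// invr_gt0 mulr_gt0.
  apply: filterS2 (nB _ Bz) (nbhsx_ballx z _ t10) => z' Bz'.
  rewrite ballE distrC => zz'; rewrite distrC (le_trans (eta_lip _ _ Bz Bz'))//.
  by rewrite -ler_pdivlMl ?mulr_gt0// ltW.
have oW : open W.
  rewrite openE => y Wy; have [By Bpsi] := Wy.
  apply: filterI; first by apply: open_nbhs_nbhs; split => //; exact: ball_open.
  exact: (near_continuous (psic _ (WU _ Wy)) (nB _ Bpsi)).
(* The increment [w] of [eta] is of order [h] by the Lipschitz bound, so the error in the expansion
   of [psi] is of lower order, and [w] solves the linear system with right side [(v1 h, v2 h)] up to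
   that error. *)
have key ze s v1 v2 : B (ze s) -> drv2 ze s v1 v2 -> forall t, 0 < t ->
    \forall h \near (0 : R), let w := eta (ze (s + h)) - eta (ze s) in
      `|a11 (eta (ze s)) * c1 w + a12 (eta (ze s)) * c2 w - v1 * h| <= t * `|h| /\
      `|a21 (eta (ze s)) * c1 w + a22 (eta (ze s)) * c2 w - v2 * h| <= t * `|h|.
  move=> Bs zev t t0; have zec := drv2_cont zev; move: zev => [/drvP ze1 /drvP ze2].
  set y := eta (ze s); have [Wy yE] := etaP _ Bs.
  pose C := 2 * K * (`|v1| + `|v2| + 1).
  have C0 : 0 < C by rewrite !mulr_gt0// ltr_wpDl// addr_ge0.
  pose t1 := t / (2 * C).
  have t10 : 0 < t1 by rewrite divr_gt0// mulr_gt0.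
  have shc : {for 0, continuous (fun h => s + h)}.
    by apply: continuousD; [exact: cst_continuous|exact: cvg_id].
  have zehc : {for 0, continuous (fun h => ze (s + h))}.
    by apply: (continuous_comp shc); rewrite addr0.
  have whc : {for 0, continuous (fun h => eta (ze (s + h)) - eta (ze s))}.
    apply: continuousB; last exact: cst_continuous.
    by apply: (continuous_comp zehc); rewrite addr0; exact: etac.
  have Uy : U y by exact: WU.
  have nBh : \forall h \near (0 : R), B (ze (s + h)).
    by apply: (near_continuous zehc); rewrite addr0; exact: nB.
  have F1 := C1_frechet oU Uy f1C t10.
  have F2 := C1_frechet oU Uy f2C t10.
  have w0 : 0 = eta (ze (s + 0)) - eta (ze s) by rewrite addr0 subrr.
  rewrite w0 in F1 F2.
  have {}F1 := near_continuous whc F1; have {}F2 := near_continuous whc F2.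
  have t20 : 0 < t / 2 by rewrite divr_gt0.
  have {}F1 : \forall h \near (0 : R), let w := eta (ze (s + h)) - y in
    `|f1 (y + w) - f1 y - (a11 y * c1 w + a12 y * c2 w)| <= t1 * `|w| by exact: F1.
  have {}F2 : \forall h \near (0 : R), let w := eta (ze (s + h)) - y in
    `|f2 (y + w) - f2 y - (a21 y * c1 w + a22 y * c2 w)| <= t1 * `|w| by exact: F2.
  apply: filterS (filterI nBh (filterI (filterI F1 F2) (filterI (filterI (ze1 _ ltr01)
    (ze2 _ ltr01)) (filterI (ze1 _ t20) (ze2 _ t20))))) => h [Bh [[E1 E2] [[z1 z2] [z1t z2t]]]].
  set w := eta (ze (s + h)) - y; rewrite -/w /= in E1 E2 *.
  have wC : `|w| <= C * `|h|.
    apply: le_trans (eta_lip _ _ Bs Bh) _; rewrite (_ : C * _ = 2 * K * ((`|v1| + `|v2| + 1) * `|h|)); last by rewrite mulrA.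
    apply: ler_wpM2l; first by rewrite mulr_ge0// ltW.
    apply: norm2_le; rewrite (c1B, c2B).
    - rewrite -[X in `|X|](subrK (v1 * h)) (le_trans (ler_normD _ _))// normrM.
      by have := mulr_ge0 (normr_ge0 v2) (normr_ge0 h); lra.
    - rewrite -[X in `|X|](subrK (v2 * h)) (le_trans (ler_normD _ _))// normrM.
      by have := mulr_ge0 (normr_ge0 v1) (normr_ge0 h); lra.
  have t1w : t1 * `|w| <= t / 2 * `|h|.
    apply: (@le_trans _ _ (t1 * (C * `|h|))); first by rewrite ler_wpM2l// ltW.
    by rewrite /t1 mulrA le_eqVlt; apply/orP; left; apply/eqP; congr (_ * _); field; rewrite gt_eqF.
  have yw : y + w = eta (ze (s + h)) by rewrite /w subrKC.
  have [_ yhE] := etaP _ Bh.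
  have P1 z : f1 z = c1 (psi z) by rewrite c1_vec2.
  have P2 z : f2 z = c2 (psi z) by rewrite c2_vec2.
  move: E1 E2; rewrite yw !P1 !P2 yhE yE => E1 E2.
  split.
  - rewrite -[X in `|X|](subrKA (c1 (ze (s + h)) - c1 (ze s))).
    by rewrite (le_trans (ler_normD _ _))// distrC; lra.
  - rewrite -[X in `|X|](subrKA (c2 (ze (s + h)) - c2 (ze s))).
    by rewrite (le_trans (ler_normD _ _))// distrC; lra.
have comb (p q u1 u2 x1 x2 t h : R) : 0 < t -> `|u1 - x1 * h| <= t / (`|p| + `|q| + 1) * `|h| ->
    `|u2 - x2 * h| <= t / (`|p| + `|q| + 1) * `|h| ->
    `|p * u1 + q * u2 - (p * x1 + q * x2) * h| <= t * `|h|.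
  move=> t0 h1 h2.
  have pq0 : 0 < `|p| + `|q| + 1 by rewrite ltr_wpDl// addr_ge0.
  have -> : p * u1 + q * u2 - (p * x1 + q * x2) * h = p * (u1 - x1 * h) + q * (u2 - x2 * h) by ring.
  rewrite (le_trans (ler_normD _ _))// !normrM.
  apply: (@le_trans _ _ ((`|p| + `|q|) * (t / (`|p| + `|q| + 1) * `|h|))).
    by rewrite mulrDl lerD// ler_wpM2l.
  rewrite mulrA ler_wpM2r// mulrCA ler_piMr ?(ltW t0)// ler_pdivrMr// mul1r.
  by rewrite lerDl.
have fracc (f : V2 -> R) z : {for eta z, continuous f} -> B z ->
    {for z, continuous (fun z => f (eta z) / det (eta z))}.
  move=> fc Bz; have [Wz _] := etaP _ Bz; have Uz := WU _ Wz.
  have dc : {for eta z, continuous det}.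
    by apply: continuousB; apply: continuousM; [exact: (C1_cont1 f1C)|exact: (C1_cont2 f2C)|exact: (C1_cont2 f1C)|exact: (C1_cont1 f2C)].
  have fdc : {for eta z, continuous (fun y => f y / det y)}.
    by apply: continuousM => //; apply: continuousV => //; have [_ []] := He _ (We _ Wz).
  exact: (continuous_comp (etac _ Bz) fdc).
have Nc f : forall z, {for z, continuous f} -> {for z, continuous (fun y : V2 => - f y : R)}.
  by move=> z; exact: continuousN.
exists W, r, eta; cbv zeta; split; split=> //.
- split; last exact: ballxx.
  by rewrite ballE subrr normr0 divr_gt0.
- by move=> y Wy; split; [exact: Wy.2|exact: etaK|have [_ []] := He _ (We _ Wy)].
- split=> [z Bz|z Bz|z Bz|ze s v1 v2 Bs zev].
  + exact: c1_continuous (etac _ Bz).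
  + by apply: fracc => //; apply: (C1_cont2 f2C); apply: WU; have [] := etaP _ Bz.
  + by apply: (fracc (fun y => - a12 y)) => //; apply: Nc; apply: (C1_cont2 f1C); apply: WU; have [] := etaP _ Bz.
  + have [Wy _] := etaP _ Bs; have [_ [_ dy0]] := He _ (We _ Wy).
    apply/drvP => t t0.
    set p := a22 (eta (ze s)) / det (eta (ze s)); set q := - a12 (eta (ze s)) / det (eta (ze s)).
    have t10 : 0 < t / (`|p| + `|q| + 1) by rewrite divr_gt0// ltr_wpDl// addr_ge0.
    apply: filterS (key _ _ _ _ Bs zev _ t10) => h /= [k1 k2].
    have := comb p q _ _ _ _ _ _ t0 k1 k2; rewrite -c1B.
    set w := eta _ - eta _; rewrite (_ : p * _ + q * _ = c1 w)//.
    by rewrite /p /q /det; field.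
- split=> [z Bz|z Bz|z Bz|ze s v1 v2 Bs zev].
  + exact: c2_continuous (etac _ Bz).
  + by apply: (fracc (fun y => - a21 y)) => //; apply: Nc; apply: (C1_cont1 f2C); apply: WU; have [] := etaP _ Bz.
  + by apply: fracc => //; apply: (C1_cont1 f1C); apply: WU; have [] := etaP _ Bz.
  + have [Wy _] := etaP _ Bs; have [_ [_ dy0]] := He _ (We _ Wy).
    apply/drvP => t t0.
    set p := - a21 (eta (ze s)) / det (eta (ze s)); set q := a11 (eta (ze s)) / det (eta (ze s)).
    have t10 : 0 < t / (`|p| + `|q| + 1) by rewrite divr_gt0// ltr_wpDl// addr_ge0.
    apply: filterS (key _ _ _ _ Bs zev _ t10) => h /= [k1 k2].
    have := comb p q _ _ _ _ _ _ t0 k1 k2; rewrite -c2B.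
    set w := eta _ - eta _; rewrite (_ : p * _ + q * _ = c2 w)//.
    by rewrite /p /q /det; field.
Unshelve. all: by end_near. Qed.

End local_inverse.

(** * From continuous directional derivatives to the chain rule *)

Section Ck_C1.
Context {R : realType}.
Local Notation V2 := 'rV[R]_2.

Lemma drv2_lipschitz (y : R -> V2) s v1 v2 : drv2 y s v1 v2 ->
  \forall h \near (0 : R), `|y (s + h) - y s| <= (`|v1| + `|v2| + 1) * `|h|.
Proof.
move=> [/drvP/(_ _ ltr01) y1 /drvP/(_ _ ltr01) y2].
apply: filterS2 y1 y2 => h /= h1 h2; apply: norm2_le; rewrite (c1B, c2B).
- rewrite -[X in `|X|](subrK (v1 * h)) (le_trans (ler_normD _ _))// normrM.
  by have := mulr_ge0 (normr_ge0 v2) (normr_ge0 h); lra.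
- rewrite -[X in `|X|](subrK (v2 * h)) (le_trans (ler_normD _ _))// normrM.
  by have := mulr_ge0 (normr_ge0 v1) (normr_ge0 h); lra.
Qed.

Lemma frechet_chain (f : V2 -> R) z p q :
  (forall e, 0 < e -> \forall w \near (0 : V2),
    `|f (z + w) - f z - (p * c1 w + q * c2 w)| <= e * `|w|) ->
  forall y s v1 v2, y s = z -> drv2 y s v1 v2 -> drv (f \o y) s (p * v1 + q * v2).
Proof.
move=> fd y s v1 v2 ysz yv; apply/drvP => e e0.
set C := `|v1| + `|v2| + 1; have C0 : 0 < C by rewrite ltr_wpDl// addr_ge0.
have e10 : 0 < e / (2 * C) by rewrite divr_gt0// mulr_gt0.
set D := `|p| + `|q| + 1; have D0 : 0 < D by rewrite ltr_wpDl// addr_ge0.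
have e20 : 0 < e / (2 * D) by rewrite divr_gt0// mulr_gt0.
have whc : {for 0, continuous (fun h => y (s + h) - y s)}.
  apply: continuousB; last exact: cst_continuous.
  apply: (@continuous_comp _ _ _ (fun h => s + h) y).
    by apply: continuousD; [exact: cst_continuous|exact: cvg_id].
  by rewrite addr0; exact: drv2_cont yv.
have w0 : 0 = y (s + 0) - y s by rewrite addr0 subrr.
have F := fd _ e10; rewrite w0 in F.
have {}F := near_continuous whc F.
have L := drv2_lipschitz yv; have [/drvP/(_ _ e20) y1 /drvP/(_ _ e20) y2] := yv.
apply: filterS (filterI (filterI F L) (filterI y1 y2)) => h [[Fh Lh] [/= h1 h2]].
move: Fh Lh h1 h2; rewrite /= -!c1B -!c2B; set w := y (s + h) - y s => Fh Lh h1 h2.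
have yw : y (s + h) = z + w by rewrite -ysz /w subrKC.
rewrite yw ysz -[X in `|X|](subrKA (p * c1 w + q * c2 w)).
rewrite (le_trans (ler_normD _ _))// (_ : e * `|h| = e / 2 * `|h| + e / 2 * `|h|); last by field.
apply: lerD.
- apply: le_trans Fh _; apply: (@le_trans _ _ (e / (2 * C) * (C * `|h|))).
    by rewrite ler_wpM2l// ltW.
  by rewrite le_eqVlt; apply/orP; left; apply/eqP; field; rewrite gt_eqF.
- have -> : p * c1 w + q * c2 w - (p * v1 + q * v2) * h = p * (c1 w - v1 * h) + q * (c2 w - v2 * h) by ring.
  rewrite (le_trans (ler_normD _ _))// !normrM.
  apply: (@le_trans _ _ ((`|p| + `|q|) * (e / (2 * D) * `|h|))).
    by rewrite mulrDl lerD// ler_wpM2l.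
  have -> : e / 2 * `|h| = D * (e / (2 * D) * `|h|) by field; rewrite gt_eqF.
  by apply: ler_wpM2r; [rewrite mulr_ge0// ltW|rewrite /D lerDl].
Qed.

Lemma drv_line0 (V : normedModType R) (f : V -> R) x v : derivable f x v ->
  drv (fun r => f (x + r *: v)) 0 ('D_v f x).
Proof.
move=> fd.
have E : (fun h : R => h^-1 *: (((fun r : R => f (x + r *: v)) \o shift 0) (h *: (1 : R)) -
    f (x + 0 *: v))) = (fun h => h^-1 *: ((f \o shift x) (h *: v) - f x)).
  apply/funext => h; have -> : h *: (1 : R) = h by exact: mulr1.
  by rewrite /= addr0 scale0r addr0 (addrC x).
by split; rewrite /derivable /derive E.
Qed.

Lemma drv_line (V : normedModType R) (f : V -> R) x v s : derivable f (x + s *: v) v ->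
  drv (fun r => f (x + r *: v)) s ('D_v f (x + s *: v)).
Proof.
move=> /drv_line0 fd.
apply: (@drv_ext _ (fun r => (fun r' => f ((x + s *: v) + r' *: v)) (r - s))).
  by move=> r /=; rewrite -addrA -scalerDl subrKC.
have D1 : drv (fun r => r - s) s (1 - 0) by apply: drvB; [exact: drv_id|exact: drv_cst].
rewrite -(subrr s) in fd.
by apply: drv_eq (drv_comp D1 fd) _; rewrite subr0 mulr1.
Qed.

(** The increment is split into a step in the second coordinate and one in the first; the one
    variable mean value theorem applies to each. *)
Lemma partials_C1 (U : set V2) (f : V2 -> R) : open U ->
  (forall z, U z -> {for z, continuous f}) ->
  (forall v z, U z -> derivable f z v) ->
  (forall v z, U z -> {for z, continuous ('D_v f)}) ->
  C1 U f ('D_(vec2 1 0) f) ('D_(vec2 0 1) f).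
Proof.
move=> oU fc fd dfc; split; [exact: fc|exact: dfc|exact: dfc|move=> y s v1 v2 Uy yv].
apply: (frechet_chain (z := y s)) => // e e0; set z := y s in Uy *.
have e20 : 0 < e / 2 by rewrite divr_gt0.
have /cvgrPdist_le/(_ _ e20) := dfc (vec2 1 0) _ Uy.
have /cvgrPdist_le/(_ _ e20) := dfc (vec2 0 1) _ Uy.
have := open_nbhs_nbhs (conj oU Uy).
move=> /nbhs_ballP[d1 /= d10 U1] /nbhs_ballP[d2 /= d20 U2] /nbhs_ballP[d3 /= d30 U3].
have d0 : 0 < Num.min d1 (Num.min d2 d3) by rewrite !lt_min d10 d20.
have := nbhsx_ballx (0 : V2) _ d0; apply: filterS => w.
rewrite -ball_normE /= sub0r normrN !lt_min => /and3P[w1 w2 w3].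
have Bv r t : 0 <= r <= 1 -> 0 <= t <= 1 -> let w' := vec2 (r * c1 w) (t * c2 w) in
    [/\ ball z d1 (z + w'), ball z d2 (z + w') & ball z d3 (z + w')].
  move=> /andP[r0 r1] /andP[t0 t1] w'.
  have N : `|z - (z + w')| <= `|w|.
    rewrite opprD addrA subrr add0r normrN; apply: norm2_le; rewrite (c1_vec2, c2_vec2) normrM ger0_norm//.
    - by rewrite (le_trans _ (c1_le w))// ler_piMl.
    - by rewrite (le_trans _ (c2_le w))// ler_piMl.
  by rewrite -!ball_normE /=; split; apply: le_lt_trans N _.
have E1 : exists2 r, 0 <= r <= 1 & f (z + w) - f (z + vec2 0 (c2 w)) = 'D_(vec2 1 0) f (z + vec2 (r * c1 w) (c2 w)) * c1 w.
  have A r : z + vec2 0 (c2 w) + r *: vec2 (c1 w) 0 = z + vec2 (r * c1 w) (c2 w).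
    by apply: rV2P; rewrite !(c1D,c2D,c1Z,c2Z,c1_vec2,c2_vec2); ring.
  have [|r /andP[r0 r1]] := @drv_MVT _ (fun r => f (z + vec2 0 (c2 w) + (r * c1 w) *: vec2 1 0))
      (fun r => 'D_(vec2 1 0) f (z + vec2 (r * c1 w) (c2 w)) * c1 w) 0 1 ltr01.
    move=> r r01; have A' : z + vec2 (r * c1 w) (c2 w) = z + vec2 0 (c2 w) + (r * c1 w) *: vec2 1 0.
      by apply: rV2P; rewrite !(c1D,c2D,c1Z,c2Z,c1_vec2,c2_vec2); ring.
    rewrite A'; apply: (@drv_comp _ (fun r => f (z + vec2 0 (c2 w) + r *: vec2 1 0)) (fun r => r * c1 w)).
      by apply: drv_eq; [apply: drvM; [exact: drv_id|exact: drv_cst]|rewrite /=; ring].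
    apply: drv_line; apply: fd; rewrite -A'; apply: U1.
    by have [] := Bv r 1 r01; rewrite ?ler01 ?lexx// mul1r.
  rewrite subr0 mulr1 mul1r mul0r scale0r addr0 => E; exists r; first by rewrite !ltW.
  by rewrite -E; congr (f _ - _); apply: rV2P; rewrite !(c1D,c2D,c1Z,c2Z,c1_vec2,c2_vec2); ring.
have E2 : exists2 r, 0 <= r <= 1 & f (z + vec2 0 (c2 w)) - f z = 'D_(vec2 0 1) f (z + vec2 0 (r * c2 w)) * c2 w.
  have [|r /andP[r0 r1]] := @drv_MVT _ (fun r => f (z + (r * c2 w) *: vec2 0 1))
      (fun r => 'D_(vec2 0 1) f (z + vec2 0 (r * c2 w)) * c2 w) 0 1 ltr01.
    move=> r r01; have A' : z + vec2 0 (r * c2 w) = z + (r * c2 w) *: vec2 0 1.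
      by apply: rV2P; rewrite !(c1D,c2D,c1Z,c2Z,c1_vec2,c2_vec2); ring.
    rewrite A'; apply: (@drv_comp _ (fun r => f (z + r *: vec2 0 1)) (fun r => r * c2 w)).
      by apply: drv_eq; [apply: drvM; [exact: drv_id|exact: drv_cst]|rewrite /=; ring].
    apply: drv_line; apply: fd; rewrite -A'; apply: U1.
    by have [] := Bv 0 r _ r01; rewrite ?ler01 ?lexx// mul0r.
  rewrite subr0 mulr1 mul1r mul0r scale0r addr0 => E; exists r; first by rewrite !ltW.
  by rewrite -E; congr (f _ - _); apply: rV2P; rewrite !(c1D,c2D,c1Z,c2Z,c1_vec2,c2_vec2); ring.
have [r r01 {}E1] := E1; have [t t01 {}E2] := E2.
rewrite -[X in X - _](subrKA (f (z + vec2 0 (c2 w)))) E1 E2.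
have [_ _ B3] : [/\ ball z d1 (z + vec2 (r * c1 w) (c2 w)), ball z d2 (z + vec2 (r * c1 w) (c2 w)) & ball z d3 (z + vec2 (r * c1 w) (c2 w))].
  by have := Bv r 1 r01; rewrite mul1r; apply; rewrite ler01 lexx.
have [_ B2 _] : [/\ ball z d1 (z + vec2 0 (t * c2 w)), ball z d2 (z + vec2 0 (t * c2 w)) & ball z d3 (z + vec2 0 (t * c2 w))].
  by have := Bv 0 t _ t01; rewrite mul0r; apply; rewrite ler01 lexx.
set a := 'D__ f _; set b := 'D__ f _; rewrite (_ : _ - _ = (a - 'D_(vec2 1 0) f z) * c1 w + (b - 'D_(vec2 0 1) f z) * c2 w); last ring.
rewrite (le_trans (ler_normD _ _))// !normrM (_ : e * `|w| = e / 2 * `|w| + e / 2 * `|w|); last by field.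
apply: lerD.
- by rewrite ler_pM// ?c1_le// distrC; exact: U3 B3.
- by rewrite ler_pM// ?c2_le// distrC; exact: U2 B2.
Qed.

Lemma Ck1_C1 n (U : set V2) (G : V2 -> 'rV[R]_n) k : open U -> Ck 1 U G ->
  C1 U (fun y => G y ord0 k) (fun y => 'D_(vec2 1 0) G y ord0 k)
    (fun y => 'D_(vec2 0 1) G y ord0 k).
Proof.
move=> oU [Gc GD].
have dE v y : U y -> 'D_v (fun y => G y ord0 k) y = 'D_v G y ord0 k.
  by move=> Uy; rewrite derive_mx ?mxE//; have [GDv _] := GD v; exact: GDv.
have C : C1 U (fun y => G y ord0 k) ('D_(vec2 1 0) (fun y => G y ord0 k)) ('D_(vec2 0 1) (fun y => G y ord0 k)).
  apply: partials_C1 => //.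
  - by move=> z Uz; apply: rV_coord_continuous; exact: Gc.
  - by move=> v z Uz; have [GDv _] := GD v; have /derivable_mxP := GDv _ Uz; exact.
  - move=> v z Uz; have [_ [GDc _]] := GD v.
    apply: (@continuous_near_eq _ _ (fun y => 'D_v G y ord0 k) ('D_v (fun y => G y ord0 k)) z); last exact: rV_coord_continuous (GDc _ Uz).
    by apply: filterS (open_nbhs_nbhs (conj oU Uz)) => t Ut; rewrite dE.
by apply: C1_eqd C => // z /set_mem Uz; exact: dE.
Qed.

(** [Ck] speaks of each direction separately; linearity in [v] comes from the chain rule along the
    line through [y]. *)
Lemma Ck1_derive n (U : set V2) (G : V2 -> 'rV[R]_n) y v : open U -> U y -> Ck 1 U G ->
  'D_v G y = c1 v *: 'D_(vec2 1 0) G y + c2 v *: 'D_(vec2 0 1) G y.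
Proof.
move=> oU Uy GC; apply/rowP => k; have C := Ck1_C1 k oU GC.
have GD : derivable G y v by have [_ GD] := GC; have [GDv _] := GD v; exact: GDv.
have /derivable_mxP/(_ ord0 k) := GD => /(@drv_line0 _ (fun y => G y ord0 k)) D1.
have y0 : y + 0 *: v = y by rewrite scale0r addr0.
have := C1_chain C (y := fun r => y + r *: v) (s := 0); rewrite y0 => /(_ _ _ Uy (drv2_line y v 0)) D2.
have E := drv_unique D1 D2.
have -> : 'D_v G y ord0 k = 'D_v (fun y => G y ord0 k) y by rewrite (derive_mx GD) mxE.
rewrite E.
have -> A B : (c1 v *: A + c2 v *: B : 'rV[R]_n) ord0 k = A ord0 k * c1 v + B ord0 k * c2 v.
  by move=> *; rewrite !mxE (mulrC (c1 v)) (mulrC (c2 v)).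
by [].
Qed.

End Ck_C1.

(** * The Levi-Civita connection *)

Section connection.
Context {R : realType}.
Local Notation H1 := 'rV[R]_3.
Implicit Types p u v w : H1.

Lemma rV3P u v : xc u = xc v -> yc u = yc v -> tc u = tc v -> u = v.
Proof. by move=> h1 h2 h3; rewrite (vec3E u) (vec3E v) h1 h2 h3. Qed.

Lemma xcD u v : xc (u + v) = xc u + xc v. Proof. by rewrite /xc mxE. Qed.
Lemma ycD u v : yc (u + v) = yc u + yc v. Proof. by rewrite /yc mxE. Qed.
Lemma tcD u v : tc (u + v) = tc u + tc v. Proof. by rewrite /tc mxE. Qed.
Lemma xcN u : xc (- u) = - xc u. Proof. by rewrite /xc mxE. Qed.
Lemma ycN u : yc (- u) = - yc u. Proof. by rewrite /yc mxE. Qed.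
Lemma tcN u : tc (- u) = - tc u. Proof. by rewrite /tc mxE. Qed.
Lemma xcZ k u : xc (k *: u) = k * xc u. Proof. by rewrite /xc mxE. Qed.
Lemma ycZ k u : yc (k *: u) = k * yc u. Proof. by rewrite /yc mxE. Qed.
Lemma tcZ k u : tc (k *: u) = k * tc u. Proof. by rewrite /tc mxE. Qed.
Definition cE := (xcD, ycD, tcD, xcN, ycN, tcN, xcZ, ycZ, tcZ, @xc_vec3 R, @yc_vec3 R, @tc_vec3 R).

Lemma tcompD p u v : tcomp p (u + v) = tcomp p u + tcomp p v.
Proof. by rewrite /tcomp !cE; ring. Qed.

Lemma tcompZ p k u : tcomp p (k *: u) = k * tcomp p u.
Proof. by rewrite /tcomp !cE; ring. Qed.

Lemma metricDl p u v w : metric p (u + v) w = metric p u w + metric p v w.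
Proof. by rewrite /metric tcompD !cE; ring. Qed.

Lemma horizontalP p u : horizontal p u <-> tcomp p u = 0.
Proof.
split=> [[a [b ->]]|u0]; first by rewrite /tcomp /fieldX /fieldY !cE; ring.
by exists (xc u), (yc u); rewrite {1}(frame_decomp p u) u0 scale0r addr0.
Qed.

Lemma hprojE p u : hproj p u = xc u *: fieldX p + yc u *: fieldY p.
Proof.
by congr (_ *: _ + _ *: _); rewrite /metric /tcomp /fieldX /fieldY !cE; ring.
Qed.

Let ex (i : 'I_3) : R := xc (delta_mx ord0 i).
Let ey (i : 'I_3) : R := yc (delta_mx ord0 i).
Let et (i : 'I_3) : R := tc (delta_mx ord0 i).

(** The T-component of a constant vector is affine in the base point, so each entry of [gram] is a
    constant plus a product of two affine functions. *)
Lemma derive_gram p v (j l : 'I_3) : 'D_v (fun q => gram q j l) p =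
  (- yc v * ex j + xc v * ey j) * (et l - yc p * ex l + xc p * ey l) +
  (et j - yc p * ex j + xc p * ey j) * (- yc v * ex l + xc v * ey l).
Proof.
have lin (k : 'I_3) (r : R) : is_derive p v (fun q : H1 => r * q ord0 k) (r * v ord0 k).
  have D : is_derive p v (fun q : H1 => q ord0 k) (v ord0 k).
    split; first exact/diff_derivable/differentiable_coord.
    by have /(congr1 (fun u : H1 => u ord0 k)) := @derive_mx R _ 1 3 id p v (@derivable_id _ _ p v); rewrite derive_id mxE.
  exact: is_deriveZ.
have tau (m : 'I_3) : is_derive p v (fun q : H1 => et m + ((- ex m) * yc q + ey m * xc q))
    (0 + ((- ex m) * yc v + ey m * xc v)).
  by apply: is_deriveD; apply: is_deriveD; exact: lin.
pose T (m : 'I_3) q := et m + (- ex m * yc q + ey m * xc q).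
pose dT (m : 'I_3) := 0 + (- ex m * yc v + ey m * xc v).
have [_ fE] : is_derive p v (fun q => (ex j * ex l + ey j * ey l) + T j q * T l q)
    (0 + (T j p * dT l + T l p * dT j)).
  exact: (is_deriveD (is_derive_cst (ex j * ex l + ey j * ey l) p v) (is_deriveM (tau j) (tau l))).
have -> : (fun q => gram q j l) = (fun q => (ex j * ex l + ey j * ey l) + T j q * T l q).
  apply/funext => q; rewrite mxE /metric /tcomp -/(ex j) -/(ex l) -/(ey j) -/(ey l) -/(et j) -/(et l) /T; ring.
by rewrite fE /T /dT; ring.
Qed.


Lemma ex_e : [/\ ex ord0 = 1, ex 1 = 0 & ex ord_max = 0].
Proof. by rewrite /ex /xc; split; rewrite mxE. Qed.
Lemma ey_e : [/\ ey ord0 = 0, ey 1 = 1 & ey ord_max = 0].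
Proof. by rewrite /ey /yc; split; rewrite mxE. Qed.
Lemma et_e : [/\ et ord0 = 0, et 1 = 0 & et ord_max = 1].
Proof. by rewrite /et /tc; split; rewrite mxE. Qed.

Lemma sum3 (f : 'I_3 -> R) : \sum_i f i = f ord0 + f 1 + f ord_max.
Proof.
rewrite !big_ord_recl big_ord0 addr0 addrA; congr (_ + f _ + f _); exact/val_inj.
Qed.

(* The inverse Gram matrix is the sum of [E^T E] over the orthonormal frame. *)
Lemma invmx_gram p : invmx (gram p) = \matrix_(k, l)
  (fieldX p ord0 k * fieldX p ord0 l + fieldY p ord0 k * fieldY p ord0 l +
   fieldT p ord0 k * fieldT p ord0 l).
Proof.
set B := \matrix_(k, l) _.
have AB : gram p *m B = 1%:M.
  have [x0 x1 x2] := ex_e; have [y0 y1 y2] := ey_e; have [t0 t1 t2] := et_e.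
  apply/matrixP => i j; rewrite mxE sum3 ![gram p i _]mxE /metric /tcomp.
  rewrite -!/(ex _) -!/(ey _) -!/(et _) x0 x1 x2 y0 y1 y2 t0 t1 t2 !mxE /=.
  case: i => -[|[|[|//]]] i3; case: j => -[|[|[|//]]] j3 /=; 
   rewrite /ex /ey /et /xc /yc /tc !mxE /=; ring.
have [Au _] := mulmx1_unit AB.
by rewrite -[LHS]mulmx1 -AB mulmxA mulVmx// mul1mx.
Qed.

(** The coordinate Christoffel symbols become short when read in the frame X, Y. The identity
    [D_X Y = - T] is not visible here, as it comes from differentiating the coordinates of Y. *)
Lemma gammaE p u w : gamma p u w =
  (- (tcomp p u * yc w + yc u * tcomp p w)) *: fieldX p +
  (tcomp p u * xc w + xc u * tcomp p w) *: fieldY p.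
Proof.
have [x0 x1 x2] := ex_e; have [y0 y1 y2] := ey_e; have [t0 t1 t2] := et_e.
have chr i j k : christoffel p i j k = 2^-1 * \sum_l
    (fieldX p ord0 k * fieldX p ord0 l + fieldY p ord0 k * fieldY p ord0 l +
     fieldT p ord0 k * fieldT p ord0 l) *
    (((- ey i * ex j + ex i * ey j) * (et l - yc p * ex l + xc p * ey l) +
     (et j - yc p * ex j + xc p * ey j) * (- ey i * ex l + ex i * ey l)) +
     ((- ey j * ex i + ex j * ey i) * (et l - yc p * ex l + xc p * ey l) +
     (et i - yc p * ex i + xc p * ey i) * (- ey j * ex l + ex j * ey l)) -
     ((- ey l * ex i + ex l * ey i) * (et j - yc p * ex j + xc p * ey j) +
     (et i - yc p * ex i + xc p * ey i) * (- ey l * ex j + ex l * ey j))).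
  rewrite /christoffel; congr (_ * _); apply: eq_bigr => l _.
  by rewrite invmx_gram mxE !derive_gram.
have fE (f : 'I_3 -> 'I_3 -> 'I_3 -> R) k : \sum_i \sum_j f i j k * u ord0 i * w ord0 j =
   xc u * (f ord0 ord0 k * xc w + f ord0 1 k * yc w + f ord0 ord_max k * tc w) +
   yc u * (f 1 ord0 k * xc w + f 1 1 k * yc w + f 1 ord_max k * tc w) +
   tc u * (f ord_max ord0 k * xc w + f ord_max 1 k * yc w + f ord_max ord_max k * tc w).
  rewrite sum3 !(sum3 (fun j => _)) /xc /yc /tc; ring.
have fX : [/\ fieldX p ord0 ord0 = 1, fieldX p ord0 1 = 0 & fieldX p ord0 ord_max = yc p].
  by split; rewrite mxE.
have fY : [/\ fieldY p ord0 ord0 = 0, fieldY p ord0 1 = 1 & fieldY p ord0 ord_max = - xc p].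
  by split; rewrite mxE.
have fT : [/\ fieldT p ord0 ord0 = 0, fieldT p ord0 1 = 0 & fieldT p ord0 ord_max = 1].
  by split; rewrite mxE.
apply/rowP => k; rewrite mxE fE.
have [X0 X1 X2] := fX; have [Y0 Y1 Y2] := fY; have [T0 T1 T2] := fT.
rewrite !chr !(sum3 (fun l => _)) !x0 !x1 !x2 !y0 !y1 !y2 !t0 !t1 !t2 X0 X1 X2 Y0 Y1 Y2 T0 T1 T2.
rewrite /tcomp; case: k => -[|[|[|//]]] k3; rewrite !mxE /=; by field.
Qed.

Lemma JE p u : J p u = - yc u *: fieldX p + xc u *: fieldY p.
Proof.
rewrite /J /nabla (_ : 'D_u fieldT p = 0); last first.
  by rewrite (_ : @fieldT R = cst (vec3 0 0 1)) ?derive_cst.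
have tT : tcomp p (fieldT p) = 1 by rewrite /tcomp /fieldT !cE; ring.
by rewrite add0r gammaE tT /fieldT !cE !mulr0 !mulr1 !add0r.
Qed.

(** Hence, along horizontal curves, the geodesic equation is linear with constant coefficients in
    the components of the velocity, and its solutions are explicit. *)
Lemma gamma_horizontal p u w : tcomp p u = 0 -> tcomp p w = 0 -> gamma p u w = 0.
Proof. by move=> u0 w0; rewrite gammaE u0 w0 !mul0r !mulr0 addr0 oppr0 !scale0r addr0. Qed.

Lemma derive_vec3 (V : normedModType R) (f g h : V -> R) (y v : V) df dg dh : is_derive y v f df ->
  is_derive y v g dg -> is_derive y v h dh ->
  'D_v (fun y => vec3 (f y) (g y) (h y)) y = vec3 df dg dh.
Proof.
move=> [fd <-] [gd <-] [hd <-]; rewrite derive_mx.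
  apply: rV3P; rewrite (xc_vec3, yc_vec3, tc_vec3) /xc /yc /tc mxE;
    congr ('D_v _ y); by apply/funext => z; rewrite mxE.
apply: (@derivable_mxP R V 1 3 (fun y => vec3 (f y) (g y) (h y)) y v).2 => k j.
have -> : k = ord0 by exact: ord1.
case: j => j j3; case: j j3 => [|[|[|j]]] j3.
all: cycle 3.
  by exfalso; move: j3; rewrite !ltnS ltn0.
- have -> : (fun x => vec3 (f x) (g x) (h x) ord0 (Ordinal j3)) = f by apply/funext => z; rewrite mxE.
  exact: fd.
- have -> : (fun x => vec3 (f x) (g x) (h x) ord0 (Ordinal j3)) = g by apply/funext => z; rewrite mxE.
  exact: gd.
- have -> : (fun x => vec3 (f x) (g x) (h x) ord0 (Ordinal j3)) = h by apply/funext => z; rewrite mxE.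
  exact: hd.
Qed.

End connection.

(** * C^1 functions with unnamed partial derivatives *)

Section isC1.
Context {R : realType}.
Local Notation V2 := 'rV[R]_2.
Implicit Types (U : set V2) (f g : V2 -> R).

Definition isC1 U f := exists a b, C1 U f a b.

Lemma isC1_sub U U' f : U' `<=` U -> isC1 U f -> isC1 U' f.
Proof. by move=> U'U [a [b fC]]; exists a, b; exact: C1_sub fC. Qed.

Lemma isC1_eq U f g : open U -> {in U, f =1 g} -> isC1 U f -> isC1 U g.
Proof. by move=> oU fg [a [b fC]]; exists a, b; exact: C1_eq fC. Qed.

Lemma isC1_cst U c : isC1 U (fun=> c).
Proof. by exists (fun=> 0), (fun=> 0); exact: C1_cst. Qed.

Lemma isC1D U f g : isC1 U f -> isC1 U g -> isC1 U (fun z => f z + g z).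
Proof. by move=> [a [b fC]] [a' [b' gC]]; do 2 eexists; exact: (C1D fC gC). Qed.

Lemma isC1N U f : isC1 U f -> isC1 U (fun z => - f z).
Proof. by move=> [a [b fC]]; do 2 eexists; exact: (C1N fC). Qed.

Lemma isC1B U f g : isC1 U f -> isC1 U g -> isC1 U (fun z => f z - g z).
Proof. by move=> [a [b fC]] [a' [b' gC]]; do 2 eexists; exact: (C1B fC gC). Qed.

Lemma isC1M U f g : isC1 U f -> isC1 U g -> isC1 U (fun z => f z * g z).
Proof. by move=> [a [b fC]] [a' [b' gC]]; do 2 eexists; exact: (C1M fC gC). Qed.

Lemma isC1V U f : (forall z, U z -> f z != 0) -> isC1 U f -> isC1 U (fun z => (f z)^-1).
Proof. by move=> f0 [a [b fC]]; do 2 eexists; exact: (C1V f0 fC). Qed.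

Lemma isC1_sqrt U f : (forall z, U z -> 0 < f z) -> isC1 U f ->
  isC1 U (fun z => Num.sqrt (f z)).
Proof. by move=> f0 [a [b fC]]; do 2 eexists; exact: (C1_sqrt f0 fC). Qed.

Lemma isC1_cont U f z : isC1 U f -> U z -> {for z, continuous f}.
Proof. by move=> [a [b fC]]; exact: (C1_cont fC). Qed.

Lemma C1_is_derive U f a b y v : U y -> C1 U f a b ->
  is_derive y v f (a y * c1 v + b y * c2 v).
Proof.
move=> Uy fC; have y0 : y + 0 *: v = y by rewrite scale0r addr0.
have := C1_chain fC (y := fun r => y + r *: v) (s := 0).
rewrite y0 => /(_ _ _ Uy (drv2_line y v 0)) [D1 <-].
have E : (fun h : R => h^-1 *: (((f \o (fun r : R => y + r *: v)) \o shift 0) (h *: (1 : R)) -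
    (f \o (fun r : R => y + r *: v)) 0)) = (fun h => h^-1 *: ((f \o shift y) (h *: v) - f y)).
  apply/funext => h; have -> : h *: (1 : R) = h by exact: mulr1.
  by rewrite /= addr0 scale0r addr0 (addrC y).
by move: D1; rewrite /derivable /derive E => D1; split.
Qed.

End isC1.

Lemma same_sign (R : realType) (a b : R) : 0 < a * b -> b = a / `|a| * `|b|.
Proof.
have [a0|a0|<-] := ltgtP 0 a; last by rewrite mul0r ltxx.
- by rewrite pmulr_rgt0// => b0; rewrite !gtr0_norm// divff ?mul1r// gt_eqF.
- rewrite nmulr_rgt0// => b0; rewrite !ltr0_norm// invrN [a * _]mulrN mulrNN.
  by rewrite divff ?mul1r// lt_eqF.
Qed.

(** * Tangent planes and the cross product of two tangent vectors *)

Section cross_product.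
Context {R : realType}.
Variables a1 a2 a3 b1 b2 b3 : R.
Let m1 := a2 * b3 - a3 * b2.
Let m2 := a3 * b1 - a1 * b3.
Let m3 := a1 * b2 - a2 * b1.
Let mm := m1 ^+ 2 + m2 ^+ 2 + m3 ^+ 2.

Lemma cross_gt0 : (forall s t, s * a1 + t * b1 = 0 -> s * a2 + t * b2 = 0 ->
    s * a3 + t * b3 = 0 -> s = 0 /\ t = 0) -> 0 < mm.
Proof.
move=> K; rewrite lt0r !addr_ge0 ?sqr_ge0// andbT; apply/negP.
rewrite !paddr_eq0 ?addr_ge0 ?sqr_ge0// !sqrf_eq0 => /andP[/andP[/eqP M1 /eqP M2] /eqP M3].
rewrite /m1 in M1; rewrite /m2 in M2; rewrite /m3 in M3.
have [_ A1] : b1 = 0 /\ - a1 = 0 by apply: K; lra.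
have [_ A2] : b2 = 0 /\ - a2 = 0 by apply: K; lra.
have [_ A3] : b3 = 0 /\ - a3 = 0 by apply: K; lra.
have [|||/eqP] := K 1 0; [lra|lra|lra|].
by rewrite oner_eq0.
Qed.

Hypothesis mm_gt0 : 0 < mm.

(** The cross product of [x] with [m] vanishes by the expansion of a double cross product, so [x] is
    a multiple of [m]. *)
Lemma cross_normal x1 x2 x3 : x1 * a1 + x2 * a2 + x3 * a3 = 0 ->
  x1 * b1 + x2 * b2 + x3 * b3 = 0 -> x1 ^+ 2 + x2 ^+ 2 + x3 ^+ 2 = 1 ->
  let d := x1 * m1 + x2 * m2 + x3 * m3 in
  [/\ x1 * mm = d * m1, x2 * mm = d * m2, x3 * mm = d * m3 & d ^+ 2 = mm].
Proof.
move=> xa xb x2E d.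
have C1 : x2 * m3 - x3 * m2 = 0.
  have -> : x2 * m3 - x3 * m2 = a1 * (x1 * b1 + x2 * b2 + x3 * b3) - b1 * (x1 * a1 + x2 * a2 + x3 * a3).
    by rewrite /m3 /m2; ring.
  by rewrite xa xb !mulr0 subr0.
have C2 : x3 * m1 - x1 * m3 = 0.
  have -> : x3 * m1 - x1 * m3 = a2 * (x1 * b1 + x2 * b2 + x3 * b3) - b2 * (x1 * a1 + x2 * a2 + x3 * a3).
    by rewrite /m3 /m1; ring.
  by rewrite xa xb !mulr0 subr0.
have C3 : x1 * m2 - x2 * m1 = 0.
  have -> : x1 * m2 - x2 * m1 = a3 * (x1 * b1 + x2 * b2 + x3 * b3) - b3 * (x1 * a1 + x2 * a2 + x3 * a3).
    by rewrite /m2 /m1; ring.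
  by rewrite xa xb !mulr0 subr0.
have E1 : x1 * mm = d * m1.
  have -> : x1 * mm = d * m1 + (m2 * (x1 * m2 - x2 * m1) - m3 * (x3 * m1 - x1 * m3)) by rewrite /d /mm; ring.
  by rewrite C2 C3 !mulr0 subr0 addr0.
have E2 : x2 * mm = d * m2.
  have -> : x2 * mm = d * m2 + (m3 * (x2 * m3 - x3 * m2) - m1 * (x1 * m2 - x2 * m1)) by rewrite /d /mm; ring.
  by rewrite C1 C3 !mulr0 subr0 addr0.
have E3 : x3 * mm = d * m3.
  have -> : x3 * mm = d * m3 + (m1 * (x3 * m1 - x1 * m3) - m2 * (x2 * m3 - x3 * m2)) by rewrite /d /mm; ring.
  by rewrite C1 C2 !mulr0 subr0 addr0.
split=> //; apply: (mulIf (lt0r_neq0 mm_gt0)).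
transitivity ((d * m1) ^+ 2 + (d * m2) ^+ 2 + (d * m3) ^+ 2); first by rewrite /mm; ring.
rewrite -E1 -E2 -E3; transitivity ((x1 ^+ 2 + x2 ^+ 2 + x3 ^+ 2) * mm ^+ 2); first ring.
by rewrite x2E mul1r expr2.
Qed.

(** Cramer's rule in the basis [a], [b], [m]; the coefficient of [m] is zero because [u] is
    orthogonal to [m]. *)
Lemma cross_span x1 x2 x3 u1 u2 u3 : x1 * a1 + x2 * a2 + x3 * a3 = 0 ->
  x1 * b1 + x2 * b2 + x3 * b3 = 0 -> x1 ^+ 2 + x2 ^+ 2 + x3 ^+ 2 = 1 ->
  x1 * u1 + x2 * u2 + x3 * u3 = 0 ->
  exists s t, [/\ u1 = s * a1 + t * b1, u2 = s * a2 + t * b2 & u3 = s * a3 + t * b3].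
Proof.
move=> xa xb x2E xu; have [] := cross_normal xa xb x2E.
set d := _ + _ => E1 E2 E3 d2; have mm0 := lt0r_neq0 mm_gt0.
have d0 : d != 0 by rewrite -sqrf_eq0 d2.
have um : u1 * m1 + u2 * m2 + u3 * m3 = 0.
  apply: (mulfI d0); transitivity (u1 * (d * m1) + u2 * (d * m2) + u3 * (d * m3)); first ring.
  rewrite -E1 -E2 -E3 mulr0; transitivity (mm * (x1 * u1 + x2 * u2 + x3 * u3)); first ring.
  by rewrite xu mulr0.
pose s := (u2 * b3 - u3 * b2) * m1 + (u3 * b1 - u1 * b3) * m2 + (u1 * b2 - u2 * b1) * m3.
pose t := (a2 * u3 - a3 * u2) * m1 + (a3 * u1 - a1 * u3) * m2 + (a1 * u2 - a2 * u1) * m3.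
have P x a b m : x * mm = s * a + t * b + (u1 * m1 + u2 * m2 + u3 * m3) * m -> x = s / mm * a + t / mm * b.
  rewrite um mul0r addr0 => xE; apply: (mulIf mm0); rewrite xE; field; exact: mm0.
exists (s / mm), (t / mm); split.
- by apply: (P _ _ _ m1); rewrite /s /t /mm /m1 /m2 /m3; ring.
- by apply: (P _ _ _ m2); rewrite /s /t /mm /m1 /m2 /m3; ring.
- by apply: (P _ _ _ m3); rewrite /s /t /mm /m1 /m2 /m3; ring.
Qed.

End cross_product.

(** * The characteristic field of a surface *)

Section characteristic.
Context {R : realType} {S : surface R}.
Local Notation codom := Defs.codom.
Local Notation coord := Defs.coord.
Local Notation gnorm := Defs.gnorm.
Local Notation V2 := 'rV[R]_2.
Local Notation H1 := 'rV[R]_3.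
Variables (F N : S -> H1).
Hypothesis F_imm : immersion2 F.
Hypothesis N_nrm : unit_normal F N.

Definition n1 q := xc (N q).
Definition n2 q := yc (N q).
Definition n3 q := tcomp (F q) (N q).
(** The length of the horizontal projection of [N]; [reg] says that it is not zero. *)
Definition hh q := Num.sqrt (n1 q ^+ 2 + n2 q ^+ 2).
Definition reg q := 0 < n1 q ^+ 2 + n2 q ^+ 2.

Lemma normal_unit q : n1 q ^+ 2 + n2 q ^+ 2 + n3 q ^+ 2 = 1.
Proof.
have [_ /(_ q) + _] := N_nrm; rewrite /gnorm => /(congr1 (fun x => x ^+ 2)).
by rewrite sqr_sqrtr /metric -?expr2 ?expr1n// !addr_ge0// sqr_ge0.
Qed.

Lemma singularP q : singular_set F N q <-> ~ reg q.
Proof.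
rewrite /singular_set /= hprojE /reg -/(n1 q) -/(n2 q); split=> [E|].
  have := congr1 xc E; have := congr1 yc E.
  rewrite /fieldX /fieldY !cE /xc /yc !mxE !mulr0 !mulr1 addr0 add0r => -> ->.
  by rewrite expr0n addr0 ltxx.
move/negP; rewrite -leNgt => n0.
have : n1 q ^+ 2 + n2 q ^+ 2 == 0 by rewrite eq_le n0 addr_ge0// sqr_ge0.
rewrite paddr_eq0 ?sqr_ge0// !sqrf_eq0 => /andP[/eqP-> /eqP->].
by rewrite !scale0r addr0.
Qed.

Lemma N_cont q : {for q, continuous N}.
Proof. by have [Nc _ _] := N_nrm; exact: Nc. Qed.

Lemma dom_nbhs i q : dom (atlas i) q -> nbhs q (dom (atlas (s := S) i)).
Proof. by move=> iq; apply: open_nbhs_nbhs; split => //; exact: dom_open. Qed.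

Lemma F_cont q : {for q, continuous F}.
Proof.
have [i iq] := atlas_cover q; have [[Gc _] _] := F_imm i.
have cq : codom (atlas i) (coord (atlas i) q) by exact: coord_codom.
apply: (@continuous_near_eq _ _ ((F \o param (atlas i)) \o coord (atlas i)) F).
  by apply: filterS (dom_nbhs iq) => t it /=; rewrite coordK.
by apply: continuous_comp; [exact: Defs.coord_continuous|exact: Gc].
Qed.

Lemma xc_cont (T : topologicalType) (f : T -> H1) x : {for x, continuous f} ->
  {for x, continuous (fun t => xc (f t))}.
Proof. exact: rV_coord_continuous. Qed.
Lemma yc_cont (T : topologicalType) (f : T -> H1) x : {for x, continuous f} ->
  {for x, continuous (fun t => yc (f t))}.
Proof. exact: (@rV_coord_continuous _ _ 3 f x 1). Qed.
Lemma tc_cont (T : topologicalType) (f : T -> H1) x : {for x, continuous f} ->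
  {for x, continuous (fun t => tc (f t))}.
Proof. exact: rV_coord_continuous. Qed.

Lemma n1_cont q : {for q, continuous n1}. Proof. exact: xc_cont (N_cont (q := q)). Qed.
Lemma n2_cont q : {for q, continuous n2}. Proof. exact: yc_cont (N_cont (q := q)). Qed.
Lemma n3_cont q : {for q, continuous n3}.
Proof.
rewrite /n3 /tcomp; apply: continuousD; first apply: continuousB.
- exact: tc_cont (N_cont (q := q)).
- by apply: continuousM; [exact: yc_cont (F_cont (q := q))|exact: n1_cont].
- by apply: continuousM; [exact: xc_cont (F_cont (q := q))|exact: n2_cont].
Qed.

Section chart.
Variable i : chart_index S.
Let G := F \o param (atlas i).
Let U0 := codom (atlas i).
Let e1 := vec2 (1 : R) 0.
Let e2 := vec2 (0 : R) 1.
Let a1 y := xc ('D_e1 G y). Let a2 y := yc ('D_e1 G y). Let a3 y := tcomp (G y) ('D_e1 G y).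
Let b1 y := xc ('D_e2 G y). Let b2 y := yc ('D_e2 G y). Let b3 y := tcomp (G y) ('D_e2 G y).
Let m1 y := a2 y * b3 y - a3 y * b2 y.
Let m2 y := a3 y * b1 y - a1 y * b3 y.
Let m3 y := a1 y * b2 y - a2 y * b1 y.
Let mm y := m1 y ^+ 2 + m2 y ^+ 2 + m3 y ^+ 2.

Lemma G_Ck2 : Ck 2 U0 G. Proof. by have [] := F_imm i. Qed.
Lemma G_Ck1 : Ck 1 U0 G.
Proof.
by have [Gc GD] := G_Ck2; split; [exact: Gc|move=> v; have [h [h' _]] := GD v; split].
Qed.
Lemma oU0 : open U0. Proof. exact: codom_open. Qed.

Lemma chart_derive y v : U0 y -> 'D_v G y = c1 v *: 'D_e1 G y + c2 v *: 'D_e2 G y.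
Proof. by move=> Uy; exact: Ck1_derive oU0 Uy G_Ck1. Qed.

Lemma chart_C1 k : C1 U0 (fun y => G y ord0 k) (fun y => 'D_e1 G y ord0 k)
    (fun y => 'D_e2 G y ord0 k).
Proof. exact: Ck1_C1 oU0 G_Ck1. Qed.

Lemma chart_C1' v k : isC1 U0 (fun y => 'D_v G y ord0 k).
Proof.
have [_ /(_ v)[_ GD]] := G_Ck2.
by do 2 eexists; exact: Ck1_C1 oU0 GD.
Qed.

Lemma chart_isC1 k : isC1 U0 (fun y => G y ord0 k).
Proof. by do 2 eexists; exact: chart_C1. Qed.

Lemma tcomp_isC1 v : isC1 U0 (fun y => tcomp (G y) ('D_v G y)).
Proof.
by apply: isC1D; [apply: isC1B|]; [exact: chart_C1'|apply: isC1M|apply: isC1M];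
  by [exact: chart_isC1|exact: chart_C1'].
Qed.

Lemma isC1_sqr U (f : V2 -> R) : isC1 U f -> isC1 U (fun y => f y ^+ 2).
Proof. by move=> fC; exact: (isC1M fC fC). Qed.

Let a1C : isC1 U0 a1. Proof. exact: chart_C1'. Qed.
Let a2C : isC1 U0 a2. Proof. exact: chart_C1'. Qed.
Let a3C : isC1 U0 a3. Proof. exact: tcomp_isC1. Qed.
Let b1C : isC1 U0 b1. Proof. exact: chart_C1'. Qed.
Let b2C : isC1 U0 b2. Proof. exact: chart_C1'. Qed.
Let b3C : isC1 U0 b3. Proof. exact: tcomp_isC1. Qed.
Let m1C : isC1 U0 m1. Proof. by apply: isC1B; exact: isC1M. Qed.
Let m2C : isC1 U0 m2. Proof. by apply: isC1B; exact: isC1M. Qed.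
Let m3C : isC1 U0 m3. Proof. by apply: isC1B; exact: isC1M. Qed.

Lemma tcomp_chart_derive y v : U0 y ->
  [/\ xc ('D_v G y) = c1 v * a1 y + c2 v * b1 y,
      yc ('D_v G y) = c1 v * a2 y + c2 v * b2 y &
      tcomp (G y) ('D_v G y) = c1 v * a3 y + c2 v * b3 y].
Proof.
move=> Uy; have := chart_derive v Uy; rewrite /a1 /a2 /a3 /b1 /b2 /b3.
move: ('D_v G y) ('D_e1 G y) ('D_e2 G y) => u ua ub ->.
by rewrite tcompD !tcompZ xcD ycD !xcZ !ycZ.
Qed.

Lemma frame_inj p u v : xc u = xc v -> yc u = yc v -> tcomp p u = tcomp p v -> u = v :> H1.
Proof. by move=> h1 h2 h3; rewrite (frame_decomp p u) (frame_decomp p v) h1 h2 h3. Qed.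

Lemma mm_gt0 y : U0 y -> 0 < mm y.
Proof.
move=> Uy; have [_ /(_ y Uy) inj] := F_imm i.
apply: cross_gt0 => s t h1 h2 h3.
have [d1 d2 d3] := tcomp_chart_derive (vec2 s t) Uy.
have [d1' d2' d3'] := tcomp_chart_derive (vec2 0 0) Uy.
have E : vec2 s t = vec2 0 0.
  apply: inj => /=; apply: (@frame_inj (G y)).
  - rewrite d1 d1' !c1_vec2 !c2_vec2; move: (a1 y) (b1 y) h1 => A B ->; ring.
  - rewrite d2 d2' !c1_vec2 !c2_vec2; move: (a2 y) (b2 y) h2 => A B ->; ring.
  - rewrite d3 d3' !c1_vec2 !c2_vec2; move: (a3 y) (b3 y) h3 => A B ->; ring.
by have := congr1 c1 E; have := congr1 c2 E; rewrite !c1_vec2 !c2_vec2.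
Qed.

Lemma normal_tangent y v : U0 y -> n1 (param (atlas i) y) * xc ('D_v G y) +
  n2 (param (atlas i) y) * yc ('D_v G y) +
  n3 (param (atlas i) y) * tcomp (G y) ('D_v G y) = 0.
Proof.
move=> Uy; have [_ _ /(_ i (param (atlas i) y) v (param_dom Uy))] := N_nrm.
by rewrite paramK.
Qed.

Lemma normal_cross y : U0 y -> let d := n1 (param (atlas i) y) * m1 y +
    n2 (param (atlas i) y) * m2 y + n3 (param (atlas i) y) * m3 y in
  [/\ n1 (param (atlas i) y) * mm y = d * m1 y,
      n2 (param (atlas i) y) * mm y = d * m2 y,
      n3 (param (atlas i) y) * mm y = d * m3 y & d ^+ 2 = mm y].
Proof.
move=> Uy; apply: cross_normal.
- exact: mm_gt0.
- exact: normal_tangent.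
- exact: normal_tangent.
- exact: normal_unit.
Qed.

Lemma tangent_span y u : U0 y ->
  n1 (param (atlas i) y) * xc u + n2 (param (atlas i) y) * yc u +
    n3 (param (atlas i) y) * tcomp (G y) u = 0 ->
  exists v, 'D_v G y = u.
Proof.
move=> Uy Nu.
have [s [t [h1 h2 h3]]] := cross_span (mm_gt0 Uy) (normal_tangent e1 Uy) (normal_tangent e2 Uy)
   (normal_unit (param (atlas i) y)) Nu.
exists (vec2 s t); have [d1 d2 d3] := tcomp_chart_derive (vec2 s t) Uy.
apply: (@frame_inj (G y)).
- by rewrite d1 h1 c1_vec2 c2_vec2.
- by rewrite d2 h2 c1_vec2 c2_vec2.
- by rewrite d3 h3 c1_vec2 c2_vec2.
Qed.

(** [N] is given as a continuous map. It is plus or minus the normalized cross product of the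
    coordinate tangent vectors, which is C^1 since [F] is C^2, and continuity makes the sign [sg]
    constant near [y0]. *)
Lemma normal_C1 y0 : U0 y0 -> exists U, [/\ open U, U y0, U `<=` U0 &
  [/\ isC1 U (n1 \o param (atlas i)), isC1 U (n2 \o param (atlas i)) &
      isC1 U (n3 \o param (atlas i))]].
Proof.
move=> Uy0; pose d y := n1 (param (atlas i) y) * m1 y +
    n2 (param (atlas i) y) * m2 y + n3 (param (atlas i) y) * m3 y.
have pc y : U0 y -> {for y, continuous (param (atlas i))} by exact: param_continuous.
have dc y : U0 y -> {for y, continuous d}.
  move=> Uy; apply: continuousD; first apply: continuousD; apply: continuousM.
  - by apply: (continuous_comp (pc _ Uy)); exact: n1_cont.
  - exact: isC1_cont m1C Uy.
  - by apply: (continuous_comp (pc _ Uy)); exact: n2_cont.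
  - exact: isC1_cont m2C Uy.
  - by apply: (continuous_comp (pc _ Uy)); exact: n3_cont.
  - exact: isC1_cont m3C Uy.
have d2 y : U0 y -> d y ^+ 2 = mm y by move=> /normal_cross[].
have d0 : d y0 != 0 by rewrite -sqrf_eq0 d2// gt_eqF// mm_gt0.
pose sg := d y0 / `|d y0|.
have sg2 : sg ^+ 2 = 1.
  by rewrite /sg expr_div_n real_normK ?num_real// divff// sqrf_eq0.
pose U := U0 `&` [set y | 0 < d y0 * d y].
have oU : open U.
  rewrite openE => y [Uy dy]; apply: filterI; first exact: open_nbhs_nbhs (conj oU0 Uy).
  have c : {for y, continuous (fun y => d y0 * d y)}.
    by apply: continuousM; [exact: cst_continuous|exact: dc].
  exact: (near_continuous c (open_nbhs_nbhs (conj (@open_gt R 0) dy))).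
have dE y : U y -> d y = sg * Num.sqrt (mm y).
  by move=> [Uy /= dy]; rewrite -d2// sqrtr_sqr; exact: same_sign.
have mmC : isC1 U0 mm.
  by apply: isC1D; [apply: isC1D|]; exact: isC1_sqr.
have U0U : U `<=` U0 by move=> y [].
have nC (n : S -> R) (m : V2 -> R) : (forall y, U0 y -> n (param (atlas i) y) * mm y = d y * m y) ->
    isC1 U0 m -> isC1 U (n \o param (atlas i)).
  move=> nm mC; apply: (@isC1_eq _ U (fun y => (sg * Num.sqrt (mm y) * m y) * (mm y)^-1)) => //.
    move=> y /set_mem Uy /=; apply: (mulIf (lt0r_neq0 (mm_gt0 (U0U _ Uy)))).
    by rewrite divfK ?gt_eqF ?mm_gt0//; [rewrite -dE// nm//; exact: U0U|exact: U0U].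
  apply: (isC1_sub U0U); apply: isC1M; last by apply: isC1V => [y Uy|]; [exact: lt0r_neq0 (mm_gt0 Uy)|].
  apply: isC1M => //; apply: isC1M; first exact: isC1_cst.
  by apply: isC1_sqrt => // y Uy; exact: mm_gt0.
exists U; split=> //.
  by split=> //=; rewrite -expr2 lt0r sqrf_eq0 d0 sqr_ge0.
by split; [apply: (nC n1 m1)|apply: (nC n2 m2)|apply: (nC n3 m3)] => // y /normal_cross[].
Qed.

Definition nu1 q := n1 q / hh q.
Definition nu2 q := n2 q / hh q.

Lemma nu1E q : nu1 q = n1 q / hh q. Proof. by []. Qed.
Lemma nu2E q : nu2 q = n2 q / hh q. Proof. by []. Qed.

Lemma hh_gt0 q : reg q -> 0 < hh q.
Proof. by move=> rq; rewrite sqrtr_gt0. Qed.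

Lemma nu_unit q : reg q -> nu1 q ^+ 2 + nu2 q ^+ 2 = 1.
Proof.
move=> rq; have h0 := hh_gt0 rq; have h2 : hh q ^+ 2 = n1 q ^+ 2 + n2 q ^+ 2.
  by rewrite sqr_sqrtr// ltW.
by rewrite /nu1 /nu2 !expr_div_n -mulrDl h2 divff// gt_eqF.
Qed.

Lemma reg_nbhs q : reg q -> \forall q' \near q, reg q'.
Proof.
move=> rq; have c : {for q, continuous (fun q => n1 q ^+ 2 + n2 q ^+ 2)}.
  by apply: continuousD; apply: continuousM; (exact: n1_cont || exact: n2_cont).
exact: (near_continuous c (open_nbhs_nbhs (conj (@open_gt R 0) rq))).
Qed.

Lemma nu_C1 U y0 : open U -> U y0 -> U `<=` U0 ->
  isC1 U (n1 \o param (atlas i)) -> isC1 U (n2 \o param (atlas i)) ->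
  reg (param (atlas i) y0) ->
  exists U', [/\ open U', U' y0, U' `<=` U, forall y, U' y -> reg (param (atlas i) y) &
    isC1 U' (nu1 \o param (atlas i)) /\ isC1 U' (nu2 \o param (atlas i))].
Proof.
move=> oU Uy0 UU0 n1C n2C ry0.
pose U' := U `&` [set y | reg (param (atlas i) y)].
have U'U : U' `<=` U by move=> y [].
have oU' : open U'.
  rewrite openE => y [Uy ry]; apply: filterI; first exact: open_nbhs_nbhs (conj oU Uy).
  have pc : {for y, continuous (param (atlas i))} by apply: param_continuous; exact: UU0.
  exact: (near_continuous pc (reg_nbhs ry)).
exists U'; split=> //; first by move=> y [].
have hC : isC1 U' (fun y => (hh (param (atlas i) y))^-1).
  apply: isC1V => [y [_ ry]|]; first exact: lt0r_neq0 (hh_gt0 ry).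
  apply: isC1_sqrt => [y []//|]; apply: (isC1_sub U'U).
  by apply: isC1D; exact: isC1_sqr.
by split; apply: isC1M => //; apply: (isC1_sub U'U).
Qed.

Lemma nuHE q : nuH F N q = vec3 (nu1 q) (nu2 q) (yc (F q) * nu1 q - xc (F q) * nu2 q).
Proof.
have gE : gnorm (F q) (hproj (F q) (N q)) = hh q.
  rewrite /gnorm hprojE -/(n1 q) -/(n2 q); congr Num.sqrt.
  by rewrite /metric /tcomp /fieldX /fieldY !cE; ring.
rewrite /nuH gE hprojE -/(n1 q) -/(n2 q) /nu1 /nu2 /fieldX /fieldY.
by apply: rV3P; rewrite !cE; ring.
Qed.

Lemma nu_derive U a b a' b' y v : open U -> U y -> U `<=` U0 ->
  (forall y, U y -> reg (param (atlas i) y)) ->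
  C1 U (nu1 \o param (atlas i)) a b -> C1 U (nu2 \o param (atlas i)) a' b' ->
  nu1 (param (atlas i) y) * (a y * c1 v + b y * c2 v) +
  nu2 (param (atlas i) y) * (a' y * c1 v + b' y * c2 v) = 0.
Proof.
move=> oU Uy UU0 rU f1C f2C.
have sC := C1D (C1M f1C f1C) (C1M f2C f2C).
have cC : C1 U (fun y => (nu1 \o param (atlas i)) y * (nu1 \o param (atlas i)) y +
    (nu2 \o param (atlas i)) y * (nu2 \o param (atlas i)) y) (fun=> 0) (fun=> 0).
  apply: (C1_eq oU _ (C1_cst U 1)) => z /set_mem Uz /=.
  by rewrite -(nu_unit (rU _ Uz)) !expr2.
have [_ D1] := C1_is_derive v Uy sC; have [_ D2] := C1_is_derive v Uy cC.
rewrite D1 in D2; move: D2 => /=.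
move: (nu1 _) (nu2 _) (a y) (a' y) (b y) (b' y) => x z A A' B B'; lra.
Qed.

(** The divergence is evaluated in the orthonormal basis formed by the characteristic vector
    [- nu2 X + nu1 Y] and [u2 = n3 nu - hh T]. The second term vanishes because [nu] has constant
    length, so the first one equals [- 2 * H]; together with the constant length this determines the
    derivative of [nu] along the characteristic vector. *)
Lemma chart_curvature H U a b a' b' y v : constant_mean_curvature F N H ->
  open U -> U y -> U `<=` U0 -> (forall y, U y -> reg (param (atlas i) y)) ->
  C1 U (nu1 \o param (atlas i)) a b -> C1 U (nu2 \o param (atlas i)) a' b' ->
  let q := param (atlas i) y in
  xc ('D_v G y) = - nu2 q -> yc ('D_v G y) = nu1 q -> tcomp (G y) ('D_v G y) = 0 ->
  a y * c1 v + b y * c2 v = 2 * H * nu2 q /\ a' y * c1 v + b' y * c2 v = - (2 * H * nu1 q).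
Proof.
move=> F_cmc oU Uy UU0 rU f1C f2C q vx vy vt.
have U0y : U0 y by exact: UU0.
have rq : reg q by exact: rU.
have nu2E := nu_unit rq; have nE := normal_unit q.
have h0 := hh_gt0 rq; have h2 : hh q ^+ 2 = n1 q ^+ 2 + n2 q ^+ 2.
  by rewrite sqr_sqrtr// ltW.
have hn1 : n1 q = hh q * nu1 q by rewrite /nu1 mulrCA divff ?mulr1// gt_eqF.
have hn2 : n2 q = hh q * nu2 q by rewrite /nu2 mulrCA divff ?mulr1// gt_eqF.
pose p := G y.
pose u2 := (n3 q * nu1 q) *: fieldX p + (n3 q * nu2 q) *: fieldY p + (- hh q) *: fieldT p.
have u2x : xc u2 = n3 q * nu1 q by rewrite /u2 /fieldX /fieldY /fieldT !cE; ring.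
have u2y : yc u2 = n3 q * nu2 q by rewrite /u2 /fieldX /fieldY /fieldT !cE; ring.
have u2t : tcomp p u2 = - hh q by rewrite /tcomp u2x u2y /u2 /fieldX /fieldY /fieldT !cE; ring.
have [v2 v2E] : exists v, 'D_v G y = u2.
  apply: tangent_span => //; rewrite -/q u2x u2y u2t hn1 hn2.
  transitivity (hh q * n3 q * ((nu1 q ^+ 2 + nu2 q ^+ 2) - 1)); first ring.
  by rewrite nu2E subrr mulr0.
have nD w : 'D_w (nuH F N \o param (atlas i)) y =
    vec3 (a y * c1 w + b y * c2 w) (a' y * c1 w + b' y * c2 w)
      ((yc p * (a y * c1 w + b y * c2 w) + nu1 q * yc ('D_w G y)) -
       (xc p * (a' y * c1 w + b' y * c2 w) + nu2 q * xc ('D_w G y))).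
  rewrite (_ : nuH F N \o param (atlas i) = (fun y => vec3 ((nu1 \o param (atlas i)) y)
    ((nu2 \o param (atlas i)) y) (yc (G y) * (nu1 \o param (atlas i)) y - xc (G y) * (nu2 \o param (atlas i)) y))).
    have xG : is_derive y w (fun y => xc (G y)) (xc ('D_w G y)).
      have [-> _ _] := tcomp_chart_derive w U0y; rewrite (mulrC (c1 w)) (mulrC (c2 w)).
      exact: (C1_is_derive w U0y (chart_C1 ord0)).
    have yG : is_derive y w (fun y => yc (G y)) (yc ('D_w G y)).
      have [_ -> _] := tcomp_chart_derive w U0y; rewrite (mulrC (c1 w)) (mulrC (c2 w)).
      exact: (C1_is_derive w U0y (chart_C1 1)).
    have D1 := C1_is_derive w Uy f1C; have D2 := C1_is_derive w Uy f2C.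
    apply: derive_vec3 => //.
    exact: (is_deriveB (is_deriveM yG D1) (is_deriveM xG D2)).
  by apply/funext => z /=; rewrite nuHE.
have nq : ~ singular_set F N q by move/singularP.
have := F_cmc q nq i v v2 (param_dom U0y).
rewrite /nabla_along /dchart paramK// -/G -/p -/q.
have -> : F q = p by [].
rewrite !nD v2E nuHE -/q -/p.
have tnu : tcomp p (vec3 (nu1 q) (nu2 q) (yc p * nu1 q - xc p * nu2 q)) = 0.
  by rewrite /tcomp !cE; ring.
rewrite (gamma_horizontal vt tnu) addr0 gammaE tnu u2t u2x u2y vx vy.
have n1E := nu_derive v oU Uy UU0 rU f1C f2C.
have n2E := nu_derive v2 oU Uy UU0 rU f1C f2C.
rewrite -/q in n1E n2E.
move: n1E n2E; move: (a y * c1 v + b y * c2 v) (a' y * c1 v + b' y * c2 v).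
move: (a y * c1 v2 + b y * c2 v2) (a' y * c1 v2 + b' y * c2 v2) => A2 B2 A1 B1 n1E n2E.
move: vx vy vt; move: ('D_v G y) => w1 vx vy vt.
set A := vec3 A1 B1 _; set B := vec3 A2 B2 _; set C := _ *: fieldX p + _ *: fieldY p.
have h3 : n3 q ^+ 2 + hh q ^+ 2 = 1 by rewrite h2 addrC.
have M1 : metric p w1 w1 = 1 by rewrite /metric vx vy vt -nu2E; ring.
have M2 : metric p u2 u2 = 1.
  rewrite /metric u2x u2y u2t; transitivity (n3 q ^+ 2 * (nu1 q ^+ 2 + nu2 q ^+ 2) + hh q ^+ 2); first ring.
  by rewrite nu2E mulr1.
have M3 : metric p w1 u2 = 0 by rewrite /metric u2x u2y u2t vx vy vt; ring.
have MA : metric p A w1 = - A1 * nu2 q + B1 * nu1 q.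
  by rewrite /metric vx vy vt /A !cE; ring.
have MB : metric p B u2 = n3 q * (nu1 q * A2 + nu2 q * B2).
  by rewrite /metric u2x u2y u2t /tcomp /B !cE; ring.
have MC : metric p C u2 = 0.
  by rewrite /metric u2x u2y u2t /tcomp /C /fieldX /fieldY !cE; ring.
move=> /(_ M1 M2 M3); rewrite metricDl MA MB MC n2E mulr0 !addr0 => E.
split.
- transitivity (nu1 q * (nu1 q * A1 + nu2 q * B1) - nu2 q * (- A1 * nu2 q + B1 * nu1 q)).
    by rewrite -[LHS]mulr1 -nu2E; ring.
  by rewrite n1E E; ring.
- transitivity (nu2 q * (nu1 q * A1 + nu2 q * B1) + nu1 q * (- A1 * nu2 q + B1 * nu1 q)).
    by rewrite -[LHS]mulr1 -nu2E; ring.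
  by rewrite n1E E; ring.
Qed.

End chart.
End characteristic.

Section C1_composition.
Context {R : realType}.
Local Notation V2 := 'rV[R]_2.

Lemma C1_comp (U B : set V2) (f : V2 -> R) a b (eta : V2 -> V2) e11 e12 e21 e22 :
  C1 U f a b -> (forall z, B z -> U (eta z)) ->
  C1 B (fun z => c1 (eta z)) e11 e12 -> C1 B (fun z => c2 (eta z)) e21 e22 ->
  C1 B (fun z => f (eta z)) (fun z => a (eta z) * e11 z + b (eta z) * e21 z)
    (fun z => a (eta z) * e12 z + b (eta z) * e22 z).
Proof.
move=> fC BU e1C e2C.
have ec z : B z -> {for z, continuous eta}.
  move=> Bz; rewrite (_ : eta = fun z => vec2 (c1 (eta z)) (c2 (eta z))); last first.
    by apply/funext => r; rewrite -vec2E.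
  by apply: vec2_continuous; [exact: (C1_cont e1C)|exact: (C1_cont e2C)].
split=> [z Bz|z Bz|z Bz|y s v1 v2 Bs yv].
- by apply: (continuous_comp (ec _ Bz)); apply: (C1_cont fC); exact: BU.
- apply: continuousD; apply: continuousM.
  + by apply: (continuous_comp (ec _ Bz)); apply: (C1_cont1 fC); exact: BU.
  + exact: (C1_cont1 e1C).
  + by apply: (continuous_comp (ec _ Bz)); apply: (C1_cont2 fC); exact: BU.
  + exact: (C1_cont1 e2C).
- apply: continuousD; apply: continuousM.
  + by apply: (continuous_comp (ec _ Bz)); apply: (C1_cont1 fC); exact: BU.
  + exact: (C1_cont2 e1C).
  + by apply: (continuous_comp (ec _ Bz)); apply: (C1_cont2 fC); exact: BU.
  + exact: (C1_cont2 e2C).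
- have D : drv2 (fun r => eta (y r)) s (e11 (y s) * v1 + e12 (y s) * v2) (e21 (y s) * v1 + e22 (y s) * v2).
    by split; [exact: (C1_chain e1C)|exact: (C1_chain e2C)].
  by apply: drv_eq (C1_chain fC (BU _ Bs) D) _; ring.
Qed.

Lemma isC1_comp (U B : set V2) (f : V2 -> R) (eta : V2 -> V2) :
  isC1 U f -> (forall z, B z -> U (eta z)) ->
  isC1 B (fun z => c1 (eta z)) -> isC1 B (fun z => c2 (eta z)) ->
  isC1 B (fun z => f (eta z)).
Proof.
by move=> [a [b fC]] BU [e11 [e12 e1C]] [e21 [e22 e2C]]; do 2 eexists; exact: (C1_comp fC BU e1C e2C).
Qed.

End C1_composition.

(** * Local sections *)

Section projections.
Context {R : realType}.
Local Notation V2 := 'rV[R]_2.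
Local Notation H1 := 'rV[R]_3.

(** Arbitrary linear maps onto the plane are allowed because the tangent plane contains T wherever
    [N] is horizontal, and there the surface is no graph over the xy-plane. *)
Record proj := Proj { pa : R; pb : R; pc : R; qa : R; qb : R; qc : R }.

Definition prj (P : proj) (u : H1) : V2 :=
  vec2 (pa P * xc u + pb P * yc u + pc P * tc u) (qa P * xc u + qb P * yc u + qc P * tc u).

Lemma prjZ P k u : prj P (k *: u) = k *: prj P u.
Proof. by apply: rV2P; rewrite /prj ?c1Z ?c2Z ?c1_vec2 ?c2_vec2 xcZ ycZ tcZ; ring. Qed.

Lemma prj_cont (T : topologicalType) (f : T -> H1) x P : {for x, continuous f} ->
  {for x, continuous (fun t => prj P (f t))}.
Proof.
move=> fc; have xf := xc_cont fc; have yf := yc_cont fc; have tf := tc_cont fc.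
by apply: vec2_continuous; (apply: continuousD; [apply: continuousD|]);
  apply: continuousM => //; exact: cst_continuous.
Qed.

End projections.

Section local_sections.
Context {R : realType} {S : surface R}.
Local Notation V2 := 'rV[R]_2.
Local Notation H1 := 'rV[R]_3.
Local Notation codom := Defs.codom.
Local Notation coord := Defs.coord.
Variables (F N : S -> H1) (H : R).
Hypothesis F_imm : immersion2 F.
Hypothesis N_nrm : unit_normal F N.
Hypothesis F_cmc : constant_mean_curvature F N H.
Local Notation n1 := (n1 N).
Local Notation n2 := (n2 N).
Local Notation n3 := (n3 F N).
Local Notation nu1 := (nu1 N).
Local Notation nu2 := (nu2 N).
Local Notation reg := (reg N).

Definition tangent q u := n1 q * xc u + n2 q * yc u + n3 q * tcomp (F q) u = 0.

(* Near a point where the linear map [P] is injective on the tangent plane, the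
   surface is a graph over an open set of the plane: [ls_kap] is a C^1 section
   of [prj P \o F]. *)
Record lsec (i : chart_index S) (q : S) (P : proj) := LSec {
  ls_r : R; ls_U : set S; ls_kap : V2 -> S;
  ls_x1 : V2 -> R; ls_x2 : V2 -> R; ls_y1 : V2 -> R; ls_y2 : V2 -> R;
  ls_t1 : V2 -> R; ls_t2 : V2 -> R;
  ls_r0 : 0 < ls_r; ls_Uo : open ls_U; ls_Uq : ls_U q;
  ls_B := ball (prj P (F q)) ls_r;
  ls_kapU : forall z, ls_B z -> ls_U (ls_kap z);
  ls_kapP : forall z, ls_B z -> prj P (F (ls_kap z)) = z;
  ls_UB : forall q', ls_U q' -> ls_B (prj P (F q'));
  ls_UK : forall q', ls_U q' -> ls_kap (prj P (F q')) = q';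
  ls_kapc : forall z, ls_B z -> {for z, continuous ls_kap};
  ls_xC : C1 ls_B (fun z => xc (F (ls_kap z))) ls_x1 ls_x2;
  ls_yC : C1 ls_B (fun z => yc (F (ls_kap z))) ls_y1 ls_y2;
  ls_tC : C1 ls_B (fun z => tc (F (ls_kap z))) ls_t1 ls_t2;
  ls_tan : forall z u, ls_B z -> tangent (ls_kap z) u ->
    [/\ ls_x1 z * c1 (prj P u) + ls_x2 z * c2 (prj P u) = xc u,
        ls_y1 z * c1 (prj P u) + ls_y2 z * c2 (prj P u) = yc u &
        ls_t1 z * c1 (prj P u) + ls_t2 z * c2 (prj P u) = tc u];
  ls_tan' : forall z w1 w2, ls_B z -> tangent (ls_kap z)
    (vec3 (ls_x1 z * w1 + ls_x2 z * w2) (ls_y1 z * w1 + ls_y2 z * w2)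
          (ls_t1 z * w1 + ls_t2 z * w2));
  ls_n1C : isC1 ls_B (fun z => n1 (ls_kap z));
  ls_n2C : isC1 ls_B (fun z => n2 (ls_kap z));
  ls_n3C : isC1 ls_B (fun z => n3 (ls_kap z));
  ls_e1C : isC1 ls_B (fun z => c1 (coord (atlas i) (ls_kap z)));
  ls_e2C : isC1 ls_B (fun z => c2 (coord (atlas i) (ls_kap z)));
  ls_curv : forall U a b a' b' z, open U -> U z -> U `<=` ls_B ->
    (forall z, U z -> reg (ls_kap z)) ->
    C1 U (fun z => nu1 (ls_kap z)) a b -> C1 U (fun z => nu2 (ls_kap z)) a' b' ->
    let p := F (ls_kap z) in
    let w := prj P (vec3 (- nu2 (ls_kap z)) (nu1 (ls_kap z))
                     (yc p * - nu2 (ls_kap z) - xc p * nu1 (ls_kap z))) in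
    a z * c1 w + b z * c2 w = 2 * H * nu2 (ls_kap z) /\
    a' z * c1 w + b' z * c2 w = - (2 * H * nu1 (ls_kap z)) }.

(** The inverse function theorem for [prj P \o F] read in the chart [i], followed by [param]. The
    existential packs the data of the record into a proposition. The fields on the coordinates in
    the chart serve to see that lifted geodesics are C^1 curves of [S]. *)
Lemma local_section i q P : dom (atlas i) q ->
  (forall u, tangent q u -> prj P u = 0 -> u = 0) ->
  exists _ : lsec i q P, True.
Proof.
move=> iq Pinj.
set U0 := codom (atlas i); pose G := F \o param (atlas i); set y0 := coord (atlas i) q.
have Uy0 : U0 y0 by exact: coord_codom.
have py0 : param (atlas i) y0 = q by exact: coordK.
have [U1 [oU1 U1y0 U1U0 [n1C n2C n3C]]] := normal_C1 F_imm N_nrm Uy0.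
pose e1 := vec2 (1 : R) 0; pose e2 := vec2 (0 : R) 1.
pose xa y := xc ('D_e1 G y); pose xb y := xc ('D_e2 G y).
pose ya y := yc ('D_e1 G y); pose yb y := yc ('D_e2 G y).
pose ta y := tc ('D_e1 G y); pose tb y := tc ('D_e2 G y).
have xC : C1 U1 (fun y => xc (G y)) xa xb by apply: C1_sub U1U0 _; exact: chart_C1.
have yC : C1 U1 (fun y => yc (G y)) ya yb by apply: C1_sub U1U0 _; exact: (chart_C1 F_imm i 1).
have tC : C1 U1 (fun y => tc (G y)) ta tb by apply: C1_sub U1U0 _; exact: chart_C1.
have CZ k f a b : C1 U1 f a b -> C1 U1 (fun z => k * f z) (fun z => k * a z) (fun z => k * b z).
  by move=> fC; apply: C1_eqd (C1M (C1_cst _ k) fC) => // z _; rewrite mulr0 addr0.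
pose a11 y := pa P * xa y + pb P * ya y + pc P * ta y.
pose a12 y := pa P * xb y + pb P * yb y + pc P * tb y.
pose a21 y := qa P * xa y + qb P * ya y + qc P * ta y.
pose a22 y := qa P * xb y + qb P * yb y + qc P * tb y.
pose f1 y := pa P * xc (G y) + pb P * yc (G y) + pc P * tc (G y).
pose f2 y := qa P * xc (G y) + qb P * yc (G y) + qc P * tc (G y).
have f1C : C1 U1 f1 a11 a12 by apply: C1D; [apply: C1D|]; exact: CZ.
have f2C : C1 U1 f2 a21 a22 by apply: C1D; [apply: C1D|]; exact: CZ.
have DE y v : U0 y -> [/\ xc ('D_v G y) = xa y * c1 v + xb y * c2 v,
    yc ('D_v G y) = ya y * c1 v + yb y * c2 v & tc ('D_v G y) = ta y * c1 v + tb y * c2 v].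
  move=> Uy; have := chart_derive F_imm v Uy; rewrite -/G /xa /xb /ya /yb /ta /tb /e1 /e2.
  move: ('D_v G y) ('D_(vec2 1 0) G y) ('D_(vec2 0 1) G y) => u ua ub ->.
  by rewrite xcD ycD tcD !xcZ !ycZ !tcZ; split; ring.
have prjDE y v : U0 y -> prj P ('D_v G y) = vec2 (a11 y * c1 v + a12 y * c2 v) (a21 y * c1 v + a22 y * c2 v).
  move=> Uy; have [d1 d2 d3] := DE y v Uy.
  by rewrite /prj d1 d2 d3 /a11 /a12 /a21 /a22; congr vec2; ring.
have tanD y v : U0 y -> tangent (param (atlas i) y) ('D_v G y) by move=> Uy; exact: (normal_tangent N_nrm).
have vec2_0 : vec2 0 0 = 0 :> V2 by apply: rV2P; rewrite ?c1_vec2 ?c2_vec2 /c1 /c2 mxE.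
have z1 : c1 (0 : V2) = 0 by rewrite /c1 mxE.
have z2 : c2 (0 : V2) = 0 by rewrite /c2 mxE.
have ker v : a11 y0 * c1 v + a12 y0 * c2 v = 0 -> a21 y0 * c1 v + a22 y0 * c2 v = 0 -> v = 0.
  move=> h1 h2; have [_ inj] := F_imm i; apply: (inj _ Uy0) => /=.
  transitivity (0 : H1).
    by apply: Pinj; [rewrite -py0; exact: tanD|rewrite prjDE// h1 h2].
  have E A B C D : vec2 (A * c1 (0 : V2) + B * c2 (0 : V2)) (C * c1 (0 : V2) + D * c2 (0 : V2)) = 0 :> V2.
    by rewrite z1 z2 !mulr0 addr0.
  have p0 := etrans (prjDE y0 0 Uy0) (E _ _ _ _).
  by apply/esym; apply: Pinj p0; rewrite -py0; exact: tanD.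
have V u w : vec2 u w = 0 :> V2 -> u = 0 /\ w = 0.
  by move=> E; have := congr1 c1 E; have := congr1 c2 E; rewrite c1_vec2 c2_vec2 /c1 /c2 !mxE.
have det0 : a11 y0 * a22 y0 - a12 y0 * a21 y0 != 0.
  apply/negP => /eqP d0.
  suff [E _] : (1 : R) = 0 /\ (0 : R) = 0 by have := oner_neq0 R; rewrite E eqxx.
  move: ker V d0; move: (a11 y0) (a12 y0) (a21 y0) (a22 y0) => A B C D ker V d0.
  have [B0 A0] : B = 0 /\ - A = 0 by apply: V; apply: ker; rewrite c1_vec2 c2_vec2; lra.
  have [D0 C0] : D = 0 /\ - C = 0 by apply: V; apply: ker; rewrite c1_vec2 c2_vec2; lra.
  by apply: V; apply: ker; rewrite c1_vec2 c2_vec2; lra.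
have [W [r [eta [[oW Wy0 WU1 r0] [etaP psiP eta1C eta2C]]]]] := local_inverse oU1 U1y0 f1C f2C det0.
set det := fun y => a11 y * a22 y - a12 y * a21 y.
pose kap z := param (atlas i) (eta z).
pose U := dom (atlas i) `&` [set q' | W (coord (atlas i) q')].
have psiE y : vec2 (f1 y) (f2 y) = prj P (G y) by [].
have BE : vec2 (f1 y0) (f2 y0) = prj P (F q) by rewrite psiE /G /= py0.
set B := ball (prj P (F q)) r.
have {}etaP z : B z -> W (eta z) /\ vec2 (f1 (eta z)) (f2 (eta z)) = z.
  by rewrite /B -BE; exact: etaP.
have etaW z : B z -> W (eta z) by move=> /etaP[].
have etaU1 z : B z -> U1 (eta z) by move=> /etaW/WU1.
have etaU0 z : B z -> U0 (eta z) by move=> /etaU1/U1U0.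
have oU : open U.
  rewrite openE => q' [iq' Wq']; apply: filterI; first exact: dom_nbhs.
  exact: (near_continuous (Defs.coord_continuous iq') (open_nbhs_nbhs (conj oW Wq'))).
pose e11 z := a22 (eta z) / det (eta z); pose e12 z := - a12 (eta z) / det (eta z).
pose e21 z := - a21 (eta z) / det (eta z); pose e22 z := a11 (eta z) / det (eta z).
have {}eta1C : C1 B (fun z => c1 (eta z)) e11 e12 by rewrite /B -BE; exact: eta1C.
have {}eta2C : C1 B (fun z => c2 (eta z)) e21 e22 by rewrite /B -BE; exact: eta2C.
have deta z : B z -> det (eta z) != 0 by move=> /etaW/psiP[].
pose lift w z := vec2 (e11 z * c1 w + e12 z * c2 w) (e21 z * c1 w + e22 z * c2 w).
have liftP v z : B z -> lift (prj P ('D_v G (eta z))) z = v.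
  move=> Bz; rewrite prjDE; last exact: etaU0.
  rewrite /lift !c1_vec2 !c2_vec2; have := deta _ Bz; rewrite /e11 /e12 /e21 /e22 /det.
  move: (a11 (eta z)) (a12 (eta z)) (a21 (eta z)) (a22 (eta z)) => A A' A'' A''' ?.
  by apply: rV2P; rewrite ?c1_vec2 ?c2_vec2; field.
have tanW z u : B z -> tangent (kap z) u -> exists v, 'D_v G (eta z) = u.
  by move=> Bz; apply: (tangent_span F_imm N_nrm); exact: etaU0.
have etac z : B z -> {for z, continuous eta}.
  move=> Bz; rewrite (_ : eta = fun z => vec2 (c1 (eta z)) (c2 (eta z))); last first.
    by apply/funext => ?; rewrite -vec2E.
  by apply: vec2_continuous; [exact: (C1_cont eta1C)|exact: (C1_cont eta2C)].
have kapc z : B z -> {for z, continuous kap}.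
  by move=> Bz; apply: (continuous_comp (etac _ Bz)); apply: param_continuous; exact: etaU0.
have partE (fa fb : V2 -> R) z w : fa (eta z) * c1 (lift w z) + fb (eta z) * c2 (lift w z) =
    (fa (eta z) * e11 z + fb (eta z) * e21 z) * c1 w + (fa (eta z) * e12 z + fb (eta z) * e22 z) * c2 w.
  by rewrite /lift c1_vec2 c2_vec2; ring.
have nisC (n : S -> R) : isC1 U1 (n \o param (atlas i)) -> isC1 B (fun z => n (kap z)).
  by move=> nC; apply: (isC1_comp nC etaU1); do 2 eexists; [exact: eta1C|exact: eta2C].
suff sec : lsec i q P by exists sec.
apply: (@LSec i q P r U kap _ _ _ _ _ _ r0 oU _ _ _ _ _ kapc (C1_comp xC etaU1 eta1C eta2C)
  (C1_comp yC etaU1 eta1C eta2C) (C1_comp tC etaU1 eta1C eta2C)).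
- by split=> //.
- by move=> z Bz; split; [apply: param_dom; exact: etaU0|rewrite /= paramK; [exact: etaW|exact: etaU0]].
- by move=> z Bz; have [_] := etaP _ Bz; rewrite psiE.
- move=> q' [iq' Wq']; have [] := psiP _ Wq'.
  by rewrite BE psiE /G /= coordK.
- move=> q' [iq' Wq']; have [_] := psiP _ Wq'.
  by rewrite psiE /G /= coordK// /kap => -> _; rewrite coordK.
- move=> z u Bz tu; have [v vE] := tanW z u Bz tu.
  have := liftP v z Bz; rewrite vE => wE.
  have [d1 d2 d3] := DE (eta z) v (etaU0 _ Bz); rewrite vE in d1 d2 d3.
  by rewrite -!partE wE d1 d2 d3.
- move=> z w1 w2 Bz; have Uz := etaU0 _ Bz.
  have [d1 d2 d3] := DE (eta z) (lift (vec2 w1 w2) z) Uz.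
  have := tanD _ (lift (vec2 w1 w2) z) Uz.
  have := partE xa xb z (vec2 w1 w2); have := partE ya yb z (vec2 w1 w2); have := partE ta tb z (vec2 w1 w2).
  rewrite c1_vec2 c2_vec2 => <- <- <-; rewrite -d1 -d2 -d3.
  by rewrite -vec3E.
- exact: nisC.
- exact: nisC.
- exact: nisC.
- apply: (@isC1_eq _ B (fun z => c1 (eta z))); first exact: ball_open.
    by move=> z /set_mem Bz; rewrite /kap paramK//; exact: etaU0.
  by do 2 eexists; exact: eta1C.
- apply: (@isC1_eq _ B (fun z => c2 (eta z))); first exact: ball_open.
    by move=> z /set_mem Bz; rewrite /kap paramK//; exact: etaU0.
  by do 2 eexists; exact: eta2C.
- move=> U' a b a' b' z oU' U'z U'B rU' aC bC p w.
  have Bz := U'B _ U'z; have U1z := etaU1 _ Bz.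
  have [U2 [oU2 U2z U2U1 rU2 [[a_ [b_ a_C]] [a'_ [b'_ b_C]]]]] :=
    nu_C1 N_nrm oU1 U1z U1U0 n1C n2C (rU' _ U'z).
  set u := vec3 _ _ _ in w *.
  have tu : tangent (kap z) u.
    rewrite /tangent /tcomp /u xc_vec3 yc_vec3 tc_vec3 /p -/(kap z).
    rewrite !nu1E !nu2E; move: (n1 (kap z)) (n2 (kap z)) (n3 (kap z)) (xc (F (kap z))) (yc (F (kap z))) (hh N (kap z))^-1.
    by move=> *; ring.
  have [v vE] := tanW z u Bz tu.
  have U2U0 : U2 `<=` U0 by move=> y /U2U1/U1U0.
  have := chart_curvature F_imm N_nrm (v := v) F_cmc oU2 U2z U2U0 rU2 a_C b_C.
  rewrite -/G vE xc_vec3 yc_vec3 => /(_ erefl erefl).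
  have -> : tcomp (G (eta z)) u = 0 by rewrite /tcomp /u xc_vec3 yc_vec3 tc_vec3 /p; ring.
  move=> /(_ erefl) [E1 E2].
  (* The lift to the chart of the line through [z] has velocity [v]. Along it, the derivatives known
     in the chart are compared with those of the compositions with the section. *)
  have D2 : drv2 (fun s => eta (z + s *: w)) 0 (c1 v) (c2 v).
    have z0 : z + 0 *: w = z by rewrite scale0r addr0.
    have Bz0 : B (z + 0 *: w) by rewrite z0.
    have := C1_chain eta1C (y := fun s => z + s *: w) Bz0 (drv2_line z w 0).
    have := C1_chain eta2C (y := fun s => z + s *: w) Bz0 (drv2_line z w 0).
    rewrite z0; have := liftP v z Bz; rewrite vE => <-.
    by rewrite /lift c1_vec2 c2_vec2; split.
  have z0 : z + 0 *: w = z by rewrite scale0r addr0.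
  have U2z0 : U2 (eta (z + 0 *: w)) by rewrite z0.
  have U'z0 : U' (z + 0 *: w) by rewrite z0.
  have X1 := drv_unique (C1_chain a_C (y := fun s => eta (z + s *: w)) U2z0 D2)
     (C1_chain aC (y := fun s => z + s *: w) U'z0 (drv2_line z w 0)).
  have X2 := drv_unique (C1_chain b_C (y := fun s => eta (z + s *: w)) U2z0 D2)
     (C1_chain bC (y := fun s => z + s *: w) U'z0 (drv2_line z w 0)).
  by rewrite z0 in X1 X2; rewrite -X1 -X2.
Qed.

End local_sections.

(** * Uniqueness for homogeneous linear differential systems *)

Section linear_bounds.
Context {R : realType}.
Implicit Types (V f g : R -> R) (r : R).

Definition lin_bounded V r g := exists K, \forall s \near r, `|g s| <= K * V s.

Lemma lin_boundedW V r f : (forall s, `|f s| <= V s) -> lin_bounded V r f.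
Proof. by move=> fV; exists 1; near=> s; rewrite mul1r.
Unshelve. all: by end_near. Qed.

Lemma lin_boundedD V r f g : lin_bounded V r f -> lin_bounded V r g ->
  lin_bounded V r (fun s => f s + g s).
Proof.
move=> [K fK] [L gL]; exists (K + L); apply: filterS2 fK gL => s fs gs.
by rewrite (le_trans (ler_normD _ _))// mulrDl lerD.
Qed.

Lemma lin_boundedN V r f : lin_bounded V r f -> lin_bounded V r (fun s => - f s).
Proof. by move=> [K fK]; exists K; apply: filterS fK => s; rewrite normrN. Qed.

Lemma lin_boundedB V r f g : lin_bounded V r f -> lin_bounded V r g ->
  lin_bounded V r (fun s => f s - g s).
Proof. by move=> fV gV; apply: lin_boundedD => //; exact: lin_boundedN. Qed.

Lemma lin_boundedM V r f g : {for r, continuous f} -> lin_bounded V r g ->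
  lin_bounded V r (fun s => f s * g s).
Proof.
move=> fc [K gK]; exists ((`|f r| + 1) * K).
have /cvgrPdist_le/(_ _ ltr01) := fc => fb; apply: filterS2 fb gK => s fs gs.
rewrite normrM -mulrA ler_pM//; rewrite -lerBlDl.
by rewrite (le_trans _ fs)// distrC lerB_dist.
Qed.

Lemma lin_boundedZ V r c g : lin_bounded V r g -> lin_bounded V r (fun s => c * g s).
Proof. by apply: lin_boundedM; exact: cst_continuous. Qed.

(** Gronwall is applied to the sum of squares [f], which is differentiable, whereas the bounds are
    stated with the sum of absolute values [V]. The factor 10 is 2 from differentiating squares
    times 5 from [V ^+ 2 <= 5 * f]. The five unknowns will be three of position and two of
    direction. *)
Lemma drv_linear_system (v1 v2 v3 v4 v5 d1 d2 d3 d4 d5 : R -> R) a b s0 :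
  let V s := `|v1 s| + `|v2 s| + `|v3 s| + `|v4 s| + `|v5 s| in
  a <= s0 <= b ->
  (forall s, a <= s <= b -> [/\ drv v1 s (d1 s), drv v2 s (d2 s), drv v3 s (d3 s),
     drv v4 s (d4 s) & drv v5 s (d5 s)]) ->
  (forall s, a <= s <= b -> [/\ lin_bounded V s d1, lin_bounded V s d2, lin_bounded V s d3,
     lin_bounded V s d4 & lin_bounded V s d5]) ->
  V s0 = 0 -> forall s, a <= s <= b -> V s = 0.
Proof.
move=> V sab vd dV V0.
pose f s := v1 s * v1 s + v2 s * v2 s + v3 s * v3 s + v4 s * v4 s + v5 s * v5 s.
pose df s := (v1 s * d1 s + v1 s * d1 s) + (v2 s * d2 s + v2 s * d2 s) + (v3 s * d3 s + v3 s * d3 s) +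
   (v4 s * d4 s + v4 s * d4 s) + (v5 s * d5 s + v5 s * d5 s).
have V_ge0 s : 0 <= V s by rewrite !addr_ge0.
have fV s : V s ^+ 2 <= 5 * f s.
  have sq x : x * x = `|x| ^+ 2 :> R by rewrite real_normK ?num_real// expr2.
  rewrite /f !sq /V; move: `|v1 s| `|v2 s| `|v3 s| `|v4 s| `|v5 s| => x y z t u.
  have -> : 5 * (x ^+ 2 + y ^+ 2 + z ^+ 2 + t ^+ 2 + u ^+ 2) = (x + y + z + t + u) ^+ 2 +
     ((x - y) ^+ 2 + (x - z) ^+ 2 + (x - t) ^+ 2 + (x - u) ^+ 2 + (y - z) ^+ 2 + (y - t) ^+ 2 + (y - u) ^+ 2
      + (z - t) ^+ 2 + (z - u) ^+ 2 + (t - u) ^+ 2) by ring.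
  by rewrite lerDl !addr_ge0// sqr_ge0.
have vV s : [/\ `|v1 s| <= V s, `|v2 s| <= V s, `|v3 s| <= V s, `|v4 s| <= V s & `|v5 s| <= V s].
  have := (normr_ge0 (v1 s), normr_ge0 (v2 s), normr_ge0 (v3 s), normr_ge0 (v4 s), normr_ge0 (v5 s)).
  by rewrite /V; move: `|v1 s| `|v2 s| `|v3 s| `|v4 s| `|v5 s| => x y z t u [[[[? ?] ?] ?] ?]; split; lra.
have f0 s : f s = 0 -> V s = 0.
  move=> fs0; apply/eqP; rewrite -sqrf_eq0 eq_le sqr_ge0 andbT.
  by have := fV s; rewrite fs0 mulr0.
have f_ge0 s : 0 <= f s by rewrite !addr_ge0// -expr2 sqr_ge0.
move=> s sab'; apply: f0; move: s sab'.
apply: (@drv_gronwall _ f df a b s0 sab) => //.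
- move=> s /vd[? ? ? ? ?]; apply: drvD; [apply: drvD; [apply: drvD; [apply: drvD|]|]|]; exact: drvM.
- move=> s /dV[[K1 h1] [K2 h2] [K3 h3] [K4 h4] [K5 h5]].
  exists (10 * `|K1 + K2 + K3 + K4 + K5|).
  apply: filterS (filterI (filterI (filterI h1 h2) (filterI h3 h4)) h5).
  move=> r [[[{}h1 {}h2] [{}h3 {}h4]] {}h5] _.
  have [w1 w2 w3 w4 w5] := vV r.
  have P v d K : `|v| <= V r -> `|d| <= K * V r -> `|v * d + v * d| <= 2 * (K * V r ^+ 2).
    move=> hv hd; rewrite -mulr2n normrMn mulr_natl ler_wMn2r// normrM.
    by rewrite (le_trans (ler_pM _ _ hv hd))// expr2 mulrCA.
  apply: (@le_trans _ _ (2 * ((K1 + K2 + K3 + K4 + K5) * V r ^+ 2))).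
    have -> : 2 * ((K1 + K2 + K3 + K4 + K5) * V r ^+ 2) = 2 * (K1 * V r ^+ 2) + 2 * (K2 * V r ^+ 2) +
      2 * (K3 * V r ^+ 2) + 2 * (K4 * V r ^+ 2) + 2 * (K5 * V r ^+ 2) by ring.
    rewrite /df; do 4 (apply: (le_trans (ler_normD _ _)); apply: lerD; last by exact: P).
    exact: P.
  set K := K1 + K2 + K3 + K4 + K5.
  have -> : 10 * `|K| * f r = 2 * (`|K| * (5 * f r)) by ring.
  rewrite ler_wpM2l//; apply: (@le_trans _ _ (`|K| * V r ^+ 2)).
    by rewrite ler_wpM2r ?sqr_ge0// ler_norm.
  by rewrite ler_wpM2l.
- have E0 : [/\ v1 s0 = 0, v2 s0 = 0, v3 s0 = 0, v4 s0 = 0 & v5 s0 = 0].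
    have [w1 w2 w3 w4 w5] := vV s0.
    by split; apply/eqP; rewrite -normr_le0 -V0.
  by rewrite /f; have [-> -> -> -> ->] := E0; rewrite !mulr0 !addr0.
Qed.

End linear_bounds.

(** * Geodesics contained in the surface *)

Section geodesics.
Context {R : realType} {S : surface R}.
Local Notation V2 := 'rV[R]_2.
Local Notation H1 := 'rV[R]_3.
Variables (F N : S -> H1) (H eps : R).
Hypothesis F_imm : immersion2 F.
Hypothesis N_nrm : unit_normal F N.
Hypothesis eps2 : eps * eps = 1.
Local Notation n1 := (n1 N).
Local Notation n2 := (n2 N).
Local Notation n3 := (n3 F N).
Local Notation nu1 := (nu1 N).
Local Notation nu2 := (nu2 N).
Local Notation reg := (reg N).

(* The characteristic direction in the frame X, Y. *)
Definition zeta1 q := - (eps * nu2 q).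
Definition zeta2 q := eps * nu1 q.
(** Reversing a curve changes the sign of its curvature. Later [eps] is the T-component of [N] at
    the isolated singular point, which makes the field [(zeta1, zeta2)] point away from it. *)
Definition lam := eps * H.

(* [gam] is a geodesic of curvature [l]; its velocity has components [s1] and
   [s2] in the frame X, Y. *)
Definition geod (l : R) (gam : R -> H1) (s1 s2 : R -> R) := forall s,
  [/\ drv (fun r => xc (gam r)) s (s1 s), drv (fun r => yc (gam r)) s (s2 s),
      drv (fun r => tc (gam r)) s (yc (gam s) * s1 s - xc (gam s) * s2 s),
      drv s1 s (2 * l * s2 s) & drv s2 s (- (2 * l * s1 s))].

Lemma nu_isC1 i q P (sec : lsec F N H i q P) U : U `<=` ls_B sec ->
  (forall z, U z -> reg (ls_kap sec z)) ->
  isC1 U (fun z => nu1 (ls_kap sec z)) /\ isC1 U (fun z => nu2 (ls_kap sec z)).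
Proof.
move=> UB rU.
have hC : isC1 U (fun z => (hh N (ls_kap sec z))^-1).
  apply: isC1V => [z Uz|]; first exact: lt0r_neq0 (hh_gt0 (rU _ Uz)).
  apply: isC1_sqrt => [z Uz|]; first exact: rU.
  by apply: isC1D; apply: isC1_sqr; apply: (isC1_sub UB); [exact: ls_n1C|exact: ls_n2C].
by split; apply: isC1M => //; apply: (isC1_sub UB); [exact: ls_n1C|exact: ls_n2C].
Qed.

Lemma zeta_tangent q : tangent F N q (vec3 (zeta1 q) (zeta2 q)
   (yc (F q) * zeta1 q - xc (F q) * zeta2 q)).
Proof.
rewrite /tangent /tcomp xc_vec3 yc_vec3 tc_vec3 /zeta1 /zeta2 !nu1E !nu2E.
by move: (n1 q) (n2 q) (n3 q) (hh N q)^-1 (xc (F q)) (yc (F q)) => *; ring.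
Qed.

Lemma geod_drv2 l gam s1 s2 P s : geod l gam s1 s2 ->
  let u := vec3 (s1 s) (s2 s) (yc (gam s) * s1 s - xc (gam s) * s2 s) in
  drv2 (fun r => prj P (gam r)) s (c1 (prj P u)) (c2 (prj P u)).
Proof.
move=> /(_ s)[gx gy gt _ _] u; rewrite /prj /u xc_vec3 yc_vec3 tc_vec3 c1_vec2 c2_vec2; split.
- apply: (@drv_ext _ (fun r => pa P * xc (gam r) + pb P * yc (gam r) + pc P * tc (gam r))).
    by move=> r /=; rewrite c1_vec2.
  by apply: drvD; [apply: drvD|]; exact: drvZ.
- apply: (@drv_ext _ (fun r => qa P * xc (gam r) + qb P * yc (gam r) + qc P * tc (gam r))).
    by move=> r /=; rewrite c2_vec2.
  by apply: drvD; [apply: drvD|]; exact: drvZ.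
Qed.

(* The differences of position and of direction between a geodesic of curvature
   [lam] and the surface above its projection satisfy a homogeneous linear
   differential system, hence vanish everywhere if they vanish once (Gronwall). *)
Lemma geod_in_section i q P (sec : lsec F N H i q P) gam s1 s2 a b s0 :
  let k s := ls_kap sec (prj P (gam s)) in
  geod lam gam s1 s2 -> a <= s0 <= b ->
  (forall s, a <= s <= b -> ls_B sec (prj P (gam s)) /\ reg (k s)) ->
  F (k s0) = gam s0 -> zeta1 (k s0) = s1 s0 -> zeta2 (k s0) = s2 s0 ->
  forall s, a <= s <= b -> [/\ F (k s) = gam s, zeta1 (k s) = s1 s & zeta2 (k s) = s2 s].
Proof.
move=> k gg sab Bk F0 z10 z20.
pose U := ls_B sec `&` [set z | reg (ls_kap sec z)].
have UB : U `<=` ls_B sec by move=> z [].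
have rU z : U z -> reg (ls_kap sec z) by case.
have oB : open (ls_B sec) by exact: ball_open.
have oU : open U.
  rewrite openE => z [Bz rz]; apply: filterI; first exact: open_nbhs_nbhs (conj oB Bz).
  exact: (near_continuous (ls_kapc Bz) (reg_nbhs N_nrm rz)).
have [[a1 [b1 nu1C]] [a2 [b2 nu2C]]] := nu_isC1 UB rU.
have Uk s : a <= s <= b -> U (prj P (gam s)) by move=> /Bk[].
pose pz s := prj P (gam s).
pose v1 s := xc (F (k s)) - xc (gam s); pose v2 s := yc (F (k s)) - yc (gam s).
pose v3 s := tc (F (k s)) - tc (gam s).
pose v4 s := zeta1 (k s) - s1 s; pose v5 s := zeta2 (k s) - s2 s.
(* the velocity of [gam] minus the characteristic vector *)
pose d3 s := - (v2 s * zeta1 (k s) + yc (gam s) * v4 s - v1 s * zeta2 (k s) - xc (gam s) * v5 s).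
pose w1 s := pa P * - v4 s + pb P * - v5 s + pc P * d3 s.
pose w2 s := qa P * - v4 s + qb P * - v5 s + qc P * d3 s.
(* [e1] to [e5] are the derivatives of [v1] to [v5]. The velocity of [gam] projects to that of the
   characteristic vector plus [(w1, w2)]; the characteristic contributions cancel and what is left
   is linear in the errors, with continuous coefficients. *)
pose e1 s := ls_x1 sec (pz s) * w1 s + ls_x2 sec (pz s) * w2 s + v4 s.
pose e2 s := ls_y1 sec (pz s) * w1 s + ls_y2 sec (pz s) * w2 s + v5 s.
pose e3 s := ls_t1 sec (pz s) * w1 s + ls_t2 sec (pz s) * w2 s - d3 s.
pose e4 s := 2 * lam * v5 s - eps * (a2 (pz s) * w1 s + b2 (pz s) * w2 s).
pose e5 s := - (2 * lam * v4 s) + eps * (a1 (pz s) * w1 s + b1 (pz s) * w2 s).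
have W s : let u := vec3 (s1 s) (s2 s) (yc (gam s) * s1 s - xc (gam s) * s2 s) in
    let z := vec3 (zeta1 (k s)) (zeta2 (k s)) (yc (F (k s)) * zeta1 (k s) - xc (F (k s)) * zeta2 (k s)) in
    c1 (prj P u) = c1 (prj P z) + w1 s /\ c2 (prj P u) = c2 (prj P z) + w2 s.
  rewrite /prj !xc_vec3 !yc_vec3 !tc_vec3 !c1_vec2 !c2_vec2 /w1 /w2 /d3 /v1 /v2 /v4 /v5.
  by split; ring.
have D s : a <= s <= b -> [/\ drv v1 s (e1 s), drv v2 s (e2 s), drv v3 s (e3 s), drv v4 s (e4 s) & drv v5 s (e5 s)].
  move=> sab'; have [Bs rs] := Bk s sab'; have Us := Uk s sab'.
  have [gx gy gt gs1 gs2] := gg s.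
  have D2 := geod_drv2 P s gg; cbv zeta in D2; have [W1 W2] := W s; rewrite W1 W2 in D2.
  have [tx ty tt] := ls_tan Bs (zeta_tangent (k s)).
  rewrite xc_vec3 in tx; rewrite yc_vec3 in ty; rewrite tc_vec3 in tt.
  set z := vec3 _ _ _ in tx ty tt D2.
  have [cu1 cu2] := ls_curv oU Us UB rU nu1C nu2C.
  set u0 := prj P (vec3 _ _ _) in cu1 cu2.
  have zE : prj P z = eps *: u0.
    rewrite -prjZ; congr prj; rewrite /z /zeta1 /zeta2; apply: rV3P.
    - by rewrite xcZ !xc_vec3 -!/(k s); ring.
    - by rewrite ycZ !yc_vec3 -!/(k s); ring.
    - by rewrite tcZ !tc_vec3 -!/(k s); ring.
  have z1E : c1 (prj P z) = eps * c1 u0 by rewrite zE c1Z.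
  have z2E : c2 (prj P z) = eps * c2 u0 by rewrite zE c2Z.
  split.
  - refine (drv_eq (drvB (C1_chain (y := pz) (ls_xC sec) Bs D2) gx) _).
    by rewrite /e1 /v4 -tx /pz; ring.
  - refine (drv_eq (drvB (C1_chain (y := pz) (ls_yC sec) Bs D2) gy) _).
    by rewrite /e2 /v5 -ty /pz; ring.
  - refine (drv_eq (drvB (C1_chain (y := pz) (ls_tC sec) Bs D2) gt) _).
    transitivity ((yc (F (k s)) * zeta1 (k s) - xc (F (k s)) * zeta2 (k s)) + (ls_t1 sec (pz s) * w1 s + ls_t2 sec (pz s) * w2 s)
       - (yc (gam s) * s1 s - xc (gam s) * s2 s)).
      by rewrite -tt /pz; ring.
    by rewrite /e3 /d3 /v1 /v2 /v4 /v5; ring.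
  - refine (drv_eq (drvB (drvN (drvZ eps (C1_chain (y := pz) nu2C Us D2))) gs1) _).
    rewrite z1E z2E; transitivity (- (eps * (eps * (a2 (prj P (gam s)) * c1 u0 + b2 (prj P (gam s)) * c2 u0) +
      (a2 (prj P (gam s)) * w1 s + b2 (prj P (gam s)) * w2 s))) - 2 * lam * s2 s); first ring.
    rewrite cu2 /e4 /v5 /zeta2 /lam -!/(k s) -!/(pz s).
    by ring.
  - refine (drv_eq (drvB (drvZ eps (C1_chain (y := pz) nu1C Us D2)) gs2) _).
    rewrite z1E z2E; transitivity (eps * (eps * (a1 (prj P (gam s)) * c1 u0 + b1 (prj P (gam s)) * c2 u0) +
      (a1 (prj P (gam s)) * w1 s + b1 (prj P (gam s)) * w2 s)) - - (2 * lam * s1 s)); first ring.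
    rewrite cu1 /e5 /v4 /zeta1 /lam -!/(k s) -!/(pz s).
    by ring.
have kc s : a <= s <= b -> {for s, continuous k}.
  move=> sab'; have [Bs _] := Bk s sab'.
  have := drv2_cont (geod_drv2 P s gg) => pc.
  exact: (continuous_comp pc (ls_kapc Bs)).
have pzc s : {for s, continuous pz} by exact: drv2_cont (geod_drv2 P s gg).
have gxc s : {for s, continuous (fun s => xc (gam s))} by have [/drv_cont] := gg s.
have gyc s : {for s, continuous (fun s => yc (gam s))} by have [_ /drv_cont] := gg s.
have h1 s : a <= s <= b -> 0 = 0 :> R by [].
have z1c s : a <= s <= b -> {for s, continuous (fun s => zeta1 (k s))}.
  move=> /D[_ _ _ /drv_cont v4c _]; have [_ _ _ /drv_cont s1c _] := gg s.
  rewrite (_ : (fun s => zeta1 (k s)) = (fun s => v4 s + s1 s)); last by apply/funext => r; rewrite /v4 subrK.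
  by apply: continuousD; [exact: v4c|exact: s1c].
have z2c s : a <= s <= b -> {for s, continuous (fun s => zeta2 (k s))}.
  move=> /D[_ _ _ _ /drv_cont v5c]; have [_ _ _ _ /drv_cont s2c] := gg s.
  rewrite (_ : (fun s => zeta2 (k s)) = (fun s => v5 s + s2 s)); last by apply/funext => r; rewrite /v5 subrK.
  by apply: continuousD; [exact: v5c|exact: s2c].
pose V s := `|v1 s| + `|v2 s| + `|v3 s| + `|v4 s| + `|v5 s|.
have V0 : forall s, a <= s <= b -> V s = 0.
  apply: (drv_linear_system sab D); last first.
    by rewrite /v1 /v2 /v3 /v4 /v5 F0 z10 z20 !subrr normr0 !addr0.
  move=> s sab'; rewrite -/V.
  have [Bs _] := Bk s sab'; have Us := Uk s sab'.
  have Vv r : [/\ `|v1 r| <= V r, `|v2 r| <= V r, `|v4 r| <= V r & `|v5 r| <= V r].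
    have := (normr_ge0 (v1 r), normr_ge0 (v2 r), normr_ge0 (v3 r), normr_ge0 (v4 r), normr_ge0 (v5 r)).
    by rewrite /V; move: `|v1 r| `|v2 r| `|v3 r| `|v4 r| `|v5 r| => x y z t u [[[[? ?] ?] ?] ?]; split; lra.
  have L1 : lin_bounded V s v1 by apply: lin_boundedW => r; have [] := Vv r.
  have L2 : lin_bounded V s v2 by apply: lin_boundedW => r; have [] := Vv r.
  have L4 : lin_bounded V s v4 by apply: lin_boundedW => r; have [] := Vv r.
  have L5 : lin_bounded V s v5 by apply: lin_boundedW => r; have [] := Vv r.
  have Ld3 : lin_bounded V s d3.
    apply: lin_boundedN; apply: lin_boundedB; first apply: lin_boundedB; first apply: lin_boundedD.
    - rewrite (_ : (fun s => v2 s * zeta1 (k s)) = (fun s => zeta1 (k s) * v2 s)); last by apply/funext => r; rewrite mulrC.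
      by apply: lin_boundedM L2; exact: z1c.
    - exact: lin_boundedM.
    - rewrite (_ : (fun s => v1 s * zeta2 (k s)) = (fun s => zeta2 (k s) * v1 s)); last by apply/funext => r; rewrite mulrC.
      by apply: lin_boundedM L1; exact: z2c.
    - exact: lin_boundedM.
  have Lw1 : lin_bounded V s w1.
    by apply: lin_boundedD; [apply: lin_boundedD|]; apply: lin_boundedZ => //; exact: lin_boundedN.
  have Lw2 : lin_bounded V s w2.
    by apply: lin_boundedD; [apply: lin_boundedD|]; apply: lin_boundedZ => //; exact: lin_boundedN.
  have Lc (f1 f2 : V2 -> R) : {for pz s, continuous f1} -> {for pz s, continuous f2} ->
      lin_bounded V s (fun s => f1 (pz s) * w1 s + f2 (pz s) * w2 s).
    move=> f1c f2c; apply: lin_boundedD.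
    - by apply: (@lin_boundedM _ V s (fun s => f1 (pz s)) w1) => //; exact: (continuous_comp (@pzc s) f1c).
    - by apply: (@lin_boundedM _ V s (fun s => f2 (pz s)) w2) => //; exact: (continuous_comp (@pzc s) f2c).
  split.
  - by apply: lin_boundedD => //; apply: Lc; [exact: (C1_cont1 (ls_xC sec) Bs)|exact: (C1_cont2 (ls_xC sec) Bs)].
  - by apply: lin_boundedD => //; apply: Lc; [exact: (C1_cont1 (ls_yC sec) Bs)|exact: (C1_cont2 (ls_yC sec) Bs)].
  - by apply: lin_boundedB => //; apply: Lc; [exact: (C1_cont1 (ls_tC sec) Bs)|exact: (C1_cont2 (ls_tC sec) Bs)].
  - by apply: lin_boundedB; [exact: lin_boundedZ|apply: lin_boundedZ; apply: Lc; [exact: (C1_cont1 nu2C Us)|exact: (C1_cont2 nu2C Us)]].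
  - by apply: lin_boundedD; [apply: lin_boundedN; exact: lin_boundedZ|apply: lin_boundedZ; apply: Lc; [exact: (C1_cont1 nu1C Us)|exact: (C1_cont2 nu1C Us)]].
move=> s /V0 Vs.
have [E1 E2 E3 E4 E5] : [/\ v1 s = 0, v2 s = 0, v3 s = 0, v4 s = 0 & v5 s = 0].
  move: Vs; rewrite /V => Vs.
  have := (normr_ge0 (v1 s), normr_ge0 (v2 s), normr_ge0 (v3 s), normr_ge0 (v4 s), normr_ge0 (v5 s)).
  move=> [[[[? ?] ?] ?] ?].
  by split; apply/eqP; rewrite -normr_le0; lra.
split; [|by apply/eqP; rewrite -subr_eq0 -/(v4 s) E4|by apply/eqP; rewrite -subr_eq0 -/(v5 s) E5].
by apply: rV3P; apply/eqP; rewrite -subr_eq0 -?/(v1 s) -?/(v2 s) -?/(v3 s) ?E1 ?E2 ?E3.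
Qed.

End geodesics.

(** * Explicit geodesics and the circles below them *)

Section model.
Context {R : realType}.
Local Notation V2 := 'rV[R]_2.
Local Notation H1 := 'rV[R]_3.
Variable l : R.
Implicit Types a b s r : R.

(* Unit speed circles of curvature [-2 l] with initial velocity [(a, b)]. *)
Definition dir1 a b s := a * cos (2 * l * s) + b * sin (2 * l * s).
Definition dir2 a b s := b * cos (2 * l * s) - a * sin (2 * l * s).
Definition cx a b s := (a * sin (2 * l * s) + b * (1 - cos (2 * l * s))) / (2 * l).
Definition cy a b s := (b * sin (2 * l * s) - a * (1 - cos (2 * l * s))) / (2 * l).
Definition ct s := (2 * l * s - sin (2 * l * s)) / (4 * l ^+ 2).
Definition cir (z : V2) a b s : V2 := vec2 (c1 z + cx a b s) (c2 z + cy a b s).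

(* The geodesic of curvature [l] from [p]: its t-component makes it horizontal. *)
Definition geo (p : H1) a b s : H1 := vec3 (xc p + cx a b s) (yc p + cy a b s)
  (tc p + (a ^+ 2 + b ^+ 2) * ct s + (yc p * cx a b s - xc p * cy a b s)).

Hypothesis l0 : l != 0.
Let l20 : 2 * l != 0. Proof. by rewrite mulf_neq0// pnatr_eq0. Qed.

Lemma drv_arg s : drv (fun s => 2 * l * s) s (2 * l).
Proof. by apply: drv_eq (drvZ _ (drv_id s)) _; rewrite mulr1. Qed.

Lemma drv_dir1 a b s : drv (dir1 a b) s (2 * l * dir2 a b s).
Proof.
apply: drv_eq (drvD (drvZ a (drv_cos (drv_arg s))) (drvZ b (drv_sin (drv_arg s)))) _.
by rewrite /dir2; ring.
Qed.

Lemma drv_dir2 a b s : drv (dir2 a b) s (- (2 * l * dir1 a b s)).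
Proof.
apply: drv_eq (drvB (drvZ b (drv_cos (drv_arg s))) (drvZ a (drv_sin (drv_arg s)))) _.
by rewrite /dir1; ring.
Qed.

Lemma drv_cx a b s : drv (cx a b) s (dir1 a b s).
Proof.
have D := drvM (drvD (drvZ a (drv_sin (drv_arg s)))
  (drvZ b (drvB (drv_cst 1 s) (drv_cos (drv_arg s))))) (drv_cst (2 * l)^-1 s).
by apply: drv_eq D _; rewrite /dir1; field.
Qed.

Lemma drv_cy a b s : drv (cy a b) s (dir2 a b s).
Proof.
have D := drvM (drvB (drvZ b (drv_sin (drv_arg s)))
  (drvZ a (drvB (drv_cst 1 s) (drv_cos (drv_arg s))))) (drv_cst (2 * l)^-1 s).
by apply: drv_eq D _; rewrite /dir2; field.
Qed.

Lemma drv_ct s : drv ct s ((1 - cos (2 * l * s)) / (2 * l)).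
Proof.
have D := drvM (drvB (drv_arg s) (drv_sin (drv_arg s))) (drv_cst (4 * l ^+ 2)^-1 s).
by apply: drv_eq D _; field.
Qed.

Lemma dir_unit a b s : a ^+ 2 + b ^+ 2 = 1 -> dir1 a b s ^+ 2 + dir2 a b s ^+ 2 = 1.
Proof.
move=> ab; rewrite /dir1 /dir2.
transitivity ((a ^+ 2 + b ^+ 2) * (cos (2 * l * s) ^+ 2 + sin (2 * l * s) ^+ 2)); first ring.
by rewrite cos2Dsin2 ab mulr1.
Qed.

Lemma geo_geod p a b s :
  [/\ drv (fun r => xc (geo p a b r)) s (dir1 a b s),
      drv (fun r => yc (geo p a b r)) s (dir2 a b s) &
      drv (fun r => tc (geo p a b r)) s
        (yc (geo p a b s) * dir1 a b s - xc (geo p a b s) * dir2 a b s)].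
Proof.
split.
- apply: (@drv_ext _ (fun r => xc p + cx a b r)) => [r|]; first by rewrite xc_vec3.
  by apply: drv_eq (drvD (drv_cst _ _) (drv_cx a b s)) _; rewrite add0r.
- apply: (@drv_ext _ (fun r => yc p + cy a b r)) => [r|]; first by rewrite yc_vec3.
  by apply: drv_eq (drvD (drv_cst _ _) (drv_cy a b s)) _; rewrite add0r.
- apply: (@drv_ext _ (fun r => tc p + (a ^+ 2 + b ^+ 2) * ct r + (yc p * cx a b r - xc p * cy a b r))).
    by move=> r; rewrite tc_vec3.
  have D := drvD (drvD (drv_cst (tc p) s) (drvZ (a ^+ 2 + b ^+ 2) (drv_ct s)))
    (drvB (drvZ (yc p) (drv_cx a b s)) (drvZ (xc p) (drv_cy a b s))).
  apply: drv_eq D _; rewrite /geo xc_vec3 yc_vec3 /cx /cy /dir1 /dir2.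
  have C := cos2Dsin2 (2 * l * s).
  set c := cos _ in C *; set d := sin _ in C *.
  apply/eqP; rewrite -subr_eq0; apply/eqP.
  rewrite (_ : _ - _ = - ((a ^+ 2 + b ^+ 2) * (c ^+ 2 + d ^+ 2 - 1) / (2 * l))); last by field.
  by rewrite C subrr mulr0 mul0r oppr0.
Qed.

Lemma geo0 p a b : geo p a b 0 = p.
Proof.
rewrite /geo /cx /cy /ct mulr0 sin0 cos0 !subrr !mulr0 addr0 subrr !mul0r !mulr0 subrr !addr0.
by rewrite -vec3E.
Qed.

Lemma cir0 z a b : cir z a b 0 = z.
Proof.
by rewrite /cir /cx /cy mulr0 sin0 cos0 !subrr !mulr0 addr0 subrr !mul0r !addr0 -vec2E.
Qed.

Lemma dir0 a b : dir1 a b 0 = a /\ dir2 a b 0 = b.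
Proof. by rewrite /dir1 /dir2 mulr0 sin0 cos0 !mulr0 !mulr1 subr0 addr0. Qed.

Lemma dir_flow a b r s : dir1 (dir1 a b r) (dir2 a b r) s = dir1 a b (r + s) /\
  dir2 (dir1 a b r) (dir2 a b r) s = dir2 a b (r + s).
Proof. by rewrite /dir1 /dir2 [2 * l * (r + s)]mulrDr cosD sinD; split; ring. Qed.

Lemma cir_flow z a b r s :
  cir (cir z a b r) (dir1 a b r) (dir2 a b r) s = cir z a b (r + s).
Proof.
rewrite /cir; apply: rV2P; rewrite ?c1_vec2 ?c2_vec2 -addrA; congr (_ + _).
- by rewrite /cx /dir1 /dir2 [2 * l * (r + s)]mulrDr cosD sinD; field.
- by rewrite /cy /dir1 /dir2 [2 * l * (r + s)]mulrDr cosD sinD; field.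
Qed.

(** [geo p] is the left translate by [p] of a geodesic from the origin; the t-components add up
    thanks to the cross term of the group law. *)
Lemma geo_flow p a b r s : a ^+ 2 + b ^+ 2 = 1 ->
  geo (geo p a b r) (dir1 a b r) (dir2 a b r) s = geo p a b (r + s).
Proof.
move=> ab; have dE := dir_unit r ab.
have X : cx a b r + cx (dir1 a b r) (dir2 a b r) s = cx a b (r + s).
  by rewrite /cx /dir1 /dir2 [2 * l * (r + s)]mulrDr cosD sinD; field.
have Y : cy a b r + cy (dir1 a b r) (dir2 a b r) s = cy a b (r + s).
  by rewrite /cy /dir1 /dir2 [2 * l * (r + s)]mulrDr cosD sinD; field.
rewrite /geo; apply: rV3P; rewrite ?xc_vec3 ?yc_vec3 ?tc_vec3.
- by rewrite -addrA X.
- by rewrite -addrA Y.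
rewrite ab dE !mul1r -X -Y.
set tr := ct r; set ts := ct s.
suff -> : ct (r + s) = tr + ts + (cy a b r * cx (dir1 a b r) (dir2 a b r) s - cx a b r * cy (dir1 a b r) (dir2 a b r) s) by ring.
rewrite /tr /ts /ct /cx /cy /dir1 /dir2 [2 * l * (r + s)]mulrDr sinD.
have Cr := cos2Dsin2 (2 * l * r); move: Cr.
set c := cos (2 * l * r); set d := sin (2 * l * r); set c' := cos _; set d' := sin _ => C.
apply/eqP; rewrite -subr_eq0; apply/eqP.
transitivity ((d' * (1 - (a ^+ 2 + b ^+ 2) * (c ^+ 2 + d ^+ 2)) + ((a ^+ 2 + b ^+ 2) - 1) * (d' * c + c' * d - d)) / (4 * l ^+ 2)).
  by field.
by rewrite ab C; rewrite mulr1 !subrr mulr0 mul0r addr0 mul0r.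
Qed.

Lemma unit_le1 a b : a ^+ 2 + b ^+ 2 = 1 -> `|a| <= 1 /\ `|b| <= 1.
Proof.
move=> ab; split.
- by rewrite -(@ler_pXn2r _ 2)// ?nnegrE// expr1n real_normK ?num_real// -ab lerDl sqr_ge0.
- by rewrite -(@ler_pXn2r _ 2)// ?nnegrE// expr1n real_normK ?num_real// -ab lerDr sqr_ge0.
Qed.

Lemma dir_le1 a b s : a ^+ 2 + b ^+ 2 = 1 -> `|dir1 a b s| <= 1 /\ `|dir2 a b s| <= 1.
Proof. by move=> /(dir_unit s)/unit_le1. Qed.

Lemma drv_lipschitz (f df : R -> R) K s : (forall r, drv f r (df r)) ->
  (forall r, `|df r| <= K) -> `|f s - f 0| <= K * `|s|.
Proof.
move=> fd dK.
have P x y : x <= y -> `|f y - f x| <= K * `|y - x|.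
  rewrite le_eqVlt => /predU1P[->|xy]; first by rewrite !subrr normr0 mulr0.
  by have [c _ ->] := drv_MVT xy (fun s _ => fd s); rewrite normrM ler_wpM2r.
have [s0|/ltW s0] := leP 0 s; first by have := P _ _ s0; rewrite subr0.
by have := P _ _ s0; rewrite sub0r normrN distrC.
Qed.

Lemma dir_lipschitz a b s : a ^+ 2 + b ^+ 2 = 1 ->
  `|dir1 a b s - a| <= 2 * `|l| * `|s| /\ `|dir2 a b s - b| <= 2 * `|l| * `|s|.
Proof.
move=> ab; have [d1 d2] := dir0 a b.
have := drv_lipschitz (K := 2 * `|l|) s (drv_dir1 a b).
have := drv_lipschitz (K := 2 * `|l|) s (drv_dir2 a b).
rewrite d1 d2 => h2 h1; split; [apply: h1|apply: h2] => r; have [e1 e2] := dir_le1 r ab.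
- by rewrite !normrM ger0_norm// ler_piMr// mulr_ge0.
- by rewrite normrN !normrM ger0_norm// ler_piMr// mulr_ge0.
Qed.

(** Second order Taylor estimate from the Lipschitz bound on the direction; the mean value theorem
    gives it with a constant that is not optimal but sufficient. *)
Lemma c_approx a b s : a ^+ 2 + b ^+ 2 = 1 ->
  `|cx a b s - a * s| <= 2 * `|l| * s ^+ 2 /\ `|cy a b s - b * s| <= 2 * `|l| * s ^+ 2.
Proof.
move=> ab.
have P (f df : R -> R) k x : f 0 = 0 -> (forall r, drv f r (df r)) -> (forall r, `|df r - k| <= 2 * `|l| * `|r|) ->
    `|f x - k * x| <= 2 * `|l| * x ^+ 2.
  move=> f0 fd dK.
  have D r : drv (fun x => f x - k * x) r (df r - k).
    by apply: drv_eq (drvB (fd r) (drvZ k (drv_id r))) _; rewrite mulr1.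
  have B r c : `|c| <= `|r| -> `|(df c - k) * r| <= 2 * `|l| * r ^+ 2.
    move=> cr; rewrite normrM (le_trans (ler_wpM2r _ (dK c)))//.
    have -> : r ^+ 2 = `|r| * `|r| by rewrite -expr2 real_normK ?num_real.
    rewrite -[leLHS]mulrA; apply: ler_wpM2l; first by rewrite mulr_ge0.
    by rewrite ler_wpM2r.
  have [x0|x0|<-] := ltgtP 0 x; last by rewrite f0 !mulr0 subrr normr0 expr0n mulr0.
  - have [c /andP[c0 cx_]] := drv_MVT x0 (fun s _ => D s).
    rewrite f0 mulr0 !subr0 => ->; apply: B.
    by rewrite !gtr0_norm// ltW.
  - have [c /andP[cx_ c0]] := drv_MVT x0 (fun s _ => D s).
    rewrite f0 mulr0 !subr0 sub0r => E; rewrite -normrN E.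
    rewrite sub0r mulrN normrN; apply: B.
    by rewrite !ltr0_norm// lerN2 ltW.
have [x0 y0] : cx a b 0 = 0 /\ cy a b 0 = 0.
  by rewrite /cx /cy mulr0 sin0 cos0 subrr !mulr0 addr0 subrr mul0r.
split.
- by apply: (P _ (dir1 a b)) => // [r|r]; [exact: drv_cx|have [] := dir_lipschitz r ab].
- by apply: (P _ (dir2 a b)) => // [r|r]; [exact: drv_cy|have [] := dir_lipschitz r ab].
Qed.

End model.

(** * Fields on the plane with circular orbits *)

Section planar.
Context {R : realType}.
Local Notation V2 := 'rV[R]_2.
Variables (l r : R) (z0 : V2) (f1 f2 a11 a12 a21 a22 u t1 t2 : V2 -> R).
Let B := ball z0 r.

Definition vn z := Num.sqrt (f1 z ^+ 2 + f2 z ^+ 2).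
Definition d1 z := f2 z / vn z.
Definition d2 z := - f1 z / vn z.

Hypothesis l0 : l != 0.
Hypothesis r0 : 0 < r.
Hypothesis f1C : C1 B f1 a11 a12.
Hypothesis f2C : C1 B f2 a21 a22.
Hypothesis uC : C1 B u t1 t2.
(** [u] is the height of the surface as a graph over the xy-plane. A horizontal plane has slopes
    [c2 z] and [- c1 z], so [(f1, f2)] is the deviation of the tangent plane from the horizontal
    one. *)
Hypothesis t1E : forall z, B z -> t1 z = c2 z + f1 z.
Hypothesis t2E : forall z, B z -> t2 z = - c1 z + f2 z.
Hypothesis f10 : f1 z0 = 0.
Hypothesis f20 : f2 z0 = 0.
Hypothesis fn0 : forall z, B z -> z != z0 -> 0 < f1 z ^+ 2 + f2 z ^+ 2.
(* The unit field orthogonal to [(f1, f2)] is tangent to circles. *)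
Hypothesis orbit : forall z a b, B z -> z != z0 -> a <= 0 <= b ->
  (forall s, a <= s <= b -> B (cir l z (d1 z) (d2 z) s) /\ cir l z (d1 z) (d2 z) s != z0) ->
  forall s, a <= s <= b -> d1 (cir l z (d1 z) (d2 z) s) = dir1 l (d1 z) (d2 z) s /\
    d2 (cir l z (d1 z) (d2 z) s) = dir2 l (d1 z) (d2 z) s.

Lemma oB : open B. Proof. exact: ball_open. Qed.
Lemma Bz0 : B z0. Proof. exact: ballxx. Qed.
Lemma ballE (x y : V2) t : ball x t y = (`|x - y| < t) :> Prop.
Proof. by rewrite -ball_normE. Qed.

Lemma vn2 z : vn z ^+ 2 = f1 z ^+ 2 + f2 z ^+ 2.
Proof. by rewrite sqr_sqrtr// addr_ge0// sqr_ge0. Qed.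

Lemma vn_gt0 z : B z -> z != z0 -> 0 < vn z.
Proof. by move=> Bz zz0; rewrite sqrtr_gt0 fn0. Qed.

Lemma vnd z : B z -> z != z0 -> vn z * d1 z = f2 z /\ vn z * d2 z = - f1 z.
Proof.
move=> Bz zz0; have v0 := lt0r_neq0 (vn_gt0 Bz zz0).
by rewrite /d1 /d2 !(mulrCA (vn z)) divff// !mulr1.
Qed.

Lemma d_unit z : B z -> z != z0 -> d1 z ^+ 2 + d2 z ^+ 2 = 1.
Proof.
move=> Bz zz0; have v0 := lt0r_neq0 (vn_gt0 Bz zz0).
by rewrite /d1 /d2 !expr_div_n sqrrN -mulrDl addrC -vn2 divff// expf_neq0.
Qed.

Lemma cir_drv2 z a b s : drv2 (cir l z a b) s (dir1 l a b s) (dir2 l a b s).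
Proof.
split.
- apply: (@drv_ext _ (fun r => c1 z + cx l a b r)) => [x|]; first by rewrite /= c1_vec2.
  by apply: drv_eq (drvD (drv_cst _ _) (drv_cx l0 a b s)) _; rewrite add0r.
- apply: (@drv_ext _ (fun r => c2 z + cy l a b r)) => [x|]; first by rewrite /= c2_vec2.
  by apply: drv_eq (drvD (drv_cst _ _) (drv_cy l0 a b s)) _; rewrite add0r.
Qed.

Lemma cir_cont z a b s : {for s, continuous (cir l z a b)}.
Proof. exact: drv2_cont (cir_drv2 z a b s). Qed.

Lemma neq_nbhs (z : V2) : z != z0 -> \forall z' \near z, z' != z0.
Proof.
move=> zz0; apply/nbhs_ballP; exists `|z - z0|; first by rewrite /= normr_gt0 subr_eq0.
by move=> z'; rewrite ballE; apply: contraTneq => ->; rewrite ltxx.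
Qed.

Lemma cir_near z a b s : B (cir l z a b s) -> cir l z a b s != z0 ->
  exists2 e, 0 < e & forall x, `|s - x| < e -> B (cir l z a b x) /\ cir l z a b x != z0.
Proof.
move=> Bs s0; have cc := @cir_cont z a b s.
have : \forall x \near s, B (cir l z a b x) /\ cir l z a b x != z0.
  exact: filterI (near_continuous cc (open_nbhs_nbhs (conj oB Bs))) (near_continuous cc (neq_nbhs s0)).
by move=> /nbhs_ballP[e /= e0 He]; exists e => // x sx; exact: He.
Qed.

Lemma pde z : B z -> a11 z * f2 z ^+ 2 - (a12 z + a21 z) * (f1 z * f2 z) + a22 z * f1 z ^+ 2 =
  2 * l * vn z ^+ 3.
Proof.
move=> Bz; have [->|zz0] := eqVneq z z0.
  by rewrite /vn f10 f20 !expr0n /= !mulr0 !addr0 subrr sqrtr0 expr0n mulr0.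
have du := d_unit Bz zz0.
set a := d1 z in du *; set b := d2 z in du *.
have z0E : cir l z a b 0 = z by rewrite cir0.
have [||e e0 He] := @cir_near z a b 0; rewrite ?z0E//.
have O s : `|s| < e -> d1 (cir l z a b s) = dir1 l a b s /\ d2 (cir l z a b s) = dir2 l a b s.
  move=> se; apply: (@orbit z (- `|s|) `|s|) => //; last by rewrite -ler_norml.
    by rewrite oppr_le0 normr_ge0.
  by move=> x; rewrite -ler_norml => xs; apply: He; rewrite sub0r normrN (le_lt_trans xs).
pose g s := f1 (cir l z a b s) * dir1 l a b s + f2 (cir l z a b s) * dir2 l a b s.
have g0 : \forall s \near 0, g s = 0.
  apply/nbhs_ballP; exists e => //= s; rewrite /ball /= sub0r normrN => se.
  have [h1 h2] := O s se; have [Bs ss0] := He s ltac:(by rewrite sub0r normrN).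
  have [v1 v2] := vnd Bs ss0.
  by rewrite /g -h1 -h2 -v1 -[f1 _]opprK -v2; ring.
have D0 : drv g 0 0 by apply: drv_near (drv_cst 0 0); apply: filterS g0 => s ->.
have Bz0' : B (cir l z a b 0) by rewrite z0E.
have D1 := drvD (drvM (C1_chain f1C Bz0' (cir_drv2 z a b 0)) (drv_dir1 l a b 0))
  (drvM (C1_chain f2C Bz0' (cir_drv2 z a b 0)) (drv_dir2 l a b 0)).
have := drv_unique D0 D1; have [-> ->] := dir0 l a b; rewrite /= z0E.
have [v1 v2] := vnd Bz zz0; rewrite -/a -/b in v1 v2.
have {}v2 : f1 z = - (vn z * b) by rewrite v2 opprK.
rewrite v2 -v1 => E.
transitivity (vn z ^+ 2 * (a11 z * a ^+ 2 + (a12 z + a21 z) * a * b + a22 z * b ^+ 2)); first ring.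
transitivity (vn z ^+ 2 * (2 * l * vn z)); last ring.
congr (_ * _).
transitivity (2 * l * vn z * (a ^+ 2 + b ^+ 2)); last by rewrite du mulr1.
by apply/eqP; rewrite -subr_eq0 [X in _ == X]E; apply/eqP; ring.
Qed.

Lemma slope_cvg (f : R -> R) w : drv f 0 w -> f 0 = 0 -> f h / h @[h --> 0^'] --> w.
Proof.
move=> [fd <-] f0; move: fd; rewrite /derive /derivable.
have -> : (fun h : R => h^-1 *: ((f \o shift 0) (h *: (1 : R)) - f 0)) = (fun h => f h / h).
  apply/funext => h; have -> : h *: (1 : R) = h by exact: mulr1.
  by rewrite /= addr0 f0 subr0 mulrC.
by [].
Qed.

(** Blow-up: [pde] on the line through [z0] is divided by [h ^+ 2]. Its right side is cubic in the
    field and disappears in the limit, while the field divided by [h] tends to [(w1, w2)]. *)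
Lemma jacobian_form v1 v2 : let w1 := a11 z0 * v1 + a12 z0 * v2 in
  let w2 := a21 z0 * v1 + a22 z0 * v2 in
  a11 z0 * w2 ^+ 2 - (a12 z0 + a21 z0) * (w1 * w2) + a22 z0 * w1 ^+ 2 = 0.
Proof.
move=> w1 w2; pose y t := z0 + t *: vec2 v1 v2.
have y0 : y 0 = z0 by rewrite /y scale0r addr0.
have Dy s : drv2 y s v1 v2.
  by have := drv2_line z0 (vec2 v1 v2) s; rewrite c1_vec2 c2_vec2.
have By0 : B (y 0) by rewrite y0; exact: Bz0.
have D1 : drv (f1 \o y) 0 w1 by have := C1_chain f1C By0 (Dy 0); rewrite y0.
have D2 : drv (f2 \o y) 0 w2 by have := C1_chain f2C By0 (Dy 0); rewrite y0.
have S1 := slope_cvg D1 (ltac:(by rewrite /= y0 f10)).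
have S2 := slope_cvg D2 (ltac:(by rewrite /= y0 f20)).
have yc : {for 0, continuous y} by exact: drv2_cont (Dy 0).
have cv (a : V2 -> R) : {for z0, continuous a} -> a (y h) @[h --> 0^'] --> a z0.
  move=> ac; have ac' : {for y 0, continuous a} by rewrite y0.
  have := continuous_comp yc ac'; rewrite /prop_for /continuous_at /= y0 => c.
  by apply: cvg_trans c; apply: cvg_app; exact: cvg_within.
have A11 := cv _ (C1_cont1 f1C Bz0); have A12 := cv _ (C1_cont2 f1C Bz0).
have A21 := cv _ (C1_cont1 f2C Bz0); have A22 := cv _ (C1_cont2 f2C Bz0).
have vc : {for z0, continuous vn}.
  apply: (@continuous_comp _ _ _ (fun z => f1 z ^+ 2 + f2 z ^+ 2) Num.sqrt); last exact: sqrt_continuous.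
  by apply: continuousD; [apply: (@continuousM _ _ f1 f1)|apply: (@continuousM _ _ f2 f2)];
    by [exact: (C1_cont f1C Bz0)|exact: (C1_cont f2C Bz0)].
have VC := cv _ vc.
have vn0 : vn z0 = 0 by rewrite /vn f10 f20 expr0n addr0 sqrtr0.
rewrite vn0 in VC.
have cM (f g : R -> R) (a b : R) : f h @[h --> 0^'] --> a -> g h @[h --> 0^'] --> b ->
    f h * g h @[h --> 0^'] --> a * b by move=> fa gb; exact: cvgM.
have cD (f g : R -> R) (a b : R) : f h @[h --> 0^'] --> a -> g h @[h --> 0^'] --> b ->
    f h + g h @[h --> 0^'] --> a + b by move=> fa gb; exact: cvgD.
have cB (f g : R -> R) (a b : R) : f h @[h --> 0^'] --> a -> g h @[h --> 0^'] --> b ->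
    f h - g h @[h --> 0^'] --> a - b by move=> fa gb; exact: cvgB.
have S22 := cM _ _ _ _ S2 S2; have S11 := cM _ _ _ _ S1 S1; have S12 := cM _ _ _ _ S1 S2.
have L := cD _ _ _ _ (cB _ _ _ _ (cM _ _ _ _ A11 S22) (cM _ _ _ _ (cD _ _ _ _ A12 A21) S12)) (cM _ _ _ _ A22 S11).
have cc := cv (fun=> 2 * l) (@cst_continuous _ _ (2 * l) z0).
have Rt := cM _ _ _ _ (cM _ _ _ _ cc VC) (cD _ _ _ _ S11 S22).
have nB : \forall h \near 0^', B (y h) /\ h != 0.
  have n1 : \forall h \near 0^', B (y h).
    by apply: cvg_within; exact: near_continuous yc (open_nbhs_nbhs (conj oB By0)).
  by near=> h; split; [near: h|near: h; exact: nbhs_dnbhs_neq].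
have E : \forall h \near 0^', (2 * l * vn (y h)) * ((f1 \o y) h / h * ((f1 \o y) h / h) + (f2 \o y) h / h * ((f2 \o y) h / h)) =
   a11 (y h) * ((f2 \o y) h / h * ((f2 \o y) h / h)) - (a12 (y h) + a21 (y h)) * ((f1 \o y) h / h * ((f2 \o y) h / h))
   + a22 (y h) * ((f1 \o y) h / h * ((f1 \o y) h / h)).
  apply: filterS nB => h [Bh h0]; have P := pde Bh; rewrite /=.
  transitivity ((2 * l * vn (y h) ^+ 3) / h ^+ 2).
    by rewrite exprS vn2; field.
  by rewrite -P; field.
have {}Rt : (fun h => a11 (y h) * ((f2 \o y) h / h * ((f2 \o y) h / h)) - (a12 (y h) + a21 (y h)) * ((f1 \o y) h / h * ((f2 \o y) h / h))
   + a22 (y h) * ((f1 \o y) h / h * ((f1 \o y) h / h))) h @[h --> 0^'] --> 2 * l * 0 * (w1 * w1 + w2 * w2).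
  by apply: cvg_trans Rt; apply: near_eq_cvg; apply: filterS E => h.
have := cvg_unique _ L Rt.
rewrite mulr0 mul0r -!expr2 => <-.
by [].
Unshelve. all: by end_near. Qed.

(** The mixed second difference [D] of [u] over a small square is computed in both orders by mean
    values. The 2 reflects the bracket [[X, Y] = - 2 T]. *)
Lemma schwarz : a21 z0 - a12 z0 = 2.
Proof.
have c1r : {for z0, continuous a12} := C1_cont2 f1C Bz0.
have c2r : {for z0, continuous a21} := C1_cont1 f2C Bz0.
apply/eqP; rewrite -subr_eq0 -normr_le0; apply/ler_addgt0Pl => e e0; rewrite addr0.
have e20 : 0 < e / 2 by rewrite divr_gt0.
have /cvgrPdist_le/(_ _ e20)/nbhs_ballP[s1 /= s10 H1] := c1r.
have /cvgrPdist_le/(_ _ e20)/nbhs_ballP[s2 /= s20 H2] := c2r.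
pose m := Num.min r (Num.min s1 s2).
have m0 : 0 < m by rewrite !lt_min r0 s10.
pose h := m / 2; have h0 : 0 < h by rewrite divr_gt0.
have hm : h < m by rewrite /h; lra.
pose w x y := z0 + vec2 x y.
have wB x y : 0 <= x <= h -> 0 <= y <= h -> [/\ B (w x y), ball z0 s1 (w x y) & ball z0 s2 (w x y)].
  move=> /andP[x0 xh] /andP[y0 yh].
  have N : `|z0 - w x y| <= h.
    rewrite /w opprD addrA subrr add0r normrN.
    by apply: norm2_le; rewrite (c1_vec2, c2_vec2) ger0_norm.
  have : `|z0 - w x y| < m by exact: le_lt_trans N hm.
  by rewrite /B !ballE !lt_min => /and3P[].
have w1 y s : drv2 (fun x => w x y) s 1 0.
  split.
  - apply: (@drv_ext _ (fun x => c1 z0 + x)) => [t|]; first by rewrite /= /w c1D c1_vec2.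
    by apply: drv_eq (drvD (drv_cst _ _) (drv_id _)) _; rewrite add0r.
  - apply: (@drv_ext _ (fun x => c2 z0 + y)) => [t|]; first by rewrite /= /w c2D c2_vec2.
    exact: drv_cst.
have w2 x s : drv2 (fun y => w x y) s 0 1.
  split.
  - apply: (@drv_ext _ (fun y => c1 z0 + x)) => [t|]; first by rewrite /= /w c1D c1_vec2.
    exact: drv_cst.
  - apply: (@drv_ext _ (fun y => c2 z0 + y)) => [t|]; first by rewrite /= /w c2D c2_vec2.
    by apply: drv_eq (drvD (drv_cst _ _) (drv_id _)) _; rewrite add0r.
have hh : 0 <= h <= h by rewrite lexx ltW.
have h00 : 0 <= (0 : R) <= h by rewrite lexx ltW.
pose D := u (w h h) - u (w h 0) - (u (w 0 h) - u (w 0 0)).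
have E1 : exists x y, [/\ 0 <= x <= h, 0 <= y <= h & D = h * h * (1 + a12 (w x y))].
  have [|x /andP[x0 xh]] := @drv_MVT _ (fun x => u (w x h) - u (w x 0))
      (fun x => t1 (w x h) - t1 (w x 0)) 0 h h0.
    move=> x xh; have [Bh _ _] := wB x h xh hh; have [B0 _ _] := wB x 0 xh h00.
    refine (drv_eq (drvB (C1_chain uC (y := fun x => w x h) Bh (w1 h x))
      (C1_chain uC (y := fun x => w x 0) B0 (w1 0 x))) _); ring.
  have xr : 0 <= x <= h by rewrite !ltW.
  have [Bh _ _] := wB x h xr hh; have [B0 _ _] := wB x 0 xr h00.
  have [|y /andP[y0 yh]] := @drv_MVT _ (fun y => f1 (w x y)) (fun y => a12 (w x y)) 0 h h0.
    move=> y yh; have [By _ _] := wB x y xr yh.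
    refine (drv_eq (C1_chain f1C (y := fun y => w x y) By (w2 x y)) _); ring.
  rewrite !subr0 => fE uE; exists x, y; split=> //; first by rewrite !ltW.
  rewrite /D uE !t1E// [f1 (w x h)](_ : _ = f1 (w x 0) + a12 (w x y) * h); last by rewrite -fE subrKC.
  by rewrite /w !c2D !c2_vec2; ring.
have E2 : exists x y, [/\ 0 <= x <= h, 0 <= y <= h & D = h * h * (- 1 + a21 (w x y))].
  have [|y /andP[y0 yh]] := @drv_MVT _ (fun y => u (w h y) - u (w 0 y))
      (fun y => t2 (w h y) - t2 (w 0 y)) 0 h h0.
    move=> y yh; have [Bh _ _] := wB h y hh yh; have [B0 _ _] := wB 0 y h00 yh.
    refine (drv_eq (drvB (C1_chain uC (y := fun y => w h y) Bh (w2 h y))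
      (C1_chain uC (y := fun y => w 0 y) B0 (w2 0 y))) _); ring.
  have yr : 0 <= y <= h by rewrite !ltW.
  have [Bh _ _] := wB h y hh yr; have [B0 _ _] := wB 0 y h00 yr.
  have [|x /andP[x0 xh]] := @drv_MVT _ (fun x => f2 (w x y)) (fun x => a21 (w x y)) 0 h h0.
    move=> x xh; have [By _ _] := wB x y xh yr.
    refine (drv_eq (C1_chain f2C (y := fun x => w x y) By (w1 y x)) _); ring.
  rewrite !subr0 => fE uE; exists x, y; split=> //; first by rewrite !ltW.
  have -> : D = u (w h h) - u (w 0 h) - (u (w h 0) - u (w 0 0)) by rewrite /D; ring.
  rewrite uE !t2E// [f2 (w h y)](_ : _ = f2 (w 0 y) + a21 (w x y) * h); last by rewrite -fE subrKC.
  by rewrite /w !c1D !c1_vec2; ring.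
have [x [y [xr yr D1]]] := E1; have [x' [y' [xr' yr' D2]]] := E2.
have [_ b1 _] := wB x y xr yr; have [_ _ b2] := wB x' y' xr' yr'.
have := H1 _ b1; have := H2 _ b2; move: D1; rewrite D2 => /(mulfI (lt0r_neq0 (mulr_gt0 h0 h0))) E G2 G1.
have -> : a21 z0 - a12 z0 - 2 = (a21 z0 - a21 (w x' y')) - (a12 z0 - a12 (w x y)).
  have -> : a21 (w x' y') = 2 + a12 (w x y) by lra.
  by ring.
apply: le_trans (ler_normB _ _) _; rewrite [leRHS]splitr.
exact: lerD G2 G1.
Qed.

(** The relation [a21 - a12 = 2] excludes the zero matrix, so a singular differential is a column
    [w] times a row [x]. The relation then says that the kernel vector [(- x2, x1)] has component 2
    along [w]. *)
Lemma rank_one_form : a11 z0 * a22 z0 - a12 z0 * a21 z0 = 0 ->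
  exists w1 w2 x1 x2, [/\ w1 ^+ 2 + w2 ^+ 2 = 1, w2 * x1 - w1 * x2 = 2,
    a11 z0 = w1 * x1 /\ a12 z0 = w1 * x2 & a21 z0 = w2 * x1 /\ a22 z0 = w2 * x2].
Proof.
have := schwarz; move: (a11 z0) (a12 z0) (a21 z0) (a22 z0) => a b c d cb dt.
have nrm (x y : R) : x ^+ 2 + y ^+ 2 != 0 -> let m := Num.sqrt (x ^+ 2 + y ^+ 2) in
    [/\ m != 0, m ^+ 2 = x ^+ 2 + y ^+ 2 & (x / m) ^+ 2 + (y / m) ^+ 2 = 1].
  move=> xy m; have xy0 : 0 <= x ^+ 2 + y ^+ 2 by rewrite addr_ge0// sqr_ge0.
  have m2 : m ^+ 2 = x ^+ 2 + y ^+ 2 by rewrite sqr_sqrtr.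
  have m0 : m != 0 by rewrite -sqrf_eq0 m2.
  by split=> //; rewrite !expr_div_n -mulrDl -m2 divff// sqrf_eq0.
have [E|ac] := eqVneq (a ^+ 2 + c ^+ 2) 0.
  have : a ^+ 2 + c ^+ 2 == 0 by rewrite E.
  rewrite paddr_eq0 ?sqr_ge0// !sqrf_eq0 => /andP[/eqP a0 /eqP c0].
  have b2 : b = - 2 by lra.
  have bd : b ^+ 2 + d ^+ 2 != 0.
    by rewrite gt_eqF// ltr_pwDl ?sqr_ge0// b2 sqrrN expr2 mulr_gt0.
  have [m0 m2 w1] := nrm _ _ bd; set m := Num.sqrt _ in m0 m2 w1.
  exists (b / m), (d / m), 0, m; rewrite a0 c0; split=> //.
  - by rewrite mulr0 sub0r divfK// b2 opprK.
  - by rewrite mulr0 divfK.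
  - by rewrite mulr0 divfK.
have [m0 m2 w1] := nrm _ _ ac; set m := Num.sqrt _ in m0 m2 w1.
pose k := (a * b + c * d) / m ^+ 2.
have m20 : m ^+ 2 != 0 by rewrite sqrf_eq0.
have kb : k * a = b.
  apply: (mulIf m20); rewrite /k mulrAC divfK// m2.
  transitivity (a * a * b + c * (a * d)); first ring.
  have -> : a * d = b * c by lra.
  by ring.
have kd : k * c = d.
  apply: (mulIf m20); rewrite /k mulrAC divfK// m2.
  transitivity (a * (b * c) + c * c * d); first ring.
  have -> : b * c = a * d by lra.
  by ring.
exists (a / m), (c / m), m, (k * m); split=> //.
- rewrite divfK// mulrA [a / m * k]mulrC mulrA mulfVK// kb; lra.
- by rewrite divfK// mulrA [a / m * k]mulrC mulrA divfK// kb.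
- by rewrite divfK// mulrA [c / m * k]mulrC mulrA divfK// kd.
Qed.

Ltac clr := clear - R l r z0 f1 f2 a11 a12 a21 a22 u t1 t2 B l0 r0 f1C f2C uC t1E t2E f10 f20 fn0 orbit.

(** The equation [y + k * (x ^+ 2 + y ^+ 2) = 0] describes a circle tangent to the axis [y = 0] at
    the origin. At the scale [rho] it is so flat that [y] alone decides the side. *)
Lemma side_gt0 (rho k x y : R) : 0 < rho -> `|k| * rho <= 1000^-1 -> `|x| <= 2 * rho ->
  rho / 5 <= y <= 3 * rho -> 0 < y + k * (x ^+ 2 + y ^+ 2).
Proof.
move=> rho0 kr xr /andP[y1 y2].
have q0 : 0 <= x ^+ 2 + y ^+ 2 by rewrite addr_ge0// sqr_ge0.
have q1 : x ^+ 2 + y ^+ 2 <= 13 * rho * rho.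
  have -> : 13 * rho * rho = (2 * rho) ^+ 2 + (3 * rho) ^+ 2 by ring.
  have yr : `|y| <= 3 * rho by rewrite ger0_norm//; lra.
  by apply: lerD; rewrite -[leLHS]real_normK ?num_real// ler_pXn2r// ?nnegrE// mulr_ge0// ltW.
have : `|k * (x ^+ 2 + y ^+ 2)| <= 13 * rho * 1000^-1.
  rewrite normrM (ger0_norm q0) (le_trans (ler_wpM2l (normr_ge0 _) q1))//.
  have -> : `|k| * (13 * rho * rho) = 13 * rho * (`|k| * rho) by ring.
  by rewrite ler_wpM2l// mulr_ge0// ltW.
rewrite ler_norml => /andP[h _]; lra.
Qed.

(** The difference of the two equations factors, and the factor [1 + k * (y + y')] is positive. *)
Lemma side_inj (rho k x y y' : R) : `|k| * rho <= 1000^-1 ->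
  `|y| <= 3 * rho -> `|y'| <= 3 * rho ->
  y + k * (x ^+ 2 + y ^+ 2) = 0 -> y' + k * (x ^+ 2 + y' ^+ 2) = 0 -> y = y'.
Proof.
move=> kr yr yr' e e'.
have /eqP : (y - y') * (1 + k * (y + y')) = 0.
  transitivity (y + k * (x ^+ 2 + y ^+ 2) - (y' + k * (x ^+ 2 + y' ^+ 2))); first ring.
  by rewrite e e' subrr.
rewrite mulf_eq0 subr_eq0 => /orP[/eqP//|/eqP h].
have : `|k * (y + y')| <= 6 * 1000^-1.
  rewrite normrM (@le_trans _ _ (`|k| * (3 * rho + 3 * rho)))//.
    by rewrite ler_wpM2l// (le_trans (ler_normD _ _))// lerD.
  have -> : `|k| * (3 * rho + 3 * rho) = 6 * (`|k| * rho) by ring.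
  by rewrite ler_wpM2l.
rewrite ler_norml => /andP[h1 _]; lra.
Qed.

(* If the linear part of [(f1, f2)] at [z0] had rank one, with range spanned by
   [w], some integral circle would run in the direction [w] close to its kernel
   and meet transversally a circle coming from outside the kernel. *)
Lemma rank_one_false : a11 z0 * a22 z0 - a12 z0 * a21 z0 != 0.
Proof.
apply/negP => /eqP /rank_one_form [w1 [w2 [x1 [x2 [wu wx [A11 A12] [A21 A22]]]]]].
have [w1l w2l] := unit_le1 wu.
set L := `|l|; have L0 : 0 <= L by exact: normr_ge0.
(* [K] bounds the rescaled points used below, so that with this [e] the linear approximation of each
   component errs by at most [rho / 100]. The last bound on [rho] makes [L * rho] at most 1/1000: at
   this scale the circles are almost straight. *)
pose K := `|x1| + `|x2| + 5; have K0 : 0 < K by rewrite ltr_wpDl// addr_ge0.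
pose e := (100 * K)^-1; have e0 : 0 < e by rewrite invr_gt0 mulr_gt0.
have F1 := C1_frechet oB Bz0 f1C e0; have F2 := C1_frechet oB Bz0 f2C e0.
have : \forall v \near (0 : V2),
    `|f1 (z0 + v) - f1 z0 - (a11 z0 * c1 v + a12 z0 * c2 v)| <= e * `|v| /\
    `|f2 (z0 + v) - f2 z0 - (a21 z0 * c1 v + a22 z0 * c2 v)| <= e * `|v| by exact: filterI F1 F2.
move=> /nbhs_ballP[dl /= dl0 Hdl].
pose rho := Num.min (dl / (2 * K)) (Num.min (r / (2 * K)) (1000 * (L + 1))^-1).
have K20 : 0 < 2 * K by rewrite mulr_gt0.
have rho0 : 0 < rho.
  have rho1 : 0 < dl / (2 * K) by exact: (divr_gt0 dl0 K20).
  have rho2 : 0 < r / (2 * K) by exact: (divr_gt0 r0 K20).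
  have rho3 : 0 < (1000 * (L + 1))^-1.
    have L1 : 0 < L + 1 by exact: (ltr_wpDl L0 ltr01).
    have M0 : 0 < 1000 * (L + 1) by apply: mulr_gt0 L1; rewrite ltr0n.
    by rewrite invr_gt0.
  by rewrite /rho lt_min rho1 lt_min rho2 rho3.
have [rd rr rL] : [/\ rho <= dl / (2 * K), rho <= r / (2 * K) & rho <= (1000 * (L + 1))^-1].
  by rewrite /rho !ge_min !lexx ?orbT.
have rdK : rho * K < dl.
  by apply: (@le_lt_trans _ _ (dl / 2)); [rewrite -ler_pdivlMr// -mulrA -invfM|lra].
have rrK : rho * K < r.
  have r20 : 0 < r / 2 by exact: divr_gt0.
  by apply: (@le_lt_trans _ _ (r / 2)); [rewrite -ler_pdivlMr// -mulrA -invfM|lra].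
have Lrho : L * rho <= 1000^-1.
  apply: (@le_trans _ _ ((L + 1) * rho)); first by rewrite mulrDl mul1r lerDl ltW.
  by rewrite mulrC -ler_pdivlMr ?ltr_wpDl// -invfM.
(* Components along [w] and along its quarter turn [(- w2, w1)]: of the field, of the orthogonal
   unit field, and of the position. *)
pose Gw z := f1 z * w1 + f2 z * w2; pose Gi z := - (f1 z * w2) + f2 z * w1.
pose Dw z := d1 z * w1 + d2 z * w2; pose Di z := - (d1 z * w2) + d2 z * w1.
pose X z := (c1 z - c1 z0) * w1 + (c2 z - c2 z0) * w2.
pose Y z := - ((c1 z - c1 z0) * w2) + (c2 z - c2 z0) * w1.
have XYeq z z' : X z = X z' -> Y z = Y z' -> z = z'.
  rewrite /X /Y => hX hY; apply: rV2P; apply/eqP; rewrite -subr_eq0; apply/eqP.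
  - transitivity ((w1 ^+ 2 + w2 ^+ 2) * (c1 z - c1 z')); first by rewrite wu mul1r.
    transitivity (w1 * (((c1 z - c1 z0) * w1 + (c2 z - c2 z0) * w2) - ((c1 z' - c1 z0) * w1 + (c2 z' - c2 z0) * w2))
      - w2 * ((- ((c1 z - c1 z0) * w2) + (c2 z - c2 z0) * w1) - (- ((c1 z' - c1 z0) * w2) + (c2 z' - c2 z0) * w1))); first ring.
    by rewrite hX hY !subrr !mulr0 subrr.
  - transitivity ((w1 ^+ 2 + w2 ^+ 2) * (c2 z - c2 z')); first by rewrite wu mul1r.
    transitivity (w2 * (((c1 z - c1 z0) * w1 + (c2 z - c2 z0) * w2) - ((c1 z' - c1 z0) * w1 + (c2 z' - c2 z0) * w2))
      + w1 * ((- ((c1 z - c1 z0) * w2) + (c2 z - c2 z0) * w1) - (- ((c1 z' - c1 z0) * w2) + (c2 z' - c2 z0) * w1))); first ring.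
    by rewrite hX hY !subrr !mulr0 addr0.
have X0 : X z0 = 0 by rewrite /X !subrr !mul0r addr0.
have Xne z : 0 < X z -> z != z0 by apply: contraTneq => ->; rewrite X0 ltxx.
have comb (x y c : R) : `|x| <= c -> `|y| <= c -> `|x * w1 + y * w2| <= 2 * c /\ `|- (x * w2) + y * w1| <= 2 * c.
  move=> xc yc; have c0 : 0 <= c by exact: le_trans xc.
  have M a b : `|a| <= c -> `|b| <= 1 -> `|a * b| <= c.
    by move=> ac b1; rewrite normrM -[leRHS]mulr1 ler_pM.
  split; rewrite (le_trans (ler_normD _ _))// ?normrN mulr2n mulrDl mul1r lerD// ; exact: M.
have Bsup z : `|z - z0| <= rho * K -> B z.
  by move=> zK; rewrite /B ballE distrC (le_lt_trans zK).
have GE (y : V2) : `|y| <= K -> let z := z0 + rho *: y in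
    `|Gw z - rho * (x1 * c1 y + x2 * c2 y)| <= rho / 50 /\ `|Gi z| <= rho / 50.
  move=> yK z; have vE : `|rho *: y| = rho * `|y| by rewrite normrZ gtr0_norm.
  have vK : `|rho *: y| <= rho * K by rewrite vE ler_wpM2l// ltW.
  have [|g1 g2] := Hdl (rho *: y); first by rewrite -ball_normE /= sub0r normrN (le_lt_trans vK).
  move: g1 g2; rewrite f10 f20 !subr0 A11 A12 A21 A22 c1Z c2Z -/z => g1 g2.
  have eK : e * `|rho *: y| <= rho / 100.
    apply: (le_trans (ler_wpM2l (ltW e0) vK)).
    by rewrite /e le_eqVlt; apply/orP; left; apply/eqP; field; rewrite gt_eqF.
  have [h1 h2] := comb _ _ _ (le_trans g1 eK) (le_trans g2 eK).
  have E2 : 2 * (rho / 100) = rho / 50 by field.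
  rewrite E2 in h1 h2; split.
  - rewrite (_ : Gw z - _ = (f1 z - (w1 * x1 * (rho * c1 y) + w1 * x2 * (rho * c2 y))) * w1 +
      (f2 z - (w2 * x1 * (rho * c1 y) + w2 * x2 * (rho * c2 y))) * w2)//.
    transitivity (Gw z - (w1 ^+ 2 + w2 ^+ 2) * (rho * (x1 * c1 y + x2 * c2 y))); first by rewrite wu mul1r.
    by rewrite /Gw; ring.
  - rewrite (_ : Gi z = - ((f1 z - (w1 * x1 * (rho * c1 y) + w1 * x2 * (rho * c2 y))) * w2) +
      (f2 z - (w2 * x1 * (rho * c1 y) + w2 * x2 * (rho * c2 y))) * w1)//.
    by rewrite /Gi; ring.
have GD z : B z -> z != z0 -> [/\ vn z * Dw z = Gi z, vn z * Di z = - Gw z & Dw z ^+ 2 + Di z ^+ 2 = 1].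
  move=> Bz zz0; have [v1 v2] := vnd Bz zz0; have du := d_unit Bz zz0.
  split.
  - rewrite /Dw /Gi -v1 -[f1 z]opprK -v2; ring.
  - rewrite /Di /Gw -v1 -[f1 z]opprK -v2; ring.
  - transitivity ((d1 z ^+ 2 + d2 z ^+ 2) * (w1 ^+ 2 + w2 ^+ 2)); first by rewrite /Dw /Di; ring.
    by rewrite du wu mulr1.
pose ga z s := cir l z (d1 z) (d2 z) s.
have gaE z s : B z -> z != z0 -> [/\ `|X (ga z s) - X z - Dw z * s| <= 4 * (L * s ^+ 2),
    `|Y (ga z s) - Y z - Di z * s| <= 4 * (L * s ^+ 2) &
    `|ga z s - z| <= `|s| + 2 * (L * s ^+ 2)].
  move=> Bz zz0; have du := d_unit Bz zz0; have [dl1 dl2] := unit_le1 du.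
  have [a1 a2] := c_approx l0 s du; rewrite -!(mulrA 2 `|l|) -/L in a1 a2.
  have [b1 b2] := comb _ _ _ a1 a2; have E4 : 2 * (2 * (L * s ^+ 2)) = 4 * (L * s ^+ 2) by ring.
  rewrite E4 in b1 b2; split.
  - rewrite (_ : X _ - _ - _ = (cx l (d1 z) (d2 z) s - d1 z * s) * w1 + (cy l (d1 z) (d2 z) s - d2 z * s) * w2); first exact: b1.
    by rewrite /X /ga /cir c1_vec2 c2_vec2 /Dw; ring.
  - rewrite (_ : Y _ - _ - _ = - ((cx l (d1 z) (d2 z) s - d1 z * s) * w2) + (cy l (d1 z) (d2 z) s - d2 z * s) * w1); first exact: b2.
    by rewrite /Y /ga /cir c1_vec2 c2_vec2 /Di; ring.
  - have Q (c d : R) : `|c - d * s| <= 2 * (L * s ^+ 2) -> `|d| <= 1 -> `|c| <= `|s| + 2 * (L * s ^+ 2).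
      move=> h hd; rewrite -[c](subrK (d * s)) addrC (le_trans (ler_normD _ _))// lerD//.
      by rewrite normrM ler_piMl.
    apply: norm2_le; rewrite /ga /cir (c1B, c2B) (c1_vec2, c2_vec2) addrC addKr.
    + exact: Q a1 dl1.
    + exact: Q a2 dl2.
have gaC z s : {for s, continuous (ga z)} by exact: cir_cont.
have Xc (z : V2) : {for z, continuous X}.
  by apply: continuousD; apply: continuousM; (exact: cst_continuous || (apply: continuousB; [exact: coord_continuous|exact: cst_continuous])).
have Yc (z : V2) : {for z, continuous Y}.
  by apply: continuousD; [apply: continuousN|]; apply: continuousM; (exact: cst_continuous || (apply: continuousB; [exact: coord_continuous|exact: cst_continuous])).
have Ls s : `|s| <= 2 * rho -> L * s ^+ 2 <= rho / 250.
  move=> s2; have -> : s ^+ 2 = `|s| * `|s| by rewrite -expr2 real_normK ?num_real.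
  apply: (@le_trans _ _ (L * (2 * rho * (2 * rho)))); first by rewrite ler_wpM2l// ler_pM.
  have -> : L * (2 * rho * (2 * rho)) = 4 * rho * (L * rho) by ring.
  have -> : rho / 250 = 4 * rho * 1000^-1 by field.
  by rewrite ler_wpM2l// mulr_ge0// ltW.
(* The abscissa [X] stays positive on the arc, which keeps it away from [z0], so that [orbit]
   applies. *)
have gaO z c m : `|z - z0| <= rho * (K - 3) -> 0 < X z -> 0 <= m <= 2 * rho ->
    rho / 2 < X z - c * m -> `|Dw z| <= c ->
    forall s, - m <= s <= m -> [/\ Dw (ga z s) = dir1 l (d1 z) (d2 z) s * w1 + dir2 l (d1 z) (d2 z) s * w2,
      `|Dw (ga z s) - Dw z| <= 4 * (L * `|s|) & B (ga z s) /\ ga z s != z0].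
  move=> zK Xz /andP[m0 m2] cX Dc.
  have zz0 := Xne _ Xz; have Bz : B z by apply: Bsup; rewrite (le_trans zK)// ler_wpM2l ?(ltW rho0)// gerBl.
  have du := d_unit Bz zz0.
  have P s : - m <= s <= m -> B (ga z s) /\ ga z s != z0.
    rewrite -ler_norml => sm; have [g1 _ g3] := gaE z s Bz zz0.
    have sl := Ls s (le_trans sm m2); split.
    - apply: Bsup; rewrite -[_ - z0](subrKA z) (le_trans (ler_normD _ _))//.
      have -> : rho * K = 3 * rho + rho * (K - 3) by ring.
      apply: lerD => //; apply: (le_trans g3); move: sl sm m2 rho0; clr => sl sm m2 rho0; lra.
    - apply: Xne; have : `|Dw z * s| <= c * m by rewrite normrM ler_pM.
      move: g1; rewrite !ler_norml => /andP[g1 _] /andP[g2 _].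
      by move: g1 g2 cX sl rho0; clr; move=> g1 g2 cX sl rho0; lra.
  move=> s sm; have m0' : - m <= 0 <= m by rewrite oppr_le0 m0.
  have [h1 h2] := @orbit z _ _ Bz zz0 m0' P s sm.
  have E : Dw (ga z s) = dir1 l (d1 z) (d2 z) s * w1 + dir2 l (d1 z) (d2 z) s * w2 by rewrite /Dw h1 h2.
  split=> //; last exact: P.
  have [k1 k2] := dir_lipschitz l s du; rewrite -!(mulrA 2 `|l|) -/L in k1 k2.
  have [h _] := comb _ _ _ k1 k2; rewrite E.
  rewrite (_ : _ - Dw z = (dir1 l (d1 z) (d2 z) s - d1 z) * w1 + (dir2 l (d1 z) (d2 z) s - d2 z) * w2).
    by rewrite (_ : 4 * (L * `|s|) = 2 * (2 * (L * `|s|)))//; ring.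
  by rewrite /Dw; ring.
pose nu := x1 * w1 + x2 * w2.
(* The kernel vector [(- x2, x1)] moved by [t] perpendicularly to [w]: its components are 2 and
   [nu + t], and the linear form [x] takes the value [- 2 * t] on it. *)
pose yq t := vec2 (- x2 - t * w2) (x1 + t * w1).
have yqK t : `|t| <= 1 -> `|yq t| <= K - 4.
  move=> tt; have tw (a : R) : `|a| <= 1 -> `|t * a| <= 1 by move=> a1; rewrite normrM mulr_ile1.
  apply: norm2_le; rewrite (c1_vec2, c2_vec2); [apply: (le_trans (ler_normB _ _))|apply: (le_trans (ler_normD _ _))]; rewrite ?normrN.
  - have h1 := tw _ w2l; have h2 := normr_ge0 x1; rewrite /K; move: h1 h2; clr; move=> h1 h2; lra.
  - have h1 := tw _ w1l; have h2 := normr_ge0 x2; rewrite /K; move: h1 h2; clr; move=> h1 h2; lra.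
pose zq t := z0 + rho *: yq t.
have XYq t : X (zq t) = 2 * rho /\ Y (zq t) = rho * (nu + t).
  rewrite /X /Y /zq !c1D !c2D !c1Z !c2Z c1_vec2 c2_vec2; split.
  - transitivity (rho * (w2 * x1 - w1 * x2)); first ring.
    by rewrite wx mulrC.
  - transitivity (rho * (nu + t * (w1 ^+ 2 + w2 ^+ 2))); first by rewrite /nu; ring.
    by rewrite wu mulr1.
have xiq t : x1 * c1 (yq t) + x2 * c2 (yq t) = - 2 * t.
  rewrite c1_vec2 c2_vec2; transitivity (- (w2 * x1 - w1 * x2) * t); first ring.
  by rewrite wx.
(* [Gw] equals [- 2 * rho * t] up to [rho / 50], so it changes sign between -1/10 and 1/10. At its
   zero the orthogonal unit field is parallel to [w]. *)
have [t0 t0l Gq] : exists2 t, `|t| <= 10^-1 & Gw (zq t) = 0.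
  have ab : - 10^-1 <= 10^-1 :> R by rewrite ge0_cp// invr_ge0.
  have K3 : K - 4 <= K by rewrite gerBl.
  have gc : {within `[- 10^-1, 10^-1], continuous (fun t => Gw (zq t))}.
    apply: continuous_in_subspaceT => t; rewrite inE /= in_itv /= -ler_norml => tt.
    have tt' : `|t| <= 1 by move: tt; clr; move=> tt; lra.
    have Bt : B (zq t).
      apply: Bsup; rewrite /zq addrC addKr normrZ gtr0_norm// ler_wpM2l ?(ltW rho0)//.
      by apply: le_trans (yqK _ tt') _.
    have Dz : drv2 zq t (- (rho * w2)) (rho * w1).
      split.
      - apply: (@drv_ext _ (fun t => (c1 z0 - rho * x2) + (- (rho * w2)) * t)) => [x|].
          by rewrite /= c1D c1Z c1_vec2; ring.
        by apply: drv_eq (drvD (drv_cst _ _) (drvZ _ (drv_id _))) _; ring.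
      - apply: (@drv_ext _ (fun t => (c2 z0 + rho * x1) + (rho * w1) * t)) => [x|].
          by rewrite /= c2D c2Z c2_vec2; ring.
        by apply: drv_eq (drvD (drv_cst _ _) (drvZ _ (drv_id _))) _; ring.
    exact: drv_cont (drvD (drvM (C1_chain f1C (y := zq) Bt Dz) (drv_cst w1 _)) (drvM (C1_chain f2C (y := zq) Bt Dz) (drv_cst w2 _))).
  have S t : `|t| <= 1 -> `|Gw (zq t) + 2 * rho * t| <= rho / 50.
    move=> tt; have [g _] := GE (yq t) (le_trans (yqK t tt) K3).
    by move: g; rewrite xiq (_ : rho * (-2 * t) = - (2 * rho * t)) ?opprK//; ring.
  have [|t] := IVT ab gc (v := 0).
  - have h10 : `|10^-1| <= 1 :> R by rewrite ger0_norm ?invr_ge0// invf_le1// ler1n.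
    have h2 := S (- 10^-1) ltac:(by rewrite normrN); have h1 := S _ h10.
    move: h1 h2; rewrite !ler_norml => /andP[h1 h2] /andP[h3 h4].
    move: h1 h2 h3 h4 rho0; clr; move=> h1 h2 h3 h4 rho0.
    by rewrite ge_min le_max; apply/andP; split; apply/orP; [right|left]; lra.
  - by rewrite in_itv /= -ler_norml => tt Gt; exists t.
pose q := zq t0; have t0' : `|t0| <= 1 by move: t0l; clr; move=> t0l; lra.
have qK : `|q - z0| <= rho * (K - 4).
  by rewrite /q /zq addrC addKr normrZ gtr0_norm// ler_wpM2l ?(ltW rho0)// yqK.
have [Xq Yq] : X q = 2 * rho /\ Y q = rho * (nu + t0) by exact: XYq.
have Xq0 : 0 < X q by rewrite Xq mulr_gt0.
have qz0 := Xne _ Xq0.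
have K34 : rho * (K - 4) <= rho * (K - 3) by rewrite ler_wpM2l ?(ltW rho0)// lerB// ler_nat.
have K30 : rho * (K - 3) <= rho * K by rewrite ler_wpM2l ?(ltW rho0)// gerBl.
have Bq : B q by apply: Bsup; apply: le_trans qK (le_trans K34 K30).
have [Dwq Diq Duq] := GD q Bq qz0.
have vq := vn_gt0 Bq qz0.
have Di0 : Di q = 0.
  by apply/eqP; move/eqP: Diq; rewrite Gq oppr0 mulf_eq0 (gt_eqF vq).
have ep2 : Dw q ^+ 2 = 1 by rewrite -Duq Di0 expr0n addr0.
pose ep := Dw q; rewrite -/ep in Dwq ep2.
have epn : `|ep| = 1.
  apply/eqP; rewrite -(@eqrXn2 _ 2)// expr1n real_normK ?num_real//.
  by rewrite ep2.
have [dq1 dq2] : d1 q = ep * w1 /\ d2 q = ep * w2.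
  split.
  - transitivity (d1 q * (w1 ^+ 2 + w2 ^+ 2)); first by rewrite wu mulr1.
    transitivity (Dw q * w1 - Di q * w2); last by rewrite Di0 mul0r subr0.
    by rewrite /Dw /Di; ring.
  - transitivity (d2 q * (w1 ^+ 2 + w2 ^+ 2)); first by rewrite wu mulr1.
    transitivity (Dw q * w2 + Di q * w1); last by rewrite Di0 mul0r addr0.
    by rewrite /Dw /Di; ring.
pose k := ep * l.
have kr : `|k| * rho <= 1000^-1 by rewrite normrM epn mul1r.
(* The equation of the orbit circle of [q], in coordinates centred at [q] whose first axis is the
   tangent [w]. *)
pose Phi z := (Y z - Y q) + k * ((X z - X q) ^+ 2 + (Y z - Y q) ^+ 2).
have Phiq s : Phi (ga q s) = 0.
  have E1 : X (ga q s) - X q = ep * sin (2 * l * s) / (2 * l).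
    transitivity (ep * (w1 ^+ 2 + w2 ^+ 2) * sin (2 * l * s) / (2 * l)); last by rewrite wu mulr1.
    by rewrite /X /ga /cir c1_vec2 c2_vec2 /cx /cy dq1 dq2; field.
  have E2 : Y (ga q s) - Y q = - ep * (1 - cos (2 * l * s)) / (2 * l).
    transitivity (- ep * (w1 ^+ 2 + w2 ^+ 2) * (1 - cos (2 * l * s)) / (2 * l)); last by rewrite wu mulr1.
    by rewrite /Y /ga /cir c1_vec2 c2_vec2 /cx /cy dq1 dq2; field.
  have cs := cos2Dsin2 (2 * l * s).
  rewrite /Phi E1 E2 /k; move: (cos _) (sin _) cs => c_ s_ cs.
  transitivity (ep / (4 * l) * (ep ^+ 2 * (s_ ^+ 2 + (1 - c_) ^+ 2) - 2 * (1 - c_))); first by field.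
  rewrite ep2 mul1r; have -> : s_ ^+ 2 = 1 - c_ ^+ 2 by rewrite -cs addrC addKr.
  by ring.
(* At the point [z1] below, the linear form takes the value [nu - 2 * eta]. The sign of [eta] keeps
   it away from 0, so that the orbit of [z1] runs almost perpendicularly to [w]. *)
have [eta eta2 nue] : exists2 eta : R, `|eta| = 1 & 2 <= `|nu - 2 * eta|.
  have [n0|n0] := leP 0 nu; [exists (- 1); rewrite ?normrN ?normr1//|exists 1; rewrite ?normr1//].
    by rewrite ger0_norm; move: n0; clr; move=> n0; lra.
  by rewrite ler0_norm; move: n0; clr; move=> n0; lra.
pose y1 := yq eta + vec2 w1 w2; pose z1 := z0 + rho *: y1.
have y1K : `|y1| <= K - 3.
  have n1 : `|vec2 w1 w2| <= 1 by apply: norm2_le; rewrite (c1_vec2, c2_vec2).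
  have n2 : `|yq eta| <= K - 4 by apply: yqK; rewrite eta2.
  by apply: (le_trans (ler_normD _ _)); move: n1 n2; clr; move=> n1 n2; lra.
have z1K : `|z1 - z0| <= rho * (K - 3).
  by rewrite /z1 addrC addKr normrZ gtr0_norm// ler_wpM2l ?(ltW rho0).
have X1 : X z1 = 3 * rho.
  have [e1 _] := XYq eta; transitivity (X (zq eta) + rho * (w1 ^+ 2 + w2 ^+ 2)).
    by rewrite /X /z1 /zq /y1 !(c1D, c2D, c1Z, c2Z) c1_vec2 c2_vec2; ring.
  by rewrite e1 wu; ring.
have Y1 : Y z1 = rho * (nu + eta).
  have [_ <-] := XYq eta.
  by rewrite /Y /z1 /zq /y1 !(c1D, c2D, c1Z, c2Z) c1_vec2 c2_vec2; ring.
have X10 : 0 < X z1 by rewrite X1 mulr_gt0.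
have zz1 := Xne _ X10.
have B1 : B z1 by apply: Bsup; apply: le_trans z1K K30.
have K3' : K - 3 <= K by rewrite gerBl.
have [G1 G2] := GE y1 (le_trans y1K K3').
rewrite -/z1 in G1 G2.
have xi1 : x1 * c1 y1 + x2 * c2 y1 = nu - 2 * eta.
  transitivity (x1 * c1 (yq eta) + x2 * c2 (yq eta) + nu); last by rewrite xiq; ring.
  by rewrite /y1 c1D c2D [c1 (vec2 w1 w2)]c1_vec2 [c2 (vec2 w1 w2)]c2_vec2 /nu; ring.
have Gw1 : 198 / 100 * rho <= `|Gw z1|.
  have h : 2 * rho <= `|rho * (nu - 2 * eta)|.
    by rewrite normrM (gtr0_norm rho0) mulrC ler_wpM2l ?(ltW rho0).
  rewrite xi1 in G1.
  have := ler_normD (Gw z1) (- (Gw z1 - rho * (nu - 2 * eta))).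
  rewrite opprB addrC subrK [`|rho * _ - _|]distrC => h2.
  by move: h h2 G1; clr; move=> h h2 G1; lra.
have [Dw1 Di1 Du1] := GD z1 B1 zz1.
have v1 := vn_gt0 B1 zz1.
have Dile : `|Di z1| <= 1.
  by have [] := @unit_le1 _ (Dw z1) (Di z1) Du1.
have Gv : `|Gw z1| <= vn z1.
  by rewrite -[`|Gw _|]normrN -Di1 normrM (gtr0_norm v1) ler_piMr// ltW.
(* The quotient of [rho / 50] by [198 / 100 * rho] is 1/99. *)
have Dws : `|Dw z1| <= 90^-1.
  have h : vn z1 * `|Dw z1| <= rho / 50 by rewrite -[X in X * _](gtr0_norm v1) -normrM Dw1.
  have h2 : 198 / 100 * rho * `|Dw z1| <= rho / 50.
    apply: le_trans h; apply: ler_wpM2r => //; exact: le_trans Gv.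
  rewrite -(ler_pM2l rho0); move: h2 rho0; clr; move=> h2 rho0; lra.
have Dib : 9 / 10 <= `|Di z1|.
  have h : Dw z1 ^+ 2 <= 90^-1 ^+ 2.
    by rewrite -[Dw z1 ^+ 2]real_normK ?num_real// ler_pXn2r ?nnegrE.
  rewrite leNgt; apply/negP => h2.
  have : `|Di z1| ^+ 2 < (9 / 10) ^+ 2 by rewrite ltr_pXn2r// nnegrE.
  by rewrite real_normK ?num_real// => h3; move: h h3 Du1; clr; move=> h h3 Du1; lra.
have O1 := gaO z1 90^-1 (3 / 2 * rho) z1K X10 ltac:(move: rho0; clr; move=> rho0; apply/andP; split; lra)
   ltac:(rewrite X1; move: rho0; clr; move=> rho0; lra) Dws.
have Oq := gaO q 1 (5 / 4 * rho) (le_trans qK K34) Xq0 ltac:(move: rho0; clr; move=> rho0; apply/andP; split; lra)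
   ltac:(rewrite Xq; move: rho0; clr; move=> rho0; lra) ltac:(by rewrite -/ep epn).
have bd1 s : `|s| <= 3 / 2 * rho -> [/\ `|X (ga z1 s) - X q - rho| <= rho / 20,
    `|Y (ga z1 s) - Y q - (rho * (eta - t0) + Di z1 * s)| <= rho / 60 &
    `|Y (ga z1 s) - Y q| <= 3 * rho].
  move=> sr; have [g1 g2 _] := gaE z1 s B1 zz1.
  have ls := Ls s ltac:(move: sr rho0; clr; move=> sr rho0; lra).
  have ds : `|Dw z1 * s| <= 90^-1 * (3 / 2 * rho) by rewrite normrM ler_pM.
  have dis : `|Di z1 * s| <= 1 * (3 / 2 * rho) by rewrite normrM ler_pM.
  have et : `|rho * (eta - t0)| <= rho * (11 / 10).
    rewrite normrM (gtr0_norm rho0) ler_wpM2l ?(ltW rho0)// (le_trans (ler_normB _ _))// eta2.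
    by move: t0l; clr; move=> t0l; lra.
  rewrite X1 in g1; rewrite Y1 in g2; rewrite Xq Yq.
  move: g1 g2 ds dis et; move: (X _) (Y _) (Dw z1 * s) (Di z1 * s) => a b c d.
  have -> : b - rho * (nu + eta) - d = b - rho * (nu + t0) - (rho * (eta - t0) + d) by ring.
  move: (rho * (eta - t0)) (rho * (nu + t0)) => x y.
  rewrite !ler_norml => /andP[h1 h2] /andP[h3 h4] /andP[h5 h6] /andP[h7 h8] /andP[h9 h10].
  move: h1 h2 h3 h4 h5 h6 h7 h8 h9 h10 ls rho0; clr; move=> h1 h2 h3 h4 h5 h6 h7 h8 h9 h10 ls rho0.
  by split; apply/andP; split; lra.
have PhiC (z : V2) : {for z, continuous Phi}.
  have sub0 (f : V2 -> R) c : {for z, continuous f} -> {for z, continuous (fun z => f z - c)}.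
    by move=> fc; apply: continuousB => //; exact: cst_continuous.
  apply: continuousD; first exact: sub0.
  apply: continuousM; first exact: cst_continuous.
  by apply: continuousD; [apply: (@continuousM _ _ (fun z => X z - X q) (fun z => X z - X q))|
    apply: (@continuousM _ _ (fun z => Y z - Y q) (fun z => Y z - Y q))]; exact: sub0.
(* Within time [3 / 2 * rho] the orbit of [z1] moves by at least [27 / 20 * rho] in the direction of
   [Y], more than its initial distance to the ordinate of [q], at most [11 / 10 * rho]. Its two ends
   lie on opposite sides of the circle. *)
have et s : `|s| = 3 / 2 * rho -> (0 < Di z1 * s -> 0 < Phi (ga z1 s)) /\ (Di z1 * s < 0 -> Phi (ga z1 s) < 0).
  move=> sE; have [b1 b2 b3] := bd1 s ltac:(by rewrite sE).
  have dis : 27 / 20 * rho <= `|Di z1 * s|.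
    rewrite normrM sE; have -> : 27 / 20 * rho = 9 / 10 * (3 / 2 * rho) by field.
    by rewrite ler_wpM2r// mulr_ge0// ltW.
  have xb : `|X (ga z1 s) - X q| <= 2 * rho.
    by move: b1; rewrite !ler_norml => /andP[h1 h2]; move: h1 h2 rho0; clr; move=> h1 h2 rho0; apply/andP; split; lra.
  have et : `|rho * (eta - t0)| <= rho * (11 / 10).
    rewrite normrM (gtr0_norm rho0) ler_wpM2l ?(ltW rho0)// (le_trans (ler_normB _ _))// eta2.
    by move: t0l; clr; move=> t0l; lra.
  split=> dS.
  - apply: (side_gt0 rho0 kr xb); move: b2 b3 et dis; rewrite (gtr0_norm dS) !ler_norml.
    move=> /andP[h1 h2] /andP[h3 h4] /andP[h5 h6] h7.
    by move: h1 h2 h3 h4 h5 h6 h7 rho0; clr; move=> h1 h2 h3 h4 h5 h6 h7 rho0; apply/andP; split; lra.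
  - rewrite -oppr_gt0 (_ : - Phi _ = - (Y (ga z1 s) - Y q) + (- k) * ((X (ga z1 s) - X q) ^+ 2 + (- (Y (ga z1 s) - Y q)) ^+ 2)); last first.
      by rewrite /Phi; ring.
    apply: (side_gt0 rho0 _ xb); first by rewrite normrN.
    move: b2 b3 et dis; rewrite (ltr0_norm dS) !ler_norml.
    move=> /andP[h1 h2] /andP[h3 h4] /andP[h5 h6] h7.
    by move: h1 h2 h3 h4 h5 h6 h7 rho0; clr; move=> h1 h2 h3 h4 h5 h6 h7 rho0; apply/andP; split; lra.
have r320 : 0 < 3 / 2 * rho by rewrite mulr_gt0.
have [s1 s1r P1] : exists2 s, `|s| <= 3 / 2 * rho & Phi (ga z1 s) = 0.
  have ab : - (3 / 2 * rho) <= 3 / 2 * rho by rewrite ge0_cp// ltW.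
  have gc : {within `[- (3 / 2 * rho), 3 / 2 * rho], continuous (fun s => Phi (ga z1 s))}.
    apply: continuous_in_subspaceT => s _.
    exact: continuous_comp (gaC z1 s) (PhiC _).
  have [e1 e2] := et (3 / 2 * rho) (gtr0_norm r320).
  have [e3 e4] := et (- (3 / 2 * rho)) (etrans (normrN _) (gtr0_norm r320)).
  have Dn0 : Di z1 != 0 by apply: contraTneq Dib => ->; rewrite normr0 -ltNge divr_gt0.
  have [|s] := IVT ab gc (v := 0).
  - rewrite ge_min le_max; move: Dn0; rewrite neq_lt => /orP[D0|D0].
    + by rewrite (ltW (e2 _)) ?(ltW (e3 _)) ?orbT// ?nmulr_rgt0// ?oppr_lt0// nmulr_rlt0.
    + by rewrite (ltW (e1 _)) ?(ltW (e4 _)) ?orbT// ?pmulr_rgt0// pmulr_rlt0// oppr_lt0.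
  - by rewrite in_itv /= -ler_norml => sr Ps; exists s.
have [b1 _ b3] := bd1 s1 s1r.
(* The circle of [q] starts along plus or minus [w] and sweeps the abscissas on both sides of [X q],
   including that of the crossing. *)
have [s2 s2r X2] : exists2 s, `|s| <= 5 / 4 * rho & X (ga q s) = X (ga z1 s1).
  have r54 : 0 < 5 / 4 * rho by rewrite mulr_gt0.
  have ab : - (5 / 4 * rho) <= 5 / 4 * rho by rewrite ge0_cp// ltW.
  have gc : {within `[- (5 / 4 * rho), 5 / 4 * rho], continuous (fun s => X (ga q s))}.
    apply: continuous_in_subspaceT => s _.
    exact: continuous_comp (gaC q s) (Xc _).
  have ee s : `|s| = 5 / 4 * rho -> `|X (ga q s) - X q - ep * s| <= rho / 50.
    move=> sE; have [g1 _ _] := gaE q s Bq qz0; have ls := Ls s ltac:(by rewrite sE; move: rho0; clr; move=> rho0; lra).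
    by apply: (le_trans g1); move: ls rho0; clr; move=> ls rho0; lra.
  have e1 := ee (5 / 4 * rho) (gtr0_norm r54).
  have e2 := ee (- (5 / 4 * rho)) (etrans (normrN _) (gtr0_norm r54)).
  have [|s] := IVT ab gc (v := X (ga z1 s1)).
  - rewrite ge_min le_max; move: b1 e1 e2; rewrite !ler_norml.
    move=> /andP[h1 h2] /andP[h3 h4] /andP[h5 h6].
    have /eqP : (ep - 1) * (ep + 1) = 0 by transitivity (ep ^+ 2 - 1); [ring|rewrite ep2 subrr].
    rewrite mulf_eq0 subr_eq0 addr_eq0 => /orP[] /eqP epE; rewrite epE in h3 h4 h5 h6;
      move: h1 h2 h3 h4 h5 h6 rho0; clr; move=> h1 h2 h3 h4 h5 h6 rho0.
    + by apply/andP; split; apply/orP; [left|right]; lra.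
    + by apply/andP; split; apply/orP; [right|left]; lra.
  - by rewrite in_itv /= -ler_norml => sr Ps; exists s.
have [_ y2 _] := gaE q s2 Bq qz0.
rewrite Di0 mul0r subr0 in y2.
have ls2 := Ls s2 ltac:(move: s2r rho0; clr; move=> s2r rho0; lra).
have y2r : `|Y (ga q s2) - Y q| <= 3 * rho by apply: (le_trans y2); move: ls2 rho0; clr; move=> ls2 rho0; lra.
(* Both points satisfy the circle equation with the same abscissa, so they coincide by
   [side_inj]. *)
have PE : ga q s2 = ga z1 s1.
  apply: (XYeq _ _ X2); apply: (addIr (- Y q)); apply: (side_inj (x := X (ga z1 s1) - X q) kr y2r b3).
  - by have := Phiq s2; rewrite /Phi X2.
  - exact: P1.
have [_ q1 _] := Oq s2 ltac:(by rewrite -ler_norml).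
have [_ q2 _] := O1 s1 ltac:(by rewrite -ler_norml).
have m1 : 4 * (L * `|s2|) <= 4 * (5 / 4) * 1000^-1.
  have h : L * `|s2| <= L * (5 / 4 * rho) by rewrite ler_wpM2l.
  by move: h Lrho; clr; move=> h Lrho; lra.
have m2 : 4 * (L * `|s1|) <= 4 * (3 / 2) * 1000^-1.
  have h : L * `|s1| <= L * (3 / 2 * rho) by rewrite ler_wpM2l.
  by move: h Lrho; clr; move=> h Lrho; lra.
(* At the common point the unit field is almost parallel to [w] along one orbit and almost
   perpendicular to it along the other. *)
rewrite PE -/ep in q1.
have := ler_normD (Dw (ga z1 s1)) (- (Dw (ga z1 s1) - ep)); rewrite normrN opprB addrC subrK epn.
have := ler_normD (Dw z1) (Dw (ga z1 s1) - Dw z1); rewrite addrC subrK.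
by move: q1 q2 m1 m2 Dws; clr; move=> q1 q2 m1 m2 Dws; lra.
Qed.

(** Once the differential is onto, the quadratic form of [jacobian_form] vanishes on all vectors;
    with [schwarz] this fixes the four entries. *)
Lemma jacobian_rotation : [/\ a11 z0 = 0, a22 z0 = 0, a12 z0 = -1 & a21 z0 = 1].
Proof.
have dt := rank_one_false.
have F w1 w2 : a11 z0 * w2 ^+ 2 - (a12 z0 + a21 z0) * (w1 * w2) + a22 z0 * w1 ^+ 2 = 0.
  pose D := a11 z0 * a22 z0 - a12 z0 * a21 z0.
  have := jacobian_form ((a22 z0 * w1 - a12 z0 * w2) / D) ((a11 z0 * w2 - a21 z0 * w1) / D).
  cbv zeta; have -> : a11 z0 * ((a22 z0 * w1 - a12 z0 * w2) / D) + a12 z0 * ((a11 z0 * w2 - a21 z0 * w1) / D) = w1.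
    by rewrite /D; field.
  have -> // : a21 z0 * ((a22 z0 * w1 - a12 z0 * w2) / D) + a22 z0 * ((a11 z0 * w2 - a21 z0 * w1) / D) = w2.
  by rewrite /D; field.
have := F 1 0; have := F 0 1; have := F 1 1; have := schwarz.
move: (a11 z0) (a12 z0) (a21 z0) (a22 z0) => p q x y h1 h2 h3 h4.
by split; lra.
Qed.

(** The square of the Euclidean distance, which can be differentiated along orbits; the norm of row
    vectors is the sup norm. *)
Definition rad2 z := (c1 z - c1 z0) ^+ 2 + (c2 z - c2 z0) ^+ 2.

Lemma rad2_ge0 z : 0 <= rad2 z. Proof. by rewrite addr_ge0// sqr_ge0. Qed.

Lemma rad2_eq0 z : rad2 z = 0 -> z = z0.
Proof.
move/eqP; rewrite paddr_eq0 ?sqr_ge0// !sqrf_eq0 !subr_eq0 => /andP[/eqP h1 /eqP h2].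
exact: rV2P.
Qed.

Lemma rad2_gt0 z : z != z0 -> 0 < rad2 z.
Proof.
move=> zz0; rewrite lt_neqAle rad2_ge0 andbT eq_sym; apply/eqP => /rad2_eq0 E.
by rewrite E eqxx in zz0.
Qed.

Lemma norm_rad z : `|z - z0| <= Num.sqrt (rad2 z) <= 2 * `|z - z0|.
Proof.
have := c1_le (z - z0); have := c2_le (z - z0); rewrite c1B c2B => h2 h1.
apply/andP; split.
  by apply: norm2_le; rewrite (c1B, c2B) -sqrtr_sqr ler_wsqrtr// /rad2 (lerDl, lerDr) sqr_ge0.
rewrite -[leRHS]ger0_norm ?mulr_ge0// -sqrtr_sqr ler_wsqrtr// exprMn.
have k (a : R) : `|a| <= `|z - z0| -> a ^+ 2 <= `|z - z0| ^+ 2.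
  by move=> h; rewrite -[a ^+ 2]real_normK ?num_real// ler_pXn2r ?nnegrE.
by have := k _ h1; have := k _ h2; rewrite /rad2; have := sqr_ge0 `|z - z0|; lra.
Qed.

(** Near [z0] the field is the quarter turn of the position up to a relative error 1/20, so the unit
    field [(d1, d2)], turned back from it, is nearly radial. *)
Lemma radial : exists2 rho, 0 < rho & forall z, `|z - z0| <= rho -> B z /\
  (z != z0 -> Num.sqrt (rad2 z) / 2 <= (c1 z - c1 z0) * d1 z + (c2 z - c2 z0) * d2 z).
Proof.
have [A11 A22 A12 A21] := jacobian_rotation.
have e0 : 0 < 20^-1 :> R by rewrite invr_gt0.
have F1 := C1_frechet oB Bz0 f1C e0; have F2 := C1_frechet oB Bz0 f2C e0.
have : \forall v \near (0 : V2),
    `|f1 (z0 + v) - f1 z0 - (a11 z0 * c1 v + a12 z0 * c2 v)| <= 20^-1 * `|v| /\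
    `|f2 (z0 + v) - f2 z0 - (a21 z0 * c1 v + a22 z0 * c2 v)| <= 20^-1 * `|v| by exact: filterI F1 F2.
rewrite A11 A12 A21 A22 f10 f20; move=> /nbhs_ballP[dl /= dl0 Hdl].
pose m := Num.min dl r; have m0 : 0 < m by rewrite lt_min dl0.
exists (m / 2) => [|z zm]; first by rewrite divr_gt0.
have {}zm : `|z - z0| < m by apply: le_lt_trans zm _; rewrite ltr_pdivrMr// ltr_pMr// ltr1n.
have [zd zr] : `|z - z0| < dl /\ `|z - z0| < r by move: zm; rewrite lt_min => /andP[].
have Bz : B z by rewrite /B ballE distrC.
split=> // zz0; have v0 := vn_gt0 Bz zz0.
have [|h1 h2] := Hdl (z - z0); first by rewrite -ball_normE /= sub0r normrN.
move: h1 h2; rewrite subrKC c1B c2B !subr0 !mul0r !mul1r addr0 add0r mulN1r => h1 h2.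
have /andP[n1 n2] := norm_rad z; set n := Num.sqrt _ in n1 n2 *.
have n20 : n ^+ 2 = rad2 z by rewrite sqr_sqrtr ?rad2_ge0.
have n0 : 0 < n by rewrite sqrtr_gt0 rad2_gt0.
rewrite /rad2 in n20; move: h1 h2 n20; set x := c1 z - _; set y := c2 z - _ => h1 h2 n20.
have V2 := vn2 z; move: v0 V2; rewrite /d1 /d2.
move: (vn z) (f1 z) (f2 z) h1 h2 => v g1 g2 h1 h2 v0 V2.
have sq (a : R) : `|a| <= 20^-1 * `|z - z0| -> a ^+ 2 <= (n / 20) ^+ 2.
  move=> h; rewrite -[a ^+ 2]real_normK ?num_real// ler_pXn2r ?nnegrE ?divr_ge0 ?(ltW n0)//.
  by apply: (le_trans h); rewrite mulrC ler_wpM2r ?invr_ge0.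
have s1 := sq _ h1; have s2 := sq _ h2.
rewrite opprK in s1.
have vn : v <= 3 / 2 * n.
  rewrite -(@ler_pXn2r _ 2)// ?nnegrE ?mulr_ge0 ?(ltW n0) ?(ltW v0)// V2.
  have q1 := sqr_ge0 (g1 + y + y); have q2 := sqr_ge0 (g2 - x - x).
  have q3 := sqr_ge0 n.
  by move: s1 s2 q1 q2 q3 n20; clr; move=> s1 s2 q1 q2 q3 n20; lra.
have -> : x * (g2 / v) + y * (- g1 / v) = (x * g2 - y * g1) / v by ring.
rewrite ler_pdivlMr//.
(* Young's inequality for the error terms [y * (g1 + y)] and [x * (g2 - x)], written as squares. *)
have q1 := sqr_ge0 (20 * (g1 + y) - y); have q2 := sqr_ge0 (20 * (g2 - x) + x).
have q3 : n / 2 * v <= n / 2 * (3 / 2 * n) by rewrite ler_wpM2l// divr_ge0// ltW.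
have q4 := sqr_ge0 n.
by move: s1 s2 q1 q2 q3 q4 n20; clr; move=> s1 s2 q1 q2 q3 q4 n20; lra.
Qed.

(* The linear part at [z0] being a rotation, the field is almost radial there:
   followed backwards, an orbit approaches [z0] with speed at least 1/2. *)
Lemma orbit_hits : exists2 rho, 0 < rho & forall z, `|z - z0| <= rho -> z != z0 ->
  B z /\ exists2 s, 0 < s <= 8 * `|z - z0| & cir l z (d1 z) (d2 z) (- s) = z0 /\
    forall x, 0 <= x < s -> B (cir l z (d1 z) (d2 z) (- x)) /\ cir l z (d1 z) (d2 z) (- x) != z0.
Proof.
have [rho rho0 H] := radial.
(* In time [8 * |z - z0|] a unit speed orbit stays within [9 * |z - z0|] of [z0]. The Euclidean
   distance is at most [2 * |z - z0|], and at radial speed 1/2 it is used up in half of that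
   time. *)
exists (rho / 9) => [|z zr zz0]; first by rewrite divr_gt0.
have nz : 0 < `|z - z0| by rewrite normr_gt0 subr_eq0.
have Bz : B z by case: (H z ltac:(apply: (le_trans zr); rewrite ler_pdivrMr// ler_peMr ?(ltW rho0)// ler1n)).
split=> //; have du := d_unit Bz zz0.
set a := d1 z in du *; set b := d2 z in du *; pose g x := cir l z a b (- x).
set T := 8 * `|z - z0|; have T0 : 0 < T by rewrite mulr_gt0.
have gK x : `|x| <= T -> `|g x - z0| <= rho.
  move=> xT; have cl : `|g x - z| <= `|x|.
    have [x0 y0] : cx l a b 0 = 0 /\ cy l a b 0 = 0.
      by rewrite /cx /cy mulr0 sin0 cos0 subrr !mulr0 addr0 subrr mul0r.
    have := drv_lipschitz (K := 1) (- x) (drv_cx l0 a b) (fun r => proj1 (dir_le1 l r du)).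
    have := drv_lipschitz (K := 1) (- x) (drv_cy l0 a b) (fun r => proj2 (dir_le1 l r du)).
    rewrite x0 y0 !subr0 !mul1r normrN => h2 h1.
    by apply: norm2_le; rewrite /g /cir (c1B, c2B) (c1_vec2, c2_vec2) addrC addKr.
  rewrite -(subrK z (g x)) -addrA (le_trans (ler_normD _ _))//.
  have h1 := le_trans cl xT; move: h1 zr; rewrite /T; move: `|g x - z| `|z - z0| => u1 u2; clr.
  by move=> h1 h2; lra.
have gB x : `|x| <= T -> B (g x) by move=> /gK/H[].
have g0 : g 0 = z by rewrite /g oppr0 cir0.
pose D x := (c1 (g x) - c1 z0) * - dir1 l a b (- x) + (c2 (g x) - c2 z0) * - dir2 l a b (- x).
have gD x : drv2 g x (- dir1 l a b (- x)) (- dir2 l a b (- x)).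
  have [h1 h2] := cir_drv2 z a b (- x); have dN := drvN (drv_id x).
  by split; [refine (drv_eq (drv_comp dN h1) _)|refine (drv_eq (drv_comp dN h2) _)]; ring.
have RD x : drv (fun x => rad2 (g x)) x (2 * D x).
  have [h1 h2] := gD x.
  have k1 := drvB h1 (drv_cst (c1 z0) x); have k2 := drvB h2 (drv_cst (c2 z0) x).
  by apply: drv_eq (drvD (drvM k1 k1) (drvM k2 k2)) _; rewrite /D /=; ring.
have NZ s : 0 <= s <= T -> (forall x, 0 <= x <= s -> g x != z0) -> 
   Num.sqrt (rad2 (g s)) <= Num.sqrt (rad2 z) - s / 2.
  move=> /andP[+ sT] h; rewrite le_eqVlt => /predU1P[<-|s0]; first by rewrite g0 mul0r subr0.
  have dS x : 0 <= x <= s -> drv (fun x => Num.sqrt (rad2 (g x))) x ((2 * D x) / (2 * Num.sqrt (rad2 (g x)))).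
    by move=> xs; apply: drv_sqrt (RD x); exact: rad2_gt0 (h _ xs).
  have [x /andP[x0 xs] E] := drv_MVT s0 dS.
  have xr : 0 <= x <= s by rewrite !ltW.
  have xT : `|x| <= T by rewrite gtr0_norm// (le_trans (ltW xs)).
  have [Bx Hx] := H _ (gK _ xT); have xz0 := h _ xr; have {}Hx := Hx xz0.
  have sx : - s <= - x <= 0 by rewrite lerN2 (ltW xs) oppr_le0 ltW.
  have m0 : - s <= (0 : R) <= 0 by apply/andP; split=> //; rewrite oppr_le0 ltW.
  have PP y : - s <= y <= 0 -> B (cir l z a b y) /\ cir l z a b y != z0.
    move=> /andP[y1 y2]; have yr : 0 <= - y <= s by rewrite oppr_ge0 y2 lerNl.
    have := h _ yr; have := gB (- y); rewrite /g opprK normrN => k1 k2; split=> //; apply: k1.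
    by rewrite ler0_norm//; case/andP: yr => _ k; apply: le_trans sT.
  have [e1 e2] := @orbit z _ _ Bz zz0 m0 PP (- x) sx.
  rewrite -/a -/b in e1 e2; rewrite /g e1 e2 in Hx.
  have q0 : 0 < Num.sqrt (rad2 (g x)) by rewrite sqrtr_gt0 rad2_gt0.
  move: E; rewrite g0 subr0 => E; rewrite -[leLHS](subrK (Num.sqrt (rad2 z))) E addrC lerD2l.
  rewrite (_ : - (s / 2) = - 2^-1 * s); last by ring.
  rewrite ler_wpM2r ?(ltW s0)// -mulf_div divff// mul1r ler_pdivrMr//.
  move: Hx; rewrite /D /g; move: (Num.sqrt _) (c1 _ - c1 z0) (c2 _ - c2 z0) (dir1 _ _ _ _) (dir2 _ _ _ _).
  by clr; move=> m p q p' q' Hx; lra.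
have [ex|nex] := pselect (forall s, 0 <= s <= T -> g s != z0).
  exfalso; have := NZ T ltac:(by rewrite lexx ltW) ex.
  have /andP[_ n2] := norm_rad z; have := sqrtr_ge0 (rad2 (g T)).
  rewrite /T; move: n2 nz; move: (Num.sqrt (rad2 z)) (Num.sqrt (rad2 (g T))) (`|z - z0|).
  by clr; move=> p q v n2 nz h1 h2; lra.
have gc x : {for x, continuous g} by exact: drv2_cont (gD x).
(* The first hitting time: without one, real induction would keep [g] away from [z0] on the whole
   interval. *)
have [s sT [gs Hs]] : exists2 s, 0 <= s <= T & g s = z0 /\ forall x, 0 <= x < s -> g x != z0.
  apply: contrapT => nh; apply: nex; apply: real_induction.
  - by rewrite g0.
  - move=> s /andP[s0 sT] h; have : \forall x \near s, g x != z0.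
      have hs := h s ltac:(by rewrite s0 lexx).
      exact: near_continuous (gc s) (neq_nbhs hs).
    move=> /nbhs_ballP[e /= e0 He]; exists e => // x /andP[sx xe]; apply: He.
    by rewrite /ball /= distrC gtr0_norm ?subr_gt0// ltrBlDl.
  - move=> s /andP[s0 sT] h; apply/negP => /eqP gs; apply: nh; exists s; first by rewrite (ltW s0).
    by split.
have s0 : 0 < s.
  case/andP: sT => + _; rewrite le_eqVlt => /predU1P[s0|//].
  by move: gs zz0; rewrite -s0 g0 => ->; rewrite eqxx.
case/andP: sT => _ sT; exists s; first by rewrite s0.
split=> // x xs; split; last exact: Hs.
apply: gB; case/andP: xs => x0 xs; rewrite ger0_norm//; exact: le_trans (ltW xs) sT.
Qed.

End planar.

(** * Polar coordinates given by circles through a point *)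

Section polar.
Context {R : realType}.
Local Notation V2 := 'rV[R]_2.
Variable l : R.
Hypothesis l0 : l != 0.

Lemma cir_norm (z : V2) a b s : a ^+ 2 + b ^+ 2 = 1 ->
  (c1 (cir l z a b s) - c1 z) ^+ 2 + (c2 (cir l z a b s) - c2 z) ^+ 2 = (sin (l * s) / l) ^+ 2.
Proof.
move=> ab; rewrite /cir c1_vec2 c2_vec2 addrAC subrr add0r addrAC subrr add0r /cx /cy.
have -> : 2 * l * s = l * s + l * s by ring.
rewrite sinD cosD; have C := cos2Dsin2 (l * s).
move: (cos _) (sin _) C => c d C.
transitivity ((a ^+ 2 + b ^+ 2) * (4 * c ^+ 2 * d ^+ 2 + (1 - c * c + d * d) ^+ 2) / (4 * l ^+ 2)).
  by field.
have -> : c ^+ 2 = 1 - d ^+ 2 by rewrite -C addrK.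
have -> : 1 - c * c + d * d = 2 * d ^+ 2.
  by rewrite -[X in X - _ + _]C; ring.
by rewrite ab; field.
Qed.

(** Half-angle formulas: the chord has length [|sin (l * s) / l|] and the initial direction turned
    by [- l * s]. At a fixed time the end points thus form a circle around [z]. *)
Lemma cir_scale (z : V2) a b s :
  cir l z a b s = z + (sin (l * s) / l) *: vec2 (a * cos (l * s) + b * sin (l * s)) (b * cos (l * s) - a * sin (l * s)).
Proof.
have E : 2 * l * s = l * s + l * s by ring.
have C := cos2Dsin2 (l * s).
apply: rV2P; rewrite ?c1D ?c2D ?c1Z ?c2Z ?c1_vec2 ?c2_vec2; congr (_ + _); rewrite /cx /cy E sinD cosD;
  move: (cos _) (sin _) C => c d C.
- transitivity ((a * (2 * c * d) + b * (c ^+ 2 + d ^+ 2 - c ^+ 2 + d ^+ 2)) / (2 * l)); last by field.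
  by rewrite C; field.
- transitivity ((b * (2 * c * d) - a * (c ^+ 2 + d ^+ 2 - c ^+ 2 + d ^+ 2)) / (2 * l)); last by field.
  by rewrite C; field.
Qed.

Lemma rotation_inj a b a' b' t : a * cos t + b * sin t = a' * cos t + b' * sin t ->
  b * cos t - a * sin t = b' * cos t - a' * sin t -> a = a' :> R /\ b = b'.
Proof.
have C := cos2Dsin2 t; move: (cos t) (sin t) C => c d C h1 h2; split.
- transitivity (a * (c ^+ 2 + d ^+ 2)); first by rewrite C mulr1.
  transitivity ((a * c + b * d) * c - (b * c - a * d) * d); first ring.
  rewrite h1 h2; transitivity (a' * (c ^+ 2 + d ^+ 2)); last by rewrite C mulr1.
  by ring.
- transitivity (b * (c ^+ 2 + d ^+ 2)); first by rewrite C mulr1.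
  transitivity ((a * c + b * d) * d + (b * c - a * d) * c); first ring.
  rewrite h1 h2; transitivity (b' * (c ^+ 2 + d ^+ 2)); last by rewrite C mulr1.
  by ring.
Qed.

Lemma cir_inj (z : V2) a b s a' b' : sin (l * s) != 0 ->
  cir l z a b s = cir l z a' b' s -> a = a' /\ b = b'.
Proof.
move=> s0; rewrite !cir_scale => /addrI E.
have k0 : sin (l * s) / l != 0 by rewrite mulf_neq0// invr_eq0.
have e1 : c1 (_ *: _) = c1 (_ *: _) := congr1 c1 E; have e2 : c2 (_ *: _) = c2 (_ *: _) := congr1 c2 E.
move: e1 e2; rewrite !c1Z !c2Z !c1_vec2 !c2_vec2 => /(mulfI k0) h1 /(mulfI k0) h2.
exact: rotation_inj h1 h2.
Qed.

(* The period parameter is kept positive by working with [|l|]. *)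
Lemma sin_normM s : sin (l * s) / l = sin (`|l| * s) / `|l|.
Proof.
have [l1|l1] := ltP 0 l; first by rewrite gtr0_norm.
by rewrite ler0_norm// mulNr sinN invrN mulrNN.
Qed.

Lemma sin_lin_gt0 s : 0 < s < pi / `|l| -> 0 < sin (l * s) / l.
Proof.
move=> /andP[s0 sp]; have n0 : 0 < `|l| by rewrite normr_gt0.
rewrite sin_normM divr_gt0// sin_gt0_pi// mulr_gt0//=.
by move: sp; rewrite ltr_pdivlMr// mulrC.
Qed.

End polar.

(** * Geodesics from an isolated singular point *)

Section isolated.
Context {R : realType} {S : surface R}.
Local Notation V2 := 'rV[R]_2.
Local Notation H1 := 'rV[R]_3.
Variables (F N : S -> H1) (H : R) (p : S).
Hypothesis F_imm : immersion2 F.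
Hypothesis N_nrm : unit_normal F N.
Hypothesis F_cmc : constant_mean_curvature F N H.
Local Notation n1 := (n1 N).
Local Notation n2 := (n2 N).
Local Notation n3 := (n3 F N).
Local Notation reg := (reg N).

Definition Pxy : proj := @Proj R 1 0 0 0 1 0.

Lemma prj_xy u : prj Pxy u = vec2 (xc u) (yc u).
Proof. by rewrite /prj /= !mul1r !mul0r !addr0 add0r. Qed.

Lemma prj_geo l q a b s : prj Pxy (geo l q a b s) = cir l (prj Pxy q) a b s.
Proof. by rewrite !prj_xy /geo xc_vec3 yc_vec3 /cir c1_vec2 c2_vec2. Qed.

Lemma singular_normal q : ~ reg q -> [/\ n1 q = 0, n2 q = 0 & n3 q * n3 q = 1].
Proof.
move=> nr; have : n1 q ^+ 2 + n2 q ^+ 2 <= 0 by rewrite leNgt; apply/negP.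
rewrite le_eqVlt ltNge addr_ge0 ?sqr_ge0// orbF paddr_eq0 ?sqr_ge0// !sqrf_eq0.
move=> /andP[/eqP e1 /eqP e2]; have := normal_unit N_nrm q.
by rewrite e1 e2 expr0n !add0r expr2.
Qed.

Lemma Pxy_inj q u : n3 q != 0 -> tangent F N q u -> prj Pxy u = 0 -> u = 0.
Proof.
rewrite prj_xy /tangent /tcomp => n0 T E.
have h1 : c1 (vec2 (xc u) (yc u)) = 0 by rewrite E /c1 mxE.
have h2 : c2 (vec2 (xc u) (yc u)) = 0 by rewrite E /c2 mxE.
rewrite c1_vec2 in h1; rewrite c2_vec2 in h2.
move: T; rewrite h1 h2 !mulr0 subr0 !add0r => /eqP.
rewrite mulf_eq0 (negbTE n0) => /eqP h3.
rewrite addr0 in h3; apply: rV3P; [rewrite h1|rewrite h2|rewrite h3]; by rewrite /xc /yc /tc mxE.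
Qed.

Lemma geo_isgeod (l : R) q a b : l != 0 -> geod l (geo l q a b) (dir1 l a b) (dir2 l a b).
Proof.
move=> l0 s; have [g1 g2 g3] := geo_geod l0 q a b s.
by split=> //; [exact: drv_dir1|exact: drv_dir2].
Qed.

Lemma zeta_unit eps q : eps * eps = 1 -> reg q -> zeta1 N eps q ^+ 2 + zeta2 N eps q ^+ 2 = 1.
Proof.
move=> e2 rq; rewrite -(nu_unit rq) /zeta1 /zeta2.
transitivity (eps * eps * (nu1 N q ^+ 2 + nu2 N q ^+ 2)); first ring.
by rewrite e2 mul1r.
Qed.

Hypothesis p_iso : isolated (singular_set F N) p.
Hypothesis H0 : H != 0.
Let eps := n3 p.
Let l := lam H eps.

Lemma p_singular : ~ reg p.
Proof. by apply/(singularP F N p); case: p_iso => /set_mem. Qed.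

Lemma eps2 : eps * eps = 1. Proof. by have [] := singular_normal p_singular. Qed.

Lemma l_neq0 : l != 0.
Proof.
rewrite mulf_neq0//; apply: contra_eq_neq eps2 => ->.
by rewrite mul0r eq_sym oner_neq0.
Qed.

(** At [p] the normal is plus or minus T, so the surface is a graph over the xy-plane near [p]; by
    continuity [n3] keeps the sign [eps] there. *)
Lemma isolated_section : exists i (sec : lsec F N H i p Pxy) r, [/\ dom (atlas i) p,
  0 < r, ball (prj Pxy (F p)) r `<=` ls_B sec &
  forall z, ball (prj Pxy (F p)) r z -> 0 < n3 (ls_kap sec z) * eps /\
    (z != prj Pxy (F p) -> reg (ls_kap sec z))].
Proof.
have [_ _ n31] := singular_normal p_singular.
have n30 : n3 p != 0 by apply: contra_eq_neq n31 => ->; rewrite mul0r eq_sym oner_neq0.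
have [i ip] := atlas_cover p.
have [sec _] := local_section F_imm N_nrm F_cmc ip (fun u => @Pxy_inj p u n30).
set z0 := prj Pxy (F p); have Bz0 : ls_B sec z0 by exact: ballxx (ls_r0 sec).
have kz0 : ls_kap sec z0 = p by exact: ls_UK (ls_Uq sec).
have N1 : \forall q \near p, 0 < n3 q * eps.
  have c : {for p, continuous (fun q => n3 q * eps)}.
    by apply: continuousM; [exact: n3_cont|exact: cst_continuous].
  have nb : nbhs (n3 p * eps) [set x | 0 < x].
    by apply: open_nbhs_nbhs; split; [exact: (@open_gt R 0)|rewrite /= eps2].
  exact: near_continuous c nb.
have [_ [V nV VE]] := p_iso.
have N2 : \forall q \near p, q <> p -> reg q.
  apply: filterS nV => q Vq qp; apply: contrapT => /(singularP F) sq.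
  by apply: qp; have : (V `&` singular_set F N) q by []; rewrite VE.
have NN : nbhs (ls_kap sec z0) [set q | 0 < n3 q * eps /\ (q <> p -> reg q)].
  by rewrite kz0; exact: filterI N1 N2.
have : \forall z \near z0, ls_B sec z /\ (0 < n3 (ls_kap sec z) * eps /\ (ls_kap sec z <> p -> reg (ls_kap sec z))).
  apply: filterI; first exact: open_nbhs_nbhs (conj (ball_open _ _) Bz0).
  exact: near_continuous (ls_kapc Bz0) NN.
move=> /nbhs_ballP[r /= r0 Hr]; exists i, sec, r; split=> //; first by move=> z /Hr[].
move=> z Bz; have [Bz' [h1 h2]] := Hr z Bz; split=> // zz0; apply: h2 => kp.
by move/eqP: zz0; apply; rewrite -(ls_kapP Bz') kp.
Qed.

(* By [orbit_hits] points near [p] are reached by a characteristic geodesic from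
   [p]; conversely, a short geodesic from [p] is the one reaching its end point,
   as a short circle through [z0] is determined by a second point. *)
Lemma isolated_geodesics : exists i (sec : lsec F N H i p Pxy) e0, let z0 := prj Pxy (F p) in
  [/\ dom (atlas i) p, 0 < e0 < pi / `|l|,
   forall a b s, a ^+ 2 + b ^+ 2 = 1 -> 0 < s <= e0 ->
     [/\ ls_B sec (cir l z0 a b s), reg (ls_kap sec (cir l z0 a b s)),
      F (ls_kap sec (cir l z0 a b s)) = geo l (F p) a b s,
      zeta1 N eps (ls_kap sec (cir l z0 a b s)) = dir1 l a b s &
      zeta2 N eps (ls_kap sec (cir l z0 a b s)) = dir2 l a b s] &
   exists2 e1, 0 < e1 & forall z, `|z - z0| <= e1 -> z != z0 ->
     exists a b s, [/\ a ^+ 2 + b ^+ 2 = 1, 0 < s <= e0 & z = cir l z0 a b s]].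
Proof.
have l0 := l_neq0.
have [i [sec [r [ip r0 rB Hr]]]] := isolated_section.
set z0 := prj Pxy (F p) in rB Hr *; pose kap := ls_kap sec.
pose B := ball z0 r; have oB : open B by exact: ball_open.
have kz0 : kap z0 = p by exact: ls_UK (ls_Uq sec).
have n30 z : B z -> n3 (kap z) != 0.
  by move=> /Hr[+ _]; apply: contraTneq => ->; rewrite mul0r ltxx.
(* The T-components of the tangent vectors lying above the two coordinate directions. They vanish
   exactly at singular points. *)
pose f1 z := - n1 (kap z) / n3 (kap z); pose f2 z := - n2 (kap z) / n3 (kap z).
have n3V : isC1 B (fun z => (n3 (kap z))^-1).
  by apply: isC1V n30 _; apply: (isC1_sub rB); exact: ls_n3C.
have [a11 [a12 f1C]] : isC1 B f1.
  by apply: isC1M n3V; apply: isC1N; apply: (isC1_sub rB); exact: ls_n1C.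
have [a21 [a22 f2C]] : isC1 B f2.
  by apply: isC1M n3V; apply: isC1N; apply: (isC1_sub rB); exact: ls_n2C.
have uC := C1_sub rB (ls_tC sec).
have gE z x y : B z -> let u := vec3 x y (yc (F (kap z)) * x - xc (F (kap z)) * y - (n1 (kap z) * x + n2 (kap z) * y) / n3 (kap z)) in
    tangent F N (kap z) u.
  move=> Bz u; rewrite /tangent /tcomp /u xc_vec3 yc_vec3 tc_vec3; have := n30 z Bz.
  by move: (n1 _) (n2 _) (n3 _) (xc _) (yc _) => *; field.
have xyk z : B z -> xc (F (kap z)) = c1 z /\ yc (F (kap z)) = c2 z.
  by move=> Bz; rewrite -{2 4}(ls_kapP (rB _ Bz)) prj_xy c1_vec2 c2_vec2.
have t1E z : B z -> ls_t1 sec z = c2 z + f1 z.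
  move=> Bz; have [_ _] := ls_tan (rB _ Bz) (gE z 1 0 Bz).
  have [ex ey] := xyk z Bz.
  rewrite prj_xy xc_vec3 yc_vec3 tc_vec3 c1_vec2 c2_vec2 ex ey !mulr1 !mulr0 addr0 subr0 => ->.
  by rewrite addr0 /f1 mulNr.
have t2E z : B z -> ls_t2 sec z = - c1 z + f2 z.
  move=> Bz; have [_ _] := ls_tan (rB _ Bz) (gE z 0 1 Bz).
  have [ex ey] := xyk z Bz.
  rewrite prj_xy xc_vec3 yc_vec3 tc_vec3 c1_vec2 c2_vec2 ex ey !mulr1 !mulr0 !add0r => ->.
  by rewrite /f2 mulNr.
have [p1 p2 p3] := singular_normal p_singular.
have f10 : f1 z0 = 0 by rewrite /f1 kz0 p1 oppr0 mul0r.
have f20 : f2 z0 = 0 by rewrite /f2 kz0 p2 oppr0 mul0r.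
have fE z : f1 z ^+ 2 + f2 z ^+ 2 = (n1 (kap z) ^+ 2 + n2 (kap z) ^+ 2) * (n3 (kap z))^-1 ^+ 2.
  by rewrite /f1 /f2; ring.
have rg z : B z -> z != z0 -> reg (kap z) by move=> Bz; have [_] := Hr z Bz.
have fn0 z : B z -> z != z0 -> 0 < f1 z ^+ 2 + f2 z ^+ 2.
  move=> Bz zz0; rewrite fE mulr_gt0//; first exact: rg.
  by rewrite exprn_even_gt0//= invr_eq0 n30.
(* [eps] is the sign of [n3] on [B]; it compensates the absolute value coming from the length of
   [(f1, f2)]. *)
have dE z : B z -> z != z0 -> d1 f1 f2 z = zeta1 N eps (kap z) /\ d2 f1 f2 z = zeta2 N eps (kap z).
  move=> Bz zz0; have h0 := hh_gt0 (rg z Bz zz0).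
  have vE : vn f1 f2 z = hh N (kap z) * `|n3 (kap z)|^-1.
    by rewrite /vn fE sqrtrM ?addr_ge0 ?sqr_ge0// sqrtr_sqr normfV.
  have [n0 _] := Hr z Bz; have q0 := n30 z Bz.
  have ee : eps = `|n3 (kap z)| / n3 (kap z).
    have := same_sign n0; have -> : `|eps| = 1.
      by apply/eqP; rewrite -(@eqrXn2 _ 2)// expr1n real_normK ?num_real// expr2 eps2.
    rewrite mulr1 => ->; have [x0|x0] := ltP 0 (n3 (kap z)); first by rewrite gtr0_norm// !divff.
    by rewrite ler0_norm// invrN mulrN mulNr !divff.
  rewrite /d1 /d2 vE /zeta1 /zeta2 /nu1 /nu2 /f1 /f2 ee.
  have a0 : `|n3 (kap z)| != 0 by rewrite normr_eq0.
  have h0' := lt0r_neq0 h0.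
  by split; field; rewrite ?h0' ?q0 ?a0.
have orb z a b : B z -> z != z0 -> a <= 0 <= b ->
   (forall s, a <= s <= b -> B (cir l z (d1 f1 f2 z) (d2 f1 f2 z) s) /\ cir l z (d1 f1 f2 z) (d2 f1 f2 z) s != z0) ->
   forall s, a <= s <= b -> [/\ F (kap (cir l z (d1 f1 f2 z) (d2 f1 f2 z) s)) = geo l (F (kap z)) (d1 f1 f2 z) (d2 f1 f2 z) s,
     zeta1 N eps (kap (cir l z (d1 f1 f2 z) (d2 f1 f2 z) s)) = dir1 l (d1 f1 f2 z) (d2 f1 f2 z) s &
     zeta2 N eps (kap (cir l z (d1 f1 f2 z) (d2 f1 f2 z) s)) = dir2 l (d1 f1 f2 z) (d2 f1 f2 z) s].
  move=> Bz zz0 ab hab s sab.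
  have gg := geo_isgeod (F (kap z)) (d1 f1 f2 z) (d2 f1 f2 z) l0.
  have pE r' : prj Pxy (geo l (F (kap z)) (d1 f1 f2 z) (d2 f1 f2 z) r') = cir l z (d1 f1 f2 z) (d2 f1 f2 z) r'.
    by rewrite prj_geo (ls_kapP (rB _ Bz)).
  have [e1 e2] := dE z Bz zz0; have [i1 i2] := dir0 l (d1 f1 f2 z) (d2 f1 f2 z).
  have := geod_in_section N_nrm (sec := sec) gg ab _ _ _ _ sab.
  rewrite !pE cir0 geo0 i1 i2 -/kap; apply=> //.
  move=> s' sab'; rewrite pE; have [b1 b2] := hab s' sab'; split; first exact: rB.
  exact: rg.
have orbit z a b : B z -> z != z0 -> a <= 0 <= b ->
   (forall s, a <= s <= b -> B (cir l z (d1 f1 f2 z) (d2 f1 f2 z) s) /\ cir l z (d1 f1 f2 z) (d2 f1 f2 z) s != z0) ->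
   forall s, a <= s <= b -> d1 f1 f2 (cir l z (d1 f1 f2 z) (d2 f1 f2 z) s) = dir1 l (d1 f1 f2 z) (d2 f1 f2 z) s /\
    d2 f1 f2 (cir l z (d1 f1 f2 z) (d2 f1 f2 z) s) = dir2 l (d1 f1 f2 z) (d2 f1 f2 z) s.
  move=> Bz zz0 ab hab s sab; have [_ h1 h2] := orb z a b Bz zz0 ab hab s sab.
  by have [b1 b2] := hab s sab; have [-> ->] := dE _ b1 b2.
have [rho rho0 hit] := orbit_hits l0 r0 f1C f2C uC t1E t2E f10 f20 fn0 orbit.
have n0 : 0 < `|l| by rewrite normr_gt0.
(* A point within [e2] of [z0] is reached in time at most [8 * e2], a quarter of [pi / |l|]. Up to
   that time [sin (|l| * s)] determines [s]. *)
pose e2 := Num.min rho (Num.min (r / 2) (pi / `|l| / 32)).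
have e20 : 0 < e2 by rewrite !lt_min rho0 !divr_gt0// pi_gt0.
have [e2r e2R e2p] : [/\ e2 <= rho, e2 <= r / 2 & e2 <= pi / `|l| / 32].
  by rewrite !ge_min !lexx ?orbT.
have polar z : `|z - z0| <= e2 -> z != z0 -> exists a b s, [/\ a ^+ 2 + b ^+ 2 = 1,
    0 < s <= 8 * `|z - z0|, z = cir l z0 a b s & forall x, 0 < x <= s ->
    [/\ B (cir l z0 a b x), cir l z0 a b x != z0, F (kap (cir l z0 a b x)) = geo l (F p) a b x,
      zeta1 N eps (kap (cir l z0 a b x)) = dir1 l a b x & zeta2 N eps (kap (cir l z0 a b x)) = dir2 l a b x]].
  move=> ze zz0; have [Bz [s s8 [sz sx]]] := hit z (le_trans ze e2r) zz0.
  have [s0 s1] := andP s8.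
  set a' := d1 f1 f2 z in sz sx *; set b' := d2 f1 f2 z in sz sx *.
  have [ea eb] := dE z Bz zz0.
  have du : a' ^+ 2 + b' ^+ 2 = 1 by rewrite /a' /b' ea eb zeta_unit ?eps2//; exact: rg.
  (* [(a, b)] is the direction at the hitting time, so that the geodesic can be run from [p]
     forwards. *)
  pose a := dir1 l a' b' (- s); pose b := dir2 l a' b' (- s).
  have ab : a ^+ 2 + b ^+ 2 = 1 by exact: dir_unit.
  have cE x : cir l z0 a b x = cir l z a' b' (x - s).
    by rewrite -sz cir_flow// addrC.
  have dE1 x : dir1 l a' b' (x - s) = dir1 l a b x /\ dir2 l a' b' (x - s) = dir2 l a b x.
    by have [-> ->] := dir_flow l a' b' (- s) x; rewrite addrC.
  have PP x : 0 < x <= s -> forall y, x - s <= y <= 0 -> B (cir l z a' b' y) /\ cir l z a' b' y != z0.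
    move=> /andP[x0 xs] y /andP[y1 y2]; have := sx (- y); rewrite opprK; apply.
    by rewrite oppr_ge0 y2 /= ltrNl (lt_le_trans _ y1)// ltrDr.
  have O x : 0 < x <= s -> [/\ B (cir l z0 a b x), cir l z0 a b x != z0,
      F (kap (cir l z0 a b x)) = geo l (F (kap z)) a' b' (x - s),
      zeta1 N eps (kap (cir l z0 a b x)) = dir1 l a b x & zeta2 N eps (kap (cir l z0 a b x)) = dir2 l a b x].
    move=> xs; have Px := PP x xs; have m0 : x - s <= (0 : R) <= 0.
      by apply/andP; split=> //; rewrite subr_le0; case/andP: xs.
    have m1 : x - s <= x - s <= 0 by rewrite lexx; case/andP: m0.
    have [k1 k2 k3] := orb z _ _ Bz zz0 m0 Px _ m1.
    have [b1 b2] := Px _ m1; have [<- <-] := dE1 x; rewrite cE; split=> //.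
  have Fp : F p = geo l (F (kap z)) a' b' (- s).
    (* both sides are continuous in [x] and agree for positive [x] *)
    have kc : {for 0, continuous (fun x => kap (cir l z0 a b x))}.
      have cc := @cir_cont R l l0 z0 a b 0.
      apply: continuous_comp; first exact: cc.
      by rewrite cir0; apply: ls_kapc; apply: rB; exact: ballxx.
    have eqc (f : H1 -> R) : (forall (g : R -> H1) x, {for x, continuous g} -> {for x, continuous (f \o g)}) ->
       {for 0, continuous (fun x => f (geo l (F (kap z)) a' b' (x - s)))} ->
       f (F p) = f (geo l (F (kap z)) a' b' (- s)).
      move=> fc gc; have fc1 : {for 0, continuous (fun x => f (F (kap (cir l z0 a b x))))}.
        apply: (fc (fun x => F (kap (cir l z0 a b x)))).
        by apply: (continuous_comp kc); exact: F_cont.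
      have L1 : (fun x => f (F (kap (cir l z0 a b x)))) x @[x --> 0^'+] --> f (F p).
        by have := cvg_at_right_filter fc1; rewrite /= cir0 kz0.
      have L2 : (fun x => f (geo l (F (kap z)) a' b' (x - s))) x @[x --> 0^'+] --> f (geo l (F (kap z)) a' b' (- s)).
        by have := cvg_at_right_filter gc; rewrite /= sub0r.
      apply: (cvg_unique _ _ L2) => //.
      apply: cvg_trans L1; apply: near_eq_cvg; near=> x.
      have [|_ _ -> _ _ //] := O x; apply/andP; split; first by near: x; exact: nbhs_right_gt.
      by near: x; apply: nbhs_right_le.
    have cp (g : R -> R) d : drv g (0 - s) d -> {for 0, continuous (fun x => g (x - s))}.
      move=> gd; have D := drvB (drv_id (0 : R)) (drv_cst s 0).
      exact: drv_cont (drv_comp D gd).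
    have [g1 g2 g3] := geo_geod l0 (F (kap z)) a' b' (0 - s).
    apply: rV3P; apply: eqc.
    - by move=> g x gc; exact: xc_cont.
    - exact: cp g1.
    - by move=> g x gc; exact: yc_cont.
    - exact: cp g2.
    - by move=> g x gc; exact: tc_cont.
    - exact: cp g3.
  exists a, b, s; split=> //; first by rewrite cE subrr cir0.
  move=> x xs; have [k1 k2 k3 k4 k5] := O x xs; split=> //.
  by rewrite k3 Fp geo_flow// addrC.
set e0 := Num.min (e2 / 2) (pi / `|l| / 32).
have p32 : 0 < pi / `|l| / 32 by rewrite !divr_gt0 ?pi_gt0.
have e00 : 0 < e0 by rewrite lt_min divr_gt0.
have [e02 e03] : e0 <= e2 / 2 /\ e0 <= pi / `|l| / 32 by rewrite /e0 !ge_min !lexx orbT.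
have e04 : 0 < e0 < pi / `|l|.
  by rewrite e00 /=; apply: (le_lt_trans e03); rewrite ltr_pdivrMr// ltr_pMr ?divr_gt0 ?pi_gt0// ltr1n.
exists i, sec, e0; cbv zeta; rewrite -/z0 -/kap; split=> //; last first.
  exists (e0 / 8) => [|z ze zz0]; first by rewrite divr_gt0.
  have [|a [b [s [ab /andP[s1 s2] zE _]]]] := polar z _ zz0; first by lra.
  exists a, b, s; split=> //; rewrite s1 /=.
  by apply: le_trans s2 _; rewrite mulrC -ler_pdivlMr.
move=> a b s ab /andP[s0 se].
set z := cir l z0 a b s.
have small x : 0 < x <= pi / `|l| / 4 -> 0 < x < pi / `|l|.
  by move=> /andP[x0 x1]; rewrite x0 /=; have := p32; lra.
have zs : `|z - z0| <= s.
  have [x0 y0] : cx l a b 0 = 0 /\ cy l a b 0 = 0.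
    by rewrite /cx /cy mulr0 sin0 cos0 subrr !mulr0 addr0 subrr mul0r.
  have := drv_lipschitz (K := 1) s (drv_cx l0 a b) (fun r => proj1 (dir_le1 l r ab)).
  have := drv_lipschitz (K := 1) s (drv_cy l0 a b) (fun r => proj2 (dir_le1 l r ab)).
  rewrite x0 y0 !subr0 !mul1r (gtr0_norm s0) => h2 h1.
  by apply: norm2_le; rewrite /z /cir (c1B, c2B) (c1_vec2, c2_vec2) addrC addKr.
have ss : 0 < s <= pi / `|l| / 4 by rewrite s0 /=; lra.
have sp := sin_lin_gt0 l0 (small _ ss).
have zz0 : z != z0.
  apply/eqP => zE; have := cir_norm l0 z0 s ab; rewrite -/z zE !subrr expr0n addr0.
  by move/esym/eqP; rewrite sqrf_eq0 gt_eqF.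
have [|a' [b' [s' [ab' /andP[s1 s2] zE P]]]] := polar z _ zz0; first by lra.
have ss' : 0 < s' <= pi / `|l| / 4 by rewrite s1 /=; lra.
have sp' := sin_lin_gt0 l0 (small _ ss').
have es : s = s'.
  have := cir_norm l0 z0 s ab; rewrite -/z [in LHS]zE cir_norm//.
  move=> E2.
  have E : sin (l * s') / l = sin (l * s) / l.
    by apply/eqP; rewrite -(@eqrXn2 _ 2 _ _ isT (ltW sp') (ltW sp)) E2.
  rewrite (sin_normM l s') (sin_normM l s) in E.
  have li : `|l|^-1 != 0 by rewrite invr_eq0 gt_eqF.
  move: E => /(mulIf li) E.
  have I x : 0 < x <= pi / `|l| / 4 -> `|l| * x \in `[- (pi / 2), pi / 2].
    move=> /andP[x0 x1]; rewrite in_itv /=; apply/andP; split.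
      by apply: (@le_trans _ _ 0); rewrite ?oppr_le0 ?divr_ge0 ?pi_ge0// mulr_ge0// ltW.
    have : `|l| * x <= `|l| * (pi / `|l| / 4) by rewrite ler_wpM2l.
    have -> : `|l| * (pi / `|l| / 4) = pi / 4 by field; rewrite gt_eqF.
    by have := pi_gt0 R; lra.
  apply/esym; apply: (mulfI (lt0r_neq0 n0)); exact: sin_inj (I _ ss') (I _ ss) E.
rewrite -es in zE P; have sn0 : sin (l * s) != 0.
  by apply: contraTneq sp => ->; rewrite mul0r ltxx.
have [ea eb] := cir_inj l0 sn0 zE.
have [|k1 k2 k3 k4 k5] := P s; first by rewrite s0 lexx.
rewrite -ea -eb -/z in k1 k2 k3 k4 k5; split=> //; [exact: rB|exact: rg].
Unshelve. all: by end_near. Qed.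

End isolated.

(** * Length and completeness *)

Section length.
Context {R : realType}.
Local Notation mu := (@lebesgue_measure R).

Lemma derivable_LR (f df : R -> R) a b : (forall s, drv f s (df s)) -> derivable_oo_LRcontinuous f a b.
Proof.
move=> fd; split.
- by move=> x _; have [] := fd x.
- exact: cvg_at_right_filter (drv_cont (fd a)).
- exact: cvg_at_left_filter (drv_cont (fd b)).
Qed.

Lemma integral_drv (f df : R -> R) a b : a < b -> (forall s, drv f s (df s)) ->
  continuous df -> (\int[mu]_(x in `[a, b]) (df x)%:E = (f b - f a)%:E)%E.
Proof.
move=> ab fd dc; rewrite (@continuous_FTC2 _ df f)//.
- exact: continuous_subspaceT.
- exact: derivable_LR fd.
- by move=> x _; rewrite derive1E; case: (fd x).
Qed.

Lemma integrable_cont (f : R -> R) a b : continuous f -> mu.-integrable `[a, b] (EFin \o f).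
Proof.
by move=> fc; apply: continuous_compact_integrable; [exact: segment_compact|exact: continuous_subspaceT].
Qed.

(** The derivative is controlled from [s] on only: just this end of the curve is known to lie in a
    local section when the estimate is applied. *)
Lemma integral_growth (f df g : R -> R) C s : 0 <= s < 1 -> 0 <= C ->
  (forall x, drv f x (df x)) -> continuous df -> continuous g -> (forall x, 0 <= g x) ->
  (forall x, s <= x <= 1 -> `|df x| <= C * g x) ->
  (`|f 1 - f s|%:E <= C%:E * \int[mu]_(x in `[0%R, 1%R]) (g x)%:E)%E.
Proof.
move=> /andP[s0 s1] C0 fd dc gc g0 H.
have gC : continuous (fun x => C * g x) by move=> x; apply: continuousM; [exact: cst_continuous|exact: gc].
have K h dh : (forall x, drv h x (dh x)) -> continuous dh -> (forall x, s <= x <= 1 -> dh x <= C * g x) ->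
    ((h 1 - h s)%:E <= C%:E * \int[mu]_(x in `[0%R, 1%R]) (g x)%:E)%E.
  move=> hd hc hg; rewrite -(integral_drv s1 hd hc).
  apply: (@le_trans _ _ (\int[mu]_(x in `[s, 1%R]) (C * g x)%:E)%E).
    apply: le_integral => //; [exact: integrable_cont|exact: integrable_cont|].
    by move=> x; rewrite inE /= in_itv /= lee_fin => xs; exact: hg.
  rewrite -integralZl//; last exact: integrable_cont.
  under [X in (_ <= X)%E]eq_integral do rewrite -EFinM.
  apply: ge0_subset_integral => //.
  - have I := @integrable_cont (fun x => C * g x) 0 1 gC; exact: measurable_int I.
  - by move=> x _; rewrite lee_fin mulr_ge0.
  - by move=> x; rewrite /= !in_itv /= => /andP[sx ->]; rewrite (le_trans s0 sx).
have [h|h] := leP 0 (f 1 - f s).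
  by rewrite ger0_norm//; apply: K fd dc _ => x /H; apply: le_trans; exact: ler_norm.
rewrite ltr0_norm//.
have fdN x : drv (fun x => - f x) x (- df x) by exact: drvN.
have dcN : continuous (fun x => - df x) by move=> x; apply: continuousN; exact: dc.
have := K _ _ fdN dcN; rewrite opprB opprK addrC; apply.
by move=> x /H; apply: le_trans; rewrite -normrN; exact: ler_norm.
Qed.

End length.

Lemma drv_coord (R : realType) n (y : R -> 'rV[R]_n) k s : derivable y s 1 ->
  drv (fun r => y r ord0 k) s ('D_1 y s ord0 k).
Proof.
move=> yd; have /derivable_mxP/(_ ord0 k) := yd => ykd.
by rewrite (derive_mx yd) mxE; split.
Qed.

(** * Curves in the surface and the induced distance *)

Section curves.
Context {R : realType} {S : surface R}.
Local Notation V2 := 'rV[R]_2.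
Local Notation H1 := 'rV[R]_3.
Local Notation codom := Defs.codom.
Local Notation coord := Defs.coord.
Local Notation gnorm := Defs.gnorm.
Variables (F N : S -> H1) (H : R).
Hypothesis F_imm : immersion2 F.
Hypothesis N_nrm : unit_normal F N.
Hypothesis F_cmc : constant_mean_curvature F N H.
Local Notation n1 := (n1 N).
Local Notation n2 := (n2 N).
Local Notation n3 := (n3 F N).

(** Some component of [N] in the frame X, Y, T is not zero, and the two other components determine a
    tangent vector. The projection reads these two, with the frame frozen at [F q]. *)
Lemma tangent_proj q : exists P, forall u, tangent F N q u -> prj P u = 0 -> u = 0.
Proof.
have K (x y : R) : vec2 x y = 0 -> x = 0 /\ y = 0.
  move=> E; have h1 : c1 (vec2 x y) = 0 by rewrite E /c1 mxE.
  have h2 : c2 (vec2 x y) = 0 by rewrite E /c2 mxE.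
  by rewrite c1_vec2 in h1; rewrite c2_vec2 in h2.
have Z u : xc u = 0 -> yc u = 0 -> tcomp (F q) u = 0 -> u = 0 :> H1.
  rewrite /tcomp => h1 h2; rewrite h1 h2 !mulr0 subr0 addr0 => h3.
  by apply: rV3P; rewrite ?h1 ?h2 ?h3 /xc /yc /tc mxE.
have T u : - yc (F q) * xc u + xc (F q) * yc u + 1 * tc u = tcomp (F q) u by rewrite /tcomp; ring.
have [a0|a0] := eqVneq (n1 q) 0; last first.
  exists (Proj 0 1 0 (- yc (F q)) (xc (F q)) 1) => u tu; rewrite /prj /= => /K[].
  rewrite T !mul0r mul1r add0r addr0 => h1 h2; apply: Z => //.
  by move: tu; rewrite /tangent h1 h2 !mulr0 !addr0 => /eqP; rewrite mulf_eq0 (negbTE a0) => /eqP.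
have [b0|b0] := eqVneq (n2 q) 0; last first.
  exists (Proj 1 0 0 (- yc (F q)) (xc (F q)) 1) => u tu; rewrite /prj /= => /K[].
  rewrite T !mul0r mul1r !addr0 => h1 h2; apply: Z => //.
  by move: tu; rewrite /tangent h1 h2 !mulr0 !addr0 add0r => /eqP; rewrite mulf_eq0 (negbTE b0) => /eqP.
exists (Pxy (R := R)) => u; apply: Pxy_inj.
apply/eqP => c0; have := normal_unit N_nrm q.
by rewrite a0 b0 c0 expr0n !addr0 => /esym/eqP; rewrite oner_eq0.
Qed.

Lemma curve_drv (c : R -> S) i s0 : C1_curve c -> dom (atlas i) (c s0) ->
  exists v1 v2 : R -> R, [/\ {for s0, continuous v1}, {for s0, continuous v2} &
   \forall s \near s0, dom (atlas i) (c s) /\ drv2 (fun r => coord (atlas i) (c r)) s (v1 s) (v2 s)].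
Proof.
move=> [cc /(_ i)[yc_ yd]] ds0.
pose y := coord (atlas i) \o c.
have nd : \forall s \near s0, dom (atlas i) (c s).
  exact: near_continuous (cc s0) (dom_nbhs ds0).
have [yd1 [dc _]] := yd 1.
exists (fun s => c1 ('D_1 y s)), (fun s => c2 ('D_1 y s)); split.
- by apply: c1_continuous; exact: dc.
- by apply: c2_continuous; exact: dc.
apply: filterS nd => s ds; split=> //.
have yds := yd1 s ds; split; [exact: (drv_coord ord0)|exact: (drv_coord 1)].
Qed.

(** The chart changes along the curve; each chart gives a local formula for the derivative, and the
    formulas agree because they all compute [derive1]. *)
Lemma curve_F (c : R -> S) k : C1_curve c -> let dF := derive1 (F \o c) in
  (forall s, drv (fun r => F (c r) ord0 k) s (dF s ord0 k)) /\ continuous (fun s => dF s ord0 k).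
Proof.
move=> cC dF; have [cc _] := cC.
have near_drv s0 : exists h : 'I_3 -> R -> R, forall k, {for s0, continuous (h k)} /\
    \forall s \near s0, drv (fun r => F (c r) ord0 k) s (h k s).
  have [i is0] := atlas_cover (c s0).
  have [v1 [v2 [v1c v2c nv]]] := curve_drv cC is0.
  pose y s := coord (atlas i) (c s).
  have yc0 : {for s0, continuous y}.
    by have [_ /drv2_cont] := nbhs_singleton nv.
  have Uy0 : codom (atlas i) (y s0) by exact: coord_codom.
  pose G := F \o param (atlas i); pose a k z := 'D_(vec2 1 0) G z ord0 k; pose b k z := 'D_(vec2 0 1) G z ord0 k.
  exists (fun k s => a k (y s) * v1 s + b k (y s) * v2 s) => k'; have kC := chart_C1 F_imm i k'; split.
    apply: continuousD; apply: continuousM => //.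
    - exact: (continuous_comp yc0 (C1_cont1 kC Uy0)).
    - exact: (continuous_comp yc0 (C1_cont2 kC Uy0)).
  apply: filterS nv => s [ds Ds].
  have Uy : codom (atlas i) (y s) by exact: coord_codom.
  apply: drv_near (C1_chain kC Uy Ds).
  apply: filterS (near_continuous (cc s) (dom_nbhs ds)) => r dr.
  by rewrite /= coordK.
have Fd s : derivable (F \o c) s 1.
  apply/derivable_mxP => i j; have [h hP] := near_drv s; rewrite (ord1 i).
  by have [_ /nbhs_singleton[]] := hP j.
have dE s k' : dF s ord0 k' = 'D_1 (fun r => F (c r) ord0 k') s.
  by rewrite /dF derive1E (derive_mx (Fd s)) mxE.
split=> s.
  rewrite dE; have [h hP] := near_drv s.
  have [_ /nbhs_singleton hD] := hP k; by have [d e] := hD; split.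
have [h hP] := near_drv s; have [hc hn] := hP k.
apply: continuous_near_eq hc; apply: filterS hn => r [_ <-].
by rewrite dE.
Qed.

Lemma speed_cont (c : R -> S) : C1_curve c ->
  continuous (fun s => gnorm (F (c s)) (derive1 (F \o c) s)).
Proof.
move=> cC s.
have [X Xd] := curve_F ord0 cC; have [Y Yd] := curve_F 1 cC; have [T Td] := curve_F ord_max cC.
apply: (@continuous_comp _ _ _ (fun s => metric (F (c s)) (derive1 (F \o c) s) (derive1 (F \o c) s)) Num.sqrt); last exact: sqrt_continuous.
have xcc : {for s, continuous (fun s => xc (F (c s)))} := drv_cont (X s).
have ycc : {for s, continuous (fun s => yc (F (c s)))} := drv_cont (Y s).
have dx : {for s, continuous (fun s => xc (derive1 (F \o c) s))} := Xd s.
have dy : {for s, continuous (fun s => yc (derive1 (F \o c) s))} := Yd s.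
have dt : {for s, continuous (fun s => tc (derive1 (F \o c) s))} := Td s.
have tt : {for s, continuous (fun s => tcomp (F (c s)) (derive1 (F \o c) s))}.
  by apply: continuousD; [apply: continuousB => //|]; apply: continuousM.
by apply: continuousD; [apply: continuousD|]; apply: continuousM.
Qed.

Lemma gnorm_ge (p u : H1) : [/\ `|xc u| <= gnorm p u, `|yc u| <= gnorm p u & `|tcomp p u| <= gnorm p u].
Proof.
have K (a m : R) : a * a <= m -> `|a| <= Num.sqrt m.
  by move=> am; rewrite -sqrtr_sqr ler_wsqrtr// expr2.
have := (sqr_ge0 (xc u), sqr_ge0 (yc u), sqr_ge0 (tcomp p u)); rewrite !expr2 => -[[h1 h2] h3].
by split; apply: K; rewrite /metric; lra.
Qed.

(* Followed backwards from [q], the projection of the curve moves by at most a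
   constant times its length as long as the curve stays in a local section. *)
Lemma short_curve q V : nbhs q V -> exists2 e, 0 < e &
  forall c, C1_curve c -> c 1 = q -> (curve_length F c < e%:E)%E -> V (c 0).
Proof.
move=> qV; have [i iq] := atlas_cover q; have [P Pinj] := tangent_proj q.
have [sec _] := local_section F_imm N_nrm F_cmc iq Pinj.
set zq := prj P (F q); have Bq : ls_B sec zq by exact: ballxx (ls_r0 sec).
have kq : ls_kap sec zq = q by exact: ls_UK (ls_Uq sec).
have kc := ls_kapc Bq.
pose M := `|xc (F q)| + `|yc (F q)| + 1.
have nF : \forall z \near zq, ls_B sec z /\ (V (ls_kap sec z) /\
    (`|xc (F (ls_kap sec z))| < M /\ `|yc (F (ls_kap sec z))| < M)).
  have Fc : {for q, continuous F} by exact: F_cont.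
  have xcn : \forall q' \near q, `|xc (F q')| < M.
    have c := xc_cont Fc; have /cvgrPdist_lt/(_ 1 ltr01) := c.
    apply: filterS => q' h; rewrite distrC in h.
    have h2 := ler_normD (xc (F q)) (xc (F q') - xc (F q)); rewrite subrKC in h2.
    by have := normr_ge0 (yc (F q)); rewrite /M; lra.
  have ycn : \forall q' \near q, `|yc (F q')| < M.
    have c := yc_cont Fc; have /cvgrPdist_lt/(_ 1 ltr01) := c.
    apply: filterS => q' h; rewrite distrC in h.
    have h2 := ler_normD (yc (F q)) (yc (F q') - yc (F q)); rewrite subrKC in h2.
    by have := normr_ge0 (xc (F q)); rewrite /M; lra.
  apply: filterI; first exact: open_nbhs_nbhs (conj (ball_open _ _) Bq).
  have nn : nbhs (ls_kap sec zq) [set q' | V q' /\ (`|xc (F q')| < M /\ `|yc (F q')| < M)].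
    by rewrite kq; apply: filterI => //; exact: filterI.
  exact: near_continuous kc nn.
have {nF}[r /= r0 Hr] : exists2 r : R, 0 < r & forall z, `|zq - z| < r -> ls_B sec z /\ (V (ls_kap sec z) /\
    (`|xc (F (ls_kap sec z))| < M /\ `|yc (F (ls_kap sec z))| < M)).
  by move: nF => /nbhs_ballP[r /= r0 Hr]; exists r => // z zr; apply: Hr; rewrite -ball_normE.
have M0 : 0 < M by rewrite ltr_wpDl// addr_ge0.
(* [C] times the speed bounds the velocity of the projected curve: [tc] differs from the T-component
   by at most [2 * M] times the speed. *)
pose C := `|pa P| + `|pb P| + `|pc P| * (1 + 2 * M) + (`|qa P| + `|qb P| + `|qc P| * (1 + 2 * M)) + 1.
have M20 : 0 <= 1 + 2 * M by rewrite addr_ge0// mulr_ge0// ltW.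
have C0 : 0 < C by rewrite ltr_wpDl// !addr_ge0// mulr_ge0.
exists (r / 4 / C) => [|c cC c1q cl]; first by rewrite !divr_gt0.
pose xi s := prj P (F (c s)).
have [cc _] := cC.
have xic s : {for s, continuous xi}.
  by apply: prj_cont; apply: (continuous_comp (cc s)); exact: F_cont.
pose g s := gnorm (F (c s)) (derive1 (F \o c) s).
have gc : continuous g by exact: speed_cont.
have g0 s : 0 <= g s by exact: sqrtr_ge0.
have [X Xd] := curve_F ord0 cC; have [Y Yd] := curve_F 1 cC; have [T Td] := curve_F ord_max cC.
set dF := derive1 (F \o c) in X Xd Y Yd T Td.
have lin (a b d : R) s : c s = ls_kap sec (xi s) -> `|zq - xi s| < r -> 
   `|a * dF s ord0 ord0 + b * dF s ord0 1 + d * dF s ord0 ord_max| <= (`|a| + `|b| + `|d| * (1 + 2 * M)) * g s.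
  move=> cs xs; have [_ [_]] := Hr _ xs; rewrite -cs => -[/ltW xM /ltW yM].
  have [gx gy gt] := gnorm_ge (F (c s)) (dF s).
  rewrite -/(xc (dF s)) -/(yc (dF s)) -/(tc (dF s)) -/(g s).
  have tE : tc (dF s) = tcomp (F (c s)) (dF s) + yc (F (c s)) * xc (dF s) - xc (F (c s)) * yc (dF s).
    by rewrite /tcomp; ring.
  have tb : `|tc (dF s)| <= (1 + 2 * M) * g s.
    rewrite tE (_ : (1 + 2 * M) * g s = g s + M * g s + M * g s); last by ring.
    rewrite (le_trans (ler_normB _ _))// lerD//; last by rewrite normrM ler_pM.
    by rewrite (le_trans (ler_normD _ _))// lerD// normrM ler_pM.
  have -> : (`|a| + `|b| + `|d| * (1 + 2 * M)) * g s = `|a| * g s + `|b| * g s + `|d| * ((1 + 2 * M) * g s) by ring.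
  rewrite (le_trans (ler_normD _ _))// lerD//; last by rewrite normrM ler_wpM2l.
  by rewrite (le_trans (ler_normD _ _))// lerD// normrM ler_wpM2l.
have len s : 0 <= s < 1 -> (forall x, s <= x <= 1 -> c x = ls_kap sec (xi x) /\ `|zq - xi x| < r) ->
    `|xi s - zq| <= r / 4.
  move=> s01 H1.
  have K (a b d : R) : `|a| + `|b| + `|d| * (1 + 2 * M) <= C ->
      `|(a * xc (F (c 1)) + b * yc (F (c 1)) + d * tc (F (c 1))) - (a * xc (F (c s)) + b * yc (F (c s)) + d * tc (F (c s)))| <= r / 4.
    move=> abC; pose f x := a * xc (F (c x)) + b * yc (F (c x)) + d * tc (F (c x)).
    pose df x := a * dF x ord0 ord0 + b * dF x ord0 1 + d * dF x ord0 ord_max.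
    have fd x : drv f x (df x) by apply: drvD; [apply: drvD|]; apply: drvZ; [exact: X|exact: Y|exact: T].
    have dfc : continuous df.
      have cM (k : R) (h : R -> R) : continuous h -> continuous (fun x => k * h x).
        by move=> hc x; apply: continuousM; [exact: cst_continuous|exact: hc].
      have cD (h h2 : R -> R) : continuous h -> continuous h2 -> continuous (fun x => h x + h2 x).
        by move=> hc hc2 x; apply: continuousD; [exact: hc|exact: hc2].
      by apply: (cD); [apply: (cD)|]; exact: (cM).
    have bd x : s <= x <= 1 -> `|df x| <= C * g x.
      by move=> /H1[e1 e2]; apply: (le_trans (lin a b d x e1 e2)); rewrite ler_wpM2r.
    have := integral_growth s01 (ltW C0) fd dfc gc g0 bd.
    rewrite -/(f 1) -/(f s) => h; rewrite -lee_fin; apply: (le_trans h).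
    have -> : (r / 4)%:E = (C%:E * (r / 4 / C)%:E)%E by rewrite -EFinM; congr EFin; field; rewrite gt_eqF.
    by rewrite lee_pmul2l//; exact: ltW.
  have Ca : `|pa P| + `|pb P| + `|pc P| * (1 + 2 * M) <= C.
    have : 0 <= `|qa P| + `|qb P| + `|qc P| * (1 + 2 * M) by rewrite !addr_ge0// mulr_ge0.
    by rewrite /C; lra.
  have Cb : `|qa P| + `|qb P| + `|qc P| * (1 + 2 * M) <= C.
    have : 0 <= `|pa P| + `|pb P| + `|pc P| * (1 + 2 * M) by rewrite !addr_ge0// mulr_ge0.
    by rewrite /C; lra.
  have k1 := K _ _ _ Ca; have k2 := K _ _ _ Cb; rewrite c1q in k1 k2.
  rewrite distrC; apply: norm2_le; rewrite (c1B, c2B) /zq /xi /prj (c1_vec2, c2_vec2) ?c1_vec2 ?c2_vec2; assumption.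
(* Real induction in the time counted back from 1. The length bound yields [r / 4], so the closed
   condition [r / 2] is always satisfied with room. Membership in [ls_U] passes to limits since [S]
   is Hausdorff and the section is continuous. *)
pose Q t := ls_U sec (c (1 - t)) /\ `|xi (1 - t) - zq| <= r / 2.
have r24 : r / 4 < r / 2 by lra.
have r2 : r / 2 < r by lra.
have Qk t : Q t -> c (1 - t) = ls_kap sec (xi (1 - t)) /\ `|zq - xi (1 - t)| < r.
  by move=> [h1 h2]; split; [rewrite /xi ls_UK|rewrite distrC (le_lt_trans h2)].
have tc1 (t : R) : {for t, continuous (fun t : R => c (1 - t))}.
  have : {for t, continuous (fun t : R => 1 - t)} by apply: continuousB; [exact: cst_continuous|exact: cvg_id].
  by move=> h; exact: (continuous_comp h (cc _)).
have txi (t : R) : {for t, continuous (fun t : R => xi (1 - t))}.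
  have : {for t, continuous (fun t : R => 1 - t)} by apply: continuousB; [exact: cst_continuous|exact: cvg_id].
  by move=> h; exact: (continuous_comp h (@xic _)).
have ndist (t : R) : {for t, continuous (fun t : R => `|xi (1 - t) - zq|)}.
  apply: (@continuous_comp _ _ _ (fun t : R => xi (1 - t) - zq) (fun z => `|z|)); last exact: norm_continuous.
  by apply: continuousB; [exact: txi|exact: cst_continuous].
have QA : forall t, 0 <= t <= 1 -> Q t.
  apply: real_induction.
  - by rewrite /Q /xi subr0 c1q subrr normr0; split; [exact: ls_Uq|rewrite divr_ge0// ltW].
  - move=> t /andP[t0 t1] Ht.
    have lt2 : `|xi (1 - t) - zq| < r / 2.
      move: t0; rewrite le_eqVlt => /predU1P[<-|t0].
        by rewrite /xi subr0 c1q subrr normr0 divr_gt0.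
      apply: le_lt_trans (len (1 - t) _ _) r24; first by rewrite subr_ge0 (ltW t1) /= gtrBl.
      move=> x /andP[x1 x2]; have := Qk (1 - x); rewrite subKr; apply; apply: Ht.
      by rewrite subr_ge0 x2 /= lerBlDr -lerBlDl.
    have [Ut _] := Ht t ltac:(by rewrite t0 lexx).
    have n1 : \forall x \near t, ls_U sec (c (1 - x)).
      exact: near_continuous (@tc1 t) (open_nbhs_nbhs (conj (ls_Uo sec) Ut)).
    have n2 : \forall x \near t, `|xi (1 - x) - zq| < r / 2.
      exact: near_continuous (@ndist t) (open_nbhs_nbhs (conj (@open_lt R (r / 2)) lt2)).
    have : \forall x \near t, ls_U sec (c (1 - x)) /\ `|xi (1 - x) - zq| < r / 2 by exact: filterI.
    move=> /nbhs_ballP[e /= e0 He]; exists e => // x /andP[tx xe].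
    have [|h1 h2] := He x; first by rewrite /ball /= distrC gtr0_norm ?subr_gt0// ltrBlDl.
    by split=> //; exact: ltW.
  - move=> t /andP[t0 t1] Ht.
    have tl : `|xi (1 - t) - zq| <= r / 2.
      have L : (fun t : R => `|xi (1 - t) - zq|) x @[x --> t^'-] --> `|xi (1 - t) - zq|.
        exact: cvg_at_left_filter (@ndist t).
      apply: (cvgr_to_le L).
      near=> x; have [] // : Q x; apply: Ht; apply/andP; split.
        by near: x; exact: nbhs_left_ge.
      by near: x; exact: nbhs_left_lt.
    have Bt : ls_B sec (xi (1 - t)) by have [] // := Hr (xi (1 - t)); rewrite distrC (le_lt_trans tl).
    have kt : {for t, continuous (fun t : R => ls_kap sec (xi (1 - t)))}.
      exact: (continuous_comp (@txi t) (ls_kapc Bt)).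
    have L1 : (fun t : R => c (1 - t)) x @[x --> t^'-] --> c (1 - t) by exact: cvg_at_left_filter (@tc1 t).
    have L2 : (fun t : R => ls_kap sec (xi (1 - t))) x @[x --> t^'-] --> ls_kap sec (xi (1 - t)).
      exact: cvg_at_left_filter kt.
    have E : c (1 - t) = ls_kap sec (xi (1 - t)).
      apply: (@cvg_unique _ (@surface_hausdorff _ S) (c (1 - x) @[x --> t^'-])) => //.
      apply: cvg_trans L2; apply: near_eq_cvg; near=> x.
      have [] // := Qk x; apply: Ht; apply/andP; split.
        by near: x; exact: nbhs_left_ge.
      by near: x; exact: nbhs_left_lt.
    by split=> //; rewrite E; exact: ls_kapU.
have [|U0 x0] := QA 1; first by rewrite ler01 lexx.
rewrite subrr in U0 x0.
have [] := Hr (xi 0); first by rewrite distrC (le_lt_trans x0).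
by rewrite /xi ls_UK// => _ [].
Unshelve. all: by end_near. Qed.

Lemma idist_cvg (u : nat -> S) q : idist F (u n) q @[n --> \oo] --> 0%E -> u n @[n --> \oo] --> q.
Proof.
move=> h V /short_curve[e e0 Ve].
have nb : nbhs (0%E : \bar R) [set x | (x < e%:E)%E].
  by apply: open_nbhs_nbhs; split; [exact: open_ereal_lt_ereal|rewrite /= lte_fin].
have hn : \forall n \near \oo, (idist F (u n) q < e%:E)%E := h _ nb.
change (\forall n \near \oo, V (u n)).
apply: filterS hn => n /ereal_inf_lt[l [c [cC c0 c1' ->]] cl].
by rewrite -c0; exact: Ve.
Qed.

End curves.

Lemma continuous_ext (T U : topologicalType) (f g : T -> U) x : (forall t, f t = g t) ->
  {for x, continuous f} -> {for x, continuous g}.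
Proof. by move=> /funext ->. Qed.

(** * Uniqueness of lifts *)

Section lifts.
Context {R : realType} {S : topologicalType}.
Hypothesis S_T2 : hausdorff_space S.

Lemma eq_limit_left (c c' : R -> S) a s : a < s -> {for s, continuous c} -> {for s, continuous c'} ->
  (forall r, a <= r < s -> c r = c' r) -> c s = c' s.
Proof.
move=> as_ cc cc' E.
have L1 : c x @[x --> s^'-] --> c s by exact: cvg_at_left_filter cc.
have L2 : c' x @[x --> s^'-] --> c' s by exact: cvg_at_left_filter cc'.
apply: (@cvg_unique _ S_T2 (c x @[x --> s^'-])) => //.
apply: cvg_trans L2; apply: near_eq_cvg; near=> x.
apply/esym/E/andP; split.
  by near: x; exact: nbhs_left_ge.
by near: x; exact: nbhs_left_lt.
Unshelve. all: by end_near. Qed.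

(** The set of agreement is open to the right by local injectivity of [G], and closed because [S] is
    Hausdorff. *)
Lemma lift_unique_right (X : Type) (G : S -> X) (c c' : R -> S) a b : 
  (forall s, a <= s <= b -> [/\ {for s, continuous c}, {for s, continuous c'} & G (c s) = G (c' s)]) ->
  (forall s, a <= s <= b -> exists U, [/\ open U, U (c s) & forall x y, U x -> U y -> G x = G y -> x = y]) ->
  c a = c' a -> forall s, a <= s <= b -> c s = c' s.
Proof.
move=> H UG ca; apply: real_induction => // s.
- move=> /andP[as_ sb] E; have sab : a <= s <= b by rewrite as_ ltW.
  have [cc cc' _] := H s sab; have [U [oU Us Ui]] := UG s sab.
  have cs : c s = c' s by apply: E; rewrite as_ lexx.
  have n1 : \forall r \near s, U (c r) by exact: near_continuous cc (open_nbhs_nbhs (conj oU Us)).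
  have n2 : \forall r \near s, U (c' r).
    by apply: near_continuous cc' _; rewrite -cs; exact: open_nbhs_nbhs (conj oU Us).
  have : \forall r \near s, U (c r) /\ U (c' r) by exact: filterI.
  move=> /nbhs_ballP[e /= e0 He]; exists (Num.min e (b - s)) => [|r /andP[sr re]].
    by rewrite lt_min e0 subr_gt0.
  have [re1 re2] : r < s + e /\ r <= b.
    split; apply: (lt_le_trans re) || (apply/ltW/(lt_le_trans re)).
      by rewrite lerD2l ge_min lexx.
    by rewrite -lerBrDl ge_min lexx orbT.
  have [|U1 U2] := He r; first by rewrite /ball /= distrC gtr0_norm ?subr_gt0// ltrBlDl.
  have [|_ _ Gr] := H r; first by rewrite re2 andbT (le_trans as_ (ltW sr)).
  exact: Ui.
- move=> /andP[as_ sb] E; have [|cc cc' _] := H s; first by rewrite ltW.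
  exact: eq_limit_left as_ cc cc' E.
Qed.

Lemma lift_unique (X : Type) (G : S -> X) (c c' : R -> S) a b s0 : a <= s0 <= b ->
  (forall s, a <= s <= b -> [/\ {for s, continuous c}, {for s, continuous c'} & G (c s) = G (c' s)]) ->
  (forall s, a <= s <= b -> exists U, [/\ open U, U (c s) & forall x y, U x -> U y -> G x = G y -> x = y]) ->
  c s0 = c' s0 -> forall s, a <= s <= b -> c s = c' s.
Proof.
move=> /andP[as0 s0b] H UG c0 s /andP[as_ sb].
have [ss|/ltW ss] := leP s0 s.
  apply: (@lift_unique_right X G c c' s0 b) => // [r /andP[r1 r2]|r /andP[r1 r2]|].
  - by apply: H; rewrite r2 (le_trans as0).
  - by apply: UG; rewrite r2 (le_trans as0).
  - by rewrite ss.
have Nc (f : R -> S) r : {for - r, continuous f} -> {for r, continuous (fun x => f (- x))}.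
  move=> fc; have nc : {for r, continuous (fun x : R => - x)} by apply: continuousN; exact: cvg_id.
  exact: continuous_comp nc fc.
have := @lift_unique_right X G (fun r => c (- r)) (fun r => c' (- r)) (- s0) (- a).
rewrite opprK => /(_ _ _ c0 (- s)); rewrite opprK; apply.
- move=> r /andP[r1 r2]; have [|c1_ c2_ E] := H (- r).
    by rewrite lerNr r2 (le_trans _ s0b)// lerNl.
  by split=> //; exact: Nc.
- move=> r /andP[r1 r2]; apply: UG.
  by rewrite lerNr r2 (le_trans _ s0b)// lerNl.
- by rewrite !lerN2 ss.
Qed.

End lifts.

Lemma ord2P (k : 'I_2) : k = ord0 \/ k = 1.
Proof. by case: k => -[|[|//]] k2; [left|right]; exact: val_inj. Qed.

Lemma ord3P (k : 'I_3) : [\/ k = ord0, k = 1 | k = ord_max].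
Proof. by case: k => -[|[|[|//]]] k3; [apply: Or31|apply: Or32|apply: Or33]; exact: val_inj. Qed.

(** * Limits of lifted geodesics in a complete surface *)

Section characteristic_curves.
Context {R : realType} {S : surface R}.
Local Notation V2 := 'rV[R]_2.
Local Notation H1 := 'rV[R]_3.
Local Notation codom := Defs.codom.
Local Notation coord := Defs.coord.
Local Notation gnorm := Defs.gnorm.
Variables (F N : S -> H1) (H : R).
Hypothesis F_imm : immersion2 F.
Hypothesis N_nrm : unit_normal F N.
Hypothesis F_cmc : constant_mean_curvature F N H.
Hypothesis F_complete : complete_surface F.

Lemma section_inj i q P (sec : lsec F N H i q P) x y : ls_U sec x -> ls_U sec y ->
  prj P (F x) = prj P (F y) -> x = y.
Proof. by move=> Ux Uy E; rewrite -(ls_UK Ux) -(ls_UK Uy) E. Qed.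

Lemma locally_injective q : exists U, [/\ open U, U q & forall x y, U x -> U y -> F x = F y -> x = y].
Proof.
have [i iq] := atlas_cover q; have [P Pinj] := tangent_proj N_nrm q.
have [sec _] := local_section F_imm N_nrm F_cmc iq Pinj.
exists (ls_U sec); split; [exact: ls_Uo|exact: ls_Uq|] => x y Ux Uy E.
by apply: section_inj Ux Uy _; rewrite E.
Qed.

Variables (l : R) (gam : R -> H1) (s1 s2 : R -> R) (c : R -> S) (a b : R).
Hypothesis gam_geod : geod l gam s1 s2.
Hypothesis gam_unit : forall s, s1 s ^+ 2 + s2 s ^+ 2 = 1.
Hypothesis cc : forall s, a < s < b -> {for s, continuous c}.
Hypothesis Fc : forall s, a < s < b -> F (c s) = gam s.

Lemma geod_cont s : {for s, continuous gam}.
Proof.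
have [gx gy gt _ _] := gam_geod s.
apply: rV_continuous => k.
by case: (ord3P k) => ->; [exact: drv_cont gx|exact: drv_cont gy|exact: drv_cont gt].
Qed.

(** A C^1 curve has to be defined on the whole line, but [c] is controlled on the open interval
    only. This parametrization oscillates between [t] and [t'], and it is monotone on [[0, 1]], so
    no length is wasted. *)
Let sg t t' (s : R) := t + (t' - t) * ((1 - cos (pi * s)) / 2).
Let dsg t t' (s : R) := (t' - t) * (pi / 2 * sin (pi * s)).

Lemma sg_drv t t' s : drv (sg t t') s (dsg t t' s).
Proof.
have D := drvD (drv_cst t s) (drvZ (t' - t) (drvM (drvB (drv_cst 1 s) (drv_cos (drvZ pi (drv_id s)))) (drv_cst 2^-1 s))).
by refine (drv_eq D _); rewrite /dsg; ring.
Qed.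

Lemma sg_range t t' s : a < t < b -> a < t' < b -> a < sg t t' s < b.
Proof.
move=> /andP[t1 t2] /andP[t3 t4]; rewrite /sg.
set k := (1 - cos (pi * s)) / 2.
have k0 : 0 <= k by rewrite divr_ge0// subr_ge0 cos_le1.
have k1 : k <= 1.
  by rewrite ler_pdivrMr// mul1r lerBlDr -[2]/(1 + 1) -addrA lerDl -lerBlDl sub0r cos_geN1.
have -> : t + (t' - t) * k = t * (1 - k) + t' * k by ring.
have k10 : 0 <= 1 - k by rewrite subr_ge0.
have E (x : R) : x = x * (1 - k) + x * k by ring.
have [kz|kz] := eqVneq k 0; first by rewrite kz subr0 !mulr1 !mulr0 !addr0 t1.
have kp : 0 < k by rewrite lt_neqAle eq_sym kz.
apply/andP; split.
- by rewrite [ltLHS]E ler_ltD ?ltr_pM2r// ler_wpM2r// ltW.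
- by rewrite [ltRHS]E ler_ltD ?ltr_pM2r// ler_wpM2r// ltW.
Qed.

Lemma drv_derivable (V : normedModType R) (f : R -> V) s v : derivable f s 1 ->
  derivable f s v /\ 'D_v f s = v *: 'D_1 f s.
Proof.
move=> /derivable1_diffP fd; split; first exact: diff_derivable.
by rewrite !deriveE// -[X in 'd f s X]mulr1 [v * 1]/(v *: 1) linearZ.
Qed.

Lemma drv2_derivable (y : R -> V2) s v1 v2 : drv2 y s v1 v2 -> derivable y s 1 /\ 'D_1 y s = vec2 v1 v2.
Proof.
move=> [[y1 e1] [y2 e2]]; have yd : derivable y s 1.
  apply/derivable_mxP => i j; rewrite (ord1 i).
  by case: (ord2P j) => ->; [exact: y1|exact: y2].
split; first exact: yd.
rewrite (derive_mx yd); apply: rV2P; rewrite ?c1_vec2 ?c2_vec2 /c1 /c2 mxE.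
- exact: e1.
- exact: e2.
Qed.

(** [c] is only continuous by hypothesis; in a local section it is the lift of the smooth curve
    [prj P (gam s)], whence its derivative in charts. *)
Lemma char_C1_curve t t' : a < t < b -> a < t' < b -> C1_curve (c \o sg t t').
Proof.
move=> tab tab'; have sr s := sg_range s tab tab'.
have sc s : {for s, continuous (sg t t')} by exact: drv_cont (sg_drv t t' s).
have ccs : continuous (c \o sg t t').
  by move=> s; apply: continuous_comp; [exact: sc|exact: cc].
split; first exact: ccs.
move=> i; pose y := coord (atlas i) \o (c \o sg t t').
have K s0 : dom (atlas i) (c (sg t t' s0)) -> exists v1 v2 : R -> R,
    [/\ {for s0, continuous v1}, {for s0, continuous v2} & \forall s \near s0, drv2 y s (v1 s) (v2 s)].
  move=> ds0; pose q := c (sg t t' s0).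
  have [P Pinj] := tangent_proj N_nrm q.
  have [sec _] := local_section F_imm N_nrm F_cmc ds0 Pinj.
  have [e11 [e12 e1C]] := ls_e1C sec; have [e21 [e22 e2C]] := ls_e2C sec.
  pose xi s := prj P (gam (sg t t' s)).
  pose w s := vec3 (s1 s) (s2 s) (yc (gam s) * s1 s - xc (gam s) * s2 s).
  pose u1 s := dsg t t' s * c1 (prj P (w (sg t t' s))); pose u2 s := dsg t t' s * c2 (prj P (w (sg t t' s))).
  have xD s : drv2 xi s (u1 s) (u2 s).
    have [D1 D2] := geod_drv2 P (sg t t' s) gam_geod.
    by split; [refine (drv_eq (drv_comp (sg_drv t t' s) D1) _)|refine (drv_eq (drv_comp (sg_drv t t' s) D2) _)]; rewrite mulrC.
  have xic s : {for s, continuous xi} by exact: drv2_cont (xD s).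
  have Us0 : ls_U sec (c (sg t t' s0)) by exact: ls_Uq.
  have xB0 : ls_B sec (xi s0) by rewrite /xi -Fc ?sr//; exact: ls_UB.
  have nU : \forall s \near s0, ls_U sec (c (sg t t' s)).
    exact: near_continuous (ccs s0) (open_nbhs_nbhs (conj (ls_Uo sec) Us0)).
  have nB : \forall s \near s0, ls_B sec (xi s).
    exact: near_continuous (@xic s0) (open_nbhs_nbhs (conj (ball_open _ _) xB0)).
  have wc s : {for s, continuous (fun s => prj P (w s))}.
    have [gx gy gt g1 g2] := gam_geod s.
    have gc := drv_cont gx; have gc' := drv_cont gy; have h1 := drv_cont g1; have h2 := drv_cont g2.
    have cM (k : R) (h : R -> R) : {for s, continuous h} -> {for s, continuous (fun x => k * h x)}.
      by move=> hc; apply: continuousM; [exact: cst_continuous|exact: hc].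
    have cD (h h' : R -> R) : {for s, continuous h} -> {for s, continuous h'} -> {for s, continuous (fun x => h x + h' x)}.
      by move=> hc hc'; apply: continuousD.
    have ht : {for s, continuous (fun s => yc (gam s) * s1 s - xc (gam s) * s2 s)}.
      by apply: continuousB; apply: continuousM.
    have e k1 k2 k3 : {for s, continuous (fun s => k1 * s1 s + k2 * s2 s + k3 * (yc (gam s) * s1 s - xc (gam s) * s2 s))}.
      by apply: (cD); [apply: (cD)|]; exact: (cM).
    rewrite /prj /w; apply: vec2_continuous.
    - refine (continuous_ext _ (e (pa P) (pb P) (pc P))).
      by move=> r; rewrite /= xc_vec3 yc_vec3 tc_vec3.
    - refine (continuous_ext _ (e (qa P) (qb P) (qc P))).
      by move=> r; rewrite /= xc_vec3 yc_vec3 tc_vec3.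
  have dc s : {for s, continuous (dsg t t')}.
    have D := drvZ (t' - t) (drvZ (pi / 2) (drv_sin (drvZ pi (drv_id s)))).
    exact: drv_cont D.
  have wsc s : {for s, continuous (fun s => prj P (w (sg t t' s)))} by exact: (continuous_comp (sc s) (wc _)).
  have u1c s : {for s, continuous u1} by apply: continuousM; [exact: dc|exact: c1_continuous (wsc s)].
  have u2c s : {for s, continuous u2} by apply: continuousM; [exact: dc|exact: c2_continuous (wsc s)].
  have cmp (e : V2 -> R) : {for xi s0, continuous e} -> {for s0, continuous (fun s => e (xi s))}.
    by move=> ec; exact: (continuous_comp (@xic s0) ec).
  exists (fun s => e11 (xi s) * u1 s + e12 (xi s) * u2 s), (fun s => e21 (xi s) * u1 s + e22 (xi s) * u2 s); split.
  - apply: continuousD; apply: continuousM; (exact: u1c || exact: u2c || apply: cmp).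
    + exact: (C1_cont1 e1C xB0).
    + exact: (C1_cont2 e1C xB0).
  - apply: continuousD; apply: continuousM; (exact: u1c || exact: u2c || apply: cmp).
    + exact: (C1_cont1 e2C xB0).
    + exact: (C1_cont2 e2C xB0).
  have nn : \forall s \near s0, ls_B sec (xi s) /\ (\forall r \near s, ls_U sec (c (sg t t' r))).
    have nU2 : \forall s \near s0, \forall r \near s, ls_U sec (c (sg t t' r)) := nbhs_interior nU.
    exact: filterI.
  apply: filterS nn => s [Bs Un].
  have E : \forall r \near s, coord (atlas i) (ls_kap sec (xi r)) = y r.
    by apply: filterS Un => r Ur; rewrite /xi -Fc ?sr// ls_UK.
  split; [apply: drv_near (C1_chain e1C Bs (xD s))|apply: drv_near (C1_chain e2C Bs (xD s))];
    by apply: filterS E => r /= ->.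
split=> [s ds|v].
  by have [v1 [v2 [_ _ /nbhs_singleton/drv2_cont]]] := K s ds.
split=> [s ds|].
  have [v1 [v2 [_ _ /nbhs_singleton/drv2_derivable[yd _]]]] := K s ds.
  by have [] := drv_derivable v yd.
split; last exact: I.
move=> s ds; have [v1 [v2 [v1c v2c nD]]] := K s ds.
apply: (@continuous_near_eq _ _ (fun s => (v : R) *: vec2 (v1 s) (v2 s))).
  apply: filterS nD => r /drv2_derivable[yd <-].
  by have [_ ->] := drv_derivable v yd.
apply: rV_continuous => k; rewrite /=.
have cM (h : R -> R) : {for s, continuous h} -> {for s, continuous (fun x => (v : R) * h x)}.
  by move=> hc; apply: continuousM; [exact: cst_continuous|exact: hc].
case: (ord2P k) => ->.
- refine (continuous_ext _ (cM _ v1c)).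
  by move=> r; rewrite mxE [vec2 _ _ _ _]c1_vec2.
- refine (continuous_ext _ (cM _ v2c)).
  by move=> r; rewrite mxE [vec2 _ _ _ _]c2_vec2.
Qed.

(** The geodesic has unit speed, so on [[0, 1]] the speed of the reparametrized curve is the
    derivative of the primitive [L]. *)
Lemma char_idist t t' : a < t < b -> a < t' < b -> (idist F (c t) (c t') <= `|t' - t|%:E)%E.
Proof.
move=> tab tab'; have sr s := sg_range s tab tab'.
apply: ereal_inf_lbound; exists (c \o sg t t'); split.
- exact: char_C1_curve.
- by rewrite /= /sg mulr0 cos0 subrr mul0r mulr0 addr0.
- by rewrite /= /sg mulr1 cospi opprK -[1 + 1]/2 divff// mulr1 subrKC.
pose L s := `|t' - t| * ((1 - cos (pi * s)) / 2); pose dL s := `|t' - t| * (pi / 2 * sin (pi * s)).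
have LD s : drv L s (dL s).
  have D := drvZ `|t' - t| (drvM (drvB (drv_cst 1 s) (drv_cos (drvZ pi (drv_id s)))) (drv_cst 2^-1 s)).
  by refine (drv_eq D _); rewrite /dL; ring.
have dLc : continuous dL.
  by move=> s; exact: drv_cont (drvZ `|t' - t| (drvZ (pi / 2) (drv_sin (drvZ pi (drv_id s))))).
have E1 : (`|t' - t| = L 1 - L 0)%R.
  by rewrite /L mulr1 mulr0 cospi cos0 subrr mul0r mulr0 subr0 opprK -[1 + 1]/2 divff// mulr1.
rewrite E1 -(integral_drv ltr01 LD dLc) /curve_length.
apply: eq_integral => s; rewrite inE /= in_itv /= => /andP[sp0 sp1]; congr EFin.
have -> : F \o (c \o sg t t') = fun s => vec3 (xc (gam (sg t t' s))) (yc (gam (sg t t' s))) (tc (gam (sg t t' s))).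
  by apply/funext => r; rewrite /= -vec3E Fc.
have [gx gy gt _ _] := gam_geod (sg t t' s).
have D := sg_drv t t' s.
rewrite derive1E (derive_vec3 (drv_comp D gx) (drv_comp D gy) (drv_comp D gt)) /= Fc//.
rewrite /gnorm /metric /tcomp xc_vec3 yc_vec3 tc_vec3.
move: (gam_unit (sg t t' s)); move: (s1 _) (s2 _) (xc _) (yc _) => p q x y pq.
have -> : (p * dsg t t' s * (p * dsg t t' s) + q * dsg t t' s * (q * dsg t t' s) +
   ((y * p - x * q) * dsg t t' s - y * (p * dsg t t' s) + x * (q * dsg t t' s)) *
   ((y * p - x * q) * dsg t t' s - y * (p * dsg t t' s) + x * (q * dsg t t' s))) = dsg t t' s ^+ 2 * (p ^+ 2 + q ^+ 2) by ring.
rewrite pq mulr1 sqrtr_sqr /dsg normrM; congr (_ * _).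
rewrite ger0_norm// mulr_ge0// ?divr_ge0 ?pi_ge0// sin_ge0_pi// mulr_ge0 ?pi_ge0//=.
by rewrite ler_piMr ?pi_ge0.
Qed.

Hypothesis ab : a < b.

(* Completeness gives a limit along one sequence; uniqueness of lifts in a local
   section at the limit then gives convergence of the whole curve. *)
Lemma char_limit : exists q, F q = gam b /\
  forall i P (sec : lsec F N H i q P) r, 0 < r ->
    exists2 t, a < t < b & forall s, t <= s < b ->
      [/\ ls_B sec (prj P (gam s)), `|prj P (F q) - prj P (gam s)| < r & c s = ls_kap sec (prj P (gam s))].
Proof.
(* A sequence tending to [b] from the left; with [n.+2] the first term is the midpoint, with [n.+1]
   it would be [a]. *)
pose t (n : nat) := b - (b - a) / n.+2%:R.
have ba : 0 < b - a by rewrite subr_gt0.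
have tab n : a < t n < b.
  rewrite /t ltrBrDl -ltrBrDr ltr_pdivrMr// ltr_pMr// ltr1n /=.
  by rewrite ltrBlDr ltrDl divr_gt0.
have tc_ : t n @[n --> \oo] --> b.
  rewrite -[X in _ --> X]subr0; apply: cvgB; first exact: cvg_cst.
  rewrite -[X in _ --> X](mulr0 (b - a)); apply: cvgM; first exact: cvg_cst.
  have := @cvg_harmonic R; rewrite -(cvg_shiftn 1); apply: cvg_trans.
  by apply: near_eq_cvg; apply: nearW => n; rewrite /harmonic /= addn1.
have [|q qP] := F_complete (u := fun n => c (t n)).
  move=> e e0; have e20 : 0 < e / 2 by rewrite divr_gt0.
  have /cvgrPdist_lt/(_ _ e20)[n0 _ Hn] := tc_.
  exists n0 => m n mn nn; apply: (le_lt_trans (char_idist (tab m) (tab n))).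
  have h1 := Hn m mn; have h2 := Hn n nn; rewrite /= distrC in h2; rewrite lte_fin.
  rewrite -(subrKA b) (le_lt_trans (ler_normD _ _))// [ltRHS]splitr ltrD//.
have uq : c (t n) @[n --> \oo] --> q by exact: (idist_cvg F_imm N_nrm F_cmc).
have Fq : F q = gam b.
  have L1 : F (c (t n)) @[n --> \oo] --> F q.
    by apply: (cvg_comp _ _ uq); exact: F_cont.
  have L2 : gam (t n) @[n --> \oo] --> gam b.
    by apply: (cvg_comp _ _ tc_); exact: geod_cont.
  apply: (@cvg_unique _ (@norm_hausdorff _ _) (F (c (t n)) @[n --> \oo])) => //.
  apply: cvg_trans L2; apply: near_eq_cvg; apply: nearW => n.
  by rewrite Fc.
exists q; split=> // i P sec r r0.
pose xi s := prj P (gam s).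
have xic s : {for s, continuous xi} by apply: prj_cont; exact: geod_cont.
have xB : ls_B sec (xi b) by rewrite /xi -Fq; exact: ballxx (ls_r0 sec).
have : \forall s \near b, ls_B sec (xi s) /\ `|prj P (F q) - xi s| < r.
  apply: filterI.
    exact: near_continuous (@xic b) (open_nbhs_nbhs (conj (ball_open _ _) xB)).
  by have /cvgrPdist_lt/(_ r r0) := @xic b; rewrite /xi -Fq.
move=> /nbhs_ballP[d /= d0 Hd].
have [n Un dn] : exists2 n, ls_U sec (c (t n)) & `|b - t n| < d.
  have h1 : \forall n \near \oo, ls_U sec (c (t n)).
    by apply: uq; exact: open_nbhs_nbhs (conj (ls_Uo sec) (ls_Uq sec)).
  have /cvgrPdist_lt/(_ d d0) h2 := tc_.
  have : \forall n \near \oo, ls_U sec (c (t n)) /\ `|b - t n| < d by exact: filterI.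
  by move=> [n _ /(_ n (leqnn n))[x y]]; exists n.
have [tn1 tn2] := andP (tab n).
have xs s : t n <= s < b -> ls_B sec (xi s) /\ `|prj P (F q) - xi s| < r.
  move=> /andP[h1 h2]; apply: Hd; rewrite /ball /= gtr0_norm ?subr_gt0//.
  by apply: le_lt_trans dn; rewrite gtr0_norm ?subr_gt0// lerB.
exists (t n) => // s sb; have [s1' s2'] := xs s sb; split=> //.
have [h1 h2] := andP sb.
have sr r' : t n <= r' <= s -> t n <= r' < b by move=> /andP[-> h]; exact: le_lt_trans h2.
have sr2 r' : t n <= r' <= s -> a < r' < b by move=> /sr/andP[h ->]; rewrite (lt_le_trans tn1).
have nn : t n <= t n <= s by rewrite lexx.
have := @lift_unique R S (@surface_hausdorff _ S) V2 (fun x => prj P (F x)) (fun r => ls_kap sec (xi r)) c (t n) s (t n) nn.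
move=> /(_ _ _ _ s); rewrite h1 lexx => -> //.
- move=> r' rr; have [x1 x2] := xs _ (sr _ rr); split.
  + exact: (continuous_comp (@xic r') (ls_kapc x1)).
  + exact: cc (sr2 _ rr).
  + by rewrite (ls_kapP x1) Fc//; exact: sr2.
- move=> r' rr; have [x1 x2] := xs _ (sr _ rr); exists (ls_U sec); split.
  + exact: ls_Uo.
  + exact: ls_kapU.
  + by move=> x y; exact: section_inj.
- by rewrite /xi -Fc// ls_UK.
Qed.

End characteristic_curves.

(** * Varying the initial angle of the model geodesics *)

Section model_variation.
Context {R : realType}.
Variable l : R.
Hypothesis l0 : l != 0.
Local Notation V2 := 'rV[R]_2.
Local Notation H1 := 'rV[R]_3.

Definition polar_geo (p : H1) al s : H1 := geo l p (cos al) (sin al) s.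
Local Notation m := polar_geo.

Lemma cos_sin_unit (al : R) : cos al ^+ 2 + sin al ^+ 2 = 1. Proof. exact: cos2Dsin2. Qed.

(** Changing the angle rotates the projected arc about its starting point, so [(x, y)] is
    differentiated to its quarter turn [(- y, x)]. *)
Lemma polar_geo_var p al s : let x := cx l (cos al) (sin al) s in let y := cy l (cos al) (sin al) s in
  [/\ drv (fun al => xc (m p al s)) al (- y), drv (fun al => yc (m p al s)) al x &
      drv (fun al => tc (m p al s)) al (yc p * - y - xc p * x)].
Proof.
move=> x y.
have X : drv (fun al => cx l (cos al) (sin al) s) al (- y).
  have D := drvM (drvD (drvM (drv_cos (drv_id al)) (drv_cst (sin (2 * l * s)) al))
     (drvM (drv_sin (drv_id al)) (drv_cst (1 - cos (2 * l * s)) al))) (drv_cst (2 * l)^-1 al).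
  by refine (drv_eq D _); rewrite /y /cy; ring.
have Y : drv (fun al => cy l (cos al) (sin al) s) al x.
  have D := drvM (drvB (drvM (drv_sin (drv_id al)) (drv_cst (sin (2 * l * s)) al))
     (drvM (drv_cos (drv_id al)) (drv_cst (1 - cos (2 * l * s)) al))) (drv_cst (2 * l)^-1 al).
  by refine (drv_eq D _); rewrite /x /cx; ring.
split.
- apply: (@drv_ext _ (fun al => xc p + cx l (cos al) (sin al) s)) => [r|]; first by rewrite /m /geo xc_vec3.
  by refine (drv_eq (drvD (drv_cst _ _) X) _); ring.
- apply: (@drv_ext _ (fun al => yc p + cy l (cos al) (sin al) s)) => [r|]; first by rewrite /m /geo yc_vec3.
  by refine (drv_eq (drvD (drv_cst _ _) Y) _); ring.
- apply: (@drv_ext _ (fun al => (tc p + ct l s) + (yc p * cx l (cos al) (sin al) s - xc p * cy l (cos al) (sin al) s))) => [r|].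
    by rewrite /m /geo tc_vec3 cos_sin_unit mul1r addrA.
  by refine (drv_eq (drvD (drv_cst _ _) (drvB (drvZ _ X) (drvZ _ Y))) _); ring.
Qed.

Lemma cx2Dcy2 a b s : a ^+ 2 + b ^+ 2 = 1 -> cx l a b s ^+ 2 + cy l a b s ^+ 2 = (sin (l * s) / l) ^+ 2.
Proof.
by move=> ab; have := cir_norm l0 (0 : V2) s ab; rewrite /cir c1_vec2 c2_vec2 !(addrC (_ 0)) !addrK.
Qed.

Lemma polar_geo_cont p (k : 'I_3) (x : R * R) : {for x, continuous (fun x : R * R => m p x.1 x.2 ord0 k)}.
Proof.
have f1 : {for x, continuous (fun x : R * R => x.1)} by exact: cvg_fst.
have f2 : {for x, continuous (fun x : R * R => x.2)} by exact: cvg_snd.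
have cos1 : {for x, continuous (fun x : R * R => cos x.1)} by exact: (continuous_comp f1 (@continuous_cos R _)).
have sin1 : {for x, continuous (fun x : R * R => sin x.1)} by exact: (continuous_comp f1 (@continuous_sin R _)).
have cM (f g : R * R -> R) : {for x, continuous f} -> {for x, continuous g} -> {for x, continuous (fun y => f y * g y)}.
  by move=> fc gc; exact: continuousM.
have cD (f g : R * R -> R) : {for x, continuous f} -> {for x, continuous g} -> {for x, continuous (fun y => f y + g y)}.
  by move=> fc gc; exact: continuousD.
have cB (f g : R * R -> R) : {for x, continuous f} -> {for x, continuous g} -> {for x, continuous (fun y => f y - g y)}.
  by move=> fc gc; exact: continuousB.
have cC (c : R) : {for x, continuous (fun _ : R * R => c)} by exact: cst_continuous.
have l2 : {for x, continuous (fun x : R * R => 2 * l * x.2)} by exact: (cM).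
have cos2 : {for x, continuous (fun x : R * R => cos (2 * l * x.2))} by exact: (continuous_comp l2 (@continuous_cos R _)).
have sin2 : {for x, continuous (fun x : R * R => sin (2 * l * x.2))} by exact: (continuous_comp l2 (@continuous_sin R _)).
have X : {for x, continuous (fun x : R * R => cx l (cos x.1) (sin x.1) x.2)}.
  by apply: (cM) => //; apply: (cD); apply: (cM) => //; exact: (cB).
have Y : {for x, continuous (fun x : R * R => cy l (cos x.1) (sin x.1) x.2)}.
  by apply: (cM) => //; apply: (cB); apply: (cM) => //; exact: (cB).
have T : {for x, continuous (fun x : R * R => ct l x.2)}.
  by apply: (cM) => //; apply: (cB).
case: (ord3P k) => ->.
- refine (continuous_ext _ (cD _ _ (cC (xc p)) X)) => y.
  by rewrite -[RHS]/(xc _) /m /geo xc_vec3.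
- refine (continuous_ext _ (cD _ _ (cC (yc p)) Y)) => y.
  by rewrite -[RHS]/(yc _) /m /geo yc_vec3.
- refine (continuous_ext _ (cD _ _ (cC (tc p)) (cD _ _ T (cB _ _ (cM _ _ (cC (yc p)) X) (cM _ _ (cC (xc p)) Y))))) => y.
  by rewrite -[RHS]/(tc _) /m /geo tc_vec3 cos_sin_unit mul1r addrA.
Qed.

Lemma prj_polar_cont p P (x : R * R) : {for x, continuous (fun x : R * R => prj P (m p x.1 x.2))}.
Proof. by apply: prj_cont; apply: rV_continuous => k; exact: polar_geo_cont. Qed.

Lemma polar_near p P al s (A : set V2) : nbhs (prj P (m p al s)) A ->
  exists2 d, 0 < d & forall al' s', `|al' - al| < d -> `|s' - s| < d -> A (prj P (m p al' s')).
Proof.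
move=> nA.
have : \forall x \near (al, s), A (prj P (m p x.1 x.2)).
  exact: near_continuous (@prj_polar_cont p P (al, s)) nA.
move=> /nbhs_ballP[d /= d0 Hd]; exists d => // al' s' h1 h2.
by apply: (Hd (al', s')); split; rewrite /ball /= distrC.
Qed.

End model_variation.

(** * Lifting the family of geodesics issuing from the singular point *)

Section strips.
Context {R : realType} {S : surface R}.
Local Notation V2 := 'rV[R]_2.
Local Notation H1 := 'rV[R]_3.
Variables (F N : S -> H1) (H : R) (p : S) (eps : R).
Hypothesis F_imm : immersion2 F.
Hypothesis N_nrm : unit_normal F N.
Hypothesis F_cmc : constant_mean_curvature F N H.
Hypothesis F_complete : complete_surface F.
Local Notation n1 := (n1 N).
Local Notation n2 := (n2 N).
Local Notation n3 := (n3 F N).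
Local Notation reg := (reg N).
Local Notation l := (lam H eps).
Local Notation m := (polar_geo (lam H eps) (F p)).
Local Notation T := (pi / `|lam H eps|).
Hypothesis l0 : l != 0.
Hypothesis eps2 : eps * eps = 1.
Variables (i0 : chart_index S) (sec0 : lsec F N H i0 p (@Pxy R)) (e0 : R).
Let z0 := prj Pxy (F p).
Hypothesis e0T : 0 < e0 < T.
Hypothesis start : forall a b s, a ^+ 2 + b ^+ 2 = 1 -> 0 < s <= e0 ->
  [/\ ls_B sec0 (cir l z0 a b s), reg (ls_kap sec0 (cir l z0 a b s)),
      F (ls_kap sec0 (cir l z0 a b s)) = geo l (F p) a b s,
      zeta1 N eps (ls_kap sec0 (cir l z0 a b s)) = dir1 l a b s &
      zeta2 N eps (ls_kap sec0 (cir l z0 a b s)) = dir2 l a b s].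

Let e1 := e0 / 2.

Definition ray al s := ls_kap sec0 (cir l z0 (cos al) (sin al) s).

(* A lift of the geodesic with initial angle [al] to the surface, prescribed near [p]. *)
Definition is_lift al b (c : R -> S) := (forall s, 0 < s <= e1 -> c s = ray al s) /\
  forall s, 0 < s <= b -> [/\ {for s, continuous c}, F (c s) = m al s, reg (c s),
    zeta1 N eps (c s) = dir1 l (cos al) (sin al) s & zeta2 N eps (c s) = dir2 l (cos al) (sin al) s].

Lemma e1_gt0 : 0 < e1. Proof. by case/andP: e0T => h _; rewrite divr_gt0. Qed.
Lemma lift_le al b b' c : b' <= b -> is_lift al b c -> is_lift al b' c.
Proof. by move=> bb [h1 h2]; split=> // s /andP[s0 sb]; apply: h2; rewrite s0 (le_trans sb). Qed.

Lemma lift_eq al b c c' : is_lift al b c -> is_lift al b c' -> forall s, 0 < s <= b -> c s = c' s.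
Proof.
move=> [c1_ c2_] [d1_ d2_] s /andP[s0 sb].
have [se|/ltW es] := leP s e1; first by rewrite c1_ ?d1_ ?s0.
have e10 := e1_gt0.
apply: (@lift_unique_right R S (@surface_hausdorff _ S) H1 F c c' e1 s) => //.
- move=> r /andP[r1 r2]; have rr : 0 < r <= b by rewrite (lt_le_trans e10)//= (le_trans r2).
  by have [h1 h2 _ _ _] := c2_ r rr; have [h3 h4 _ _ _] := d2_ r rr; split=> //; rewrite h2.
- by move=> r _; exact: (locally_injective F_imm N_nrm F_cmc).
- by rewrite c1_ ?d1_ ?e10 ?lexx.
- by rewrite es lexx.
Qed.

(** The end point of any lift, independent of the choice by [lift_eq]; the default value [p] is
    taken when there is no lift. *)
Definition lift_point al s : S := xget p [set q | exists c, is_lift al s c /\ c s = q].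

Lemma lift_Ex al b c s : is_lift al b c -> 0 < s <= b -> lift_point al s = c s.
Proof.
move=> cL /andP[s0 sb]; have cs : is_lift al s c by exact: lift_le cL.
have [c' [c'L <-]] : [set q | exists c, is_lift al s c /\ c s = q] (lift_point al s).
  by apply: xgetPex; exists (c s); exists c.
by apply: (lift_eq c'L cs); rewrite s0 lexx.
Qed.

Lemma ray_lift al : is_lift al e0 (ray al).
Proof.
split=> // s se; have [h1 h2 h3 h4 h5] := start (cos_sin_unit al) se.
split=> //; exact: (continuous_comp (@cir_cont _ _ l0 z0 (cos al) (sin al) s) (ls_kapc h1)).
Qed.

Lemma Ex_ray al s : 0 < s <= e0 -> lift_point al s = ray al s.
Proof. by move=> se; exact: lift_Ex (ray_lift al) se. Qed.

(** Lifts exist for all neighbouring angles and slightly beyond [s], and a single local section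
    describes them. The neighbouring angles make it possible to differentiate the lift in [al]. *)
Definition strip al s := exists2 d, 0 < d &
  (forall al', `|al' - al| < d -> exists c, is_lift al' (s + d) c) /\
  exists i q P (sec : lsec F N H i q P), forall al' s', `|al' - al| < d -> `|s' - s| < d ->
    ls_B sec (prj P (m al' s')) /\ lift_point al' s' = ls_kap sec (prj P (m al' s')).

Lemma polar_geod al : geod l (m al) (dir1 l (cos al) (sin al)) (dir2 l (cos al) (sin al)).
Proof. exact: geo_isgeod. Qed.

Lemma prj_polar al s : prj Pxy (m al s) = cir l z0 (cos al) (sin al) s.
Proof. exact: prj_geo. Qed.

Lemma strip_start al : strip al e1.
Proof.
have e10 := e1_gt0; exists e1 => //.
have E : e1 + e1 = e0 by rewrite /e1 -splitr.
split=> [al' _|]; first by exists (ray al'); rewrite E; exact: ray_lift.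
exists i0, p, (@Pxy R), sec0 => al' s' _; rewrite ltr_norml ltrBlDr ltrBrDr addNr E => /andP[s0 se].
have se' : 0 < s' <= e0 by rewrite s0 ltW.
have [h1 _ _ _ _] := start (cos_sin_unit al') se'.
by rewrite prj_polar Ex_ray.
Qed.

Lemma strip_right al s d : 0 < d -> (forall al', `|al' - al| < d -> exists c, is_lift al' (s + d) c) ->
  (exists i q P (sec : lsec F N H i q P), forall al' s', `|al' - al| < d -> `|s' - s| < d ->
    ls_B sec (prj P (m al' s')) /\ lift_point al' s' = ls_kap sec (prj P (m al' s'))) ->
  forall r, s < r < s + d / 2 -> strip al r.
Proof.
move=> d0 dL [i [q [P [sec dS]]]] r /andP[sr re].
have d2 : d / 2 < d by lra.
exists (d / 2); first by rewrite divr_gt0.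
split=> [al' ae|]; last exists i, q, P, sec => al' s' ae se.
  by have [c cL] := dL al' (lt_trans ae d2); exists c; apply: lift_le cL; lra.
apply: dS; first exact: lt_trans ae d2.
by move: se; rewrite !ltr_norml => /andP[h1 h2]; apply/andP; split; lra.
Qed.

Lemma strip_Ex al s : strip al s -> 0 < s -> [/\ {for s, continuous (lift_point al)}, F (lift_point al s) = m al s,
  reg (lift_point al s), zeta1 N eps (lift_point al s) = dir1 l (cos al) (sin al) s & zeta2 N eps (lift_point al s) = dir2 l (cos al) (sin al) s].
Proof.
move=> [d d0 [dL _]] s0; have [|c cL] := dL al; first by rewrite subrr normr0.
have sd : s < s + d by rewrite ltrDl.
have ss : 0 < s <= s + d by rewrite s0 ltW.
have E : \forall r \near s, c r = lift_point al r.
  apply/nbhs_ballP; exists (Num.min s d); first by rewrite /= lt_min s0.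
  move=> r; rewrite /ball /= lt_min !ltr_norml => /andP[/andP[h1 h2] /andP[h3 h4]].
  by apply/esym/(lift_Ex cL)/andP; split; lra.
have [_ cc] := cL; have [h1 h2 h3 h4 h5] := cc s ss.
rewrite (lift_Ex cL ss); split=> //.
exact: continuous_near_eq E h1.
Qed.

(* The Jacobi field [d/d al] of the geodesics has components [- y], [x] and
   [(sin (l s) / l)^2] in the frame X, Y, T, and is tangent to the surface. *)
Lemma strip_tangent al s : strip al s -> 0 < s ->
  let x := cx l (cos al) (sin al) s in let y := cy l (cos al) (sin al) s in
  - (n1 (lift_point al s) * y) + n2 (lift_point al s) * x + n3 (lift_point al s) * (sin (l * s) / l) ^+ 2 = 0.
Proof.
move=> ss s0 x y; have [_ FE _ _ _] := strip_Ex ss s0.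
have [d d0 [dL [i [q [P [sec dS]]]]]] := ss.
have [||B E] := dS al s; rewrite ?subrr ?normr0//.
have [X Y TT] := polar_geo_var l (F p) al s; rewrite -/x -/y in X Y TT.
pose v := vec3 (- y) x (yc (F p) * - y - xc (F p) * x).
pose xi al' := prj P (m al' s).
have xD : drv2 xi al (c1 (prj P v)) (c2 (prj P v)).
  rewrite /xi /prj /v xc_vec3 yc_vec3 tc_vec3 c1_vec2 c2_vec2; split.
  - apply: (@drv_ext _ (fun r => pa P * xc (m r s) + pb P * yc (m r s) + pc P * tc (m r s))).
      by move=> r /=; rewrite c1_vec2.
    by apply: drvD; [apply: drvD|]; exact: drvZ.
  - apply: (@drv_ext _ (fun r => qa P * xc (m r s) + qb P * yc (m r s) + qc P * tc (m r s))).
      by move=> r /=; rewrite c2_vec2.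
    by apply: drvD; [apply: drvD|]; exact: drvZ.
have nE : \forall r \near al, F (ls_kap sec (xi r)) = m r s.
  apply/nbhs_ballP; exists d => // r; rewrite /ball /= distrC => rd.
  have [|_ <-] := dS r s rd; first by rewrite subrr normr0.
  have [c cL] := dL r rd; have rs : 0 < s <= s + d by rewrite s0 lerDl ltW.
  by rewrite (lift_Ex cL rs); have [_ /(_ s rs)[]] := cL.
(* Above the projected variation the section reproduces [m r s]; its differential therefore sends
   [prj P v] to the variation field, which [ls_tan'] shows to be tangent. *)
have K (f : H1 -> R) df u w : drv (fun r => f (m r s)) al df ->
    C1 (ls_B sec) (fun z => f (F (ls_kap sec z))) u w -> u (xi al) * c1 (prj P v) + w (xi al) * c2 (prj P v) = df.
  move=> D C; apply: (drv_unique (C1_chain C (y := xi) B xD)).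
  by apply: drv_near D; apply: filterS nE => r /= ->.
have tg := ls_tan' (c1 (prj P v)) (c2 (prj P v)) B.
rewrite (K _ _ _ _ X (ls_xC sec)) (K _ _ _ _ Y (ls_yC sec)) (K _ _ _ _ TT (ls_tC sec)) -E in tg.
move: tg; rewrite /tangent /tcomp xc_vec3 yc_vec3 tc_vec3 FE /polar_geo /geo xc_vec3 yc_vec3 -/x -/y.
rewrite -(cx2Dcy2 l0 s (cos_sin_unit al)) -/x -/y => <-.
by ring.
Qed.

Lemma sin_ratio_gt0 s : 0 < s < T -> 0 < sin (l * s) / l.
Proof. exact: sin_lin_gt0. Qed.

Lemma zeta_normal q : n1 q * zeta1 N eps q + n2 q * zeta2 N eps q = 0.
Proof. by rewrite /zeta1 /zeta2 nu1E nu2E; ring. Qed.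

Lemma cx_scale a b s : cx l a b s = sin (l * s) / l * (a * cos (l * s) + b * sin (l * s)) /\
  cy l a b s = sin (l * s) / l * (b * cos (l * s) - a * sin (l * s)).
Proof.
have E := cir_scale l0 (0 : V2) a b s; split.
- have := congr1 c1 E; rewrite /cir c1_vec2 => /=; rewrite c1D c1Z c1_vec2; exact: addrI.
- have := congr1 c2 E; rewrite /cir c2_vec2 => /=; rewrite c2D c2Z c2_vec2; exact: addrI.
Qed.

(** [(perp2, perp1)] is the unit vector along the chord, that is [(cx, cy)] divided by
    [sin (l * s) / l]. *)
Definition perp1 al s := sin al * cos (l * s) - cos al * sin (l * s).
Definition perp2 al s := cos al * cos (l * s) + sin al * sin (l * s).

(** Completeness gives the limit point, and tangency of the velocity and of the Jacobi field passes
    to the limit. The second relation is first divided by [sin (l * x) / l]; it thus keeps its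
    content at the time [pi / |l|], where this factor vanishes. *)
Lemma Ex_limit al s : e1 < s <= T -> (forall r, e1 <= r < s -> strip al r) ->
  exists q, [/\ F q = m al s,
   n1 q * dir1 l (cos al) (sin al) s + n2 q * dir2 l (cos al) (sin al) s = 0,
   - (n1 q * perp1 al s) + n2 q * perp2 al s + n3 q * (sin (l * s) / l) = 0 &
   forall i P (sec : lsec F N H i q P) r, 0 < r -> exists2 t, e1 < t < s & forall x, t <= x < s ->
     [/\ ls_B sec (prj P (m al x)), `|prj P (F q) - prj P (m al x)| < r & lift_point al x = ls_kap sec (prj P (m al x))]].
Proof.
move=> /andP[es sT] St; have e10 := e1_gt0.
have EP r : e1 < r < s -> _ := fun h => @strip_Ex al r (St r ltac:(by case/andP: h => /ltW -> ->)) (lt_trans e10 (proj1 (andP h))).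
have du r : dir1 l (cos al) (sin al) r ^+ 2 + dir2 l (cos al) (sin al) r ^+ 2 = 1 by exact: dir_unit (cos_sin_unit al).
have [q [Fq qL]] := @char_limit R S F N H F_imm N_nrm F_cmc F_complete l (m al) _ _ (lift_point al) e1 s
  (polar_geod al) du (fun r h => let: And5 c _ _ _ _ := EP r h in c) (fun r h => let: And5 _ c _ _ _ := EP r h in c) es.
exists q.
have [i iq] := atlas_cover q; have [P Pinj] := tangent_proj N_nrm q.
have [sec _] := local_section F_imm N_nrm F_cmc iq Pinj.
have [t /andP[et ts] tP] := qL i P sec 1 ltr01.
pose ch r := ls_kap sec (prj P (m al r)).
have Bq : ls_B sec (prj P (m al s)) by rewrite -Fq; exact: ballxx (ls_r0 sec).
have chc : {for s, continuous ch}.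
  apply: continuous_comp; last exact: ls_kapc Bq.
  by apply: prj_cont; exact: geod_cont (polar_geod al) _.
have chs : ch s = q by rewrite /ch -Fq ls_UK//; exact: ls_Uq.
have chE r : t <= r < s -> [/\ ch r = lift_point al r, 0 < r < T & strip al r].
  move=> rr; have [_ _ E] := tP r rr; case/andP: rr => tr rs; split; first by rewrite /ch E.
    by rewrite (lt_le_trans rs sT) (lt_trans e10)// (lt_le_trans et).
  by apply: St; rewrite rs (le_trans (ltW et)).
have lim0 (f : R -> R) : {for s, continuous f} -> (forall r, t <= r < s -> f r = 0) -> f s = 0.
  move=> fc f0; apply: (@eq_limit_left R R (@norm_hausdorff _ _) f (fun=> 0) t s ts fc _ f0).
  exact: cst_continuous.
have comp (f : S -> R) : {for q, continuous f} -> {for s, continuous (fun r => f (ch r))}.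
  by move=> fc; apply: (continuous_comp chc); rewrite chs.
have c1_ : {for s, continuous (fun r => n1 (ch r))} by apply: (comp n1); exact: (n1_cont N_nrm).
have c2_ : {for s, continuous (fun r => n2 (ch r))} by apply: (comp n2); exact: (n2_cont N_nrm).
have c3_ : {for s, continuous (fun r => n3 (ch r))} by apply: comp; exact: n3_cont.
have lD := drvZ l (drv_id s).
have co := drv_cont (drv_cos lD); have si := drv_cont (drv_sin lD).
have cM (f g : R -> R) : {for s, continuous f} -> {for s, continuous g} -> {for s, continuous (fun x => f x * g x)}.
  by move=> fc gc; exact: continuousM.
have cD (f g : R -> R) : {for s, continuous f} -> {for s, continuous g} -> {for s, continuous (fun x => f x + g x)}.
  by move=> fc gc; exact: continuousD.
have cB (f g : R -> R) : {for s, continuous f} -> {for s, continuous g} -> {for s, continuous (fun x => f x - g x)}.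
  by move=> fc gc; exact: continuousB.
have cN (f : R -> R) : {for s, continuous f} -> {for s, continuous (fun x => - f x)}.
  by move=> fc; exact: continuousN.
have cC (k : R) : {for s, continuous (fun _ : R => k)} by exact: cst_continuous.
split=> //.
- rewrite -chs; apply: (lim0 (fun r => n1 (ch r) * dir1 l (cos al) (sin al) r + n2 (ch r) * dir2 l (cos al) (sin al) r)).
    apply: (cD); apply: (cM) => //; [exact: drv_cont (drv_dir1 l _ _ s)|exact: drv_cont (drv_dir2 l _ _ s)].
  move=> r /chE[-> /andP[r0 _] /strip_Ex/(_ r0)[_ _ _ <- <-]].
  exact: zeta_normal.
- rewrite -chs; apply: (lim0 (fun r => - (n1 (ch r) * perp1 al r) + n2 (ch r) * perp2 al r + n3 (ch r) * (sin (l * r) / l))).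
    apply: (cD); [apply: (cD); [apply: (cN); apply: (cM) => //|apply: (cM) => //]|apply: (cM) => //].
    + by apply: (cB); exact: (cM).
    + by apply: (cD); exact: (cM).
    + exact: (cM).
  move=> r /chE[-> rT /strip_tangent h]; have [r0 _] := andP rT.
  have := h r0; cbv zeta; have [-> ->] := cx_scale (cos al) (sin al) r.
  have := sin_ratio_gt0 rT; rewrite -/(perp1 al r) -/(perp2 al r).
  move: (sin _ / l) (perp1 _ _) (perp2 _ _) (n1 _) (n2 _) (n3 _) => k u v x y z k0 E.
  apply: (mulfI (lt0r_neq0 k0)); rewrite mulr0 -[RHS]E; ring.
Qed.

(** The limit point is regular, and its local section contains the lifts of all neighbouring angles
    at some common time [s1 < s]. From there [geod_in_section] carries all of them beyond [s]. *)
Lemma strip_left al s : e1 < s < T -> (forall r, e1 <= r < s -> strip al r) -> strip al s.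
Proof.
move=> /andP[es sT] St; have e10 := e1_gt0.
have s0 := lt_trans e10 es.
have [|q [Fq _ qJ qL]] := @Ex_limit al s _ St; first by rewrite es ltW.
(* At a singular point the second limit relation reduces to [n3 q * (sin (l * s) / l) = 0], but
   [n3 q] is plus or minus 1 and the other factor is positive before [pi / |l|]. *)
have rq : reg q.
  apply: contrapT => nr; have [a1 a2 a3] := singular_normal N_nrm nr.
  have k0 := sin_ratio_gt0 (s := s); move: qJ; rewrite a1 a2 !mul0r oppr0 !add0r => /eqP.
  rewrite mulf_eq0 (gt_eqF (k0 _)) ?s0// orbF => /eqP h.
  by move: a3; rewrite h mul0r => /esym/eqP; rewrite oner_eq0.
have [i iq] := atlas_cover q; have [P Pinj] := tangent_proj N_nrm q.
have [sec _] := local_section F_imm N_nrm F_cmc iq Pinj.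
set zq := prj P (F q); have Bq : ls_B sec zq by exact: ballxx (ls_r0 sec).
have kq : ls_kap sec zq = q by exact: ls_UK (ls_Uq sec).
have nr : nbhs (prj P (m al s)) [set z | ls_B sec z /\ reg (ls_kap sec z)].
  rewrite -Fq; apply: filterI; first exact: open_nbhs_nbhs (conj (ball_open _ _) Bq).
  have nq : nbhs (ls_kap sec zq) [set q' | reg q'] by rewrite kq; exact: (reg_nbhs N_nrm rq).
  exact: near_continuous (ls_kapc Bq) nq.
have [d3 d30 H3] := polar_near nr.
have [t /andP[et ts] tP] := qL i P sec 1 ltr01.
(* A time when the lift with angle [al] is already given by the section at [q], and so close to [s]
   that the projected geodesics stay above the regular part from [s1] to beyond [s]. *)
pose s1 := Num.max t (s - d3 / 2).
have s1s : s1 < s by rewrite gt_max ts ltrBlDr ltrDl divr_gt0.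
have [ts1 ds1] : t <= s1 /\ s - d3 / 2 <= s1 by rewrite /s1 !le_max !lexx orbT.
have es1 : e1 < s1 by exact: lt_le_trans ts1.
have s10 := lt_trans e10 es1.
have St1 : strip al s1 by apply: St; rewrite s1s ltW.
have [E1c _ _ _ _] := strip_Ex St1 s10.
have [d4 d40 [L4 [i4 [q4 [P4 [sec4 S4]]]]]] := St1.
have U1 : ls_U sec (lift_point al s1).
  have [h1 _ ->] := tP s1 ltac:(by rewrite ts1).
  exact: ls_kapU.
have [h4 E4] := S4 al s1 ltac:(by rewrite subrr normr0) ltac:(by rewrite subrr normr0).
have [d5 d50 H5] : exists2 d5, 0 < d5 & forall al', `|al' - al| < d5 -> ls_U sec (lift_point al' s1).
  have nU : nbhs (prj P4 (m al s1)) [set z | ls_U sec (ls_kap sec4 z)].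
    have nq : nbhs (ls_kap sec4 (prj P4 (m al s1))) (ls_U sec).
      by rewrite -E4; exact: open_nbhs_nbhs (conj (ls_Uo sec) U1).
    exact: near_continuous (ls_kapc h4) nq.
  have [d5 d50 H5] := polar_near nU.
  exists (Num.min d4 d5) => [|al']; first by rewrite lt_min d40.
  rewrite lt_min => /andP[k1 k2]; have [|_ ->] := S4 al' s1 k1; first by rewrite subrr normr0.
  by apply: H5 => //; rewrite subrr normr0.
pose d := Num.min (Num.min d4 d5) (Num.min (d3 / 2) (s - s1)).
have d32 : 0 < d3 / 2 by rewrite divr_gt0.
have d0 : 0 < d by rewrite !lt_min d40 d50 d32 subr_gt0 s1s.
have [dd4 dd5 dd3 dds] : [/\ d <= d4, d <= d5, d <= d3 / 2 & d <= s - s1].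
  by rewrite /d !ge_min !lexx !orbT.
pose k al' r := ls_kap sec (prj P (m al' r)).
have kP al' r : `|al' - al| < d -> s - d3 / 2 <= r <= s + d3 / 2 ->
   [/\ ls_B sec (prj P (m al' r)), reg (k al' r), F (k al' r) = m al' r,
       zeta1 N eps (k al' r) = dir1 l (cos al') (sin al') r & zeta2 N eps (k al' r) = dir2 l (cos al') (sin al') r].
  move=> ad rr; have BB r' : s - d3 / 2 <= r' <= s + d3 / 2 -> ls_B sec (prj P (m al' r')) /\ reg (k al' r').
    move=> /andP[h1 h2]; apply: (H3 al' r'); first by apply: lt_le_trans ad _; lra.
    by rewrite ltr_norml; apply/andP; split; lra.
  have s1r : s - d3 / 2 <= s1 <= s + d3 / 2 by rewrite ds1 /=; lra.
  have Us1 : ls_U sec (lift_point al' s1) by apply: H5; exact: lt_le_trans ad dd5.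
  have [c cL] := L4 al' (lt_le_trans ad dd4).
  have ss1 : 0 < s1 <= s1 + d4 by rewrite s10 lerDl ltW.
  have [_ Fs1 _ z1 z2] := proj2 cL s1 ss1; rewrite -(lift_Ex cL ss1) in Fs1 z1 z2.
  have ks1 : k al' s1 = lift_point al' s1 by rewrite /k -Fs1 ls_UK.
  have [b1 b2] := BB r rr.
  have := geod_in_section N_nrm (sec := sec) (polar_geod al') s1r BB _ _ _ rr.
  by rewrite -!/(k al' _) ks1 => /(_ Fs1 z1 z2)[].
have kc al' r : `|al' - al| < d -> s - d3 / 2 <= r <= s + d3 / 2 -> {for r, continuous (k al')}.
  move=> ad rr; have [b1 _ _ _ _] := kP al' r ad rr.
  apply: continuous_comp; last exact: ls_kapc b1.
  by apply: prj_cont; exact: geod_cont (polar_geod al') _.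
have E' al' : `|al' - al| < d -> is_lift al' (s + d) (fun r => if r <= s1 then lift_point al' r else k al' r).
  move=> ad; have [c cL] := L4 al' (lt_le_trans ad dd4).
  have ExE r : 0 < r <= s1 + d4 -> lift_point al' r = c r by exact: lift_Ex cL.
  split=> r.
    move=> /andP[r0 re]; rewrite (le_trans re (ltW es1)) ExE; last by rewrite r0 /=; lra.
    by have [-> ] := cL; rewrite ?r0.
  move=> /andP[r0 rsd].
  have Us1 : ls_U sec (lift_point al' s1) by apply: H5; exact: lt_le_trans ad dd5.
  have ss1 : 0 < s1 <= s1 + d4 by rewrite s10 lerDl ltW.
  have [cs1 Fs1 _ _ _] := proj2 cL s1 ss1.
  (* the two pieces agree near [s1] *)
  have agree : \forall x \near s1, lift_point al' x = k al' x.
    have nU : \forall x \near s1, ls_U sec (c x).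
      have nq : nbhs (c s1) (ls_U sec) by rewrite -ExE//; exact: open_nbhs_nbhs (conj (ls_Uo sec) Us1).
      exact: near_continuous cs1 nq.
    have nx : \forall x \near s1, 0 < x < s1 + d4.
      have i1 : 0 < s1 < s1 + d4 by rewrite s10 ltrDl.
      by have := @near_in_itvoo R 0 (s1 + d4) s1; rewrite in_itv /= => /(_ i1); apply: filterS => x; rewrite in_itv.
    have nn : \forall x \near s1, 0 < x < s1 + d4 /\ ls_U sec (c x) by exact: filterI.
    apply: filterS nn => x [/andP[x0 xd] Ux]; have xx : 0 < x <= s1 + d4 by rewrite x0 ltW.
    have [_ Fx _ _ _] := proj2 cL x xx.
    by rewrite (ExE _ xx) /k -Fx ls_UK.
  have [rs|rs] := leP r s1.
    have rr : 0 < r <= s1 + d4 by rewrite r0 /=; lra.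
    have [b1 b2 b3 b4 b5] := proj2 cL r rr; rewrite (ExE _ rr); split=> //.
    move: rs; rewrite le_eqVlt => /predU1P[rs|rs].
      have s1r : s - d3 / 2 <= s1 <= s + d3 / 2 by rewrite ds1 /=; lra.
      rewrite rs; apply: continuous_near_eq (kc al' s1 ad s1r).
      by apply: filterS agree => x <-; case: ifP.
    apply: continuous_near_eq b1.
    have nx : \forall x \near r, 0 < x < s1.
      have i1 : 0 < r < s1 by rewrite r0.
      by have := @near_in_itvoo R 0 s1 r; rewrite in_itv /= => /(_ i1); apply: filterS => x; rewrite in_itv.
    apply: filterS nx => x /andP[x0 xs]; rewrite (ltW xs) ExE// x0 /=; lra.
  have rr : s - d3 / 2 <= r <= s + d3 / 2 by apply/andP; split; lra.
  have [b1 b2 b3 b4 b5] := kP al' r ad rr; split=> //.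
  apply: continuous_near_eq (kc al' r ad rr).
  have nx : \forall x \near r, s1 < x by exact: near_continuous (@cvg_id _ _) (open_nbhs_nbhs (conj (@open_gt R s1) rs)).
  by apply: filterS nx => x xs; rewrite leNgt xs.
exists d => //; split=> [al' /E' h|]; first by eexists; exact: h.
exists i, q, P, sec => al' s' ad sd.
have sr : s - d < s' < s + d by move: sd; rewrite ltr_norml => /andP[h1 h2]; apply/andP; split; lra.
have [sr1 sr2] := andP sr.
have rr : s - d3 / 2 <= s' <= s + d3 / 2 by apply/andP; split; lra.
have [b1 _ _ _ _] := kP al' s' ad rr; split=> //.
have s'1 : s1 < s' by lra.
rewrite (lift_Ex (E' al' ad)); last by rewrite ltW// andbT (lt_trans s10).
by rewrite leNgt s'1.
Qed.

Lemma strip_all al s : e1 <= s < T -> strip al s.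
Proof.
move=> /andP[es sT].
have : forall r, e1 <= r <= s -> strip al r; last by apply; rewrite es lexx.
apply: real_induction.
- exact: strip_start.
- move=> r rs /(_ r)[]; first by case/andP: rs => ->; rewrite lexx.
  move=> d d0 [dL dS]; exists (d / 2); first by rewrite divr_gt0.
  exact: strip_right dL dS.
- move=> r /andP[er rs] h; apply: strip_left => //.
  by rewrite er (le_lt_trans rs).
Qed.

End strips.

Section polar_angles.
Context {R : realType}.

Lemma exists_angle (a b : R) : a ^+ 2 + b ^+ 2 = 1 ->
  exists al, [/\ - pi <= al <= pi, cos al = a & sin al = b].
Proof.
move=> ab; have [al _] := unit_le1 ab.
have a1 : -1 <= a <= 1 by rewrite -ler_norml.
have c := acosK (x := a); rewrite in_itv /= in c.
have s := sin_acos a1.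
have b2 : Num.sqrt (1 - a ^+ 2) = `|b| by rewrite -ab addrAC subrr add0r sqrtr_sqr.
have r0 := acos_ge0 a1; have r1 := acos_lepi a1; have p0 := pi_ge0 R.
have [b0|b0] := leP 0 b.
- exists (acos a); split; [|exact: c|by rewrite s b2 ger0_norm].
  by rewrite r1 andbT (le_trans _ r0)// oppr_le0.
- exists (- acos a); split; [|by rewrite cosN c|by rewrite sinN s b2 ltr0_norm// opprK].
  by rewrite lerN2 r1 /= (le_trans _ p0)// oppr_le0.
Qed.

End polar_angles.

Lemma rV2_add (R : realType) (z z' : 'rV[R]_2) r x y : c1 z + r * x = c1 z' -> c2 z + r * y = c2 z' ->
  z + r *: vec2 x y = z'.
Proof. by move=> h1 h2; apply: rV2P; rewrite (c1D, c2D) (c1Z, c2Z) (c1_vec2, c2_vec2). Qed.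

(** * The opposite pole and the global description of the surface *)

Section top.
Context {R : realType} {S : surface R}.
Local Notation V2 := 'rV[R]_2.
Local Notation H1 := 'rV[R]_3.
Variables (F N : S -> H1) (H : R) (p : S) (eps : R).
Hypothesis F_imm : immersion2 F.
Hypothesis N_nrm : unit_normal F N.
Hypothesis F_cmc : constant_mean_curvature F N H.
Hypothesis F_complete : complete_surface F.
Local Notation n1 := (n1 N).
Local Notation n2 := (n2 N).
Local Notation n3 := (n3 F N).
Local Notation reg := (reg N).
Local Notation l := (lam H eps).
Local Notation m := (polar_geo (lam H eps) (F p)).
Local Notation T := (pi / `|lam H eps|).
Hypothesis l0 : l != 0.
Hypothesis eps2 : eps * eps = 1.
Variables (i0 : chart_index S) (sec0 : lsec F N H i0 p (@Pxy R)) (e0 : R).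
Let z0 := prj Pxy (F p).
Hypothesis e0T : 0 < e0 < T.
Hypothesis start : forall a b s, a ^+ 2 + b ^+ 2 = 1 -> 0 < s <= e0 ->
  [/\ ls_B sec0 (cir l z0 a b s), reg (ls_kap sec0 (cir l z0 a b s)),
      F (ls_kap sec0 (cir l z0 a b s)) = geo l (F p) a b s,
      zeta1 N eps (ls_kap sec0 (cir l z0 a b s)) = dir1 l a b s &
      zeta2 N eps (ls_kap sec0 (cir l z0 a b s)) = dir2 l a b s].
Local Notation Ex := (lift_point eps sec0 e0).
Let e1 := e0 / 2.
Let g s := sin (l * s) / l.

Lemma T_gt0 : 0 < T. Proof. by case/andP: e0T => /lt_trans; apply. Qed.

Lemma lT : sin (l * T) = 0 /\ cos (l * T) = -1.
Proof.
have [h|h] := ltP 0 l.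
  by rewrite gtr0_norm// mulrC divfK ?lt0r_neq0// sinpi cospi.
by rewrite ler0_norm// invrN mulrN mulrN mulrC divfK// sinN cosN sinpi cospi oppr0.
Qed.

Lemma l2T : sin (2 * l * T) = 0 /\ cos (2 * l * T) = 1.
Proof.
have [h1 h2] := lT; have -> : 2 * l * T = l * T + l * T by rewrite -mulrA mulr2n mulrDl mul1r.
by rewrite sinD cosD h1 h2 !mul0r mulr0 addr0 mulrNN mulr1 subr0.
Qed.

Lemma g_cont s : {for s, continuous g}.
Proof.
by have := drv_cont (drvM (drv_sin (drvZ l (drv_id s))) (drv_cst l^-1 s)).
Qed.

Lemma gT : g T = 0. Proof. by rewrite /g; have [-> _] := lT; rewrite mul0r. Qed.

Lemma cir_dist z a b s : a ^+ 2 + b ^+ 2 = 1 -> `|z - cir l z a b s| <= `|g s|.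
Proof.
move=> ab; have := cx2Dcy2 l0 s ab; rewrite -/(g s) => E.
have K (x y : R) : x ^+ 2 + y ^+ 2 = g s ^+ 2 -> `|x| <= `|g s|.
  by move=> h; rewrite -(@ler_pXn2r _ 2) ?nnegrE// !real_normK ?num_real// -h lerDl sqr_ge0.
by rewrite distrC; apply: norm2_le; rewrite (c1B, c2B) /cir (c1_vec2, c2_vec2) addrC addKr;
  [apply: K E|apply: K; rewrite addrC; exact: E].
Qed.

Lemma cirT z a b : cir l z a b T = z.
Proof. by rewrite cir_scale//; have [-> _] := lT; rewrite mul0r scale0r addr0. Qed.

Lemma e1_bounds : [/\ 0 < e1, e1 < e0, e0 < T & 0 < e0].
Proof.
by case/andP: e0T => h1 h2; split=> //; rewrite /e1 ?divr_gt0// ltr_pdivrMr// ltr_pMr// ltr1n.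
Qed.

Let strip_all' al s : e1 <= s < T -> strip eps sec0 e0 al s. Proof. by move=> h; apply: strip_all. Qed.
Let Ex_ray' al s : 0 < s <= e0 -> Ex al s = ray eps sec0 al s. Proof. by move=> h; apply: Ex_ray. Qed.
Let ray_lift' al : is_lift eps sec0 e0 al e0 (ray eps sec0 al). Proof. by apply: ray_lift. Qed.
Let lift_Ex' al b c s : is_lift eps sec0 e0 al b c -> 0 < s <= b -> Ex al s = c s.
Proof. by move=> h h'; apply: lift_Ex h h'. Qed.
Let strip_Ex' al s : strip eps sec0 e0 al s -> 0 < s -> [/\ {for s, continuous (Ex al)}, F (Ex al s) = m al s,
  reg (Ex al s), zeta1 N eps (Ex al s) = dir1 l (cos al) (sin al) s & zeta2 N eps (Ex al s) = dir2 l (cos al) (sin al) s].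
Proof. by move=> h h'; apply: strip_Ex h h'. Qed.
Lemma Ex_local al s : 0 < s < T -> exists2 d, 0 < d & exists i q P (sec : lsec F N H i q P),
  forall al' s', `|al' - al| < d -> `|s' - s| < d ->
    ls_B sec (prj P (m al' s')) /\ Ex al' s' = ls_kap sec (prj P (m al' s')).
Proof.
move=> /andP[s0 sT]; have [h1 h2 h3 h4] := e1_bounds.
have [es|se] := leP e1 s.
  have /(strip_all' al)[d d0 [_ h]] : e1 <= s < T by rewrite es.
  by exists d.
exists (Num.min s (e0 - s)); first by rewrite lt_min s0 subr_gt0 (lt_trans se).
exists i0, p, (@Pxy R), sec0 => al' s' _; rewrite lt_min => /andP[].
rewrite !ltr_norml => /andP[k1 k2] /andP[k3 k4].
have se' : 0 < s' <= e0 by apply/andP; split; lra.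
have [b1 _ _ _ _] := start (cos_sin_unit al') se'.
by rewrite prj_polar (Ex_ray' al' se').
Qed.

Lemma Ex_props al s : 0 < s < T -> [/\ {for s, continuous (Ex al)}, F (Ex al s) = m al s,
  reg (Ex al s), zeta1 N eps (Ex al s) = dir1 l (cos al) (sin al) s & zeta2 N eps (Ex al s) = dir2 l (cos al) (sin al) s].
Proof.
move=> /andP[s0 sT]; have [h1 h2 h3 h4] := e1_bounds.
have [es|se] := leP e1 s.
  have /(strip_all' al)/strip_Ex'/(_ s0) : e1 <= s < T by rewrite es.
  exact.
have ses : 0 < s <= e0 by rewrite s0 ltW// (lt_trans se).
have rl := ray_lift' al; have [_ /(_ s ses)[k1 k2 k3 k4 k5]] := rl.
rewrite (lift_Ex' rl ses); split=> //.
apply: continuous_near_eq k1.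
have i1 : 0 < s < e0 by rewrite s0 (lt_trans se).
have nx : \forall x \near s, x \in `]0, e0[ by apply: near_in_itvoo; rewrite in_itv.
apply: filterS nx => x; rewrite in_itv /= => /andP[x0 xe].
by apply/esym/(lift_Ex' rl); rewrite x0 ltW.
Qed.

Definition is_top al q := [/\ prj Pxy (F q) = z0, ~ reg q, F q = m al T & Ex al x @[x --> T^'-] --> q].

Lemma top_unique al q q' : is_top al q -> is_top al q' -> q = q'.
Proof. by move=> [_ _ _ h] [_ _ _ h']; exact: (@cvg_unique _ (@surface_hausdorff _ S) _ _ _ _ h h'). Qed.

(** At the time [pi / |l|] the two limit relations make [(n1, n2)] orthogonal to [(cos al, sin al)]
    and to its quarter turn: the arrival point is singular. *)
Lemma top_exists al : exists q, is_top al q.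
Proof.
have [h1 h2 h3 h4] := e1_bounds; have [sT cT] := lT; have [s2T c2T] := l2T.
have es : e1 < T <= T by rewrite lexx andbT (lt_trans h2).
have [|q [Fq E1 E2 qL]] := Ex_limit F_imm N_nrm F_cmc F_complete l0 e0T (sec0 := sec0) (al := al) es.
  by move=> r /andP[r1 r2]; apply: strip_all'; rewrite r1.
have pq : prj Pxy (F q) = z0 by rewrite Fq prj_polar cirT.
move: E1 E2; rewrite /dir1 /dir2 /perp1 /perp2 sT cT s2T c2T !mulr0 !mulr1 !addr0 !subr0 mul0r mulr0 addr0 !mulrN1 => E1 E2.
have ab := cos_sin_unit al.
have e1_ : n1 q = 0.
  transitivity (cos al * (n1 q * cos al + n2 q * sin al) + sin al * (- (n1 q * - sin al) + n2 q * - cos al)); last first.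
    by rewrite E1 E2 !mulr0 addr0.
  by transitivity (n1 q * (cos al ^+ 2 + sin al ^+ 2)); [rewrite ab mulr1|ring].
have e2_ : n2 q = 0.
  transitivity (sin al * (n1 q * cos al + n2 q * sin al) - cos al * (- (n1 q * - sin al) + n2 q * - cos al)); last first.
    by rewrite E1 E2 !mulr0 subr0.
  by transitivity (n2 q * (cos al ^+ 2 + sin al ^+ 2)); [rewrite ab mulr1|ring].
exists q; split=> //.
  by rewrite /reg e1_ e2_ expr0n addr0 ltxx.
have [i iq] := atlas_cover q; have [P Pinj] := tangent_proj N_nrm q.
have [sec _] := local_section F_imm N_nrm F_cmc iq Pinj.
have [t /andP[et tT] tP] := qL i P sec 1 ltr01.
have Bq : ls_B sec (prj P (m al T)) by rewrite -Fq; exact: ballxx (ls_r0 sec).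
have kc : {for T, continuous (fun x => ls_kap sec (prj P (m al x)))}.
  apply: continuous_comp; last exact: ls_kapc Bq.
  by apply: prj_cont; exact: geod_cont (polar_geod F p l0 al) _.
have := cvg_at_left_filter kc; rewrite -Fq ls_UK; last exact: ls_Uq.
apply: cvg_trans; apply: near_eq_cvg; near=> x.
have [] // : [/\ ls_B sec (prj P (m al x)), `|prj P (F q) - prj P (m al x)| < 1 & Ex al x = ls_kap sec (prj P (m al x))].
apply: tP; apply/andP; split.
  by near: x; exact: nbhs_left_ge.
by near: x; exact: nbhs_left_lt.
Unshelve. all: by end_near. Qed.

Lemma top_section al q : is_top al q -> exists i (sec : lsec F N H i q (@Pxy R)), dom (atlas i) q.
Proof.
move=> [_ rq _ _]; have [_ _ a3] := singular_normal N_nrm rq.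
have n30 : n3 q != 0 by apply: contra_eq_neq a3 => ->; rewrite mul0r eq_sym oner_neq0.
have [i iq] := atlas_cover q.
by have [sec _] := local_section F_imm N_nrm F_cmc iq (fun u => @Pxy_inj _ _ F N q u n30); exists i, sec.
Qed.

(** The projected geodesics are within [|g x|] of [z0] whatever the angle, and [g] vanishes at the
    final time; so one [t] serves all angles. *)
Lemma top_start i q (sec : lsec F N H i q (@Pxy R)) : exists t, e0 <= t < T /\
  forall x, t <= x <= T -> `|g x| < ls_r sec.
Proof.
have [h1 h2 h3 h4] := e1_bounds.
have := @g_cont T; move=> /cvgrPdist_lt/(_ _ (ls_r0 sec))/nbhs_ballP[d /= d0 Hd].
exists (Num.max e0 (T - d / 2)); split=> [|x /andP[]].
  by rewrite le_max lexx /= gt_max h3 ltrBlDr ltrDl divr_gt0.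
rewrite ge_max => /andP[_ x1] xT; have := Hd x; rewrite gT sub0r normrN; apply.
rewrite /ball /= ger0_norm ?subr_ge0//; lra.
Qed.

(** By uniqueness of lifts, one common point with the section at the pole suffices. *)
Lemma top_formula i q (sec : lsec F N H i q (@Pxy R)) t al x0 : prj Pxy (F q) = z0 ->
  e0 <= t < T -> (forall x, t <= x <= T -> `|g x| < ls_r sec) ->
  t <= x0 < T -> ls_U sec (Ex al x0) ->
  forall x, t <= x < T -> ls_B sec (prj Pxy (m al x)) /\ Ex al x = ls_kap sec (prj Pxy (m al x)).
Proof.
move=> qz /andP[et tT] tr /andP[tx0 x0T] U0.
have [h1 h2 h3 h4] := e1_bounds.
have B x : t <= x < T -> ls_B sec (prj Pxy (m al x)).
  move=> /andP[tx xT]; rewrite /ls_B qz -ball_normE /= prj_polar.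
  apply: le_lt_trans (cir_dist z0 x (cos_sin_unit al)) _.
  by apply: tr; rewrite tx ltW.
move=> x xt; split; first exact: B.
have [tx xT] := andP xt.
(* The interval of uniqueness has to contain both [x] and the common point [x0]. *)
pose b := Num.max x x0.
have bT : b < T by rewrite gt_max xT.
have [xb x0b] : x <= b /\ x0 <= b by rewrite /b !le_max !lexx orbT.
have tx0b : t <= x0 <= b by rewrite tx0.
have rT r : t <= r <= b -> t <= r < T by move=> /andP[-> h]; exact: le_lt_trans bT.
have r0T r : t <= r <= b -> 0 < r < T by move=> /rT/andP[h ->]; rewrite andbT (lt_le_trans h4)// (le_trans et).
have := @lift_unique R S (@surface_hausdorff _ S) V2 (fun x => prj Pxy (F x)) (fun r => ls_kap sec (prj Pxy (m al r))) (Ex al) t b x0 tx0b.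
move=> /(_ _ _ _ x); rewrite tx xb => -> //.
- move=> r rr; have Br := B r (rT r rr); have [c1_ F1 _ _ _] := Ex_props al (r0T r rr); split.
  + apply: continuous_comp; last exact: ls_kapc Br.
    by apply: prj_cont; exact: geod_cont (polar_geod F p l0 al) _.
  + exact: c1_.
  + by rewrite (ls_kapP Br) F1.
- move=> r rr; have Br := B r (rT r rr); exists (ls_U sec); split.
  + exact: ls_Uo.
  + exact: ls_kapU.
  + by move=> y y'; exact: section_inj.
- by have [_ F1 _ _ _] := Ex_props al (r0T x0 tx0b); rewrite -F1 ls_UK.
Qed.

Lemma top_near al q i (sec : lsec F N H i q (@Pxy R)) t : is_top al q -> t < T ->
  exists2 x0, t <= x0 < T & ls_U sec (Ex al x0).
Proof.
move=> [_ _ _ L] tT.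
have nU : \forall x \near T^'-, ls_U sec (Ex al x).
  by apply: L; exact: open_nbhs_nbhs (conj (ls_Uo sec) (ls_Uq sec)).
have nt : \forall x \near T^'-, t <= x by exact: nbhs_left_ge.
have nT : \forall x \near T^'-, x < T by exact: nbhs_left_lt.
have /filter_ex[x [h1 [h2 h3]]] : \forall x \near T^'-, ls_U sec (Ex al x) /\ (t <= x /\ x < T).
  by apply: filterI => //; exact: filterI.
by exists x => //; rewrite h2.
Qed.

(** At a time before the end the geodesic lies in the section at [q], and so do its neighbours by
    continuity in the angle; [top_formula] then sends them to [q] as well. *)
Lemma top_open al q : is_top al q -> exists2 d, 0 < d & forall al', `|al' - al| < d -> is_top al' q.
Proof.
move=> tq; have [h1 h2 h3 h4] := e1_bounds.
have [i [sec _]] := top_section tq; have [t [tT tr]] := top_start sec.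
have [x0 x0T U0] := top_near sec tq (proj2 (andP tT)).
have [pq rq Fq _] := tq.
have x00 : 0 < x0 < T.
  by case/andP: x0T => k ->; case/andP: tT => k' _; rewrite andbT (lt_le_trans h4)// (le_trans k').
have [d d0 [i' [q' [P' [sec' E']]]]] := Ex_local al x00.
have [||B E] := E' al x0; rewrite ?subrr ?normr0//.
have nU : nbhs (prj P' (m al x0)) [set z | ls_U sec (ls_kap sec' z)].
  have nq : nbhs (ls_kap sec' (prj P' (m al x0))) (ls_U sec).
    by rewrite -E; exact: open_nbhs_nbhs (conj (ls_Uo sec) U0).
  exact: near_continuous (ls_kapc B) nq.
have [d5 d50 H5] := polar_near nU.
exists (Num.min d d5) => [|al']; first by rewrite lt_min d0.
rewrite lt_min => /andP[k1 k2].
have U' : ls_U sec (Ex al' x0).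
  have [|_ ->] := E' al' x0 k1; first by rewrite subrr normr0.
  by apply: H5 => //; rewrite subrr normr0.
have fo := top_formula pq tT tr x0T U'.
split=> //.
  rewrite Fq; apply: rV3P; rewrite /polar_geo /geo ?xc_vec3 ?yc_vec3 ?tc_vec3;
    have [e1_ e2_] := cx_scale l0 (cos al) (sin al) T; have [e3_ e4_] := cx_scale l0 (cos al') (sin al') T;
    by rewrite ?e1_ ?e2_ ?e3_ ?e4_; have [-> _] := lT; rewrite !mul0r ?cos_sin_unit.
have BT : ls_B sec (prj Pxy (m al' T)) by rewrite prj_polar cirT -/z0 -pq; exact: ballxx (ls_r0 sec).
have kc : {for T, continuous (fun x => ls_kap sec (prj Pxy (m al' x)))}.
  apply: continuous_comp; last exact: ls_kapc BT.
  by apply: prj_cont; exact: geod_cont (polar_geod F p l0 al') _.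
have := cvg_at_left_filter kc; rewrite prj_polar cirT -/z0 -pq ls_UK; last exact: ls_Uq.
apply: cvg_trans; apply: near_eq_cvg; near=> x.
have [] // : ls_B sec (prj Pxy (m al' x)) /\ Ex al' x = ls_kap sec (prj Pxy (m al' x)).
apply: fo; apply/andP; split.
  by near: x; apply: nbhs_left_ge; case/andP: tT.
by near: x; exact: nbhs_left_lt.
Unshelve. all: by end_near. Qed.

(** The arrival points have the same image, but [S] could have several points above it. The arrival
    point is locally constant in the angle, hence constant by real induction. *)
Lemma top_const : exists q, forall al, is_top al q.
Proof.
have W a b q : a <= b -> is_top a q -> is_top b q.
  move=> ab ta; have : forall s, a <= s <= b -> is_top s q; last by apply; rewrite ab lexx.
  apply: real_induction => // s /andP[as_ sb] hr.
    have [|d d0 Hd] := @top_open s q; first by apply: hr; rewrite as_ lexx.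
    exists d => // r /andP[sr re]; apply: Hd.
    by rewrite gtr0_norm ?subr_gt0// ltrBlDl.
  have [q' tq'] := top_exists s; have [d d0 Hd] := top_open tq'.
  (* An angle before [s], at which the arrival point is known to be [q], and close enough to [s] for
     it to be [q'] too. *)
  pose r := Num.max a (s - d / 2).
  have rs : r < s by rewrite gt_max as_ ltrBlDr ltrDl divr_gt0.
  have ar : a <= r by rewrite le_max lexx.
  have dr : s - d / 2 <= r by rewrite le_max lexx orbT.
  have tr' : is_top r q' by apply: Hd; rewrite ltr0_norm ?subr_lt0// opprB; lra.
  have tr : is_top r q by apply: hr; rewrite ar.
  by rewrite (top_unique tr tr').
have [q tq] := top_exists 0; exists q => al.
have [al0|/ltW al0] := leP 0 al; first exact: W tq.
have [q' tq'] := top_exists al; have tq0 := W _ _ _ al0 tq'.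
by rewrite (top_unique tq tq0).
Qed.

Lemma polar_var_prj P al s : let v := vec3 (- cy l (cos al) (sin al) s) (cx l (cos al) (sin al) s)
    (yc (F p) * - cy l (cos al) (sin al) s - xc (F p) * cx l (cos al) (sin al) s) in
  drv2 (fun al => prj P (m al s)) al (c1 (prj P v)) (c2 (prj P v)).
Proof.
move=> v; have [X Y TT] := polar_geo_var l (F p) al s.
rewrite /prj /v xc_vec3 yc_vec3 tc_vec3 c1_vec2 c2_vec2; split.
- apply: (@drv_ext _ (fun r => pa P * xc (m r s) + pb P * yc (m r s) + pc P * tc (m r s))).
    by move=> r /=; rewrite c1_vec2.
  by apply: drvD; [apply: drvD|]; exact: drvZ.
- apply: (@drv_ext _ (fun r => qa P * xc (m r s) + qb P * yc (m r s) + qc P * tc (m r s))).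
    by move=> r /=; rewrite c2_vec2.
  by apply: drvD; [apply: drvD|]; exact: drvZ.
Qed.

Lemma C1_cos U (f : V2 -> R) : isC1 U f -> isC1 U (fun z => cos (f z)) /\ isC1 U (fun z => sin (f z)).
Proof.
move=> [a [b fC]].
have cc z : U z -> {for z, continuous (fun z => cos (f z))} /\ {for z, continuous (fun z => sin (f z))}.
  move=> Uz; have fc := C1_cont fC Uz; split.
    exact: (continuous_comp fc (@continuous_cos R _)).
  exact: (continuous_comp fc (@continuous_sin R _)).
split.
- exists (fun z => - sin (f z) * a z), (fun z => - sin (f z) * b z); split=> [z Uz|z Uz|z Uz|y s v1 v2 Us yD].
  + by have [] := cc z Uz.
  + by apply: continuousM; [apply: continuousN; have [] := cc z Uz|exact: (C1_cont1 fC Uz)].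
  + by apply: continuousM; [apply: continuousN; have [] := cc z Uz|exact: (C1_cont2 fC Uz)].
  + by refine (drv_eq (drv_cos (C1_chain fC Us yD)) _); rewrite /=; ring.
- exists (fun z => cos (f z) * a z), (fun z => cos (f z) * b z); split=> [z Uz|z Uz|z Uz|y s v1 v2 Us yD].
  + by have [] := cc z Uz.
  + by apply: continuousM; [have [] := cc z Uz|exact: (C1_cont1 fC Uz)].
  + by apply: continuousM; [have [] := cc z Uz|exact: (C1_cont2 fC Uz)].
  + by refine (drv_eq (drv_sin (C1_chain fC Us yD)) _); rewrite /=; ring.
Qed.

Lemma polar_isC1 U : open U -> [/\ isC1 U (fun y : V2 => xc (m (c1 y) (c2 y))), isC1 U (fun y : V2 => yc (m (c1 y) (c2 y))) &
  isC1 U (fun y : V2 => tc (m (c1 y) (c2 y)))].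
Proof.
move=> oU; have i1 : isC1 U (@c1 R) by exists (fun=> 1), (fun=> 0); exact: C1_c1.
have i2 : isC1 U (@c2 R) by exists (fun=> 0), (fun=> 1); exact: C1_c2.
have k c : isC1 U (fun _ : V2 => c) by exact: isC1_cst.
have [co1 si1] := C1_cos i1.
have [co2 si2] := C1_cos (isC1M (k (2 * l)) i2).
have X : isC1 U (fun y : V2 => cx l (cos (c1 y)) (sin (c1 y)) (c2 y)).
  by apply: isC1M => //; apply: isC1D; apply: isC1M => //; exact: isC1B.
have Y : isC1 U (fun y : V2 => cy l (cos (c1 y)) (sin (c1 y)) (c2 y)).
  by apply: isC1M => //; apply: isC1B; apply: isC1M => //; exact: isC1B.
have TT : isC1 U (fun y : V2 => ct l (c2 y)).
  by apply: isC1M => //; apply: isC1B => //; exact: isC1M.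
split.
- rewrite (_ : (fun y => _) = fun y => xc (F p) + cx l (cos (c1 y)) (sin (c1 y)) (c2 y)); first exact: isC1D.
  by apply/funext => y; rewrite /polar_geo /geo xc_vec3.
- rewrite (_ : (fun y => _) = fun y => yc (F p) + cy l (cos (c1 y)) (sin (c1 y)) (c2 y)); first exact: isC1D.
  by apply/funext => y; rewrite /polar_geo /geo yc_vec3.
- rewrite (_ : (fun y => _) = fun y => tc (F p) + (ct l (c2 y) + (yc (F p) * cx l (cos (c1 y)) (sin (c1 y)) (c2 y) -
    xc (F p) * cy l (cos (c1 y)) (sin (c1 y)) (c2 y)))).
    by apply: isC1D => //; apply: isC1D => //; apply: isC1B; exact: isC1M.
  by apply/funext => y; rewrite /polar_geo /geo tc_vec3 cos_sin_unit mul1r -!addrA.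
Qed.

(* If the Jacobian of the projected polar coordinates vanished, the Jacobi field
   would have no T-component, but this is [(sin (l s) / l)^2]. *)
Lemma polar_open al s : 0 < s < T -> forall d, 0 < d -> \forall q \near Ex al s,
  exists al' s', [/\ `|al' - al| < d, `|s' - s| < d & Ex al' s' = q].
Proof.
move=> sT d0 d00; have [d1 d10 [i [q [P [sec E]]]]] := Ex_local al sT.
have [s0 sT'] := andP sT.
pose d := Num.min (Num.min d0 d1) (Num.min s (T - s)).
have dp : 0 < d by rewrite !lt_min d00 d10 s0 subr_gt0.
have [dd0 dd1 dds ddT] : [/\ d <= d0, d <= d1, d <= s & d <= T - s].
  by rewrite /d !ge_min !lexx !orbT.
have sr s' : `|s' - s| < d -> 0 < s' < T.
  by rewrite ltr_norml => /andP[h1 h2]; apply/andP; split; lra.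
have E' al' s' : `|al' - al| < d -> `|s' - s| < d -> [/\ ls_B sec (prj P (m al' s')),
    Ex al' s' = ls_kap sec (prj P (m al' s')) & F (ls_kap sec (prj P (m al' s'))) = m al' s'].
  move=> h1 h2; have [b e] := E al' s' (lt_le_trans h1 dd1) (lt_le_trans h2 dd1).
  by split=> //; rewrite -e; have [] := Ex_props al' (sr s' h2).
pose U := ball (vec2 al s) d; pose y0 := vec2 al s.
have oU : open U by exact: ball_open.
have UP y : U y -> `|c1 y - al| < d /\ `|c2 y - s| < d.
  rewrite /U -ball_normE /= distrC => h; have := c1_le (y - vec2 al s); have := c2_le (y - vec2 al s).
  by rewrite c1B c2B c1_vec2 c2_vec2 => h2 h1; split; [exact: le_lt_trans h1 h|exact: le_lt_trans h2 h].
have [Xi Yi Ti] := polar_isC1 oU.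
have [a11 [a12 f1C]] : isC1 U (fun y => pa P * xc (m (c1 y) (c2 y)) + pb P * yc (m (c1 y) (c2 y)) + pc P * tc (m (c1 y) (c2 y))).
  by apply: isC1D; [apply: isC1D|]; apply: isC1M => //; exact: isC1_cst.
have [a21 [a22 f2C]] : isC1 U (fun y => qa P * xc (m (c1 y) (c2 y)) + qb P * yc (m (c1 y) (c2 y)) + qc P * tc (m (c1 y) (c2 y))).
  by apply: isC1D; [apply: isC1D|]; apply: isC1M => //; exact: isC1_cst.
set f1 := fun y => _ in f1C; set f2 := fun y => _ in f2C.
have fE y : vec2 (f1 y) (f2 y) = prj P (m (c1 y) (c2 y)) by [].
have f1E a b : f1 (vec2 a b) = c1 (prj P (m a b)) by rewrite /f1 !c1_vec2 !c2_vec2.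
have f2E a b : f2 (vec2 a b) = c2 (prj P (m a b)) by rewrite /f2 !c1_vec2 !c2_vec2.
have Uy0 : U y0 by exact: ballxx.
set v := vec3 (- cy l (cos al) (sin al) s) (cx l (cos al) (sin al) s)
    (yc (F p) * - cy l (cos al) (sin al) s - xc (F p) * cx l (cos al) (sin al) s).
set w := vec3 (dir1 l (cos al) (sin al) s) (dir2 l (cos al) (sin al) s)
   (yc (m al s) * dir1 l (cos al) (sin al) s - xc (m al s) * dir2 l (cos al) (sin al) s).
have Dv := polar_var_prj P al s; cbv zeta in Dv; rewrite -/v in Dv.
have Dw := geod_drv2 P s (polar_geod F p l0 al); cbv zeta in Dw; rewrite -/w in Dw.
have line1 : drv2 (fun t => vec2 t s) al 1 0.
  split; [apply: (@drv_ext _ (fun t => t)) (drv_id al)|apply: (@drv_ext _ (fun=> s)) (drv_cst s al)] => t /=; by rewrite ?c1_vec2 ?c2_vec2.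
have line2 : drv2 (fun t => vec2 al t) s 0 1.
  split; [apply: (@drv_ext _ (fun=> al)) (drv_cst al s)|apply: (@drv_ext _ (fun t => t)) (drv_id s)] => t /=; by rewrite ?c1_vec2 ?c2_vec2.
have A11 : a11 y0 = c1 (prj P v).
  have := C1_chain f1C (y := fun t => vec2 t s) Uy0 line1; rewrite mulr1 mulr0 addr0 => D.
  by apply: drv_unique D _; apply: drv_ext (proj1 Dv) => t /=; rewrite f1E.
have A21 : a21 y0 = c2 (prj P v).
  have := C1_chain f2C (y := fun t => vec2 t s) Uy0 line1; rewrite mulr1 mulr0 addr0 => D.
  by apply: drv_unique D _; apply: drv_ext (proj2 Dv) => t /=; rewrite f2E.
have A12 : a12 y0 = c1 (prj P w).
  have := C1_chain f1C (y := fun t => vec2 al t) Uy0 line2; rewrite mulr1 mulr0 add0r => D.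
  by apply: drv_unique D _; apply: drv_ext (proj1 Dw) => t /=; rewrite f1E.
have A22 : a22 y0 = c2 (prj P w).
  have := C1_chain f2C (y := fun t => vec2 al t) Uy0 line2; rewrite mulr1 mulr0 add0r => D.
  by apply: drv_unique D _; apply: drv_ext (proj2 Dw) => t /=; rewrite f2E.
have [B0 Ek _] : [/\ ls_B sec (prj P (m al s)), Ex al s = ls_kap sec (prj P (m al s)) & F (ls_kap sec (prj P (m al s))) = m al s].
  by apply: E'; rewrite subrr normr0.
have [X1 Y1 T1] := polar_geo_var l (F p) al s.
have [X2 Y2 T2 _ _] := polar_geod F p l0 al s.
have Kv (f : H1 -> R) df a b : drv (fun r => f (m r s)) al df ->
    C1 (ls_B sec) (fun z => f (F (ls_kap sec z))) a b ->
    df = a (prj P (m al s)) * c1 (prj P v) + b (prj P (m al s)) * c2 (prj P v).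
  move=> D C; apply: (drv_unique D (drv_near _ (C1_chain C (y := fun r => prj P (m r s)) B0 Dv))).
  apply/nbhs_ballP; exists d => // r; rewrite /ball /= distrC => rd.
  by have [|_ _ ->] := E' r s rd; first by rewrite subrr normr0.
have Kw (f : H1 -> R) df a b : drv (fun r => f (m al r)) s df ->
    C1 (ls_B sec) (fun z => f (F (ls_kap sec z))) a b ->
    df = a (prj P (m al s)) * c1 (prj P w) + b (prj P (m al s)) * c2 (prj P w).
  move=> D C; apply: (drv_unique D (drv_near _ (C1_chain C (y := fun r => prj P (m al r)) B0 Dw))).
  apply/nbhs_ballP; exists d => // r; rewrite /ball /= distrC => rd.
  by have [|_ _ ->] // := E' al r _ rd; first by rewrite subrr normr0.
have det0 : a11 y0 * a22 y0 - a12 y0 * a21 y0 != 0.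
  apply/eqP; rewrite A11 A12 A21 A22.
  have v1 := Kv _ _ _ _ X1 (ls_xC sec); have v2 := Kv _ _ _ _ Y1 (ls_yC sec); have v3 := Kv _ _ _ _ T1 (ls_tC sec).
  have w1 := Kw _ _ _ _ X2 (ls_xC sec); have w2 := Kw _ _ _ _ Y2 (ls_yC sec); have w3 := Kw _ _ _ _ T2 (ls_tC sec).
  move: v1 v2 v3 w1 w2 w3; move: (c1 (prj P v)) (c2 (prj P v)) (c1 (prj P w)) (c2 (prj P w)) => p1 p2 r1 r2.
  move: (ls_x1 _ _) (ls_x2 _ _) (ls_y1 _ _) (ls_y2 _ _) (ls_t1 _ _) (ls_t2 _ _) => x1 x2 y1 y2 u1 u2.
  have du := dir_unit l s (cos_sin_unit al); have cn := cx2Dcy2 l0 s (cos_sin_unit al).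
  have k0 := sin_lin_gt0 l0 sT.
  have mx : xc (m al s) = xc (F p) + cx l (cos al) (sin al) s by rewrite /polar_geo /geo xc_vec3.
  have my : yc (m al s) = yc (F p) + cy l (cos al) (sin al) s by rewrite /polar_geo /geo yc_vec3.
  move: du cn k0 mx my; move: (dir1 _ _ _ _) (dir2 _ _ _ _) (cx _ _ _ _) (cy _ _ _ _) (xc (m al s)) (yc (m al s)) (sin _ / l) (xc (F p)) (yc (F p)).
  move=> D1 D2 X Y mX mY k px py du cn k0 mx my v1 v2 v3 w1 w2 w3 dt.
  have tv : (py * - Y - px * X) = mY * - Y - mX * X + k ^+ 2 by rewrite -cn mx my; ring.
  (* With parallel projections the Jacobi field and the velocity, which has no T-component, would be
     linearly dependent. [Z1] and [Z2] are the two minors that involve the T-component [k ^+ 2] of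
     the Jacobi field. *)
  have Z1 : D1 * k ^+ 2 = 0.
    transitivity (D1 * (py * - Y - px * X) - - Y * (mY * D1 - mX * D2) - mX * (- Y * D2 - X * D1)); first by rewrite tv; ring.
    rewrite v3 w3 v1 v2 w1 w2.
    transitivity ((mX * (x2 * y1 - x1 * y2) + (x2 * u1 - x1 * u2)) * (p1 * r2 - r1 * p2)); last by rewrite dt mulr0.
    by ring.
  have Z2 : D2 * k ^+ 2 = 0.
    transitivity (D2 * (py * - Y - px * X) - X * (mY * D1 - mX * D2) - mY * (- Y * D2 - X * D1)); first by rewrite tv; ring.
    rewrite v3 w3 v1 v2 w1 w2.
    transitivity ((mY * (x2 * y1 - x1 * y2) + (y2 * u1 - y1 * u2)) * (p1 * r2 - r1 * p2)); last by rewrite dt mulr0.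
    by ring.
  have k2 : k ^+ 2 != 0 by rewrite sqrf_eq0 gt_eqF.
  have e1_ : D1 = 0 by apply: (mulIf k2); rewrite mul0r.
  have e2_ : D2 = 0 by apply: (mulIf k2); rewrite mul0r.
  by move: du; rewrite e1_ e2_ expr0n addr0 => /esym/eqP; rewrite oner_eq0.
have [W [r [eta [[oW Wy0 WU r0] [etaP _ _ _]]]]] := local_inverse oU Uy0 f1C f2C det0.
rewrite fE c1_vec2 c2_vec2 in etaP.
have FcE : {for Ex al s, continuous (fun q => prj P (F q))} by apply: prj_cont; exact: F_cont.
have nB : \forall q \near Ex al s, ball (prj P (m al s)) r (prj P (F q)).
  have [_ FE _ _ _] := Ex_props al sT.
  have nn : nbhs (prj P (F (Ex al s))) (ball (prj P (m al s)) r) by rewrite FE; exact: nbhsx_ballx.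
  exact: near_continuous FcE nn.
have nU : \forall q \near Ex al s, ls_U sec q.
  by apply: open_nbhs_nbhs; split; [exact: ls_Uo|rewrite Ek; exact: ls_kapU].
have nn : \forall q \near Ex al s, ls_U sec q /\ ball (prj P (m al s)) r (prj P (F q)) by exact: filterI.
apply: filterS nn => q' [Uq' /etaP[Wq' Eq']]; have [h1 h2] := UP _ (WU _ Wq').
exists (c1 (eta (prj P (F q')))), (c2 (eta (prj P (F q')))).
split; [exact: lt_le_trans h1 dd0|exact: lt_le_trans h2 dd0|].
have [_ -> _] := E' _ _ h1 h2.
by rewrite -fE Eq' ls_UK.
Qed.

Hypothesis S_connected : connected [set: S].
Hypothesis cover0 : exists2 r, 0 < r & forall z, `|z - z0| <= r -> z != z0 ->
  exists a b s, [/\ a ^+ 2 + b ^+ 2 = 1, 0 < s <= e0 & z = cir l z0 a b s].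
Variables (qt : S) (it : chart_index S) (sect : lsec F N H it qt (@Pxy R)) (tt : R).
Hypothesis qtP : forall al, is_top al qt.
Hypothesis ttT : e0 <= tt < T.
Hypothesis ttr : forall x, tt <= x <= T -> `|g x| < ls_r sect.

Lemma z0E : prj Pxy (F qt) = z0. Proof. by have [] := qtP 0. Qed.

Lemma Ex_top al x : tt <= x < T -> ls_B sect (prj Pxy (m al x)) /\ Ex al x = ls_kap sect (prj Pxy (m al x)).
Proof.
have [x0 x0T U0] := top_near sect (qtP al) (proj2 (andP ttT)).
exact: top_formula z0E ttT ttr x0T U0 x.
Qed.

(* Glues the descriptions of the surface near [p], away from the poles and near
   the top pole. *)
Definition Eh al s : S := if s <= e1 then ray eps sec0 al s else if s < tt then Ex al s
  else ls_kap sect (prj Pxy (m al s)).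

Lemma Eh_ray al s : s < e0 -> Eh al s = ray eps sec0 al s.
Proof.
move=> se; rewrite /Eh; case: ifPn => //; rewrite -ltNge => es.
have [h1 _ _ _] := e1_bounds; have [h _] := andP ttT.
by rewrite (lt_le_trans se h) Ex_ray'// ltW// andbT (lt_trans h1).
Qed.

Lemma Eh_Ex al s : 0 < s < T -> Eh al s = Ex al s.
Proof.
move=> /andP[s0 sT]; rewrite /Eh; have [_ h2 _ _] := e1_bounds.
case: ifPn => [se|_]; first by rewrite Ex_ray'// s0 (le_trans se)// ltW.
by case: ltP => // ts; have [|_ ->] := @Ex_top al s; rewrite ?ts.
Qed.

Lemma Eh_top al s : tt < s -> Eh al s = ls_kap sect (prj Pxy (m al s)).
Proof.
move=> ts; have [_ h2 _ _] := e1_bounds; have [h _] := andP ttT.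
have s1 : e1 < s by exact: lt_trans h2 (le_lt_trans h ts).
by rewrite /Eh leNgt s1 /= ltNge (ltW ts).
Qed.

Lemma sec0_z0 : ls_B sec0 z0. Proof. exact: ballxx (ls_r0 sec0). Qed.
Lemma sect_z0 : ls_B sect z0. Proof. by rewrite -z0E; exact: ballxx (ls_r0 sect). Qed.

Lemma Eh0 al : Eh al 0 = p.
Proof.
have [_ _ _ h4] := e1_bounds; rewrite Eh_ray// /ray cir0.
by rewrite ls_UK//; exact: ls_Uq.
Qed.

Lemma EhT al : Eh al T = qt.
Proof. by rewrite Eh_top; [rewrite prj_polar cirT -/z0 -z0E ls_UK//; exact: ls_Uq|case/andP: ttT]. Qed.

Lemma Eh_F al s : 0 <= s <= T -> F (Eh al s) = m al s.
Proof.
move=> /andP[]; rewrite le_eqVlt => /predU1P[<- _|s0]; first by rewrite Eh0 /polar_geo geo0.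
rewrite le_eqVlt => /predU1P[->|sT]; first by rewrite EhT; have [] := qtP al.
have s0T : 0 < s < T by rewrite s0.
by rewrite Eh_Ex//; have [] := Ex_props al s0T.
Qed.

Lemma Eh_local al s : 0 <= s <= T -> exists2 d, 0 < d & exists i q P (sec : lsec F N H i q P),
  forall al' s', `|al' - al| < d -> `|s' - s| < d ->
    ls_B sec (prj P (m al' s')) /\ Eh al' s' = ls_kap sec (prj P (m al' s')).
Proof.
move=> /andP[s0 sT]; have [h1 h2 h3 h4] := e1_bounds.
have opB i q P (sec : lsec F N H i q P) : ls_B sec (prj P (m al s)) -> nbhs (prj P (m al s)) (ls_B sec).
  by move=> B; apply: open_nbhs_nbhs; split=> //; exact: ball_open.
have [se|es] := ltP s e0.
  have B : ls_B sec0 (prj Pxy (m al s)).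
    rewrite prj_polar; move: s0; rewrite le_eqVlt => /predU1P[<-|s0]; first by rewrite cir0; exact: sec0_z0.
    by have [|] := start (cos_sin_unit al) (s := s); first by rewrite s0 ltW.
  have [d d0 Hd] := polar_near (opB _ _ _ _ B).
  exists (Num.min d (e0 - s)); first by rewrite lt_min d0 subr_gt0.
  exists i0, p, (@Pxy R), sec0 => al' s'; rewrite !lt_min => /andP[k1 _] /andP[k2 k3].
  split; first exact: Hd.
  by rewrite Eh_ray ?prj_polar//; move: k3; rewrite ltr_norml => /andP[_ k3]; lra.
have {s0}s0 : 0 < s by exact: lt_le_trans h4 es.
move: sT; rewrite le_eqVlt => /predU1P[sT|sT].
  have B : ls_B sect (prj Pxy (m al s)) by rewrite sT prj_polar cirT; exact: sect_z0.
  have [d d0 Hd] := polar_near (opB _ _ _ _ B).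
  have [_ tT] := andP ttT.
  exists (Num.min d (T - tt)); first by rewrite lt_min d0 subr_gt0.
  exists it, qt, (@Pxy R), sect => al' s'; rewrite !lt_min => /andP[k1 _] /andP[k2 k3].
  split; first exact: Hd.
  by rewrite Eh_top//; move: k3; rewrite sT ltr_norml => /andP[k3 _]; lra.
have sT' : 0 < s < T by rewrite s0.
have [d d0 [i [q [P [sec E]]]]] := Ex_local al sT'.
exists (Num.min d (Num.min s (T - s))); first by rewrite !lt_min d0 s0 subr_gt0.
exists i, q, P, sec => al' s'; rewrite !lt_min => /and3P[k1 _ _] /and3P[k2 k3 k4].
have [b e] := E al' s' k1 k2; split=> //; rewrite Eh_Ex//.
by move: k3 k4; rewrite !ltr_norml => /andP[k3 _] /andP[_ k4]; apply/andP; split; lra.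
Qed.

Lemma Eh_cont al s : 0 <= s <= T -> {for (al, s), continuous (fun x : R * R => Eh x.1 x.2)}.
Proof.
move=> sT; have [d d0 [i [q [P [sec E]]]]] := Eh_local al sT.
have [||B _] := E al s; rewrite ?subrr ?normr0//.
apply: (@continuous_near_eq _ _ (fun x : R * R => ls_kap sec (prj P (m x.1 x.2)))).
  apply/nbhs_ballP; exists d => // -[al' s'] [/= k1 k2].
  by have [||_ ->] := E al' s'; rewrite // distrC.
by apply: (continuous_comp (@prj_polar_cont _ _ _ _ _)); exact: ls_kapc.
Qed.

Lemma Eh_angle al al' s : cos al = cos al' -> sin al = sin al' -> Eh al s = Eh al' s.
Proof.
move=> hc hs; have E1 : ray eps sec0 al = ray eps sec0 al'.
  by apply/funext => r; rewrite /ray hc hs.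
have E2 b c : is_lift eps sec0 e0 al b c = is_lift eps sec0 e0 al' b c by rewrite /is_lift E1 /polar_geo hc hs.
have E3 : Ex al s = Ex al' s.
  rewrite /lift_point; congr xget; apply/funext => q; apply/propext.
  by split=> -[c [cL cs]]; exists c; rewrite ?E2// -E2.
by rewrite /Eh E1 E3 /polar_geo hc hs.
Qed.

Definition polar_image := [set q | exists al s, 0 <= s <= T /\ Eh al s = q].

(** [Eh] depends on the angle through its sine and cosine, so the angles may be restricted to
    [[- pi, pi]]. *)
Lemma image_compact : compact polar_image.
Proof.
have -> : polar_image = (fun x : R * R => Eh x.1 x.2) @` (`[- pi, pi] `*` `[0, T]).
  apply/seteqP; split=> [q [al [s [sT <-]]]|q [[al s] [/= _ sT] <-]]; last by exists al, s; move: sT; rewrite in_itv.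
  have [al' [aT hc hs]] := exists_angle (cos_sin_unit al).
  by exists (al', s); [split; rewrite /= in_itv|exact: Eh_angle].
apply: continuous_compact; last by apply: compact_setX; exact: segment_compact.
apply: continuous_in_subspaceT => -[al s]; rewrite inE => -[_ /=]; rewrite in_itv /= => sT.
exact: Eh_cont.
Qed.

(** At [p] this is [cover0] and at intermediate times [polar_open]. At the other pole the end points
    of the projected geodesics fill a disc, since [g] takes all values between [g tt] and 0. *)
Lemma image_open : open polar_image.
Proof.
rewrite openE => q [al [s [/andP[+ +] <-]]].
have [h1 h2 h3 h4] := e1_bounds; have [tt0 ttT'] := andP ttT.
(* At a pole it suffices to reach the points of the section above a punctured disc around [z0]. *)
have nearz i q0 (sec : lsec F N H i q0 (@Pxy R)) r : prj Pxy (F q0) = z0 -> 0 < r ->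
    (forall z, ls_B sec z -> `|z - z0| <= r -> z != z0 -> polar_image (ls_kap sec z)) -> polar_image q0 -> nbhs q0 polar_image.
  move=> qz r0 Hr iq0.
  have Fc : {for q0, continuous (fun q => prj Pxy (F q))} by apply: prj_cont; exact: F_cont.
  have nU : \forall q \near q0, ls_U sec q by exact: open_nbhs_nbhs (conj (ls_Uo sec) (ls_Uq sec)).
  have nr : \forall q \near q0, `|prj Pxy (F q0) - prj Pxy (F q)| <= r by move/cvgrPdist_le: Fc; exact.
  have nn : \forall q \near q0, ls_U sec q /\ `|prj Pxy (F q0) - prj Pxy (F q)| <= r by exact: filterI.
  apply: filterS nn => q' [Uq' rq']; rewrite qz distrC in rq'.
  rewrite -(ls_UK Uq'); have [zE|zz0] := eqVneq (prj Pxy (F q')) z0; last by apply: Hr => //; exact: ls_UB.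
  by rewrite zE -qz ls_UK//; exact: ls_Uq.
rewrite le_eqVlt => /predU1P[<- _|s0].
  have [r r0 Hr] := cover0; rewrite Eh0; apply: (nearz _ _ sec0 r) => //; last first.
    by exists 0, 0; rewrite Eh0 lexx ltW// T_gt0.
  move=> z Bz zr zz0; have [a [b [x [ab /andP[x0 xe] zE]]]] := Hr z zr zz0.
  have [al' [_ hc hs]] := exists_angle ab.
  exists al', x; split; first by rewrite (ltW x0) (le_trans xe)// ltW.
  have xT : 0 < x < T by rewrite x0 (le_lt_trans xe).
  by rewrite Eh_Ex// Ex_ray'; [rewrite /ray hc hs -/z0 -zE|rewrite x0].
rewrite le_eqVlt => /predU1P[->|sT]; last first.
  have s0T : 0 < s < T by rewrite s0.
  have d0 : 0 < Num.min s (T - s) by rewrite lt_min s0 subr_gt0.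
  rewrite Eh_Ex//; apply: filterS (polar_open al s0T d0) => q' [al' [s' [_ + <-]]].
  rewrite lt_min !ltr_norml => /andP[/andP[k1 _] /andP[_ k2]].
  have s'T : 0 < s' < T by apply/andP; split; lra.
  exists al', s'; rewrite Eh_Ex//; split=> //.
  by case/andP: s'T => k3 k4; rewrite !ltW.
have gt0 : 0 < g tt by apply: sin_lin_gt0 => //; rewrite ttT' (lt_le_trans h4).
rewrite EhT; apply: (nearz _ _ sect (g tt / 2)); [exact: z0E|by rewrite divr_gt0| |].
  move=> z Bz zr zz0.
  pose rho := Num.sqrt (rad2 z0 z).
  have rho0 : 0 < rho by rewrite sqrtr_gt0 rad2_gt0.
  have rho2 : rho ^+ 2 = rad2 z0 z by rewrite sqr_sqrtr// rad2_ge0.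
  have /andP[_ rhog] := norm_rad z0 z.
  have rg : rho <= g tt by apply: le_trans rhog _; rewrite mulrC -ler_pdivlMr.
  have [x xr gx] : exists2 x, tt <= x <= T & g x = rho.
    have gc : {within `[tt, T], continuous g} by apply: continuous_in_subspaceT => y _; exact: g_cont.
    have [|x] := IVT (ltW ttT') gc (v := rho).
      by rewrite gT ge_min le_max rg (ltW rho0) orbT.
    by rewrite in_itv /= => xr gx; exists x.
  have xT : x < T.
    rewrite lt_neqAle (proj2 (andP xr)) andbT; apply/eqP => xT.
    have rgT : rho = g T by rewrite -gx xT.
    by move: rho0; rewrite rgT gT ltxx.
  have [tx _] := andP xr.
  have x0 : 0 < x by rewrite (lt_le_trans h4)// (le_trans tt0).
  (* The initial direction is that of [z - z0] turned by [l * x], which inverts [cir_scale]. *)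
  pose u1 := (c1 z - c1 z0) / rho; pose u2 := (c2 z - c2 z0) / rho.
  have uu : u1 ^+ 2 + u2 ^+ 2 = 1.
    by rewrite !expr_div_n -mulrDl -/(rad2 z0 z) rho2 divff// gt_eqF// rad2_gt0.
  have C := cos2Dsin2 (l * x); set co := cos (l * x) in C; set si := sin (l * x) in C.
  have ab : (u1 * co - u2 * si) ^+ 2 + (u1 * si + u2 * co) ^+ 2 = 1.
    transitivity ((u1 ^+ 2 + u2 ^+ 2) * (co ^+ 2 + si ^+ 2)); first ring.
    by rewrite uu C mulr1.
  have [al' [_ hc hs]] := exists_angle ab.
  exists al', x; split; first by rewrite (ltW x0) ltW.
  rewrite Eh_Ex ?x0//; have [|_ ->] := @Ex_top al' x; first by rewrite tx.
  congr ls_kap; rewrite prj_polar cir_scale// -/(g x) gx -/co -/si hc hs -/z0.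
  have r1 : rho != 0 by rewrite gt_eqF.
  apply: rV2_add.
  - transitivity (c1 z0 + rho * (u1 * (co ^+ 2 + si ^+ 2))); first ring.
    by rewrite C mulr1 mulrC divfK// subrKC.
  - transitivity (c2 z0 + rho * (u2 * (co ^+ 2 + si ^+ 2))); first ring.
    by rewrite C mulr1 mulrC divfK// subrKC.
by exists 0, T; rewrite EhT lexx ltW// T_gt0.
Qed.

Lemma image_full q : exists al s, 0 <= s <= T /\ Eh al s = q.
Proof.
have : polar_image = [set: S].
  apply: S_connected.
  - by exists p, 0, 0; rewrite Eh0 lexx ltW// T_gt0.
  - by exists polar_image; [exact: image_open|rewrite setTI].
  - by exists polar_image; [exact: compact_closed (@surface_hausdorff _ S) image_compact|rewrite setTI].
by move=> E; have : [set: S] q by []; rewrite -E.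
Qed.

(** The derivative of [ct] is [l] times the square of [sin (l * c) / l], which is not zero strictly
    inside the interval. *)
Lemma ct_inj s s' : 0 <= s <= T -> 0 <= s' <= T -> ct l s = ct l s' -> s = s'.
Proof.
have K x y : 0 <= x -> y <= T -> x < y -> ct l x != ct l y.
  move=> x0 yT xy; have [c /andP[xc cy_] E] := drv_MVT xy (fun s _ => drv_ct l0 s).
  apply/eqP => h; move: E; rewrite h subrr => /esym/eqP.
  rewrite mulf_eq0 subr_eq0 (gt_eqF xy) orbF.
  have cT : 0 < c < T by rewrite (le_lt_trans x0)//= (lt_le_trans cy_).
  have := sin_lin_gt0 l0 cT; set k := sin _ / l => k0.
  have kl : k * l = sin (l * c) by rewrite /k divfK.
  have -> : 2 * l * c = l * c + l * c by ring.
  have C := cos2Dsin2 (l * c).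
  have -> : 1 - cos (l * c + l * c) = (k * l) ^+ 2 *+ 2.
    rewrite cosD -!expr2 kl; have -> : cos (l * c) ^+ 2 = 1 - sin (l * c) ^+ 2 by rewrite -C addrK.
    by rewrite mulr2n; ring.
  move=> /eqP h2.
  have : (k * l) ^+ 2 *+ 2 / (2 * l) = k ^+ 2 * l by rewrite -mulr_natl; field.
  by rewrite h2 => /esym/eqP; rewrite mulf_eq0 sqrf_eq0 (gt_eqF k0) (negbTE l0).
move=> /andP[s0 sT] /andP[s0' sT'] E; apply/eqP; apply/negPn/negP; rewrite neq_lt => /orP[h|h].
- by have := K _ _ s0 sT' h; rewrite E eqxx.
- by have := K _ _ s0' sT h; rewrite E eqxx.
Qed.

(** Once the xy-coordinates agree, the heights compare the values of [ct], so the times agree; at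
    intermediate times the chord then determines the direction. *)
Lemma polar_inj al s al' s' : 0 <= s <= T -> 0 <= s' <= T -> m al s = m al' s' -> Eh al s = Eh al' s'.
Proof.
move=> sT sT' E; have ex := congr1 xc E; have ey := congr1 yc E; have et := congr1 tc E.
move: ex ey et; rewrite /polar_geo /geo !xc_vec3 !yc_vec3 !tc_vec3 => /addrI ex /addrI ey.
rewrite ex ey !cos_sin_unit !mul1r => /addIr/addrI et.
have ss := ct_inj sT sT' et; rewrite -ss in sT' ex ey *.
move: (sT) => /andP[]; rewrite le_eqVlt => /predU1P[<- _|s0]; first by rewrite !Eh0.
rewrite le_eqVlt => /predU1P[->|s1]; first by rewrite !EhT.
have sn : sin (l * s) != 0.
  have := sin_lin_gt0 l0 (s := s); rewrite s0 s1 => /(_ isT); apply: contraTneq => ->.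
  by rewrite mul0r ltxx.
have [hc hs] : cos al = cos al' /\ sin al = sin al'.
  by apply: (cir_inj l0 (z := z0) (s := s)) => //; rewrite /cir ex ey.
exact: Eh_angle.
Qed.

Lemma F_injective : injective F.
Proof.
move=> q q'; have [al [s [sT <-]]] := image_full q; have [al' [s' [sT' <-]]] := image_full q'.
by rewrite !Eh_F// => E; exact: polar_inj.
Qed.

Lemma F_range : range F = [set m al s | al in [set: R] & s in `[0, T]].
Proof.
apply/seteqP; split=> [_ [q _ <-]|_ [al _ [s + <-]]].
  have [al [s [sT <-]]] := image_full q; rewrite Eh_F//.
  by exists al => //; exists s => //; rewrite /= in_itv.
by rewrite /= in_itv /= => sT; exists (Eh al s) => //; rewrite Eh_F.
Qed.

End top.

(** * The spheres in polar form and left translations *)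

Section spheres.
Context {R : realType}.
Local Notation H1 := 'rV[R]_3.
Local Notation gnorm := Defs.gnorm.

Lemma vec3_drv (f g h f' g' h' : R -> R) s : drv f s (f' s) -> drv g s (g' s) -> drv h s (h' s) ->
  forall k, drv (fun r => vec3 (f r) (g r) (h r) ord0 k) s (vec3 (f' s) (g' s) (h' s) ord0 k).
Proof.
move=> fd gd hd k; case: (ord3P k) => ->.
- by rewrite -[vec3 _ _ _ _ _]/(xc _) xc_vec3; apply: drv_ext fd => r; rewrite -[RHS]/(xc _) xc_vec3.
- by rewrite -[vec3 _ _ _ _ _]/(yc _) yc_vec3; apply: drv_ext gd => r; rewrite -[RHS]/(yc _) yc_vec3.
- by rewrite -[vec3 _ _ _ _ _]/(tc _) tc_vec3; apply: drv_ext hd => r; rewrite -[RHS]/(tc _) tc_vec3.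
Qed.

Lemma vec3Z k (a b c : R) : k *: vec3 a b c = vec3 (k * a) (k * b) (k * c).
Proof. by apply: rV3P; rewrite ?xcZ ?ycZ ?tcZ ?xc_vec3 ?yc_vec3 ?tc_vec3. Qed.

Lemma vec3D (a b c a' b' c' : R) : vec3 a b c + vec3 a' b' c' = vec3 (a + a') (b + b') (c + c').
Proof. by apply: rV3P; rewrite ?xcD ?ycD ?tcD ?xc_vec3 ?yc_vec3 ?tc_vec3. Qed.

Lemma vec30 : 0 = vec3 0 0 0 :> H1.
Proof. by apply: rV3P; rewrite ?xc_vec3 ?yc_vec3 ?tc_vec3 /xc /yc /tc mxE. Qed.

Lemma sqrD_eq0 (x y : R) : x ^+ 2 + y ^+ 2 = 0 -> x = 0 /\ y = 0.
Proof.
by move/eqP; rewrite paddr_eq0 ?sqr_ge0// !sqrf_eq0 => /andP[/eqP -> /eqP ->].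
Qed.

Lemma curve_derive (c dc : R -> H1) : (forall s k, drv (fun r => c r ord0 k) s (dc s ord0 k)) ->
  forall s v, derivable c s v /\ 'D_v c s = v *: dc s.
Proof.
move=> cD s v; have cd : derivable c s 1.
  by apply/derivable_mxP => i j; rewrite (ord1 i); have [] := cD s j.
have [h1 h2] := drv_derivable v cd; split=> //; rewrite h2; congr (_ *: _).
by rewrite (derive_mx cd); apply/rowP => k; rewrite mxE; have [_] := cD s k.
Qed.

Lemma curve_Ck k (c dc : R -> H1) : (forall s k, drv (fun r => c r ord0 k) s (dc s ord0 k)) ->
  (forall v : R, Ck (V := R^o) k setT (fun s => v *: dc s)) -> Ck (V := R^o) k.+1 setT c.
Proof.
move=> cD dC; split=> [s _|v].
  by apply: rV_continuous => j; exact: drv_cont (cD s j).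
split=> [s _|]; first by have [] := curve_derive cD s v.
suff -> : 'D_v c = (fun s => v *: dc s) by exact: dC.
by apply/funext => s; have [] := curve_derive cD s v.
Qed.

Section one_sphere.
Variable l : R.
Hypothesis l0 : l != 0.

Lemma geo_geodesic a b : a ^+ 2 + b ^+ 2 = 1 -> geodesic l (geo l 0 a b).
Proof.
move=> ab; pose x s := xc (geo l 0 a b s); pose y s := yc (geo l 0 a b s); pose t s := tc (geo l 0 a b s).
pose d1 := dir1 l a b; pose d2 := dir2 l a b.
pose dc s := vec3 (d1 s) (d2 s) (y s * d1 s - x s * d2 s).
pose ddc s := vec3 (2 * l * d2 s) (- (2 * l * d1 s)) (2 * l * - (x s * - d1 s + - y s * d2 s)).
have G s : [/\ drv x s (d1 s), drv y s (d2 s), drv t s (y s * d1 s - x s * d2 s),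
    drv d1 s (2 * l * d2 s) & drv d2 s (- (2 * l * d1 s))] by exact: geo_isgeod.
have cE s : geo l 0 a b s = vec3 (x s) (y s) (t s) by exact: vec3E.
have G2 s : drv (fun s => y s * d1 s - x s * d2 s) s (2 * l * (y s * d2 s + x s * d1 s)).
  have [g1 g2 _ g4 g5] := G s.
  by refine (drv_eq (drvB (drvM g2 g4) (drvM g1 g5)) _); ring.
have cD s k : drv (fun r => geo l 0 a b r ord0 k) s (dc s ord0 k).
  have [g1 g2 g3 _ _] := G s.
  have := @vec3_drv x y t d1 d2 (fun s => y s * d1 s - x s * d2 s) s g1 g2 g3 k.
  by apply: drv_ext => r; rewrite cE.
pose dd s := vec3 (2 * l * d2 s) (- (2 * l * d1 s)) (2 * l * (y s * d2 s + x s * d1 s)).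
have dD s k : drv (fun r => dc r ord0 k) s (dd s ord0 k).
  have [_ _ _ g4 g5] := G s.
  exact: (@vec3_drv d1 d2 (fun s => y s * d1 s - x s * d2 s) (fun s => 2 * l * d2 s) (fun s => - (2 * l * d1 s))
    (fun s => 2 * l * (y s * d2 s + x s * d1 s)) s g4 g5 (G2 s) k).
have derE s : derive1 (geo l 0 a b) s = dc s.
  by rewrite derive1E; have [_ ->] := curve_derive cD s 1; rewrite scale1r.
have du s : d1 s ^+ 2 + d2 s ^+ 2 = 1 by exact: dir_unit.
have hz s : tcomp (geo l 0 a b s) (dc s) = 0.
  by rewrite /tcomp /dc xc_vec3 yc_vec3 tc_vec3 -/(x s) -/(y s); ring.
split.
- apply: (curve_Ck cD) => v; apply: (@curve_Ck 0 _ (fun s => v *: dd s)) => [s k|w].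
    rewrite (_ : (v *: dd s) ord0 k = v * dd s ord0 k); last by rewrite [LHS]mxE.
    by apply: drv_ext (drvZ v (dD s k)) => r; rewrite [RHS]mxE.
  split; last exact: Logic.I.
  move=> s _; have [g1 g2 _ g4 g5] := G s.
  have K (f : R -> R) df : drv f s df -> {for s, continuous (fun s => w * (v * f s))}.
    by move=> D; exact: drv_cont (drvZ w (drvZ v D)).
  apply: rV_continuous => k; case: (ord3P k) => ->.
  + refine (continuous_ext _ (K _ _ (drvZ (2 * l) g5))) => r.
    by rewrite /= -[RHS]/(xc _) /dd !vec3Z xc_vec3.
  + refine (continuous_ext _ (K _ _ (drvN (drvZ (2 * l) g4)))) => r.
    by rewrite /= -[RHS]/(yc _) /dd !vec3Z yc_vec3.
  + refine (continuous_ext _ (K _ _ (drvZ (2 * l) (drvD (drvM g2 g5) (drvM g1 g4))))) => r.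
    by rewrite /= -[RHS]/(tc _) /dd !vec3Z tc_vec3.
- by move=> s; rewrite derE; apply/horizontalP.
- by move=> s; rewrite derE /gnorm /metric hz /dc xc_vec3 yc_vec3 mul0r addr0 -!expr2 du sqrtr1.
- move=> s; have -> : derive1 (geo l 0 a b) = dc by apply/funext => r; exact: derE.
  rewrite derive1E; have [_ ->] := curve_derive dD s 1; rewrite scale1r gamma_horizontal// addr0 JE /dd /dc.
  rewrite xc_vec3 yc_vec3 /fieldX /fieldY -/(x s) -/(y s) !vec3Z vec3D vec3Z vec3D vec30.
  by congr vec3; ring.
Qed.

(** The velocity components solve a rotation equation, for which the squared distance to
    [(dir1, dir2)] is constant. Positions follow by integration, the t-coordinate last because its
    derivative involves the two others. *)
Lemma geodesic_geo c : geodesic l c -> c 0 = 0 -> exists a b, a ^+ 2 + b ^+ 2 = 1 /\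
  forall s, 0 <= s -> c s = geo l 0 a b s.
Proof.
move=> [[_ cC] hor un ode] c0; pose u s := derive1 c s.
have [cd [_ uC]] := cC 1.
have uE : 'D_1 c = u by apply/funext => s; rewrite /u derive1E.
rewrite uE in uC; have [ud _] := uC 1.
have cD s k : drv (fun r => c r ord0 k) s (u s ord0 k) by rewrite /u derive1E; exact: drv_coord (cd s I).
have uD s k : drv (fun r => u r ord0 k) s ('D_1 u s ord0 k) by exact: drv_coord (ud s I).
have h0 s : tcomp (c s) (u s) = 0 by apply/horizontalP; exact: hor.
have tE s : tc (u s) = yc (c s) * xc (u s) - xc (c s) * yc (u s).
  by have := h0 s; rewrite /tcomp => h; apply/eqP; rewrite -subr_eq0 -[X in _ == X]h; apply/eqP; ring.
have uu s : xc (u s) ^+ 2 + yc (u s) ^+ 2 = 1.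
  have := un s; rewrite -/(u s) /gnorm /metric h0 mul0r addr0 -!expr2 => /(congr1 (fun x => x ^+ 2)).
  by rewrite expr1n sqr_sqrtr ?addr_ge0 ?sqr_ge0.
have acc s : 'D_1 u s + (2 * l) *: J (c s) (u s) = 0.
  have E : derive1 (derive1 c) s = 'D_1 u s by exact: derive1E.
  have h : derive1 (derive1 c) s + gamma (c s) (u s) (u s) + (2 * l) *: J (c s) (u s) = 0 := ode s.
  rewrite E (gamma_horizontal (h0 s) (h0 s)) addr0 in h.
  exact: h.
have a1 s : xc ('D_1 u s) = 2 * l * yc (u s).
  have := congr1 xc (acc s); rewrite JE xcD xcZ xcD !xcZ /fieldX /fieldY !xc_vec3 [RHS]mxE => h.
  by apply/eqP; rewrite -subr_eq0 -[X in _ == X]h; apply/eqP; ring.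
have a2 s : yc ('D_1 u s) = - (2 * l * xc (u s)).
  have := congr1 yc (acc s); rewrite JE ycD ycZ ycD !ycZ /fieldX /fieldY !yc_vec3 [RHS]mxE => h.
  by apply/eqP; rewrite -subr_eq0 -[X in _ == X]h; apply/eqP; ring.
pose a := xc (u 0); pose b := yc (u 0).
have ab : a ^+ 2 + b ^+ 2 = 1 by exact: uu.
exists a, b; split=> // s s0.
have r0 : 0 <= s <= s by rewrite s0 lexx.
have D1 r : drv (fun r => xc (u r)) r (2 * l * yc (u r)) by rewrite -a1; exact: uD.
have D2 r : drv (fun r => yc (u r)) r (- (2 * l * xc (u r))) by rewrite -a2; exact: uD.
have ZE r : 0 <= r <= s -> xc (u r) = dir1 l a b r /\ yc (u r) = dir2 l a b r.
  move=> rs; pose E r := (xc (u r) - dir1 l a b r) ^+ 2 + (yc (u r) - dir2 l a b r) ^+ 2.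
  have ED x : 0 <= x <= s -> drv E x 0.
    move=> _; have K1 := drvB (D1 x) (drv_dir1 l a b x); have K2 := drvB (D2 x) (drv_dir2 l a b x).
    by refine (drv_eq (drvD (drvM K1 K1) (drvM K2 K2)) _); rewrite /=; ring.
  have := drv0_cst ED rs; have [i1 i2] := dir0 l a b.
  rewrite /E i1 i2 !subrr expr0n addr0 => /sqrD_eq0[/subr0_eq e1_ /subr0_eq e2_].
  by rewrite e1_ e2_.
have [z1 z2 z3] : [/\ xc (0 : H1) = 0, yc (0 : H1) = 0 & tc (0 : H1) = 0] by rewrite /xc /yc /tc !mxE.
have X r : 0 <= r <= s -> xc (c r) = xc (geo l 0 a b r) /\ yc (c r) = yc (geo l 0 a b r).
  move=> rs; split; apply/eqP; rewrite -subr_eq0; apply/eqP.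
  - have ED x : 0 <= x <= s -> drv (fun x => xc (c x) - xc (geo l 0 a b x)) x 0.
      move=> xs; have [g1 _ _] := geo_geod l0 0 a b x; have [e1_ _] := ZE x xs.
      by refine (drv_eq (drvB (cD x ord0) g1) _); rewrite -[u x ord0 ord0]/(xc (u x)) e1_ subrr.
    by rewrite (drv0_cst ED rs) c0 geo0 subrr.
  - have ED x : 0 <= x <= s -> drv (fun x => yc (c x) - yc (geo l 0 a b x)) x 0.
      move=> xs; have [_ g2 _] := geo_geod l0 0 a b x; have [_ e2_] := ZE x xs.
      by refine (drv_eq (drvB (cD x 1) g2) _); rewrite -[u x ord0 1]/(yc (u x)) e2_ subrr.
    by rewrite (drv0_cst ED rs) c0 geo0 subrr.
have [ex ey] := X s r0; apply: rV3P => //; apply/eqP; rewrite -subr_eq0; apply/eqP.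
have ED x : 0 <= x <= s -> drv (fun x => tc (c x) - tc (geo l 0 a b x)) x 0.
  move=> xs; have [_ _ g3] := geo_geod l0 0 a b x; have [e1_ e2_] := ZE x xs; have [e3_ e4_] := X x xs.
  refine (drv_eq (drvB (cD x ord_max) g3) _).
  by rewrite -[u x ord0 ord_max]/(tc (u x)) tE e1_ e2_ e3_ e4_ subrr.
by rewrite (drv0_cst ED r0) c0 geo0 subrr.
Qed.

End one_sphere.

Lemma sphereE (L : R) : 0 < L ->
  sphere L = [set polar_geo L 0 al s | al in [set: R] & s in `[0, pi / L]].
Proof.
move=> L0; have l0 := lt0r_neq0 L0; apply/seteqP; split=> [q [c [s [cg c0 sT ->]]]|_ [al _ [s sT <-]]].
  have [a [b [ab cE]]] := geodesic_geo l0 cg c0; have [al [_ hc hs]] := exists_angle ab.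
  exists al => //; exists s; first by rewrite /= in_itv.
  by rewrite /polar_geo hc hs cE//; case/andP: sT.
exists (geo L 0 (cos al) (sin al)), s; split=> //; [|exact: geo0].
by apply: geo_geodesic => //; exact: cos_sin_unit.
Qed.

(** Left multiplication by [w] in the group; the last bracket is the imaginary part in the
    product. *)
Definition translate (w q : H1) : H1 := vec3 (xc w + xc q) (yc w + yc q)
  (tc w + tc q + (yc w * xc q - xc w * yc q)).

Lemma Ck_cst (V W : normedModType R) k (U : set V) (c : W) : Ck k U (fun=> c).
Proof.
elim: k c => [|k IH] c /=; first by split=> // x _; exact: cst_continuous.
split=> [x _|v]; first exact: cst_continuous.
split=> [x _|]; first exact: derivable_cst.
suff -> : 'D_v (fun=> c) = (fun=> 0 : W) :> (V -> W) by exact: IH.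
by apply/funext => x; exact: derive_cst.
Qed.

Lemma coord_is_derive (q v : H1) (k : 'I_3) : is_derive q v (fun q : H1 => q ord0 k) (v ord0 k).
Proof.
have qd : derivable (id : H1 -> H1) q v by exact: derivable_id.
have h : derivable (fun x : H1 => x ord0 k) q v by move/derivable_mxP: qd; exact.
split; first exact: h.
by have := congr1 (fun A : H1 => A ord0 k) (derive_mx qd); rewrite derive_id [RHS]mxE => ->.
Qed.

Lemma translate_derive w q v : derivable (translate w) q v /\
  'D_v (translate w) q = vec3 (xc v) (yc v) (tc v + (yc w * xc v - xc w * yc v)).
Proof.
have dx : is_derive q v xc (xc v) by exact: coord_is_derive.
have dy : is_derive q v yc (yc v) by exact: coord_is_derive.
have dt : is_derive q v tc (tc v) by exact: coord_is_derive.
have X : is_derive q v (fun q => xc w + xc q) (xc v).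
  by have := is_deriveD (is_derive_cst (xc w) q v) dx; rewrite add0r.
have Y : is_derive q v (fun q => yc w + yc q) (yc v).
  by have := is_deriveD (is_derive_cst (yc w) q v) dy; rewrite add0r.
have TT : is_derive q v (fun q => tc w + tc q + (yc w * xc q - xc w * yc q)) (tc v + (yc w * xc v - xc w * yc v)).
  have := is_deriveD (is_deriveD (is_derive_cst (tc w) q v) dt) (is_deriveB (is_deriveZ (yc w) dx) (is_deriveZ (xc w) dy)).
  by rewrite add0r.
split; last exact: derive_vec3.
apply/derivable_mxP => i k; rewrite (ord1 i); case: (ord3P k) => ->.
- rewrite (_ : (fun _ => _) = fun q => xc w + xc q); first by case: X.
  by apply/funext => r; rewrite -[LHS]/(xc _) xc_vec3.
- rewrite (_ : (fun _ => _) = fun q => yc w + yc q); first by case: Y.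
  by apply/funext => r; rewrite -[LHS]/(yc _) yc_vec3.
- rewrite (_ : (fun _ => _) = fun q => tc w + tc q + (yc w * xc q - xc w * yc q)); first by case: TT.
  by apply/funext => r; rewrite -[LHS]/(tc _) tc_vec3.
Qed.

(** The translation is affine with constant directional derivatives, and it preserves components in
    the frame X, Y, T; its inverse is the translation by [- w]. *)
Lemma translate_isometry w : horizontal_isometry (translate w).
Proof.
have tcE p u : tcomp (translate w p) ('D_u (translate w) p) = tcomp p u.
  by have [_ ->] := translate_derive w p u; rewrite /tcomp /translate !xc_vec3 !yc_vec3 !tc_vec3; ring.
split.
- exists (translate (- w)) => q; rewrite /translate; apply: rV3P; rewrite ?xc_vec3 ?yc_vec3 ?tc_vec3 ?xcN ?ycN ?tcN; ring.
- have cont x : {for x, continuous (translate w)}.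
    have cD (f h : H1 -> R) : {for x, continuous f} -> {for x, continuous h} -> {for x, continuous (fun q => f q + h q)}.
      by move=> fc hc; exact: continuousD.
    have cM (k : R) (f : H1 -> R) : {for x, continuous f} -> {for x, continuous (fun q => k * f q)}.
      by move=> fc; apply: continuousM => //; exact: cst_continuous.
    have cN (f : H1 -> R) : {for x, continuous f} -> {for x, continuous (fun q => - f q)}.
      by move=> fc; exact: continuousN.
    have cC (k : R) : {for x, continuous (fun _ : H1 => k)} by exact: cst_continuous.
    have idc : {for x, continuous (id : H1 -> H1)} by exact: cvg_id.
    have X := xc_cont idc; have Y := yc_cont idc; have Z := tc_cont idc.
    apply: rV_continuous => k; case: (ord3P k) => ->.
    + by refine (continuous_ext _ (cD _ _ (cC (xc w)) X)) => r; rewrite -[RHS]/(xc _) xc_vec3.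
    + by refine (continuous_ext _ (cD _ _ (cC (yc w)) Y)) => r; rewrite -[RHS]/(yc _) yc_vec3.
    + refine (continuous_ext _ (cD _ _ (cD _ _ (cC (tc w)) Z) (cD _ _ (cM (yc w) _ X) (cN _ (cM (xc w) _ Y))))) => r.
      by rewrite -[RHS]/(tc _) tc_vec3.
  case=> [|k]; split; [by move=> x _; exact: cont|exact: Logic.I|by move=> x _; exact: cont|].
  move=> v; split=> [x _|]; first by have [] := translate_derive w x v.
  rewrite (_ : 'D_v (translate w) = fun=> vec3 (xc v) (yc v) (tc v + (yc w * xc v - xc w * yc v))).
    exact: Ck_cst.
  by apply/funext => x; have [] := translate_derive w x v.
- move=> p u v; rewrite /metric !tcE; have [_ ->] := translate_derive w p u.
  by have [_ ->] := translate_derive w p v; rewrite !xc_vec3 !yc_vec3.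
- by move=> p u; rewrite !horizontalP tcE.
Qed.

(* For [l < 0] the sphere is run through from its top pole. *)
Lemma polar_sphere (l : R) p : l != 0 -> exists w,
  translate w @` [set polar_geo l p al s | al in [set: R] & s in `[0, pi / `|l|]] = sphere `|l|.
Proof.
move=> l0; have n0 : 0 < `|l| by rewrite normr_gt0.
rewrite sphereE//; have [lp|ln] := ltP 0 l.
  have E al s : translate (vec3 (- xc p) (- yc p) (- tc p)) (polar_geo l p al s) = polar_geo l 0 al s.
    have [z1 z2 z3] : [/\ xc (0 : H1) = 0, yc (0 : H1) = 0 & tc (0 : H1) = 0] by rewrite /xc /yc /tc !mxE.
    by rewrite /translate /polar_geo /geo; apply: rV3P; rewrite !(xc_vec3, yc_vec3, tc_vec3) ?z1 ?z2 ?z3; ring.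
  exists (vec3 (- xc p) (- yc p) (- tc p)); rewrite gtr0_norm//.
  apply/seteqP; split=> [_ [_ [al _ [s sT <-]] <-]|_ [al _ [s sT <-]]].
    by rewrite E; exists al => //; exists s.
  by exists (polar_geo l p al s); [exists al => //; exists s|exact: E].
have {}ln : l < 0 by rewrite lt_neqAle l0.
rewrite ltr0_norm//; set L := - l; have L0 : 0 < L by rewrite oppr_gt0.
have lE : l = - L by rewrite opprK.
have L1 := lt0r_neq0 L0.
(* [pi / (2 * L ^+ 2)] is the height of the upper pole of [sphere L]. The starting point is moved
   there, and each geodesic is run backwards in the opposite plane direction. *)
have E al s : translate (vec3 (- xc p) (- yc p) (pi / (2 * L ^+ 2) - tc p)) (polar_geo l p al s) = polar_geo L 0 (al + pi) (pi / L - s).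
  have [z1 z2 z3] : [/\ xc (0 : H1) = 0, yc (0 : H1) = 0 & tc (0 : H1) = 0] by rewrite /xc /yc /tc !mxE.
  have c2 : cos (2 * L * (pi / L - s)) = cos (2 * L * s) /\ sin (2 * L * (pi / L - s)) = - sin (2 * L * s).
    have -> : 2 * L * (pi / L - s) = - (2 * L * s) + pi *+ 2 by rewrite -mulr_natl; field.
    by rewrite cosD2pi sinD2pi cosN sinN.
  have [e1_ e2_] := c2.
  have ca : cos (al + pi) = - cos al by exact: cosDpi.
  have sa : sin (al + pi) = - sin al by exact: sinDpi.
  have l2 : 2 * l * s = - (2 * L * s) by rewrite lE; ring.
  rewrite /translate /polar_geo /geo /ct /cx /cy e1_ e2_ ca sa l2 cosN sinN lE.
  apply: rV3P; rewrite !(xc_vec3, yc_vec3, tc_vec3) ?z1 ?z2 ?z3.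
  - by field.
  - by field.
  - rewrite !sqrrN cos_sin_unit; field.
    by apply/andP; split; [exact: L1|exact: l0].
exists (vec3 (- xc p) (- yc p) (pi / (2 * L ^+ 2) - tc p)).
apply/seteqP; split=> [_ [_ [al _ [s + <-]] <-]|_ [al _ [s + <-]]]; rewrite /= in_itv /= => /andP[s0 sT].
  rewrite E; exists (al + pi) => //; exists (pi / L - s) => //.
  by rewrite /= in_itv /= subr_ge0 sT lerBlDr lerDl.
exists (polar_geo l p (al - pi) (pi / L - s)); last by rewrite E subrK subKr.
exists (al - pi) => //; exists (pi / L - s) => //.
by rewrite /= in_itv /= subr_ge0 sT lerBlDr lerDl.
Qed.

End spheres.

Theorem theorem6p1 (R : realType) (S : surface R) (F N : S -> 'rV[R]_3) (H : R)
  (S_connected : connected [set: S])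
  (F_immersion : immersion2 F)
  (N_normal : unit_normal F N)
  (F_complete : complete_surface F)
  (H_neq0 : H != 0)
  (F_cmc : constant_mean_curvature F N H)
  (F_isolated : exists p : S, isolated (singular_set F N) p) :
  congruent F (sphere `|H|).
Proof.
have [p p_iso] := F_isolated.
have e2 := eps2 N_normal p_iso; have l0 := l_neq0 N_normal p_iso H_neq0.
set eps := n3 F N p in e2 l0.
have [i0 [sec0 [e0 [ip e0T start cover0]]]] := isolated_geodesics F_immersion N_normal F_cmc p_iso H_neq0.
have {}cover0 : exists2 r, 0 < r & forall z, `|z - prj (@Pxy R) (F p)| <= r -> z != prj (@Pxy R) (F p) ->
   exists a b s, [/\ a ^+ 2 + b ^+ 2 = 1, 0 < s <= e0 & z = cir (lam H eps) (prj (@Pxy R) (F p)) a b s] by exact: cover0.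
have [qt qtP] := top_const F_immersion N_normal F_cmc F_complete l0 e0T start.
have [it [sect _]] := top_section F_immersion N_normal F_cmc (qtP 0).
have [t [tT tr]] := top_start (eps := eps) l0 e0T sect.
have Finj := F_injective F_immersion N_normal F_cmc F_complete l0 e0T start S_connected cover0 qtP tT tr.
have Fran := F_range F_immersion N_normal F_cmc F_complete l0 e0T start S_connected cover0 qtP tT tr.
(* [eps] is plus or minus 1, so the two choices of the unit normal lead to the same sphere. *)
have lH : `|lam H eps| = `|H|.
  rewrite /lam normrM (_ : `|eps| = 1) ?mul1r//.
  by apply/eqP; rewrite -(@eqrXn2 _ 2)// expr1n real_normK ?num_real// expr2 e2.
have [w wE] := polar_sphere (F p) l0.
exists (translate w); split; [exact: translate_isometry|exact: Finj|].
by rewrite Fran wE lH.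
Qed.
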